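(* Let $\omega>0$ and $-\frac{\pi}{2}<\theta_1<\theta_2<0$, and let $\mathcal{C}=\{(\varphi,\theta)\in[0,2\pi)\times(\theta_1,\theta_2)\}$, $\overline{\mathcal{C}}=\{(\varphi,\theta)\in[0,2\pi)\times[\theta_1,\theta_2]\}$. Suppose that $\mathbf{u}_0=u_0\,\mathbf{e}_\varphi+v_0\,\mathbf{e}_\theta\in C^{1+\vartheta}(\overline{\mathcal{C}})$ for some $\vartheta\in(0,1)$, that $\operatorname{div}\mathbf{u}_0=\frac{1}{\cos\theta}[\partial_\varphi u_0+\partial_\theta(v_0\cos\theta)]=0$ in $\mathcal{C}$, and that $v_0=0$ on $\partial\mathcal{C}=\{\theta=\theta_1\}\cup\{\theta=\theta_2\}$. Let $T>0$. Then there exists a solution $(u\,\mathbf{e}_\varphi+v\,\mathbf{e}_\theta,p)$, with $u,v,p$ functions of $(\varphi,\theta,t)$ that are $2\pi$-periodic in $\varphi$, of the system \begin{align*} & u_t + \frac{uu_\varphi}{\cos\theta} + vu_\theta - uv\tan\theta - 2\omega v\sin\theta = -\frac{p_\varphi}{\cos\theta},\\ & v_t + \frac{uv_\varphi}{\cos\theta} + vv_\theta + u^2\tan\theta + 2\omega u\sin\theta = -p_\theta,\\ & u_\varphi + (v\cos\theta)_\theta = 0 \end{align*} in $\mathcal{C}\times[0,T]$, with boundary condition $v(\varphi,\theta_1,t)=v(\varphi,\theta_2,t)=0$ for all $\varphi\in[0,2\pi)$ and $t\in[0,T]$, and initial condition $(u\,\mathbf{e}_\varphi+v\,\mathbf{e}_\theta)|_{t=0}=\mathbf{u}_0$,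 such that $u$, $v$, $p$ and all their derivatives appearing in the system belong to $C(\overline{\mathcal{C}}\times[0,T])$. Such a solution is unique up to an arbitrary function of $t$ which may be added to $p$.
   Context: Spherical coordinates on the unit sphere $\mathbb{S}^2$ are $(\varphi,\theta)\mapsto(\cos\varphi\cos\theta,\sin\varphi\cos\theta,\sin\theta)$ (longitude $\varphi$, latitude $\theta$), with tangent vectors $\mathbf{e}_\varphi=\frac{1}{\cos\theta}\partial_\varphi$, $\mathbf{e}_\theta=\partial_\theta$. A function $f$ on $\mathcal{C}$ belongs to $C^{0+\vartheta}(\overline{\mathcal{C}})$ if there is $C>0$ with $|f(P_1)-f(P_2)|\le C\,d(P_1,P_2)^\vartheta$ for all $P_1,P_2\in\overline{\mathcal{C}}$, where $d$ is the geodesic distance on the sphere; $f\in C^{k+\vartheta}(\overline{\mathcal{C}})$ if all derivatives of $f$ with respect to $(\varphi,\theta)$ up to order $k$ lie in $C^{0+\vartheta}(\overline{\mathcal{C}})$. A vector field $f\,\mathbf{e}_\varphi+g\,\mathbf{e}_\theta$ is in $C^{k+\vartheta}(\overline{\mathcal{C}})$ if both $f$ and $g$ are. *)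

(* Defs.v *)
From Stdlib Require Import Reals.
From Coquelicot Require Import Coquelicot.
Open Scope R_scope.

Definition sph (phi theta : R) : R * R * R :=
  (cos phi * cos theta, sin phi * cos theta, sin theta).

Definition geod (P Q : R * R * R) : R :=
  let '(x1, y1, z1) := P in let '(x2, y2, z2) := Q in
  acos (x1 * x2 + y1 * y2 + z1 * z2).

Definition in_Cbar (th1 th2 phi theta : R) : Prop :=
  0 <= phi < 2 * PI /\ th1 <= theta <= th2.

Definition in_C (th1 th2 phi theta : R) : Prop :=
  0 <= phi < 2 * PI /\ th1 < theta < th2.

Definition periodic2 (f : R -> R -> R) : Prop :=
  forall phi theta, f (phi + 2 * PI) theta = f phi theta.
Definition periodic3 (f : R -> R -> R -> R) : Prop :=
  forall phi theta t, f (phi + 2 * PI) theta t = f phi theta t.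

Definition holder0 (th1 th2 a : R) (f : R -> R -> R) : Prop :=
  exists C, 0 < C /\
    forall p1 t1 p2 t2, in_Cbar th1 th2 p1 t1 -> in_Cbar th1 th2 p2 t2 ->
      0 < geod (sph p1 t1) (sph p2 t2) ->
      Rabs (f p1 t1 - f p2 t2) <= C * Rpower (geod (sph p1 t1) (sph p2 t2)) a.

Definition holder1 (th1 th2 a : R) (f : R -> R -> R) : Prop :=
  exists fphi ftheta : R -> R -> R,
    (forall phi theta, in_C th1 th2 phi theta ->
       is_derive (fun x => f x theta) phi (fphi phi theta) /\
       is_derive (fun y => f phi y) theta (ftheta phi theta)) /\
    holder0 th1 th2 a f /\ holder0 th1 th2 a fphi /\ holder0 th1 th2 a ftheta.

(* Continuity on Cbar x [0,T] (with phi ranging over R; for 2pi-periodic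
   functions this is continuity on the closed cylinder band). *)
Definition in_S (th1 th2 T phi theta t : R) : Prop :=
  th1 <= theta <= th2 /\ 0 <= t <= T.

Definition cont_S (th1 th2 T : R) (f : R -> R -> R -> R) : Prop :=
  forall phi theta t, in_S th1 th2 T phi theta t ->
    forall eps, 0 < eps -> exists delta, 0 < delta /\
      forall phi' theta' t', in_S th1 th2 T phi' theta' t' ->
        Rabs (phi' - phi) < delta -> Rabs (theta' - theta) < delta ->
        Rabs (t' - t) < delta ->
        Rabs (f phi' theta' t' - f phi theta t) < eps.

(* (u e_phi + v e_theta, p) is a classical solution of the rotating Euler
   system on C x [0,T] with the stated boundary and initial conditions, and
   u, v, p and all derivatives appearing in the system are continuous on
   Cbar x [0,T].  The derivatives are given by functions (ut, uphi, ...)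
   that are the actual partial derivatives at interior points and are
   continuous on Cbar x [0,T] (hence are the one-sided derivatives at the
   boundary). *)
Definition is_solution (omega th1 th2 T : R) (u0 v0 : R -> R -> R)
    (u v p : R -> R -> R -> R) : Prop :=
  periodic3 u /\ periodic3 v /\ periodic3 p /\
  exists ut uphi utheta vt vphi vtheta pphi ptheta divv : R -> R -> R -> R,
    (forall phi theta t, th1 < theta < th2 -> 0 <= t <= T ->
       is_derive (fun x => u x theta t) phi (uphi phi theta t) /\
       is_derive (fun y => u phi y t) theta (utheta phi theta t) /\
       is_derive (fun x => v x theta t) phi (vphi phi theta t) /\
       is_derive (fun y => v phi y t) theta (vtheta phi theta t) /\
       is_derive (fun y => v phi y t * cos y) theta (divv phi theta t) /\
       is_derive (fun x => p x theta t) phi (pphi phi theta t) /\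
       is_derive (fun y => p phi y t) theta (ptheta phi theta t)) /\
    (forall phi theta t, th1 < theta < th2 -> 0 < t < T ->
       is_derive (fun s => u phi theta s) t (ut phi theta t) /\
       is_derive (fun s => v phi theta s) t (vt phi theta t)) /\
    (forall phi theta t, in_C th1 th2 phi theta -> 0 <= t <= T ->
       ut phi theta t + u phi theta t * uphi phi theta t / cos theta
         + v phi theta t * utheta phi theta t
         - u phi theta t * v phi theta t * tan theta
         - 2 * omega * v phi theta t * sin theta
       = - pphi phi theta t / cos theta /\
       vt phi theta t + u phi theta t * vphi phi theta t / cos theta
         + v phi theta t * vtheta phi theta t
         + (u phi theta t) ^ 2 * tan theta
         + 2 * omega * u phi theta t * sin theta
       = - ptheta phi theta t /\
       uphi phi theta t + divv phi theta t = 0) /\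
    (forall phi t, 0 <= phi < 2 * PI -> 0 <= t <= T ->
       v phi th1 t = 0 /\ v phi th2 t = 0) /\
    (forall phi theta, in_Cbar th1 th2 phi theta ->
       u phi theta 0 = u0 phi theta /\ v phi theta 0 = v0 phi theta) /\
    cont_S th1 th2 T u /\ cont_S th1 th2 T v /\ cont_S th1 th2 T p /\
    cont_S th1 th2 T ut /\ cont_S th1 th2 T uphi /\ cont_S th1 th2 T utheta /\
    cont_S th1 th2 T vt /\ cont_S th1 th2 T vphi /\ cont_S th1 th2 T vtheta /\
    cont_S th1 th2 T divv /\
    cont_S th1 th2 T pphi /\ cont_S th1 th2 T ptheta.

(* Main.v *)
Require Import Defs.
From Stdlib Require Import ZArith Reals Psatz ClassicalEpsilon FunctionalExtensionality.
From Coquelicot Require Import Coquelicot.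
From mathcomp Require classical.filter.
Open Scope R_scope.

(** In the Mercator coordinate s, with ds = dtheta / cos theta, the field
(U, V) = cos theta (u, v) is divergence free on the flat strip 0 <= s <= L,
tangent to its walls, and the absolute vorticity Q, defined by
V_phi - U_s = (Q - f) / mu with mu = 1 / cos^2 theta and f = 2 omega sin theta,
is transported by mu (U, V).

Existence: (U, V) is an explicit convolution of (Q - f) / mu with the images of
the kernel coth, regularised at distance e, plus a shear flow. Time is
discretised by composing Q with one backward Euler step along mu (U, V). This
preserves the sup norm of Q, and since the velocity gradient is bounded by the
logarithm of the Hölder constant of Q, that logarithm grows at most
exponentially, so the bounds hold on every [0, T]. The pressure is a convolution
of the flux (U Q, V Q) with the same kernels, and the momentum equations hold up
to an error that vanishes with e and the time step. All quantities are
asymptotically equicontinuous, so their pointwise limits along an ultrafilter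
solve the limit system. At t = 0 the limit velocity has the divergence, curl and
boundary values of the data, hence differs from it by a constant in U, which the
free additive constant of the shear flow removes.

Uniqueness: the energy of the difference of two solutions satisfies a Gronwall
inequality; the gradient of the pressure difference then vanishes. *)

(** * Continuity and parametric integrals *)

(** Bounded vorticity alone does not bound the velocity gradient; hence the detour through Hölder
    constants. The map from vorticity to velocity is written out as a kernel, so that no elliptic
    theory enters, and the regularisation makes every derivative a differentiation under an integral
    of continuous functions. The kernels form a harmonic conjugate pair, so derivatives in s reduce
    to derivatives in phi, and Hölder regularity of the density in phi alone controls the whole
    gradient. The price is that the curl of the regularised velocity is only an approximate identity
    applied to the density. Composition with an Euler step, in place of a flow, requires no
    differential equation to be solved. The pressure does not come from a Poisson equation: applying
    the velocity operators to the vorticity equation in flux form and integrating by parts exhibits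
    it. It is the Bernoulli head, from which the kinetic energy is subtracted on the way back to the
    sphere. *)

Notation RU := R_UniformSpace.
Notation RU2 := (prod_UniformSpace RU RU).
Notation RN := R_NormedModule.
Notation RC := R_CompleteNormedModule.
Ltac abs_tri := eapply Rle_trans; [apply Rabs_triang|].

Definition cont {U : UniformSpace} (f : U -> R) : Prop := forall z, continuous f z.
Definition c2 (f : R -> R -> R) : Prop := cont (fun z : R * R => f (fst z) (snd z)).
Definition c3 (f : R -> R -> R -> R) : Prop :=
  cont (fun z : R * R * R => f (fst (fst z)) (snd (fst z)) (snd z)).

Lemma continuous_eps {U : UniformSpace} (f : U -> R) (z : U) :
  continuous f z <-> forall eps, 0 < eps -> exists d, 0 < d /\
    forall z', ball z d z' -> Rabs (f z' - f z) < eps.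
Proof.
  unfold continuous. split.
  - intros H eps He.
    destruct (proj1 (filterlim_locally f (f z)) H (mkposreal eps He)) as [d Hd].
    exists d. split; [apply cond_pos|]. intros z' Hz'. exact (Hd z' Hz').
  - intros H. apply filterlim_locally. intros eps.
    destruct (H eps (cond_pos eps)) as [d [Hd1 Hd]].
    exists (mkposreal d Hd1). intros z' Hz'. exact (Hd z' Hz').
Qed.

Section ContAlg.
Context {U : UniformSpace}.
Implicit Types f g : U -> R.
Lemma cont_const (c : R) : cont (fun _ : U => c).
Proof. intros z. apply continuous_const. Qed.
Lemma cont_plus f g : cont f -> cont g -> cont (fun z => f z + g z).
Proof. intros Hf Hg z. apply (continuous_plus f g z (Hf z) (Hg z)). Qed.
Lemma cont_opp f : cont f -> cont (fun z => - f z).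
Proof. intros Hf z. apply (continuous_opp f z (Hf z)). Qed.
Lemma cont_minus f g : cont f -> cont g -> cont (fun z => f z - g z).
Proof. intros Hf Hg z. apply (continuous_minus f g z (Hf z) (Hg z)). Qed.
Lemma cont_mult f g : cont f -> cont g -> cont (fun z => f z * g z).
Proof. intros Hf Hg z. apply (continuous_mult f g z (Hf z) (Hg z)). Qed.
Lemma cont_comp (h : R -> R) f : (forall x : R, continuous h x) -> cont f -> cont (fun z => h (f z)).
Proof. intros Hh Hf z. apply (continuous_comp f h z (Hf z) (Hh _)). Qed.
Lemma cont_inv f : (forall z, f z <> 0) -> cont f -> cont (fun z => / f z).
Proof. intros H0 Hf z. apply continuous_comp; [apply Hf|apply continuous_Rinv, H0]. Qed.
Lemma cont_div f g : (forall z, g z <> 0) -> cont f -> cont g -> cont (fun z => f z / g z).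
Proof. intros H0 Hf Hg. apply cont_mult; [exact Hf|apply cont_inv; assumption]. Qed.
Lemma cont_abs f : cont f -> cont (fun z => Rabs (f z)).
Proof. intros Hf z. apply (continuous_comp f Rabs); [apply Hf|apply continuous_Rabs]. Qed.
Lemma cont_comp2 (h : R -> R -> R) f g : c2 h -> cont f -> cont g -> cont (fun z => h (f z) (g z)).
Proof. intros Hh Hf Hg z. apply (continuous_comp_2 f g h z (Hf z) (Hg z) (Hh _)). Qed.
Lemma continuous_pair {V W : UniformSpace} (f : U -> V) (g : U -> W) z :
  continuous f z -> continuous g z -> continuous (fun x => (f x, g x)) z.
Proof.
  intros Hf Hg P [eps HP].
  assert (H1 := proj1 (filterlim_locally f (f z)) Hf eps).
  assert (H2 := proj1 (filterlim_locally g (g z)) Hg eps).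
  apply (filter_imp (F := locally z) _ (fun x => P (f x, g x)) (fun x Hx => HP (f x, g x) Hx)).
  apply (filter_and (F := locally z) _ _ H1 H2).
Qed.
Lemma cont_comp3 (h : R -> R -> R -> R) f g k :
  c3 h -> cont f -> cont g -> cont k -> cont (fun z => h (f z) (g z) (k z)).
Proof.
  intros Hh Hf Hg Hk z.
  apply (continuous_comp (fun x => ((f x, g x), k x))
           (fun w : R * R * R => h (fst (fst w)) (snd (fst w)) (snd w))).
  - apply continuous_pair; [apply continuous_pair|]; auto.
  - apply Hh.
Qed.
Lemma cont_compU {V : UniformSpace} (h : V -> R) (f : U -> V) :
  cont h -> (forall z, continuous f z) -> cont (fun z => h (f z)).
Proof. intros Hh Hf z. apply (continuous_comp f h z (Hf z) (Hh _)). Qed.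
Lemma cont_ext f g : (forall z, f z = g z) -> cont f -> cont g.
Proof. intros H Hf z. apply continuous_ext with f; [exact H|apply Hf]. Qed.
Lemma cont_max f g : cont f -> cont g -> cont (fun z => Rmax (f z) (g z)).
Proof.
  intros Hf Hg. apply cont_ext with (fun z => (f z + g z + Rabs (f z - g z)) * / 2).
  - intros z. unfold Rmax, Rabs. destruct (Rle_dec _ _), (Rcase_abs _); lra.
  - apply cont_mult; [|apply cont_const].
    apply cont_plus; [apply cont_plus; assumption|apply cont_abs, cont_minus; assumption].
Qed.
Lemma cont_min f g : cont f -> cont g -> cont (fun z => Rmin (f z) (g z)).
Proof.
  intros Hf Hg. apply cont_ext with (fun z => (f z + g z - Rabs (f z - g z)) * / 2).
  - intros z. unfold Rmin, Rabs. destruct (Rle_dec _ _), (Rcase_abs _); lra.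
  - apply cont_mult; [|apply cont_const].
    apply cont_minus; [apply cont_plus; assumption|apply cont_abs, cont_minus; assumption].
Qed.
Lemma cont_sum_n (f : nat -> U -> R) n :
  (forall i, cont (f i)) -> cont (fun z => sum_f_R0 (fun i => f i z) n).
Proof.
  intros H. induction n as [|n IH]; simpl; [apply H|].
  apply cont_plus; [exact IH|apply H].
Qed.
End ContAlg.

Lemma cont_id : cont (fun x : R => x).
Proof. intros z. apply continuous_id. Qed.
Lemma cont_fst {V : UniformSpace} : cont (fun z : R * V => fst z).
Proof. intros z. apply continuous_fst. Qed.
Lemma cont_snd {V : UniformSpace} : cont (fun z : V * R => snd z).
Proof. intros z. apply continuous_snd. Qed.
Lemma cont_fst' {V W : UniformSpace} (f : V -> R) : cont f -> cont (fun z : V * W => f (fst z)).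
Proof. intros H z. apply (continuous_comp fst f); [apply continuous_fst|apply H]. Qed.
Lemma cont_snd' {V W : UniformSpace} (f : V -> R) : cont f -> cont (fun z : W * V => f (snd z)).
Proof. intros H z. apply (continuous_comp snd f); [apply continuous_snd|apply H]. Qed.
Lemma cont_sin {U : UniformSpace} (f : U -> R) : cont f -> cont (fun z => sin (f z)).
Proof. apply cont_comp. apply continuous_sin. Qed.
Lemma cont_cos {U : UniformSpace} (f : U -> R) : cont f -> cont (fun z => cos (f z)).
Proof. apply cont_comp. apply continuous_cos. Qed.
Lemma cont_exp {U : UniformSpace} (f : U -> R) : cont f -> cont (fun z => exp (f z)).
Proof. apply cont_comp. apply continuous_exp. Qed.

Create HintDb cont discriminated.
#[export] Hint Resolve cont_const cont_plus cont_opp cont_minus cont_mult cont_abs cont_max cont_min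
  cont_id cont_fst cont_snd cont_sin cont_cos cont_exp cont_sum_n : cont.
#[export] Hint Extern 4 (cont (fun z => fst (fst z))) => apply (cont_fst' fst cont_fst) : cont.
#[export] Hint Extern 4 (cont (fun z => snd (fst z))) => apply (cont_fst' snd cont_snd) : cont.
#[export] Hint Extern 4 (cont (fun z => fst (snd z))) => apply (cont_snd' fst cont_fst) : cont.
#[export] Hint Extern 4 (cont (fun z => snd (snd z))) => apply (cont_snd' snd cont_snd) : cont.
#[export] Hint Extern 4 (cont (fun z => fst (fst (fst z)))) =>
  apply (cont_fst' (fun w => fst (fst w))) : cont.
#[export] Hint Extern 4 (cont (fun z => snd (fst (fst z)))) =>
  apply (cont_fst' (fun w => snd (fst w))) : cont.
Ltac Req := match goal with |- @eq _ ?a ?b => change (@eq R a b) end.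
Ltac cont_tac := auto 20 with cont.

Lemma cont_ex_RInt (f : R -> R) a b : cont f -> ex_RInt f a b.
Proof. intros H. apply (ex_RInt_continuous (V := RC)). intros z _. apply H. Qed.

Section RIntAlg.
Variables (f g : R -> R) (a b : R).
Hypotheses (Hf : cont f) (Hg : cont g).
Lemma RI_plus : RInt (fun x => f x + g x) a b = RInt f a b + RInt g a b.
Proof. apply (RInt_plus (V := RC)); apply cont_ex_RInt; assumption. Qed.
Lemma RI_minus : RInt (fun x => f x - g x) a b = RInt f a b - RInt g a b.
Proof. apply (RInt_minus (V := RC)); apply cont_ex_RInt; assumption. Qed.
Lemma RI_opp : RInt (fun x => - f x) a b = - RInt f a b.
Proof. apply (RInt_opp (V := RC)); apply cont_ex_RInt; assumption. Qed.
Lemma RI_scal c : RInt (fun x => c * f x) a b = c * RInt f a b.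
Proof. apply (RInt_scal (V := RC)); apply cont_ex_RInt; assumption. Qed.
Lemma RI_chasles c : RInt f a b + RInt f b c = RInt f a c.
Proof. apply (RInt_Chasles (V := RC)); apply cont_ex_RInt; assumption. Qed.
Lemma RI_swap : RInt f b a = - RInt f a b.
Proof.
  rewrite <- (opp_RInt_swap (V := RC)) by (apply cont_ex_RInt; assumption).
  reflexivity.
Qed.
End RIntAlg.

Lemma RI_const c a b : RInt (fun _ => c) a b = (b - a) * c.
Proof. apply (RInt_const (V := RC)). Qed.

Lemma RI_ext (f g : R -> R) a b : a <= b -> (forall x, a < x < b -> f x = g x) ->
  RInt f a b = RInt g a b.
Proof.
  intros Hab H. apply RInt_ext. intros x Hx. rewrite Rmin_left, Rmax_right in Hx by lra. auto.
Qed.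

(** Around each y there is a radius on which f varies by less than eps / 2 in both variables.
    Compactness of [a, b] gives one d not larger than the radius of some nearby centre t, and the
    values at (u, y) and (u0, y) are both compared with the one at (u0, t). *)
Lemma tube {U : UniformSpace} (f : U -> R -> R) (u0 : U) (a b eps : R) :
  cont (fun z : U * R => f (fst z) (snd z)) -> 0 < eps ->
  exists d, 0 < d /\ forall u y, ball u0 d u -> a <= y <= b -> Rabs (f u y - f u0 y) < eps.
Proof.
  intros Hf He.
  assert (H : forall y : R, { d : posreal | forall u y', ball u0 d u -> Rabs (y' - y) < d ->
              Rabs (f u y' - f u0 y) < eps / 2 }).
  { intros y. apply constructive_indefinite_description.
    destruct (proj1 (continuous_eps _ _) (Hf (u0, y)) (eps / 2) ltac:(lra)) as [d [Hd H]].
    exists (mkposreal d Hd). intros u y' Hu Hy.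
    apply (H (u, y')). split; simpl; [exact Hu|exact Hy]. }
  destruct (compactness_value_1d a b (fun y => proj1_sig (H y))) as [d Hd].
  exists d. split; [apply cond_pos|].
  intros u y Hu Hy.
  (* The compactness statement is doubly negated, so the argument is by contradiction on a decidable
     conclusion. *)
  destruct (Rlt_dec (Rabs (f u y - f u0 y)) eps) as [Hl|Hl]; [exact Hl|exfalso].
  apply (Hd y Hy). intros [t [Ht [H1 H2]]]. apply Hl.
  destruct (H t) as [dt Hdt]; simpl in *.
  assert (A : Rabs (f u y - f u0 t) < eps / 2).
  { apply Hdt; [|exact H1]. apply ball_le with d; assumption. }
  assert (B : Rabs (f u0 y - f u0 t) < eps / 2) by (apply Hdt; [apply ball_center|exact H1]).
  replace (f u y - f u0 y) with ((f u y - f u0 t) - (f u0 y - f u0 t)) by ring.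
  eapply Rle_lt_trans; [apply Rabs_triang|]. rewrite Rabs_Ropp. lra.
Qed.

Lemma RInt_abs_le (f : R -> R) a b M : a <= b -> cont f ->
  (forall x, a <= x <= b -> Rabs (f x) <= M) -> Rabs (RInt f a b) <= (b - a) * M.
Proof.
  intros Hab Hf H. apply abs_RInt_le_const; auto using cont_ex_RInt.
Qed.

Lemma RInt_abs_le' (f g : R -> R) a b : a <= b -> cont f -> ex_RInt g a b ->
  (forall x, a < x < b -> Rabs (f x) <= g x) -> Rabs (RInt f a b) <= RInt g a b.
Proof.
  intros Hab Hf Hg H.
  apply Rle_trans with (RInt (fun x => Rabs (f x)) a b).
  - apply abs_RInt_le; auto using cont_ex_RInt.
  - apply RInt_le; auto. apply cont_ex_RInt; cont_tac.
Qed.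

Lemma slice_cont {U : UniformSpace} (f : U -> R -> R) u :
  cont (fun z : U * R => f (fst z) (snd z)) -> cont (f u).
Proof.
  intros H y. apply (continuous_comp (fun y => (u, y)) (fun z : U * R => f (fst z) (snd z))).
  - apply continuous_pair; [apply continuous_const|apply continuous_id].
  - apply H.
Qed.

Lemma cont_RInt {U : UniformSpace} (f : U -> R -> R) a b :
  cont (fun z : U * R => f (fst z) (snd z)) -> cont (fun u => RInt (f u) a b).
Proof.
  intros Hf.
  assert (K : forall a b, a <= b -> cont (fun u => RInt (f u) a b)).
  { clear a b. intros a b Hab u0. apply continuous_eps. intros eps He.
    destruct (tube f u0 a b (eps / (b - a + 1)) Hf) as [d [Hd H]].
    { apply Rdiv_lt_0_compat; lra. }
    exists d. split; [exact Hd|]. intros u Hu.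
    rewrite <- (RInt_minus (V := RC)) by (apply cont_ex_RInt, slice_cont, Hf).
    eapply Rle_lt_trans.
    - apply (RInt_abs_le _ a b (eps / (b - a + 1))); [exact Hab| |].
      + apply (cont_minus (U := RU)); apply slice_cont, Hf.
      + intros y Hy. left. apply (H u y Hu Hy).
    - apply Rmult_lt_reg_r with (b - a + 1); [lra|]. field_simplify; [|lra]. nra. }
  destruct (Rle_dec a b) as [h|h]; [apply K, h|].
  apply cont_ext with (fun u => - RInt (f u) b a).
  - intros u. apply (opp_RInt_swap (V := RC)). apply cont_ex_RInt, slice_cont, Hf.
  - apply cont_opp, K; lra.
Qed.

Lemma RInt_rescale (f : R -> R) a b : cont f ->
  RInt f a b = RInt (fun y => (b - a) * f ((b - a) * y + a)) 0 1.
Proof.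
  intros Hf.
  generalize (RInt_comp_lin (V := RC) f (b - a) a 0 1 (cont_ex_RInt _ _ _ Hf)).
  unfold scal; simpl; unfold mult; simpl. intros ->. f_equal; ring.
Qed.

(** Rescaling to [0, 1] turns the moving endpoints into parameters of the integrand. *)
Lemma cont_RInt_var {U : UniformSpace} (f : U -> R -> R) (a b : U -> R) :
  cont (fun z : U * R => f (fst z) (snd z)) -> cont a -> cont b ->
  cont (fun u => RInt (f u) (a u) (b u)).
Proof.
  intros Hf Ha Hb.
  apply cont_ext with (fun u => RInt (fun y => (b u - a u) * f u ((b u - a u) * y + a u)) 0 1).
  - intros u. symmetry. apply RInt_rescale. apply slice_cont, Hf.
  - apply (cont_RInt (fun u y => (b u - a u) * f u ((b u - a u) * y + a u))).
    assert (A : cont (fun z : U * R => a (fst z))) by (apply (cont_fst' a Ha)).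
    assert (B : cont (fun z : U * R => b (fst z))) by (apply (cont_fst' b Hb)).
    apply cont_mult; [cont_tac|].
    apply (cont_compU (V := prod_UniformSpace U R_UniformSpace)
      (fun z : U * R => f (fst z) (snd z))
      (fun z : U * R => (fst z, (b (fst z) - a (fst z)) * snd z + a (fst z)))); [exact Hf|].
    intros z. apply continuous_pair; [apply continuous_fst|].
    apply (cont_plus (U := prod_UniformSpace U R_UniformSpace)
       (fun z : U * R => (b (fst z) - a (fst z)) * snd z)); cont_tac.
Qed.

Lemma is_derive_eps (f : R -> R) (x l : R) :
  is_derive f x l <-> forall eps, 0 < eps -> exists d, 0 < d /\
    forall y, Rabs (y - x) < d -> Rabs (f y - f x - (y - x) * l) <= eps * Rabs (y - x).
Proof.
  split.
  - intros [_ H] eps He.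
    destruct (H x (fun P HP => HP) (mkposreal eps He)) as [d Hd].
    exists d. split; [apply cond_pos|]. intros y Hy. exact (Hd y Hy).
  - intros H. split; [apply is_linear_scal_l|].
    intros x' Hx' eps. assert (x = x') by (apply is_filter_lim_locally_unique; exact Hx'). subst x'.
    destruct (H eps (cond_pos eps)) as [d [Hd1 Hd]].
    exists (mkposreal d Hd1). intros y Hy. exact (Hd y Hy).
Qed.

Lemma MVT_abs (f f' : R -> R) (x y : R) :
  (forall z, Rmin x y <= z <= Rmax x y -> is_derive f z (f' z)) ->
  exists c, Rmin x y <= c <= Rmax x y /\ f y - f x = f' c * (y - x).
Proof.
  intros H. destruct (MVT_gen f x y f') as [c [Hc E]].
  - intros z Hz. apply H. lra.
  - intros z Hz. apply continuity_pt_filterlim, (ex_derive_continuous f z). exists (f' z). apply H, Hz.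
  - exists c. split; assumption.
Qed.

(** By the mean value theorem the difference quotient differs from f' by an increment of f' in its
    first argument, small uniformly in y by [tube]. Differentiability is asked only for a < y < b
    because the densities are differentiable only inside the strip. *)
Lemma derive_RInt_param (f f' : R -> R -> R) (a b x0 r : R) :
  a <= b -> 0 < r -> c2 f -> c2 f' ->
  (forall x y, Rabs (x - x0) < r -> a < y < b -> is_derive (fun x => f x y) x (f' x y)) ->
  is_derive (fun x => RInt (f x) a b) x0 (RInt (f' x0) a b).
Proof.
  intros Hab Hr Hf Hf' HD. apply is_derive_eps. intros eps He.
  destruct (tube f' x0 a b (eps / (b - a + 1)) Hf') as [d [Hd H]].
  { apply Rdiv_lt_0_compat; lra. }
  exists (Rmin d r). split; [apply Rmin_pos; assumption|].
  intros x Hx. assert (Hx1 := Rlt_le_trans _ _ _ Hx (Rmin_l d r)).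
  assert (Hx2 := Rlt_le_trans _ _ _ Hx (Rmin_r d r)).
  assert (c : forall u, cont (f u)) by (intros u; apply slice_cont, Hf).
  assert (c' : forall u, cont (f' u)) by (intros u; apply slice_cont, Hf').
  replace (RInt (f x) a b - RInt (f x0) a b - (x - x0) * RInt (f' x0) a b)
    with (RInt (fun y => f x y - f x0 y - (x - x0) * f' x0 y) a b).
  2:{ symmetry.
      rewrite <- (RInt_minus (V := RC)) by (apply cont_ex_RInt; auto).
      rewrite <- (RInt_scal (V := RC)) by (apply cont_ex_RInt; auto).
      rewrite <- (RInt_minus (V := RC)); [reflexivity| |].
      - apply cont_ex_RInt. apply (cont_minus (U := RU)); auto.
      - apply cont_ex_RInt. apply (cont_mult (U := RU)); auto. apply cont_const. }
  assert (K : Rabs (RInt (fun y => f x y - f x0 y - (x - x0) * f' x0 y) a b)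
     <= RInt (fun _ => eps / (b - a + 1) * Rabs (x - x0)) a b).
  { apply RInt_abs_le'; [exact Hab| | |].
    - apply (cont_minus (U := RU)).
      + apply (cont_minus (U := RU)); auto.
      + apply (cont_mult (U := RU)); auto. apply cont_const.
    - apply ex_RInt_const.
    - intros y Hy.
      assert (B : forall z, Rmin x0 x <= z <= Rmax x0 x -> Rabs (z - x0) <= Rabs (x - x0)).
      { intros z. unfold Rmin, Rmax, Rabs. destruct (Rle_dec _ _), (Rcase_abs _), (Rcase_abs _); lra. }
      destruct (MVT_abs (fun x => f x y) (fun x => f' x y) x0 x) as [cc [Hc E]].
      + intros z Hz. apply HD; [|exact Hy]. specialize (B z Hz). lra.
      + rewrite E. replace (f' cc y * (x - x0) - (x - x0) * f' x0 y)
          with ((f' cc y - f' x0 y) * (x - x0)) by ring.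
        rewrite Rabs_mult. apply Rmult_le_compat_r; [apply Rabs_pos|].
        left. apply (H cc y); [|lra]. apply (Rle_lt_trans _ _ _ (B cc Hc) Hx1). }
  eapply Rle_trans; [exact K|].
  rewrite RInt_const. unfold scal; simpl; unfold mult; simpl.
  rewrite <- Rmult_assoc. apply Rmult_le_compat_r; [apply Rabs_pos|].
  apply Rmult_le_reg_r with (b - a + 1); [lra|]. field_simplify; [|lra]. nra.
Qed.

(** The base point of the integral is also the point of differentiation, so the dependence of the
    integrand on x contributes only to higher order. *)
Lemma derive_RInt_upper (f : R -> R -> R) (x0 : R) : c2 f ->
  is_derive (fun x => RInt (f x) x0 x) x0 (f x0 x0).
Proof.
  intros Hf. apply is_derive_eps. intros eps He.
  destruct (proj1 (continuous_eps _ _) (Hf (x0, x0)) eps He) as [d [Hd H]].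
  exists d. split; [exact Hd|]. intros x Hx.
  assert (c : forall u, cont (f u)) by (intros u; apply slice_cont, Hf).
  rewrite RInt_point. unfold zero; simpl. rewrite Rminus_0_r.
  assert (K : forall z, Rmin x0 x <= z <= Rmax x0 x -> Rabs (f x z - f x0 x0) <= eps).
  { intros z Hz. left. apply (H (x, z)). split; [exact Hx|]. simpl.
    unfold ball; simpl; unfold AbsRing_ball, abs, minus, plus, opp; simpl.
    eapply Rle_lt_trans; [|exact Hx].
    revert Hz. unfold Rmin, Rmax, Rabs. destruct (Rle_dec _ _), (Rcase_abs _), (Rcase_abs _); lra. }
  assert (E : RInt (f x) x0 x - (x - x0) * f x0 x0 = RInt (fun z => f x z - f x0 x0) x0 x).
  { rewrite (RI_minus (f x) (fun _ => f x0 x0)), RI_const; [reflexivity|apply c|apply cont_const]. }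
  rewrite E.
  assert (cc : cont (fun z => f x z - f x0 x0)).
  { apply (cont_minus (U := RU)); [apply c|apply cont_const]. }
  destruct (Rle_dec x0 x) as [h|h].
  - rewrite Rmin_left, Rmax_right in K by lra.
    rewrite (Rabs_right (x - x0)) by lra. rewrite Rmult_comm. apply RInt_abs_le; auto.
  - rewrite Rmin_right, Rmax_left in K by lra.
    rewrite <- (opp_RInt_swap (V := RC)) by (apply cont_ex_RInt, cc).
    unfold opp; simpl. rewrite Rabs_Ropp, (Rabs_left (x - x0)) by lra.
    replace (eps * - (x - x0)) with ((x0 - x) * eps) by ring. apply RInt_abs_le; auto; lra.
Qed.

(** Leibniz rule: cutting the integral at the fixed x0 separates the moving endpoint from the moving
    parameter. *)
Lemma derive_RInt_diag (f f' : R -> R -> R) (a x0 r : R) :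
  a <= x0 -> 0 < r -> c2 f -> c2 f' ->
  (forall x y, Rabs (x - x0) < r -> a < y < x0 -> is_derive (fun x => f x y) x (f' x y)) ->
  is_derive (fun x => RInt (f x) a x) x0 (f x0 x0 + RInt (f' x0) a x0).
Proof.
  intros Ha Hr Hf Hf' HD.
  apply is_derive_ext with (fun x => RInt (f x) x0 x + RInt (f x) a x0).
  - intros x. rewrite Rplus_comm.
    apply (RInt_Chasles (V := RC)); apply cont_ex_RInt, slice_cont, Hf.
  - apply (is_derive_plus (V := RN)); [apply derive_RInt_upper, Hf|].
    apply derive_RInt_param with r; auto.
Qed.

Lemma derive_RInt_diag_lower (f f' : R -> R -> R) (b x0 r : R) :
  x0 <= b -> 0 < r -> c2 f -> c2 f' ->
  (forall x y, Rabs (x - x0) < r -> x0 < y < b -> is_derive (fun x => f x y) x (f' x y)) ->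
  is_derive (fun x => RInt (f x) x b) x0 (- f x0 x0 + RInt (f' x0) x0 b).
Proof.
  intros Ha Hr Hf Hf' HD.
  apply is_derive_ext with (fun x => - RInt (f x) x0 x + RInt (f x) x0 b).
  - intros x. rewrite <- (RInt_Chasles (V := RC) (f x) x0 x b)
      by (apply cont_ex_RInt, slice_cont, Hf).
    unfold plus; simpl. ring.
  - apply (is_derive_plus (V := RN)).
    + apply (is_derive_opp (V := RN)), derive_RInt_upper, Hf.
    + apply derive_RInt_param with r; auto.
Qed.

(** F minus the primitive of f has zero derivative inside and is continuous up to the ends. This
    form suits functions that are differentiable only inside the strip. *)
Lemma RInt_FTC_closed (F f : R -> R) a b : a <= b -> cont F -> cont f ->
  (forall x, a < x < b -> is_derive F x (f x)) -> RInt f a b = F b - F a.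
Proof.
  intros Hab HF Hf HD.
  set (D := fun x => F x - RInt f a x).
  assert (E : D b = D a).
  { destruct (MVT_gen D a b (fun _ => 0)) as [c [_ Hc]].
    - intros x Hx. rewrite Rmin_left, Rmax_right in Hx by lra.
      replace 0 with (f x - f x) by ring.
      apply (is_derive_minus (V := RN)); [apply HD, Hx|].
      apply (is_derive_RInt (V := RC) f (RInt f a) a x).
      + exists (mkposreal 1 Rlt_0_1). intros y _. apply RInt_correct, cont_ex_RInt, Hf.
      + apply Hf.
    - intros x Hx. apply continuity_pt_filterlim.
      apply (cont_minus (U := RU) F); [exact HF|].
      apply (cont_RInt_var (U := RU) (fun _ y => f y)); cont_tac.
      apply (cont_snd' f Hf).
    - lra. }
  unfold D in E. rewrite RInt_point in E. unfold zero in E; simpl in E. lra.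
Qed.

(** * The kernel coth and its images in the walls *)

(** From cosh x = 1 + 2 sinh(x/2)^2 and y <= sinh y for y >= 0. *)
Lemma cosh_ge x : 1 + x ^ 2 / 2 <= cosh x.
Proof.
  assert (E : cosh x = 1 + 2 * (sinh (x / 2)) ^ 2).
  { unfold cosh, sinh. replace x with (x / 2 + x / 2) at 1 2 by field.
    rewrite Ropp_plus_distr, !exp_plus, exp_Ropp.
    field. apply Rgt_not_eq, exp_pos. }
  assert (K : forall y, 0 <= y -> y <= sinh y).
  { intros y Hy. destruct Hy as [Hy| <-].
    - destruct (MVT_gen sinh 0 y cosh) as [c [Hc H]].
      + intros z _. apply is_derive_Reals, derivable_pt_lim_sinh.
      + intros z _. apply derivable_continuous_pt, derivable_pt_sinh.
      + rewrite sinh_0 in H. assert (1 <= cosh c).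
        { unfold cosh. rewrite exp_Ropp. assert (Hp := exp_pos c).
          assert (H0 : exp c * / exp c = 1) by (field; lra).
          assert (Hq := Rinv_0_lt_compat _ Hp).
          assert (0 <= (exp c - / exp c) * (exp c - / exp c)) by apply Rle_0_sqr.
          assert (4 <= (exp c + / exp c) * (exp c + / exp c)) by nra. nra. }
        nra.
    - rewrite sinh_0. lra. }
  rewrite E. assert (x ^ 2 / 4 <= sinh (x / 2) ^ 2); [|lra].
  destruct (Rle_dec 0 x) as [h|h].
  - assert (H := K (x / 2) ltac:(lra)). nra.
  - assert (H := K (- (x / 2)) ltac:(lra)).
    replace (sinh (- (x / 2))) with (- sinh (x / 2)) in H; [nra|].
    unfold sinh. rewrite Ropp_involutive. lra.
Qed.

Lemma cosh_sinh_sq x : cosh x ^ 2 - sinh x ^ 2 = 1.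
Proof.
  unfold cosh, sinh. rewrite exp_Ropp. field. apply Rgt_not_eq, exp_pos.
Qed.

(** Half-angle formula with the Taylor bound cos y <= 1 - y^2/2 + y^4/24, which is at most 1 - y^2/3
    when y^2 <= 4. The constant 1/8 is not sharp. *)
Lemma one_minus_cos_ge phi : Rabs phi <= PI -> phi ^ 2 / 8 <= 1 - cos phi.
Proof.
  intros H. assert (Hpi := PI_4). assert (Hp0 := PI_RGT_0).
  set (y := phi / 2). assert (E : cos phi = 2 * cos y * cos y - 1).
  { rewrite <- cos_2a_cos. f_equal. unfold y. field. }
  assert (Hy : - PI / 2 <= y <= PI / 2).
  { unfold y. revert H. unfold Rabs; destruct (Rcase_abs phi); lra. }
  assert (C0 : 0 <= cos y) by (apply cos_ge_0; lra).
  destruct (cos_bound y 0 (proj1 Hy) (proj2 Hy)) as [_ Hc].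
  unfold cos_approx, cos_term in Hc. simpl in Hc.
  assert (y2 : y * y <= 4) by nra.
  assert (Hc' : cos y <= 1 - y * y / 3).
  { eapply Rle_trans; [exact Hc|]. field_simplify. nra. }
  assert (C1 : cos y <= 1) by nra.
  rewrite E. replace phi with (2 * y) by (unfold y; field). nra.
Qed.

(* coth ((x + i phi) / 2) = (sinh x - i sin phi) / dk x phi, so pk and qk are harmonic conjugates. *)
Definition dk (x phi : R) := cosh x - cos phi.
Definition pk (x phi : R) := sinh x / (2 * PI * dk x phi).
Definition qk (x phi : R) := sin phi / (2 * PI * dk x phi).
Definition pk' (x phi : R) := - (sinh x * sin phi) / (2 * PI * (dk x phi) ^ 2).
Definition qk' (x phi : R) := (cosh x * cos phi - 1) / (2 * PI * (dk x phi) ^ 2).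

Lemma dk_ge x phi : x ^ 2 / 2 <= dk x phi.
Proof. unfold dk. assert (H := cosh_ge x). assert (C := COS_bound phi). lra. Qed.
Lemma dk_pos x phi : 0 < x -> 0 < dk x phi.
Proof. intros H. assert (K := dk_ge x phi). nra. Qed.
(** Near the origin the denominator is comparable to the squared planar distance; this gives the
    kernels a singularity of order 1/r and their gradients one of order 1/r^2. *)
Lemma dk_ge2 x phi : 0 <= x -> Rabs phi <= PI -> (x + Rabs phi) ^ 2 / 16 <= dk x phi.
Proof.
  intros Hx H. unfold dk. assert (A := cosh_ge x). assert (B := one_minus_cos_ge phi H).
  assert (E : phi ^ 2 = Rabs phi ^ 2) by (rewrite <- !Rsqr_pow2; apply Rsqr_abs).
  rewrite E in B. assert (P := Rabs_pos phi). nra.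
Qed.

Lemma pk_period x phi : pk x (phi + 2 * PI) = pk x phi.
Proof. unfold pk, dk. rewrite cos_plus, cos_2PI, sin_2PI. do 3 f_equal. ring. Qed.
Lemma qk_period x phi : qk x (phi + 2 * PI) = qk x phi.
Proof. unfold qk, dk. rewrite cos_plus, sin_plus, cos_2PI, sin_2PI. f_equal; [ring|do 3 f_equal; ring]. Qed.

Lemma pk'_period x phi : pk' x (phi + 2 * PI) = pk' x phi.
Proof.
  unfold pk', dk. rewrite cos_plus, sin_plus, cos_2PI, sin_2PI.
  replace (cos phi * 1 - sin phi * 0) with (cos phi) by ring.
  replace (sin phi * 1 + cos phi * 0) with (sin phi) by ring. reflexivity.
Qed.
Lemma qk'_period x phi : qk' x (phi + 2 * PI) = qk' x phi.
Proof.
  unfold qk', dk. rewrite cos_plus, cos_2PI, sin_2PI.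
  replace (cos phi * 1 - sin phi * 0) with (cos phi) by ring. reflexivity.
Qed.

Lemma pk_dphi x phi : 0 < x -> is_derive (fun y => pk x y) phi (pk' x phi).
Proof.
  intros Hx. assert (D := dk_pos x phi Hx). assert (Hp := PI_RGT_0). unfold pk, pk'. unfold dk in *.
  auto_derive; [apply Rgt_not_eq; nra|]. field. split; lra.
Qed.
Lemma qk_dphi x phi : 0 < x -> is_derive (fun y => qk x y) phi (qk' x phi).
Proof.
  intros Hx. assert (D := dk_pos x phi Hx). assert (Hp := PI_RGT_0). unfold qk, qk'. unfold dk in *.
  assert (T := sin2_cos2 phi). unfold Rsqr in T.
  auto_derive; [apply Rgt_not_eq; nra|].
  replace (cosh x * cos phi - 1) with (cosh x * cos phi - (sin phi * sin phi + cos phi * cos phi)) by lra.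
  field. split; lra.
Qed.
(** Together with [qk_dx] these are the Cauchy-Riemann equations: a derivative in x is, up to sign,
    the phi-derivative of the conjugate kernel and needs no estimate of its own. *)
Lemma pk_dx x phi : 0 < x -> is_derive (fun y => pk y phi) x (- qk' x phi).
Proof.
  intros Hx. assert (D := dk_pos x phi Hx). assert (Hp := PI_RGT_0). unfold pk, qk'. unfold dk in *.
  assert (T := cosh_sinh_sq x).
  apply is_derive_ext with (fun y => sinh y * / (2 * PI * (cosh y - cos phi))); [reflexivity|].
  evar_last.
  - apply (is_derive_mult (K := R_AbsRing)).
    + apply is_derive_Reals, derivable_pt_lim_sinh.
    + apply is_derive_inv.
      * apply is_derive_scal. apply (is_derive_minus (V := RN)).
        -- apply is_derive_Reals, derivable_pt_lim_cosh.
        -- apply (is_derive_const (V := RN)).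
      * apply Rgt_not_eq; nra.
    + intros; apply Rmult_comm.
  - unfold plus, mult, minus, opp, zero; simpl. unfold plus; simpl.
    replace (cosh x * cos phi - 1) with (cosh x * cos phi - (cosh x ^ 2 - sinh x ^ 2)) by lra.
    field. split; lra.
Qed.
Lemma qk_dx x phi : 0 < x -> is_derive (fun y => qk y phi) x (pk' x phi).
Proof.
  intros Hx. assert (D := dk_pos x phi Hx). assert (Hp := PI_RGT_0). unfold qk, pk'. unfold dk in *.
  apply is_derive_ext with (fun y => sin phi * / (2 * PI * (cosh y - cos phi))); [reflexivity|].
  evar_last.
  - apply is_derive_scal. apply is_derive_inv.
    + apply is_derive_scal. apply (is_derive_minus (V := RN)).
      * apply is_derive_Reals, derivable_pt_lim_cosh.
      * apply (is_derive_const (V := RN)).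
    + apply Rgt_not_eq; nra.
  - unfold plus, mult, minus, opp, zero; simpl. unfold plus; simpl. field. split; lra.
Qed.

Lemma Rabs_le_of_sq a b : 0 <= b -> a ^ 2 <= b ^ 2 -> Rabs a <= b.
Proof. intros Hb H. apply Rabs_le. split; nra. Qed.

(** The left side is the squared modulus of the derivative of an analytic function: coth(z/2) has
    derivative of modulus 1 / (2 |sinh(z/2)|^2), and 2 |sinh(z/2)|^2 equals [dk]. *)
Lemma grad_sq x phi : 0 < x -> pk' x phi ^ 2 + qk' x phi ^ 2 = (/ (2 * PI * dk x phi)) ^ 2.
Proof.
  intros Hx. assert (D := dk_pos x phi Hx). assert (Hp := PI_RGT_0). unfold pk', qk'.
  assert (T := sin2_cos2 phi). unfold Rsqr in T. assert (S := cosh_sinh_sq x).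
  assert (E : (sinh x * sin phi) ^ 2 + (cosh x * cos phi - 1) ^ 2 = dk x phi ^ 2).
  { unfold dk. replace ((sinh x * sin phi) ^ 2) with ((cosh x ^ 2 - 1) * (1 - cos phi * cos phi)).
    - ring.
    - replace (cosh x ^ 2 - 1) with (sinh x ^ 2) by lra.
      replace (1 - cos phi * cos phi) with (sin phi * sin phi) by lra. ring. }
  replace ((- (sinh x * sin phi) / (2 * PI * dk x phi ^ 2)) ^ 2 +
   ((cosh x * cos phi - 1) / (2 * PI * dk x phi ^ 2)) ^ 2) with
   (((sinh x * sin phi) ^ 2 + (cosh x * cos phi - 1) ^ 2) / (2 * PI * dk x phi ^ 2) ^ 2)
   by (field; split; lra).
  rewrite E. field. split; lra.
Qed.

Lemma grad_bound x phi : 0 < x ->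
  Rabs (pk' x phi) <= / (2 * PI * dk x phi) /\ Rabs (qk' x phi) <= / (2 * PI * dk x phi).
Proof.
  intros Hx. assert (D := dk_pos x phi Hx). assert (Hp := PI_RGT_0).
  assert (E := grad_sq x phi Hx).
  assert (0 < / (2 * PI * dk x phi)) by (apply Rinv_0_lt_compat; nra).
  split; apply Rabs_le_of_sq; nra.
Qed.

Lemma PI_gt_3 : 3 < PI.
Proof. assert (H := PI2_3_2). lra. Qed.

Lemma grad_near x phi : 0 < x -> Rabs phi <= PI ->
  Rabs (pk' x phi) <= 3 / (x + Rabs phi) ^ 2 /\ Rabs (qk' x phi) <= 3 / (x + Rabs phi) ^ 2.
Proof.
  intros Hx Hphi. assert (B := grad_bound x phi Hx). assert (Hp := PI_gt_3).
  assert (D := dk_ge2 x phi (Rlt_le _ _ Hx) Hphi). assert (P := Rabs_pos phi).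
  assert (P2 : 0 < (x + Rabs phi) ^ 2) by (apply pow_lt; lra).
  assert (K : / (2 * PI * dk x phi) <= 3 / (x + Rabs phi) ^ 2).
  { replace (3 / (x + Rabs phi) ^ 2) with (/ ((x + Rabs phi) ^ 2 / 3)) by (field; lra).
    apply Rinv_le_contravar; nra. }
  destruct B; split; lra.
Qed.

Lemma grad_far x phi : 0 < x ->
  Rabs (pk' x phi) <= / x ^ 2 /\ Rabs (qk' x phi) <= / x ^ 2.
Proof.
  intros Hx. assert (B := grad_bound x phi Hx). assert (Hp := PI_gt_3).
  assert (D := dk_ge x phi).
  assert (K : / (2 * PI * dk x phi) <= / x ^ 2) by (apply Rinv_le_contravar; nra).
  destruct B; split; lra.
Qed.

(** Far away the kernel tends to the constant 1/(2 PI), not to 0. The quadratic rate, weaker than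
    the true exponential one, is enough to sum over the images. *)
Lemma pk_far x phi : 0 < x -> Rabs (pk x phi - / (2 * PI)) <= / x ^ 2.
Proof.
  intros Hx. assert (D := dk_pos x phi Hx). assert (Hp := PI_gt_3). assert (G := dk_ge x phi).
  assert (C := COS_bound phi).
  replace (pk x phi - / (2 * PI)) with ((cos phi - exp (- x)) / (2 * PI * dk x phi)).
  2:{ unfold pk. replace (sinh x) with (cosh x - exp (- x)) by (unfold cosh, sinh; field).
      unfold dk in *. field. split; lra. }
  assert (E1 := exp_pos (- x)). assert (E2 : exp (- x) <= 1).
  { rewrite <- exp_0. left. apply exp_increasing. lra. }
  unfold Rdiv. rewrite Rabs_mult, Rabs_inv. rewrite (Rabs_right (2 * PI * dk x phi)) by nra.
  apply Rle_trans with (2 * / (2 * PI * dk x phi)).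
  - apply Rmult_le_compat_r; [left; apply Rinv_0_lt_compat; nra|]. apply Rabs_le. lra.
  - replace (2 * / (2 * PI * dk x phi)) with (/ (PI * dk x phi)) by (field; split; lra).
    apply Rinv_le_contravar; nra.
Qed.

Lemma qk_far x phi : 0 < x -> Rabs (qk x phi) <= / x ^ 2.
Proof.
  intros Hx. assert (D := dk_pos x phi Hx). assert (Hp := PI_gt_3). assert (G := dk_ge x phi).
  unfold qk, Rdiv. rewrite Rabs_mult, Rabs_inv. rewrite (Rabs_right (2 * PI * dk x phi)) by nra.
  apply Rle_trans with (1 * / (2 * PI * dk x phi)).
  - apply Rmult_le_compat_r; [left; apply Rinv_0_lt_compat; nra|]. apply Rabs_le, SIN_bound.
  - rewrite Rmult_1_l. apply Rinv_le_contravar; nra.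
Qed.

(** This is |coth(z/2)|^2 = (cosh x + cos phi) / (cosh x - cos phi), divided by (2 PI)^2. *)
Lemma kern_sq x phi : 0 < x ->
  pk x phi ^ 2 + qk x phi ^ 2 = (cosh x + cos phi) / ((2 * PI) ^ 2 * dk x phi).
Proof.
  intros Hx. assert (D := dk_pos x phi Hx). assert (Hp := PI_RGT_0). unfold pk, qk.
  assert (T := sin2_cos2 phi). unfold Rsqr in T. assert (S := cosh_sinh_sq x).
  replace ((sinh x / (2 * PI * dk x phi)) ^ 2 + (sin phi / (2 * PI * dk x phi)) ^ 2)
    with ((sinh x ^ 2 + sin phi ^ 2) / (2 * PI * dk x phi) ^ 2) by (field; split; lra).
  replace (sinh x ^ 2 + sin phi ^ 2) with ((cosh x + cos phi) * dk x phi).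
  - field. split; lra.
  - unfold dk. ring_simplify. simpl. simpl in S. nra.
Qed.

Lemma cosh_incr x y : 0 <= x <= y -> cosh x <= cosh y.
Proof.
  intros [Hx Hy]. destruct Hy as [Hy| <-]; [|lra].
  destruct (MVT_gen cosh x y sinh) as [c [Hc H]].
  - intros z _. apply is_derive_Reals, derivable_pt_lim_cosh.
  - intros z _. apply derivable_continuous_pt, derivable_pt_cosh.
  - rewrite Rmin_left, Rmax_right in Hc by lra.
    assert (0 <= sinh c); [|nra].
    unfold sinh. assert (exp (- c) <= exp c); [|lra].
    destruct (Req_dec c 0) as [->|n]; [rewrite Ropp_0; lra|left; apply exp_increasing; lra].
Qed.

Lemma kern_near x phi X : 0 < x <= X -> Rabs phi <= PI ->
  Rabs (pk x phi) <= cosh X / (x + Rabs phi) /\ Rabs (qk x phi) <= cosh X / (x + Rabs phi).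
Proof.
  intros [Hx HX] Hphi. assert (E := kern_sq x phi Hx). assert (Hp := PI_gt_3).
  assert (D := dk_ge2 x phi (Rlt_le _ _ Hx) Hphi). assert (P := Rabs_pos phi).
  assert (Dp := dk_pos x phi Hx).
  assert (C := COS_bound phi). assert (cx := cosh_ge X).
  assert (ci := cosh_incr x X ltac:(lra)).
  assert (K : pk x phi ^ 2 + qk x phi ^ 2 <= (cosh X / (x + Rabs phi)) ^ 2).
  { rewrite E. assert (PP : 36 <= (2 * PI) ^ 2) by nra.
    apply Rmult_le_reg_r with ((2 * PI) ^ 2 * dk x phi); [apply Rmult_lt_0_compat; lra|].
    replace ((cosh x + cos phi) / ((2 * PI) ^ 2 * dk x phi) * ((2 * PI) ^ 2 * dk x phi))
      with (cosh x + cos phi) by (field; split; lra).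
    apply Rle_trans with ((cosh X / (x + Rabs phi)) ^ 2 * (36 * ((x + Rabs phi) ^ 2 / 16))).
    - replace ((cosh X / (x + Rabs phi)) ^ 2 * (36 * ((x + Rabs phi) ^ 2 / 16)))
        with (36 / 16 * cosh X ^ 2) by (field; lra). nra.
    - apply Rmult_le_compat_l; [apply pow2_ge_0|].
      assert (36 <= (2 * PI) ^ 2) by nra.
      assert (0 <= (x + Rabs phi) ^ 2) by apply pow2_ge_0. nra. }
  assert (0 < cosh X / (x + Rabs phi)) by (apply Rdiv_lt_0_compat; nra).
  split; apply Rabs_le_of_sq; nra.
Qed.

Lemma cont_cosh {U : UniformSpace} (f : U -> R) : cont f -> cont (fun z => cosh (f z)).
Proof. intros H. unfold cosh, Rdiv. cont_tac. Qed.
Lemma cont_sinh {U : UniformSpace} (f : U -> R) : cont f -> cont (fun z => sinh (f z)).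
Proof. intros H. unfold sinh, Rdiv. cont_tac. Qed.
#[export] Hint Resolve cont_cosh cont_sinh : cont.

Section KerCont.
Context {U : UniformSpace} (x phi : U -> R).
Hypotheses (Hx : cont x) (Hphi : cont phi) (Hpos : forall z, 0 < x z).
Lemma cont_kden : cont (fun z => 2 * PI * dk (x z) (phi z)).
Proof. unfold dk. cont_tac. Qed.
Lemma kden_neq z : 2 * PI * dk (x z) (phi z) <> 0.
Proof. assert (H := dk_pos (x z) (phi z) (Hpos z)). assert (K := PI_RGT_0). apply Rgt_not_eq. nra. Qed.
Lemma cont_pk : cont (fun z => pk (x z) (phi z)).
Proof. apply cont_div; [apply kden_neq|cont_tac|apply cont_kden]. Qed.
Lemma cont_qk : cont (fun z => qk (x z) (phi z)).
Proof. apply cont_div; [apply kden_neq|cont_tac|apply cont_kden]. Qed.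
Lemma kden2_neq z : 2 * PI * dk (x z) (phi z) ^ 2 <> 0.
Proof.
  assert (H := dk_pos (x z) (phi z) (Hpos z)). assert (K := PI_RGT_0).
  apply Rgt_not_eq. assert (0 < dk (x z) (phi z) ^ 2) by (apply pow_lt, H). nra.
Qed.
Lemma cont_kden2 : cont (fun z => 2 * PI * dk (x z) (phi z) ^ 2).
Proof. unfold dk. simpl. cont_tac. Qed.
Lemma cont_pk' : cont (fun z => pk' (x z) (phi z)).
Proof. apply cont_div; [apply kden2_neq|cont_tac|apply cont_kden2]. Qed.
Lemma cont_qk' : cont (fun z => qk' (x z) (phi z)).
Proof. apply cont_div; [apply kden2_neq|cont_tac|apply cont_kden2]. Qed.
End KerCont.

(* The integral does not depend on x, since p_x = -q_phi, and its limit at infinity is 1. *)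
Lemma pk_int x : 0 < x -> RInt (pk x) (- PI) PI = 1.
Proof.
  intros Hx. assert (Hp := PI_gt_3).
  (* Clipping y at x / 2 makes the integrand continuous on the whole plane and changes nothing for y
     above x / 2. *)
  set (P := fun y phi => pk (Rmax y (x / 2)) phi).
  set (P' := fun y phi => - qk' (Rmax y (x / 2)) phi).
  assert (pos : forall y, 0 < Rmax y (x / 2)).
  { intros y. eapply Rlt_le_trans; [|apply Rmax_r]. lra. }
  assert (cP : c2 P) by (apply cont_pk; [cont_tac|cont_tac|intros z; apply pos]).
  assert (cP' : c2 P').
  { apply cont_opp. apply cont_qk'; [cont_tac|cont_tac|intros z; apply pos]. }
  assert (D : forall y, x / 2 < y -> is_derive (fun y => RInt (P y) (- PI) PI) y 0).
  { intros y Hy. replace 0 with (RInt (P' y) (- PI) PI).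
    - apply derive_RInt_param with (y - x / 2); [lra|lra|exact cP|exact cP'|].
      intros z phi Hz _. apply Rabs_def2 in Hz.
      apply is_derive_ext_loc with (fun z => pk z phi).
      + exists (mkposreal (z - x / 2) ltac:(lra)). intros w Hw. unfold P. rewrite Rmax_left; [reflexivity|].
        unfold ball in Hw; simpl in Hw; unfold AbsRing_ball, abs, minus, plus, opp in Hw; simpl in Hw.
        apply Rabs_def2 in Hw. lra.
      + unfold P'. rewrite Rmax_left by lra. apply pk_dx. lra.
    - unfold P'. rewrite Rmax_left by lra.
      rewrite (RInt_FTC_closed (fun phi => - qk y phi) (fun phi => - qk' y phi)); [|lra| | |].
      + replace (- PI) with (PI - 2 * PI) by ring. rewrite <- (qk_period y (PI - 2 * PI)).
        replace (PI - 2 * PI + 2 * PI) with PI by ring. Req. ring.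
      + apply cont_opp, cont_qk; [cont_tac|cont_tac|intros; lra].
      + apply cont_opp, cont_qk'; [cont_tac|cont_tac|intros; lra].
      + intros phi _. apply (is_derive_opp (V := RN)), qk_dphi. lra. }
  assert (C : forall y, x <= y -> RInt (pk y) (- PI) PI = RInt (pk x) (- PI) PI).
  { intros y Hy.
    destruct (MVT_abs (fun y => RInt (P y) (- PI) PI) (fun _ => 0) x y) as [c [_ E]].
    - intros z Hz. rewrite Rmin_left in Hz by lra. apply D. lra.
    - unfold P in E. rewrite !Rmax_left in E by lra.
      change (fun phi => pk x phi) with (pk x) in E. change (fun phi => pk y phi) with (pk y) in E. lra. }
  destruct (Req_dec (RInt (pk x) (- PI) PI) 1) as [h|h]; [exact h|exfalso].
  set (A := Rabs (RInt (pk x) (- PI) PI - 1)).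
  assert (HA : 0 < A) by (apply Rabs_pos_lt; lra).
  (* Beyond this y the far bound 2 PI / y^2 falls below the supposed deviation A from 1. *)
  set (y := Rmax x (1 + 2 * PI / A)).
  assert (Hy1 : 1 + 2 * PI / A <= y) by apply Rmax_r.
  assert (Hy2 : x <= y) by apply Rmax_l.
  assert (HA2 : 0 < 2 * PI / A) by (apply Rdiv_lt_0_compat; lra).
  assert (cc : cont (pk y)) by (apply (cont_pk (fun _ => y) (fun z => z)); [cont_tac|cont_tac|intros; lra]).
  assert (B : Rabs (RInt (fun phi => pk y phi - / (2 * PI)) (- PI) PI) <= (PI - - PI) * (/ y ^ 2)).
  { apply RInt_abs_le; [lra|cont_tac|]. intros phi _. apply pk_far. lra. }
  rewrite (RI_minus (pk y) (fun _ => / (2 * PI))) in B by cont_tac.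
  rewrite RI_const, C in B by exact Hy2.
  replace ((PI - - PI) * / (2 * PI)) with 1 in B by (field; lra). fold A in B.
  assert (A * y ^ 2 <= 2 * PI).
  { apply Rmult_le_reg_r with (/ y ^ 2); [apply Rinv_0_lt_compat; nra|].
    replace (A * y ^ 2 * / y ^ 2) with A by (field; lra). lra. }
  assert (A * y >= A + 2 * PI).
  { assert (A * (1 + 2 * PI / A) = A + 2 * PI) by (field; lra). nra. }
  nra.
Qed.

(** * Summation over the images in the walls *)

Lemma sum_sq_bound (f : nat -> R) (A B : R) N : 0 <= B ->
  Rabs (f 0%nat) <= A -> (forall n, (1 <= n)%nat -> Rabs (f n) <= B / INR n ^ 2) ->
  Rabs (sum_f_R0 f N) <= A + 2 * B.
Proof.
  intros HB H0 Hn.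
  destruct N as [|N]; [simpl; lra|].
  (* The partial sums of 1/n^2 are compared with those of the telescoping series 1/(n (n + 1)),
     which leaves the constant 2. *)
  assert (K : Rabs (sum_f_R0 f (S N)) <= A + B * (2 - / (INR N + 1))).
  { induction N as [|N IH].
    - simpl. abs_tri.
      assert (Hk := Hn 1%nat ltac:(lia)). simpl in Hk.
      replace (2 - / (0 + 1)) with 1 by field. lra.
    - rewrite tech5. abs_tri.
      assert (Hk := Hn (S (S N)) ltac:(lia)). rewrite !S_INR in *.
      assert (P := pos_INR N). set (k := INR N + 1) in *. assert (k1 : 1 <= k) by (unfold k; lra).
      assert (B / (k + 1) ^ 2 <= B * / (k * (k + 1))).
      { unfold Rdiv. apply Rmult_le_compat_l; [exact HB|]. apply Rinv_le_contravar; nra. }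
      replace (B * (2 - / (k + 1))) with (B * (2 - / k) + B * / (k * (k + 1))) by (field; lra). lra. }
  assert (0 < / (INR N + 1)) by (apply Rinv_0_lt_compat; assert (P := pos_INR N); lra). nra.
Qed.

Lemma is_derive_sum_f_R0 (f : nat -> R -> R) (f' : nat -> R) N x :
  (forall n, is_derive (f n) x (f' n)) ->
  is_derive (fun y => sum_f_R0 (fun n => f n y) N) x (sum_f_R0 f' N).
Proof.
  intros H. induction N as [|N IH]; simpl; [apply H|].
  apply (is_derive_plus (V := RN)); auto.
Qed.

Lemma cont_Rpower {U : UniformSpace} (f : U -> R) r :
  cont f -> (forall z, 0 < f z) -> cont (fun z => Rpower (f z) r).
Proof.
  intros Hf H0. unfold Rpower. apply cont_exp. apply cont_mult; [cont_tac|].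
  intros z. apply (continuous_comp f ln); [apply Hf|].
  apply (ex_derive_continuous ln). exists (/ f z). apply is_derive_Reals, derivable_pt_lim_ln, H0.
Qed.

(* Images of a source in both walls, truncated after N + 1 periods and kept at distance e from the
   singularity; the cut at e / 2 is inactive for the arguments 0 <= sg <= 2 L that occur. *)
Definition X1 (e sg : R) := Rmax (e + sg) (e / 2).
Definition X2 (e L sg : R) := Rmax (e + 2 * L - sg) (e / 2).
Definition jgen (k : R -> R -> R) (c e L : R) (N : nat) (sg phi : R) :=
  sum_f_R0 (fun n => k (X1 e sg + 2 * INR n * L) phi + c * k (X2 e L sg + 2 * INR n * L) phi) N.
(** Differentiation in sg reverses the sign of the second family of images. The signs -1 and 1 are
    those for which it maps [jq] to [jp'] and [jp] to minus [jq']; with -1 the limit 1/(2 PI) of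
    [pk] cancels within each period. *)
Definition jp := jgen pk (-1).
Definition jq := jgen qk 1.
Definition jp' := jgen pk' (-1).
Definition jq' := jgen qk' 1.

Section Kernel.
Variables (e L : R) (N : nat).
Hypotheses (He : 0 < e <= 1) (HL : 0 < L).

Lemma X1_pos sg n : 0 < X1 e sg + 2 * INR n * L.
Proof.
  assert (H := Rmax_r (e + sg) (e / 2)). unfold X1. assert (P := pos_INR n).
  assert (0 <= INR n * L) by nra. lra.
Qed.
Lemma X2_pos sg n : 0 < X2 e L sg + 2 * INR n * L.
Proof.
  assert (H := Rmax_r (e + 2 * L - sg) (e / 2)). unfold X2. assert (P := pos_INR n).
  assert (0 <= INR n * L) by nra. lra.
Qed.

Lemma c2_jgen k c : (forall (x phi : R * R -> R), cont x -> cont phi ->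
  (forall z, 0 < x z) -> cont (fun z => k (x z) (phi z))) -> c2 (jgen k c e L N).
Proof.
  intros H. unfold c2, jgen.
  apply (cont_sum_n (U := RU2)
    (fun n z => k (X1 e (fst z) + 2 * INR n * L) (snd z) +
       c * k (X2 e L (fst z) + 2 * INR n * L) (snd z))).
  intros n. apply cont_plus; [|apply cont_mult; [cont_tac|]].
  - apply (H (fun z => X1 e (fst z) + 2 * INR n * L) snd); [unfold X1; cont_tac|cont_tac|].
    intros z; apply X1_pos.
  - apply (H (fun z => X2 e L (fst z) + 2 * INR n * L) snd); [unfold X2; cont_tac|cont_tac|].
    intros z; apply X2_pos.
Qed.
Lemma c2_jp : c2 (jp e L N). Proof. apply c2_jgen. apply cont_pk. Qed.
Lemma c2_jq : c2 (jq e L N). Proof. apply c2_jgen. apply cont_qk. Qed.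
Lemma c2_jp' : c2 (jp' e L N). Proof. apply c2_jgen. apply cont_pk'. Qed.
Lemma c2_jq' : c2 (jq' e L N). Proof. apply c2_jgen. apply cont_qk'. Qed.

Lemma jgen_dphi k k' c sg phi : (forall x phi, 0 < x -> is_derive (k x) phi (k' x phi)) ->
  is_derive (jgen k c e L N sg) phi (jgen k' c e L N sg phi).
Proof.
  intros H. unfold jgen.
  apply (is_derive_sum_f_R0 (fun n phi => k (X1 e sg + 2 * INR n * L) phi
        + c * k (X2 e L sg + 2 * INR n * L) phi)).
  intros n. apply (is_derive_plus (V := RN)).
  - apply H, X1_pos.
  - apply is_derive_scal. apply (H _ _ (X2_pos sg n)).
Qed.
Lemma jp_dphi sg phi : is_derive (jp e L N sg) phi (jp' e L N sg phi).
Proof. apply jgen_dphi. exact pk_dphi. Qed.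
Lemma jq_dphi sg phi : is_derive (jq e L N sg) phi (jq' e L N sg phi).
Proof. apply jgen_dphi. exact qk_dphi. Qed.

Lemma jgen_dsg k k' c sg phi : - (e / 2) < sg < 2 * L + e / 2 ->
  (forall x, 0 < x -> is_derive (fun x => k x phi) x (k' x phi)) ->
  is_derive (fun sg => jgen k c e L N sg phi) sg (jgen k' (- c) e L N sg phi).
Proof.
  intros Hs H. unfold jgen.
  apply (is_derive_sum_f_R0 (fun n sg => k (X1 e sg + 2 * INR n * L) phi
        + c * k (X2 e L sg + 2 * INR n * L) phi)).
  intros n.
  assert (Hr : 0 < Rmin (sg + e / 2) (2 * L + e / 2 - sg)) by (apply Rmin_pos; lra).
  apply is_derive_ext_loc with
    (fun sg => k (e + sg + 2 * INR n * L) phi + c * k (e + 2 * L - sg + 2 * INR n * L) phi).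
  - exists (mkposreal _ Hr). intros w Hw.
    unfold ball in Hw; simpl in Hw; unfold AbsRing_ball, abs, minus, plus, opp in Hw; simpl in Hw.
    assert (H1 := Rlt_le_trans _ _ _ Hw (Rmin_l _ _)). assert (H2 := Rlt_le_trans _ _ _ Hw (Rmin_r _ _)).
    apply Rabs_def2 in H1. apply Rabs_def2 in H2.
    unfold X1, X2. rewrite !Rmax_left by lra. reflexivity.
  - assert (P1 := X1_pos sg n). assert (P2 := X2_pos sg n). unfold X1, X2 in *.
    rewrite !Rmax_left in * by lra.
    apply (is_derive_plus (V := RN)).
    + evar_last.
      * apply (is_derive_comp (V := RN) (fun x => k x phi) (fun sg => e + sg + 2 * INR n * L)).
        -- apply H, P1.
        -- instantiate (1 := 1). auto_derive; [exact I|ring].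
      * unfold scal; simpl; unfold mult; simpl. ring.
    + replace (- c * k' (e + 2 * L - sg + 2 * INR n * L) phi)
        with (c * (- k' (e + 2 * L - sg + 2 * INR n * L) phi)) by ring.
      apply is_derive_scal. evar_last.
      * apply (is_derive_comp (V := RN) (fun x => k x phi) (fun sg => e + 2 * L - sg + 2 * INR n * L)).
        -- apply H, P2.
        -- instantiate (1 := -1). auto_derive; [exact I|ring].
      * unfold scal; simpl; unfold mult; simpl. ring.
Qed.
Lemma jq_dsg sg phi : - (e / 2) < sg < 2 * L + e / 2 ->
  is_derive (fun sg => jq e L N sg phi) sg (jp' e L N sg phi).
Proof. intros H. apply (jgen_dsg qk pk' 1); [exact H|]. intros x Hx. apply qk_dx, Hx. Qed.
Lemma jp_dsg sg phi : - (e / 2) < sg < 2 * L + e / 2 ->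
  is_derive (fun sg => jp e L N sg phi) sg (- jq' e L N sg phi).
Proof.
  intros H. evar_last.
  - apply (jgen_dsg pk (fun x phi => - qk' x phi) (-1)); [exact H|]. intros x Hx. apply pk_dx, Hx.
  - unfold jq', jgen. Req. induction N as [|M IH]; simpl; [ring|].
    simpl in IH. rewrite IH. ring.
Qed.

Lemma jgen_period k c sg phi : (forall x phi, k x (phi + 2 * PI) = k x phi) ->
  jgen k c e L N sg (phi + 2 * PI) = jgen k c e L N sg phi.
Proof. intros H. unfold jgen. apply sum_eq. intros n _. rewrite !H. reflexivity. Qed.
Lemma jp_period sg phi : jp e L N sg (phi + 2 * PI) = jp e L N sg phi.
Proof. apply jgen_period, pk_period. Qed.
Lemma jq_period sg phi : jq e L N sg (phi + 2 * PI) = jq e L N sg phi.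
Proof. apply jgen_period, qk_period. Qed.

Lemma jp'_period sg phi : jp' e L N sg (phi + 2 * PI) = jp' e L N sg phi.
Proof. apply jgen_period, pk'_period. Qed.
Lemma jq'_period sg phi : jq' e L N sg (phi + 2 * PI) = jq' e L N sg phi.
Proof. apply jgen_period, qk'_period. Qed.

(** The reflection sg to 2 L - sg exchanges the two families of images. This symmetry makes V vanish
    on the upper wall. *)
Lemma jq_sym sg phi : jq e L N (2 * L - sg) phi = jq e L N sg phi.
Proof.
  unfold jq, jgen. apply sum_eq. intros n _.
  replace (X1 e (2 * L - sg)) with (X2 e L sg) by (unfold X1, X2; f_equal; ring).
  replace (X2 e L (2 * L - sg)) with (X1 e sg) by (unfold X1, X2; f_equal; ring). ring.
Qed.

(** At sg = 0 the two families occupy the points e + 2 n L and the series telescopes. The first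
    surviving term is the Poisson kernel of the disc of radius exp(-e), an approximate identity; the
    last is close to 1/(2 PI) and produces minus the mean. *)
Lemma jp_zero phi : jp e L N 0 phi = pk e phi - pk (e + 2 * INR (S N) * L) phi.
Proof.
  unfold jp, jgen.
  replace (X1 e 0) with e by (unfold X1; rewrite Rmax_left; lra).
  replace (X2 e L 0) with (e + 2 * L) by (unfold X2; rewrite Rmax_left; lra).
  induction N as [|M IH].
  - simpl sum_f_R0. simpl INR. replace (e + 2 * 0 * L) with e by ring.
    replace (e + 2 * L + 2 * 0 * L) with (e + 2 * 1 * L) by ring. ring.
  - rewrite tech5, IH. rewrite (S_INR (S M)).
    replace (e + 2 * L + 2 * INR (S M) * L) with (e + 2 * (INR (S M) + 1) * L) by ring. ring.
Qed.

(** One constant for all four kernels: the hyperbolic cosine comes from [kern_near], the 3 from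
    [grad_near], and the two quotients absorb the far images, of total size 1/L^2, into the nearest
    singularity. *)
Definition C0 := 2 * cosh (2 * L + 1) + 3 + (2 * L + 5) ^ 2 / L ^ 2 + (2 * L + 5) / L ^ 2.

Lemma C0_pos : 1 <= C0.
Proof.
  unfold C0. assert (H := cosh_ge (2 * L + 1)).
  assert (0 < (2 * L + 5) ^ 2 / L ^ 2) by (apply Rdiv_lt_0_compat; apply pow_lt; lra).
  assert (0 < (2 * L + 5) / L ^ 2) by (apply Rdiv_lt_0_compat; [|apply pow_lt]; lra).
  nra.
Qed.

Lemma far_sq x y n : 0 < x -> (1 <= n)%nat -> y <= / (x + 2 * INR n * L) ^ 2 ->
  y <= (/ (4 * L ^ 2)) / INR n ^ 2.
Proof.
  intros Hx Hn H. eapply Rle_trans; [exact H|].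
  assert (1 <= INR n) by (apply (le_INR 1); exact Hn).
  replace (/ (4 * L ^ 2) / INR n ^ 2) with (/ (2 * INR n * L) ^ 2) by (field; lra).
  apply Rinv_le_contravar; [apply pow_lt; nra|].
  apply pow_incr. nra.
Qed.

(** c0 is the limit of k at infinity. The condition on c makes it cancel between the two images of
    each period, after which the periods n >= 1 sum like 1/n^2; E1 and E2 account for the nearest
    images. *)
Lemma jgen_bound k c sg phi (E1 E2 c0 : R) : 0 <= sg <= 2 * L -> Rabs c = 1 -> c0 + c * c0 = 0 ->
  Rabs (k (e + sg) phi) <= E1 -> Rabs (k (e + 2 * L - sg) phi) <= E2 ->
  (forall x, 0 < x -> Rabs (k x phi - c0) <= / x ^ 2) ->
  Rabs (jgen k c e L N sg phi) <= E1 + E2 + / L ^ 2.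
Proof.
  intros Hs Hc Hc0 H1 H2 Hf. unfold jgen.
  assert (x1 : X1 e sg = e + sg) by (unfold X1; rewrite Rmax_left; lra).
  assert (x2 : X2 e L sg = e + 2 * L - sg) by (unfold X2; rewrite Rmax_left; lra).
  rewrite x1, x2.
  replace (/ L ^ 2) with (2 * (2 * / (4 * L ^ 2))) by (field; lra).
  apply sum_sq_bound.
  - assert (0 < / (4 * L ^ 2)) by (apply Rinv_0_lt_compat; nra). lra.
  - simpl INR. replace (e + sg + 2 * 0 * L) with (e + sg) by ring.
    replace (e + 2 * L - sg + 2 * 0 * L) with (e + 2 * L - sg) by ring.
    abs_tri. rewrite Rabs_mult, Hc. lra.
  - intros n Hn.
    assert (P1 := X1_pos sg n). rewrite x1 in P1. assert (P2 := X2_pos sg n). rewrite x2 in P2.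
    assert (A := far_sq (e + sg) _ n ltac:(lra) Hn (Hf _ P1)).
    assert (B := far_sq (e + 2 * L - sg) _ n ltac:(lra) Hn (Hf _ P2)).
    set (a := k (e + sg + 2 * INR n * L) phi) in *. set (b := k (e + 2 * L - sg + 2 * INR n * L) phi) in *.
    unfold Rdiv in *. rewrite Rmult_assoc.
    replace (a + c * b) with ((a - c0) + c * (b - c0)) by (ring_simplify; lra).
    abs_tri. rewrite Rabs_mult, Hc. lra.
Qed.

(** 2 L + 5 bounds x + |phi|, since PI <= 4. *)
Lemma inv_L_near1 x phi : 0 < x <= 2 * L + 1 -> Rabs phi <= PI ->
  / L ^ 2 <= (2 * L + 5) / L ^ 2 * / (x + Rabs phi).
Proof.
  intros Hx Hp. assert (P4 := PI_4). assert (P := Rabs_pos phi).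
  replace ((2 * L + 5) / L ^ 2 * / (x + Rabs phi)) with (/ L ^ 2 * ((2 * L + 5) / (x + Rabs phi))) by (field; lra).
  rewrite <- (Rmult_1_r (/ L ^ 2)) at 1.
  apply Rmult_le_compat_l; [left; apply Rinv_0_lt_compat, pow_lt, HL|].
  apply Rmult_le_reg_r with (x + Rabs phi); [lra|]. field_simplify; lra.
Qed.
Lemma inv_L_near2 x phi : 0 < x <= 2 * L + 1 -> Rabs phi <= PI ->
  / L ^ 2 <= (2 * L + 5) ^ 2 / L ^ 2 * / (x + Rabs phi) ^ 2.
Proof.
  intros Hx Hp. assert (P4 := PI_4). assert (P := Rabs_pos phi).
  replace ((2 * L + 5) ^ 2 / L ^ 2 * / (x + Rabs phi) ^ 2)
    with (/ L ^ 2 * ((2 * L + 5) ^ 2 / (x + Rabs phi) ^ 2)) by (field; lra).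
  rewrite <- (Rmult_1_r (/ L ^ 2)) at 1.
  apply Rmult_le_compat_l; [left; apply Rinv_0_lt_compat, pow_lt, HL|].
  assert (0 < (x + Rabs phi) ^ 2) by (apply pow_lt; lra).
  apply Rmult_le_reg_r with ((x + Rabs phi) ^ 2); [lra|].
  replace ((2 * L + 5) ^ 2 / (x + Rabs phi) ^ 2 * (x + Rabs phi) ^ 2) with ((2 * L + 5) ^ 2) by (field; lra).
  rewrite Rmult_1_l. apply pow_incr. lra.
Qed.

Definition nu (n : nat) (sg phi : R) :=
  / (e + sg + Rabs phi) ^ n + / (e + 2 * L - sg + Rabs phi) ^ n.

Lemma j_bound sg phi : 0 <= sg <= 2 * L -> Rabs phi <= PI ->
  (Rabs (jp e L N sg phi) <= C0 * nu 1 sg phi /\ Rabs (jq e L N sg phi) <= C0 * nu 1 sg phi) /\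
  (Rabs (jp' e L N sg phi) <= C0 * nu 2 sg phi /\ Rabs (jq' e L N sg phi) <= C0 * nu 2 sg phi).
Proof.
  intros Hs Hp. assert (P := Rabs_pos phi).
  assert (Q1 : 0 < e + sg <= 2 * L + 1) by lra.
  assert (Q2 : 0 < e + 2 * L - sg <= 2 * L + 1) by lra.
  assert (ch := cosh_ge (2 * L + 1)).
  assert (cp : 0 < (2 * L + 5) ^ 2 / L ^ 2) by (apply Rdiv_lt_0_compat; apply pow_lt; lra).
  assert (cq : 0 < (2 * L + 5) / L ^ 2) by (apply Rdiv_lt_0_compat; [|apply pow_lt]; lra).
  assert (n1 := kern_near _ phi _ Q1 Hp). assert (n2 := kern_near _ phi _ Q2 Hp).
  assert (g1 := grad_near _ phi (proj1 Q1) Hp). assert (g2 := grad_near _ phi (proj1 Q2) Hp).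
  assert (l1 := inv_L_near1 _ phi Q1 Hp). assert (l2 := inv_L_near2 _ phi Q1 Hp).
  assert (i1 : 0 < / (e + sg + Rabs phi)) by (apply Rinv_0_lt_compat; lra).
  assert (i2 : 0 < / (e + 2 * L - sg + Rabs phi)) by (apply Rinv_0_lt_compat; lra).
  assert (i3 : 0 < / (e + sg + Rabs phi) ^ 2) by (apply Rinv_0_lt_compat, pow_lt; lra).
  assert (i4 : 0 < / (e + 2 * L - sg + Rabs phi) ^ 2) by (apply Rinv_0_lt_compat, pow_lt; lra).
  assert (a1 : Rabs 1 = 1) by (apply Rabs_R1). assert (a2 : Rabs (-1) = 1) by (rewrite Rabs_left; lra).
  unfold nu, C0. rewrite !pow_1. unfold Rdiv in *.
  set (c := cosh (2 * L + 1)) in *. set (A := (2 * L + 5) ^ 2 * / L ^ 2) in *.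
  set (B := (2 * L + 5) * / L ^ 2) in *.
  assert (c1 : 1 <= c) by nra.
  split; split.
  - eapply Rle_trans; [eapply (jgen_bound pk (-1) sg phi _ _ (/ (2 * PI)) Hs a2 ltac:(ring) (proj1 n1) (proj1 n2))|].
    + intros x Hx. apply pk_far, Hx.
    + nra.
  - eapply Rle_trans; [eapply (jgen_bound qk 1 sg phi _ _ 0 Hs a1 ltac:(ring) (proj2 n1) (proj2 n2))|].
    + intros x Hx. rewrite Rminus_0_r. apply qk_far, Hx.
    + nra.
  - eapply Rle_trans; [eapply (jgen_bound pk' (-1) sg phi _ _ 0 Hs a2 ltac:(ring) (proj1 g1) (proj1 g2))|].
    + intros x Hx. rewrite Rminus_0_r. apply grad_far, Hx.
    + nra.
  - eapply Rle_trans; [eapply (jgen_bound qk' 1 sg phi _ _ 0 Hs a1 ltac:(ring) (proj2 g1) (proj2 g2))|].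
    + intros x Hx. rewrite Rminus_0_r. apply grad_far, Hx.
    + nra.
Qed.

(* Integrals of the majorants over a period; the power -1 is traded for two powers -1/2. *)
Lemma RInt_even_pow (x r : R) : 0 < x -> r <> -1 ->
  RInt (fun phi => Rpower (x + Rabs phi) r) (- PI) PI
  = 2 * ((Rpower (x + PI) (r + 1) - Rpower x (r + 1)) / (r + 1)).
Proof.
  intros Hx Hr. assert (Hp := PI_RGT_0).
  assert (cR : cont (fun phi => Rpower (x + Rabs phi) r)).
  { apply (cont_Rpower (U := RU)); [cont_tac|]. intros z. assert (K := Rabs_pos z). lra. }
  assert (cP : forall c, cont (fun phi => Rpower (x + Rabs phi) (r + 1) / c)).
  { intros c. unfold Rdiv. apply (cont_mult (U := RU)); [|cont_tac].
    apply (cont_Rpower (U := RU)); [cont_tac|]. intros z. assert (K := Rabs_pos z). lra. }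
  assert (DP : forall y, 0 < y -> is_derive (fun y => Rpower y (r + 1) / (r + 1)) y (Rpower y r)).
  { intros y Hy. unfold Rpower. auto_derive; [exact Hy|].
    replace (r * ln y) with ((r + 1) * ln y - ln y) by ring. unfold Rminus.
    rewrite exp_plus, exp_Ropp, exp_ln by exact Hy. field. split; lra. }
  rewrite <- (RI_chasles (fun phi : R => Rpower (x + Rabs phi) r) (- PI) 0 cR PI).
  rewrite (RInt_FTC_closed (fun phi => - (Rpower (x + Rabs phi) (r + 1) / (r + 1)))
     (fun phi => Rpower (x + Rabs phi) r) (- PI) 0); [|lra|apply cont_opp, cP|exact cR|].
  - rewrite (RInt_FTC_closed (fun phi => Rpower (x + Rabs phi) (r + 1) / (r + 1))
     (fun phi => Rpower (x + Rabs phi) r) 0 PI); [|lra|apply cP|exact cR|].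
    + rewrite Rabs_R0, Rabs_Ropp, (Rabs_right PI), Rplus_0_r by lra. Req. field. lra.
    + intros phi Hphi.
      apply is_derive_ext_loc with (fun y => Rpower (x + y) (r + 1) / (r + 1)).
      * exists (mkposreal phi (proj1 Hphi)). intros w Hw.
        unfold ball in Hw; simpl in Hw; unfold AbsRing_ball, abs, minus, plus, opp in Hw; simpl in Hw.
        apply Rabs_def2 in Hw. rewrite (Rabs_right w) by lra. reflexivity.
      * rewrite (Rabs_right phi) by lra. evar_last.
        -- apply (is_derive_comp (V := RN) (fun y => Rpower y (r + 1) / (r + 1)) (fun y => x + y)).
           ++ apply DP. lra.
           ++ instantiate (1 := 1). auto_derive; [exact I|ring].
        -- unfold scal; simpl; unfold mult; simpl. Req. ring.
  - intros phi Hphi.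
    apply is_derive_ext_loc with (fun y => - (Rpower (x - y) (r + 1) / (r + 1))).
    + exists (mkposreal (- phi) ltac:(lra)). intros w Hw.
      unfold ball in Hw; simpl in Hw; unfold AbsRing_ball, abs, minus, plus, opp in Hw; simpl in Hw.
      apply Rabs_def2 in Hw. rewrite (Rabs_left w) by lra. reflexivity.
    + rewrite (Rabs_left phi) by lra. evar_last.
      * apply (is_derive_opp (V := RN)).
        apply (is_derive_comp (V := RN) (fun y => Rpower y (r + 1) / (r + 1)) (fun y => x - y)).
        -- apply DP. lra.
        -- instantiate (1 := -1). auto_derive; [exact I|ring].
      * unfold scal, opp; simpl; unfold mult; simpl. replace (x - phi) with (x + - phi) by ring. Req. ring.
Qed.

Lemma RInt_pow_neg (x eta : R) : 0 < x -> 0 < eta < 1 ->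
  RInt (fun phi => Rpower (x + Rabs phi) (eta - 2)) (- PI) PI <= 2 / (1 - eta) * Rpower x (eta - 1).
Proof.
  intros Hx Het. rewrite RInt_even_pow by lra.
  replace (eta - 2 + 1) with (eta - 1) by ring.
  assert (H := exp_pos ((eta - 1) * ln (x + PI))). fold (Rpower (x + PI) (eta - 1)) in H.
  replace (2 * ((Rpower (x + PI) (eta - 1) - Rpower x (eta - 1)) / (eta - 1)))
    with (2 / (1 - eta) * (Rpower x (eta - 1) - Rpower (x + PI) (eta - 1))) by (field; lra).
  apply Rmult_le_compat_l; [|lra]. left. apply Rdiv_lt_0_compat; lra.
Qed.

Lemma RInt_pow_half (x : R) : 0 < x <= 2 * L + 1 ->
  RInt (fun phi => Rpower (x + Rabs phi) (- / 2)) (- PI) PI <= 4 * (2 * L + 5).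
Proof.
  intros Hx. assert (P4 := PI_4). assert (Hp := PI_RGT_0). rewrite RInt_even_pow by lra.
  replace (- / 2 + 1) with (/ 2) by field.
  assert (H := exp_pos (/ 2 * ln x)). fold (Rpower x (/ 2)) in H.
  assert (K : Rpower (x + PI) (/ 2) <= 2 * L + 5).
  { rewrite Rpower_sqrt by lra. apply Rle_trans with (sqrt ((2 * L + 5) ^ 2)).
    - apply sqrt_le_1_alt. nra.
    - rewrite sqrt_pow2; lra. }
  replace (2 * ((Rpower (x + PI) (/ 2) - Rpower x (/ 2)) / / 2))
    with (4 * (Rpower (x + PI) (/ 2) - Rpower x (/ 2))) by field.
  lra.
Qed.
End Kernel.

(** * Velocity operators on the strip *)

Lemma RI_reflect (f : R -> R) c a b : cont f ->
  RInt (fun x => f (c - x)) a b = RInt f (c - b) (c - a).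
Proof.
  intros Hf.
  assert (E := RInt_comp_lin (V := RC) f (-1) c a b (cont_ex_RInt _ _ _ Hf)).
  unfold scal in E; simpl in E; unfold mult in E; simpl in E.
  assert (cf : cont (fun x => f (c - x))) by (apply (cont_comp (U := RU) f); [exact Hf|cont_tac]).
  assert (E2 : RInt (fun y => -1 * f (-1 * y + c)) a b = - RInt (fun x => f (c - x)) a b).
  { rewrite <- RI_opp by exact cf. apply RInt_ext. intros x _.
    replace (-1 * x + c) with (c - x) by ring. Req. ring. }
  rewrite (RI_swap f (c - a) (c - b) Hf).
  replace (c - a) with (-1 * a + c) by ring. replace (c - b) with (-1 * b + c) by ring. lra.
Qed.

Lemma RI_shift (f : R -> R) c a b : cont f ->
  RInt (fun x => f (x + c)) a b = RInt f (a + c) (b + c).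
Proof.
  intros Hf.
  assert (E := RInt_comp_lin (V := RC) f 1 c a b (cont_ex_RInt _ _ _ Hf)).
  unfold scal in E; simpl in E; unfold mult in E; simpl in E.
  rewrite !Rmult_1_l in E. rewrite <- E. apply RInt_ext. intros x _. rewrite !Rmult_1_l. reflexivity.
Qed.

Lemma RI_period (f : R -> R) a : cont f -> (forall x, f (x + 2 * PI) = f x) ->
  RInt f a (a + 2 * PI) = RInt f (- PI) PI.
Proof.
  intros Hf Hp.
  rewrite <- (RI_chasles f a (- PI) Hf (a + 2 * PI)).
  rewrite <- (RI_chasles f (- PI) PI Hf (a + 2 * PI)).
  assert (E : RInt f PI (a + 2 * PI) = RInt f (- PI) a).
  { replace PI with (- PI + 2 * PI) at 1 by ring. rewrite <- (RI_shift f) by exact Hf.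
    apply RInt_ext. intros x _. apply Hp. }
  rewrite E, (RI_swap f (- PI) a Hf). Req. ring.
Qed.

Definition per (f : R -> R -> R) := forall x y, f (x + 2 * PI) y = f x y.

Definition conv (j : R -> R -> R) (g : R -> R -> R) (sg s phi : R) : R :=
  RInt (fun x => j sg x * g (phi - x) s) (- PI) PI.

Lemma c3_conv j g : c2 j -> c2 g -> c3 (conv j g).
Proof.
  intros Hj Hg. unfold c3, conv.
  apply (cont_RInt (U := prod_UniformSpace (RU2) R_UniformSpace)
    (fun z x => j (fst (fst z)) x * g (snd z - x) (snd (fst z)))).
  apply cont_mult; apply cont_comp2; cont_tac.
Qed.

Lemma c2_slice1 j x : c2 j -> cont (j x).
Proof. intros H. apply (slice_cont (U := RU) j x H). Qed.
Lemma c2_slice2 j y : c2 j -> cont (fun x => j x y).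
Proof. intros H. apply (cont_comp2 (U := RU) j (fun x => x) (fun _ => y)); cont_tac. Qed.

(** Substitution and periodicity move the dependence on phi from the density to the kernel, so that
    the convolution can be differentiated in phi when g is merely continuous. *)
Lemma conv_second j g sg s phi : c2 j -> c2 g -> (forall x, j sg (x + 2 * PI) = j sg x) -> per g ->
  conv j g sg s phi = RInt (fun y => j sg (phi - y) * g y s) (- PI) PI.
Proof.
  intros Hj Hg Pj Pg. unfold conv.
  set (F := fun y => j sg (phi - y) * g y s).
  assert (cF : cont F).
  { apply (cont_mult (U := RU)).
    - apply (cont_comp (U := RU) (j sg)); [apply (c2_slice1 j sg Hj)|cont_tac].
    - apply (c2_slice2 g s Hg). }
  transitivity (RInt (fun x => F (phi - x)) (- PI) PI).
  - apply RInt_ext. intros x _. unfold F. replace (phi - (phi - x)) with x by ring. reflexivity.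
  - rewrite RI_reflect by exact cF.
    replace (phi - - PI) with (phi - PI + 2 * PI) by ring. apply RI_period; [exact cF|].
    intros x. unfold F. rewrite Pg. f_equal.
    replace (phi - x) with (phi - (x + 2 * PI) + 2 * PI) by ring. symmetry. apply Pj.
Qed.

Lemma conv_dphi j j' g sg s phi : c2 j -> c2 j' -> c2 g -> per g ->
  (forall x, j sg (x + 2 * PI) = j sg x) -> (forall x, j' sg (x + 2 * PI) = j' sg x) ->
  (forall x, is_derive (j sg) x (j' sg x)) ->
  is_derive (fun phi => conv j g sg s phi) phi (conv j' g sg s phi).
Proof.
  intros Hj Hj' Hg Pg Pj Pj' D. assert (Hp := PI_RGT_0).
  rewrite (conv_second j' g) by assumption.
  apply is_derive_ext with (fun phi => RInt (fun y => j sg (phi - y) * g y s) (- PI) PI).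
  - intros t. symmetry. apply conv_second; assumption.
  - apply (derive_RInt_param (fun phi y => j sg (phi - y) * g y s)
      (fun phi y => j' sg (phi - y) * g y s) _ _ phi 1); [lra|lra| | |].
    + apply cont_mult; apply cont_comp2; cont_tac.
    + apply cont_mult; apply cont_comp2; cont_tac.
    + intros x y _ _. evar_last.
      * apply (is_derive_mult (K := R_AbsRing) (fun x => j sg (x - y)) (fun _ => g y s)).
        -- apply (is_derive_comp (V := RN) (j sg) (fun x => x - y)); [apply D|].
           instantiate (1 := 1). auto_derive; [exact I|ring].
        -- apply (is_derive_const (V := RN)).
        -- intros; apply Rmult_comm.
      * unfold plus, mult, scal, zero; simpl; unfold mult; simpl. ring.
Qed.

Lemma conv_dsg j k g sg s phi r : 0 < r -> c2 j -> c2 k -> c2 g ->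
  (forall t x, Rabs (t - sg) < r -> is_derive (fun t => j t x) t (k t x)) ->
  is_derive (fun t => conv j g t s phi) sg (conv k g sg s phi).
Proof.
  intros Hr Hj Hk Hg D. assert (Hp := PI_RGT_0). unfold conv.
  apply (derive_RInt_param (fun t x => j t x * g (phi - x) s)
      (fun t x => k t x * g (phi - x) s) _ _ sg r); [lra|lra| | |].
  - apply cont_mult; apply cont_comp2; cont_tac.
  - apply cont_mult; apply cont_comp2; cont_tac.
  - intros t x Ht _. evar_last.
    + apply (is_derive_mult (K := R_AbsRing) (fun t => j t x) (fun _ => g (phi - x) s)).
      * apply D, Ht.
      * apply (is_derive_const (V := RN)).
      * intros; apply Rmult_comm.
    + unfold plus, mult, zero; simpl. ring.
Qed.

Lemma conv_dphi_g j g g' sg s phi : c2 j -> c2 g -> c2 g' ->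
  (forall x, is_derive (fun x => g x s) x (g' x s)) ->
  is_derive (fun phi => conv j g sg s phi) phi (conv j g' sg s phi).
Proof.
  intros Hj Hg Hg' D. assert (Hp := PI_RGT_0). unfold conv.
  apply (derive_RInt_param (fun phi x => j sg x * g (phi - x) s)
      (fun phi x => j sg x * g' (phi - x) s) _ _ phi 1); [lra|lra| | |].
  - apply cont_mult; apply cont_comp2; cont_tac.
  - apply cont_mult; apply cont_comp2; cont_tac.
  - intros t x _ _. apply is_derive_scal. evar_last.
    + apply (is_derive_comp (V := RN) (fun x => g x s) (fun t => t - x)); [apply D|].
      instantiate (1 := 1). auto_derive; [exact I|ring].
    + unfold scal; simpl; unfold mult; simpl. ring.
Qed.

Section Op.
Variable L : R.
Hypothesis HL : 0 < L.

(** The first argument of G is the separation between the target height s and the source height y: s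
    - y from sources below, y - s from sources above, and s + y for the reflection in the wall s =
    0. The split at y = s keeps the integrands smooth across the diagonal. *)
Definition I1 (G : R -> R -> R -> R) (phi s : R) : R := RInt (fun y => G (s - y) y phi) 0 s.
Definition I2 (G : R -> R -> R -> R) (phi s : R) : R := RInt (fun y => G (y - s) y phi) s L.
Definition I3 (G : R -> R -> R -> R) (phi s : R) : R := RInt (fun y => G (s + y) y phi) 0 L.
Definition op (a b c : R) (G : R -> R -> R -> R) (phi s : R) :=
  (a * I1 G phi s + b * I2 G phi s + c * I3 G phi s) / 2.

Lemma c2_op a b c G : c3 G -> c2 (op a b c G).
Proof.
  intros HG. unfold c2, op, Rdiv. apply cont_mult; [|cont_tac].
  apply cont_plus; [apply cont_plus|]; (apply cont_mult; [cont_tac|]).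
  - apply (cont_RInt_var (U := RU2)
      (fun z y => G (snd z - y) y (fst z)) (fun _ => 0) snd); [|cont_tac|cont_tac].
    apply cont_comp3; cont_tac.
  - apply (cont_RInt_var (U := RU2)
      (fun z y => G (y - snd z) y (fst z)) snd (fun _ => L)); [|cont_tac|cont_tac].
    apply cont_comp3; cont_tac.
  - apply (cont_RInt (U := RU2)
      (fun z y => G (snd z + y) y (fst z))).
    apply cont_comp3; cont_tac.
Qed.

Section Slices.
Variable G : R -> R -> R -> R.
Hypothesis HG : c3 G.
Lemma s1 s phi : cont (fun y => G (s - y) y phi).
Proof. apply (cont_comp3 (U := RU)); cont_tac. Qed.
Lemma s2 s phi : cont (fun y => G (y - s) y phi).
Proof. apply (cont_comp3 (U := RU)); cont_tac. Qed.
Lemma s3 s phi : cont (fun y => G (s + y) y phi).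
Proof. apply (cont_comp3 (U := RU)); cont_tac. Qed.
End Slices.

Lemma op_ext a b c G G' phi s : 0 <= s <= L ->
  (forall sg y, 0 <= sg <= 2 * L -> 0 < y < L -> G sg y phi = G' sg y phi) ->
  op a b c G phi s = op a b c G' phi s.
Proof.
  intros Hs H. unfold op.
  assert (E1 : I1 G phi s = I1 G' phi s) by (apply RI_ext; [lra|]; intros y Hy; apply H; lra).
  assert (E2 : I2 G phi s = I2 G' phi s) by (apply RI_ext; [lra|]; intros y Hy; apply H; lra).
  assert (E3 : I3 G phi s = I3 G' phi s) by (apply RI_ext; [lra|]; intros y Hy; apply H; lra).
  rewrite E1, E2, E3. reflexivity.
Qed.

Lemma op_minus a b c G G' phi s : c3 G -> c3 G' ->
  op a b c (fun x y z => G x y z - G' x y z) phi s = op a b c G phi s - op a b c G' phi s.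
Proof.
  intros HG HG'. unfold op, I1, I2, I3.
  rewrite (RI_minus (fun y => G (s - y) y phi) (fun y => G' (s - y) y phi)) by (apply s1; assumption).
  rewrite (RI_minus (fun y => G (y - s) y phi) (fun y => G' (y - s) y phi)) by (apply s2; assumption).
  rewrite (RI_minus (fun y => G (s + y) y phi) (fun y => G' (s + y) y phi)) by (apply s3; assumption).
  field.
Qed.
Lemma op_scal k a b c G phi s : c3 G ->
  op a b c (fun x y z => k * G x y z) phi s = k * op a b c G phi s.
Proof.
  intros HG. unfold op, I1, I2, I3.
  rewrite (RI_scal (fun y => G (s - y) y phi)) by (apply s1; assumption).
  rewrite (RI_scal (fun y => G (y - s) y phi)) by (apply s2; assumption).
  rewrite (RI_scal (fun y => G (s + y) y phi)) by (apply s3; assumption).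
  field.
Qed.

Lemma op_dphi a b c G G' phi s : c3 G -> c3 G' -> 0 <= s <= L ->
  (forall sg y phi, 0 <= sg <= 2 * L -> 0 < y < L -> is_derive (fun p => G sg y p) phi (G' sg y phi)) ->
  is_derive (fun p => op a b c G p s) phi (op a b c G' phi s).
Proof.
  intros HG HG' Hs D. unfold op, Rdiv.
  apply is_derive_ext with (fun p => / 2 * (a * I1 G p s + b * I2 G p s + c * I3 G p s));
    [intros; apply Rmult_comm|].
  rewrite Rmult_comm. apply is_derive_scal.
  apply (is_derive_plus (V := RN)); [apply (is_derive_plus (V := RN))|];
    apply is_derive_scal.
  - apply (derive_RInt_param (fun p y => G (s - y) y p) (fun p y => G' (s - y) y p) _ _ _ 1);
      [lra|lra|apply cont_comp3; cont_tac|apply cont_comp3; cont_tac|].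
    intros p y _ Hy. apply D; lra.
  - apply (derive_RInt_param (fun p y => G (y - s) y p) (fun p y => G' (y - s) y p) _ _ _ 1);
      [lra|lra|apply cont_comp3; cont_tac|apply cont_comp3; cont_tac|].
    intros p y _ Hy. apply D; lra.
  - apply (derive_RInt_param (fun p y => G (s + y) y p) (fun p y => G' (s + y) y p) _ _ _ 1);
      [lra|lra|apply cont_comp3; cont_tac|apply cont_comp3; cont_tac|].
    intros p y _ Hy. apply D; lra.
Qed.

(** The moving diagonal contributes G 0 from below and its opposite from above. The term (a - b) / 2
    therefore vanishes for V, where a = b = 1, and is minus [Zop] for U, where a = -1 and b = 1. *)
Lemma op_ds a b c G G' phi s r : c3 G -> c3 G' -> 0 < s < L -> 0 < r ->
  (forall sg y, - r < sg < 2 * L + r -> 0 < y < L -> is_derive (fun t => G t y phi) sg (G' sg y phi)) ->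
  is_derive (fun t => op a b c G phi t) s (op a (- b) c G' phi s + (a - b) / 2 * G 0 s phi).
Proof.
  intros HG HG' Hs Hr D.
  apply is_derive_ext with (fun t => / 2 * (a * I1 G phi t + b * I2 G phi t + c * I3 G phi t));
    [intros; unfold op; Req; field|].
  replace (op a (- b) c G' phi s + (a - b) / 2 * G 0 s phi) with
   (/ 2 * (a * (G (s - s) s phi + I1 G' phi s) + b * (- G (s - s) s phi + RInt (fun y => - G' (y - s) y phi) s L) + c * I3 G' phi s)).
  2:{ rewrite (RI_opp (fun y => G' (y - s) y phi)) by (apply s2; exact HG').
      unfold op. fold (I2 G' phi s). replace (s - s) with 0 by ring. field. }
  apply is_derive_scal.
  apply (is_derive_plus (V := RN)); [apply (is_derive_plus (V := RN))|];
    apply is_derive_scal.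
  - apply (derive_RInt_diag (fun t y => G (t - y) y phi) (fun t y => G' (t - y) y phi) 0 s r);
      [lra|lra|apply cont_comp3; cont_tac|apply cont_comp3; cont_tac|].
    intros t y Ht Hy. apply Rabs_def2 in Ht. evar_last.
    + apply (is_derive_comp (V := RN) (fun t => G t y phi) (fun t => t - y)).
      * apply D; lra.
      * instantiate (1 := 1). auto_derive; [exact I|ring].
    + unfold scal; simpl; unfold mult; simpl. ring.
  - apply (derive_RInt_diag_lower (fun t y => G (y - t) y phi) (fun t y => - G' (y - t) y phi) L s r);
      [lra|lra|apply cont_comp3; cont_tac|apply cont_opp, cont_comp3; cont_tac|].
    intros t y Ht Hy. apply Rabs_def2 in Ht. evar_last.
    + apply (is_derive_comp (V := RN) (fun t => G t y phi) (fun t => y - t)).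
      * apply D; lra.
      * instantiate (1 := -1). auto_derive; [exact I|ring].
    + unfold scal; simpl; unfold mult; simpl. ring.
  - apply (derive_RInt_param (fun t y => G (t + y) y phi) (fun t y => G' (t + y) y phi) _ _ _ (Rmin r s));
      [lra|apply Rmin_pos; lra|apply cont_comp3; cont_tac|apply cont_comp3; cont_tac|].
    intros t y Ht Hy. assert (M1 := Rmin_l r s). assert (M2 := Rmin_r r s). apply Rabs_def2 in Ht. evar_last.
    + apply (is_derive_comp (V := RN) (fun t => G t y phi) (fun t => t + y)).
      * apply D; lra.
      * instantiate (1 := 1). auto_derive; [exact I|ring].
    + unfold scal; simpl; unfold mult; simpl. ring.
Qed.

(** All separations stay in [0, 2 L], so each of the three integrals is at most the full integral of
    kap; the factor 1/2 in [op] leaves 3/2. *)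
Lemma op_bound a b c G kap phi s : c3 G -> 0 <= s <= L ->
  Rabs a <= 1 -> Rabs b <= 1 -> Rabs c <= 1 -> cont kap ->
  (forall sg y, 0 <= sg <= 2 * L -> 0 < y < L -> Rabs (G sg y phi) <= kap sg) ->
  (forall sg, 0 <= sg <= 2 * L -> 0 <= kap sg) ->
  Rabs (op a b c G phi s) <= 3 / 2 * RInt kap 0 (2 * L).
Proof.
  intros HG Hs Ha Hb Hc Hk H Hk0.
  assert (sub : forall u v, 0 <= u <= v -> v <= 2 * L -> RInt kap u v <= RInt kap 0 (2 * L)).
  { intros u v Hu Hv. rewrite <- (RI_chasles kap 0 u Hk (2 * L)), <- (RI_chasles kap u v Hk (2 * L)).
    assert (0 <= RInt kap 0 u) by (apply RInt_ge_0; [lra|apply cont_ex_RInt, Hk|]; intros; apply Hk0; lra).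
    assert (0 <= RInt kap v (2 * L)) by (apply RInt_ge_0; [lra|apply cont_ex_RInt, Hk|]; intros; apply Hk0; lra).
    lra. }
  assert (B1 : Rabs (I1 G phi s) <= RInt kap 0 (2 * L)).
  { eapply Rle_trans; [apply (RInt_abs_le' _ (fun y => kap (s - y))); [lra|apply s1, HG| |]|].
    - apply cont_ex_RInt, (cont_comp (U := RU) kap); [exact Hk|cont_tac].
    - intros y Hy. apply H; lra.
    - rewrite RI_reflect by exact Hk. apply sub; lra. }
  assert (B2 : Rabs (I2 G phi s) <= RInt kap 0 (2 * L)).
  { eapply Rle_trans; [apply (RInt_abs_le' _ (fun y => kap (y + - s))); [lra|apply s2, HG| |]|].
    - apply cont_ex_RInt, (cont_comp (U := RU) kap); [exact Hk|cont_tac].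
    - intros y Hy. apply H; lra.
    - rewrite RI_shift by exact Hk. apply sub; lra. }
  assert (B3 : Rabs (I3 G phi s) <= RInt kap 0 (2 * L)).
  { eapply Rle_trans; [apply (RInt_abs_le' _ (fun y => kap (y + s))); [lra|apply s3, HG| |]|].
    - apply cont_ex_RInt, (cont_comp (U := RU) kap); [exact Hk|cont_tac].
    - intros y Hy. rewrite Rplus_comm. apply H; lra.
    - rewrite RI_shift by exact Hk. apply sub; lra. }
  unfold op, Rdiv. rewrite Rabs_mult, (Rabs_right (/ 2)) by lra.
  assert (T : forall x y, Rabs x <= 1 -> Rabs y <= RInt kap 0 (2 * L) -> Rabs (x * y) <= RInt kap 0 (2 * L)).
  { intros x y Hx Hy. rewrite Rabs_mult. assert (P := Rabs_pos x). assert (Q := Rabs_pos y). nra. }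
  assert (K1 := T _ _ Ha B1). assert (K2 := T _ _ Hb B2). assert (K3 := T _ _ Hc B3).
  assert (K4 := Rabs_triang (a * I1 G phi s + b * I2 G phi s) (c * I3 G phi s)).
  assert (K5 := Rabs_triang (a * I1 G phi s) (b * I2 G phi s)). lra.
Qed.

(* Integration by parts in the integration variable y, for G vanishing at y = 0 and y = L. *)
Lemma op_ibp a b c G Gs Gy phi s r : c3 G -> c3 Gs -> c3 Gy -> 0 <= s <= L -> 0 < r ->
  (forall sg, G sg 0 phi = 0) -> (forall sg, G sg L phi = 0) ->
  (forall t sg y, 0 < y < L -> 0 <= sg <= 2 * L -> (t = 1 \/ t = -1) ->
     is_derive (fun w => G (sg + t * (w - y)) w phi) y (t * Gs sg y phi + Gy sg y phi)) ->
  op a b c Gy phi s = op a (- b) (- c) Gs phi s + (a - b) / 2 * G 0 s phi.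
Proof.
  intros HG HGs HGy Hs Hr G0 GL D.
  assert (E1 : I1 Gy phi s = G 0 s phi + I1 Gs phi s).
  { assert (E : RInt (fun y => Gy (s - y) y phi - Gs (s - y) y phi) 0 s = G (s - s) s phi - G (s - 0) 0 phi).
    { apply (RInt_FTC_closed (fun y => G (s - y) y phi)); [lra|apply s1, HG| |].
      - apply (cont_minus (U := RU)); apply s1; assumption.
      - intros y Hy. evar_last.
        + apply is_derive_ext with (fun w => G ((s - y) + (-1) * (w - y)) w phi).
          * intros w. f_equal. ring.
          * apply D; [lra|lra|right; reflexivity].
        + Req; ring. }
    rewrite (RI_minus (fun y => Gy (s - y) y phi) (fun y => Gs (s - y) y phi)) in E by (apply s1; assumption).
    rewrite G0 in E. replace (s - s) with 0 in E by ring. unfold I1. lra. }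
  assert (E2 : I2 Gy phi s = - G 0 s phi - I2 Gs phi s).
  { assert (E : RInt (fun y => Gy (y - s) y phi + Gs (y - s) y phi) s L = G (L - s) L phi - G (s - s) s phi).
    { apply (RInt_FTC_closed (fun y => G (y - s) y phi)); [lra|apply s2, HG| |].
      - apply (cont_plus (U := RU)); apply s2; assumption.
      - intros y Hy. evar_last.
        + apply is_derive_ext with (fun w => G ((y - s) + 1 * (w - y)) w phi).
          * intros w. f_equal. ring.
          * apply D; [lra|lra|left; reflexivity].
        + Req; ring. }
    rewrite (RI_plus (fun y => Gy (y - s) y phi) (fun y => Gs (y - s) y phi)) in E by (apply s2; assumption).
    rewrite GL in E. replace (s - s) with 0 in E by ring. unfold I2. lra. }
  assert (E3 : I3 Gy phi s = - I3 Gs phi s).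
  { assert (E : RInt (fun y => Gy (s + y) y phi + Gs (s + y) y phi) 0 L = G (s + L) L phi - G (s + 0) 0 phi).
    { apply (RInt_FTC_closed (fun y => G (s + y) y phi)); [lra|apply s3, HG| |].
      - apply (cont_plus (U := RU)); apply s3; assumption.
      - intros y Hy. evar_last.
        + apply is_derive_ext with (fun w => G ((s + y) + 1 * (w - y)) w phi).
          * intros w. f_equal. ring.
          * apply D; [lra|lra|left; reflexivity].
        + Req; ring. }
    rewrite (RI_plus (fun y => Gy (s + y) y phi) (fun y => Gs (s + y) y phi)) in E by (apply s3; assumption).
    rewrite GL, G0 in E. unfold I3. lra. }
  unfold op. rewrite E1, E2, E3. field.
Qed.
End Op.

Definition mean (g : R -> R -> R) (s : R) := RInt (fun x => g x s) (- PI) PI / (2 * PI).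

Lemma cont_mean g : c2 g -> cont (mean g).
Proof.
  intros Hg. unfold mean, Rdiv. apply (cont_mult (U := RU)); [|cont_tac].
  apply (cont_RInt (U := RU) (fun s x => g x s)). apply cont_comp2; cont_tac.
Qed.

Lemma mean_bound g M s : c2 g -> (forall x, Rabs (g x s) <= M) -> Rabs (mean g s) <= M.
Proof.
  intros Hg H. assert (Hp := PI_RGT_0). unfold mean, Rdiv.
  rewrite Rabs_mult, (Rabs_right (/ (2 * PI))) by (left; apply Rinv_0_lt_compat; lra).
  assert (B := RInt_abs_le (fun x => g x s) (- PI) PI M ltac:(lra) (c2_slice2 g s Hg) (fun x _ => H x)).
  apply Rmult_le_reg_r with (2 * PI); [lra|]. rewrite Rmult_assoc, Rinv_l by lra. lra.
Qed.

Section Vel.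
Variables (e L : R) (N : nat).
Hypotheses (He : 0 < e <= 1) (HL : 0 < L).
Notation jp := (jp e L N). Notation jq := (jq e L N).
Notation jp' := (jp' e L N). Notation jq' := (jq' e L N).

(* tau = -1 makes V vanish on both walls; tau = 1 is the pair produced by integration by parts in s.
   Zop g approximates g - mean g. *)
Definition Vop tau g := op L 1 1 tau (conv jq g).
Definition Uop tau g := op L (-1) 1 (- tau) (conv jp g).
Definition Vop' tau g := op L 1 1 tau (conv jq' g).
Definition Uop' tau g := op L (-1) 1 (- tau) (conv jp' g).
Definition Zop g phi s := conv jp g 0 s phi.

Let cjp := c2_jp e L N He HL.
Let cjq := c2_jq e L N He HL.
Let cjp' := c2_jp' e L N He HL.
Let cjq' := c2_jq' e L N He HL.

Section Density.
Variable g : R -> R -> R.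
Hypotheses (Hg : c2 g) (Pg : per g).

Lemma c2_Vop tau : c2 (Vop tau g). Proof. apply c2_op, c3_conv; auto. Qed.
Lemma c2_Uop tau : c2 (Uop tau g). Proof. apply c2_op, c3_conv; auto. Qed.
Lemma c2_Vop' tau : c2 (Vop' tau g). Proof. apply c2_op, c3_conv; auto. Qed.
Lemma c2_Uop' tau : c2 (Uop' tau g). Proof. apply c2_op, c3_conv; auto. Qed.
Lemma c2_Zop : c2 (Zop g).
Proof.
  unfold c2, Zop.
  apply (cont_comp3 (U := RU2) (conv jp g)
    (fun _ => 0) snd fst); cont_tac. apply c3_conv; auto.
Qed.

Lemma per_op a b c j : per (op L a b c (conv j g)).
Proof.
  intros x s. unfold op, I1, I2, I3.
  assert (E : forall sg y, conv j g sg y (x + 2 * PI) = conv j g sg y x).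
  { intros sg y. unfold conv. apply RInt_ext. intros z _.
    replace (x + 2 * PI - z) with (x - z + 2 * PI) by ring. rewrite Pg. reflexivity. }
  f_equal. f_equal; [f_equal|]; f_equal; apply RInt_ext; intros; apply E.
Qed.

Lemma Vop_dphi tau phi s : 0 <= s <= L -> is_derive (fun p => Vop tau g p s) phi (Vop' tau g phi s).
Proof.
  intros Hs. apply op_dphi; auto using c3_conv. intros sg y p _ _.
  apply conv_dphi; auto using jq_period, jq'_period, jq_dphi.
Qed.
Lemma Uop_dphi tau phi s : 0 <= s <= L -> is_derive (fun p => Uop tau g p s) phi (Uop' tau g phi s).
Proof.
  intros Hs. apply op_dphi; auto using c3_conv. intros sg y p _ _.
  apply conv_dphi; auto using jp_period, jp'_period, jp_dphi.
Qed.

Lemma conv_jq_dsg sg y phi : - (e / 2) < sg < 2 * L + e / 2 ->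
  is_derive (fun t => conv jq g t y phi) sg (conv jp' g sg y phi).
Proof.
  intros Hsg. set (r := Rmin (sg + e / 2) (2 * L + e / 2 - sg)).
  assert (Hr : 0 < r) by (apply Rmin_pos; lra).
  assert (H1 := Rmin_l (sg + e / 2) (2 * L + e / 2 - sg)). assert (H2 := Rmin_r (sg + e / 2) (2 * L + e / 2 - sg)).
  fold r in H1, H2.
  apply conv_dsg with r; auto. intros t x Ht. apply Rabs_def2 in Ht. apply jq_dsg; auto; lra.
Qed.
Lemma conv_jp_dsg sg y phi : - (e / 2) < sg < 2 * L + e / 2 ->
  is_derive (fun t => conv jp g t y phi) sg (- conv jq' g sg y phi).
Proof.
  intros Hsg. set (r := Rmin (sg + e / 2) (2 * L + e / 2 - sg)).
  assert (Hr : 0 < r) by (apply Rmin_pos; lra).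
  assert (H1 := Rmin_l (sg + e / 2) (2 * L + e / 2 - sg)). assert (H2 := Rmin_r (sg + e / 2) (2 * L + e / 2 - sg)).
  fold r in H1, H2.
  replace (- conv jq' g sg y phi) with (conv (fun a b => - jq' a b) g sg y phi).
  - apply conv_dsg with r; auto.
    + apply cont_opp. apply cjq'.
    + intros t x Ht. apply Rabs_def2 in Ht. apply jp_dsg; auto; lra.
  - unfold conv. rewrite <- (RI_opp (fun x => jq' sg x * g (phi - x) y)).
    + apply RInt_ext. intros x _. Req. ring.
    + apply (cont_mult (U := RU)); [apply c2_slice1, cjq'|].
      apply (cont_comp2 (U := RU)); cont_tac.
Qed.

Lemma op_opp3 a b c G phi s : op L (- a) (- b) (- c) G phi s = - op L a b c G phi s.
Proof. unfold op. field. Qed.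
Lemma op_oppG a b c G phi s : c3 G -> op L a b c (fun x y z => - G x y z) phi s = - op L a b c G phi s.
Proof.
  intros H. transitivity (op L a b c (fun x y z => (-1) * G x y z) phi s).
  - unfold op, I1, I2, I3. do 2 f_equal; [f_equal|]; f_equal; apply RInt_ext; intros; Req; ring.
  - rewrite op_scal by assumption. ring.
Qed.

(** The kernel of V has sg-derivative [jp'] and the diagonal terms cancel, so the regularised
    velocity is exactly divergence free, for every e and N. *)
Lemma Vop_ds tau phi s : 0 < s < L -> is_derive (fun t => Vop tau g phi t) s (- Uop' tau g phi s).
Proof.
  intros Hs. evar_last.
  - apply (op_ds L HL 1 1 tau (conv jq g) (conv jp' g) phi s (e / 2)); auto using c3_conv; [lra|].
    intros sg y Hsg _. apply conv_jq_dsg, Hsg.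
  - unfold Uop'. rewrite <- op_opp3. Req.
    replace (- -1) with 1 by ring. replace (- - tau) with tau by ring. lra.
Qed.
(** Here the diagonal term survives: the curl of the pair ([Uop], [Vop]) is [Zop g]. This is the
    only place where the regularisation disturbs the div-curl system. *)
Lemma Uop_ds tau phi s : 0 < s < L ->
  is_derive (fun t => Uop tau g phi t) s (Vop' tau g phi s - Zop g phi s).
Proof.
  intros Hs. evar_last.
  - apply (op_ds L HL (-1) 1 (- tau) (conv jp g) (fun x y z => - conv jq' g x y z) phi s (e / 2));
      auto using c3_conv; [apply cont_opp, c3_conv; auto|lra|].
    intros sg y Hsg _. apply conv_jp_dsg, Hsg.
  - rewrite op_oppG by (apply c3_conv; auto). rewrite <- op_opp3. unfold Vop', Zop. Req.
    replace (- -1) with 1 by ring. replace (- - (1)) with 1 by ring. replace (- - tau) with tau by ring. lra.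
Qed.

(** On the lower wall the integral over sources below is empty, and those over sources above and
    over reflections coincide, so the coefficient -1 cancels them. On the upper wall [jq_sym] plays
    the same role. *)
Lemma Vop_bdry0 phi : Vop (-1) g phi 0 = 0.
Proof.
  unfold Vop, op, I1, I2, I3. rewrite RInt_point.
  replace (RInt (fun y => conv jq g (y - 0) y phi) 0 L) with (RInt (fun y => conv jq g (0 + y) y phi) 0 L).
  - unfold zero; simpl. field.
  - apply RInt_ext. intros y _. f_equal. ring.
Qed.
Lemma Vop_bdryL phi : Vop (-1) g phi L = 0.
Proof.
  unfold Vop, op, I1, I2, I3. rewrite RInt_point.
  replace (RInt (fun y => conv jq g (L + y) y phi) 0 L) with (RInt (fun y => conv jq g (L - y) y phi) 0 L).
  - unfold zero; simpl. field.
  - apply RInt_ext. intros y _. unfold conv. apply RInt_ext. intros x _. f_equal.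
    rewrite <- (jq_sym e L N (L - y)). f_equal. ring.
Qed.
End Density.

Lemma conv_minus j g g' sg s phi : c2 j -> c2 g -> c2 g' ->
  conv j (fun x y => g x y - g' x y) sg s phi = conv j g sg s phi - conv j g' sg s phi.
Proof.
  intros Hj Hg Hg'. unfold conv.
  rewrite <- (RI_minus (fun x => j sg x * g (phi - x) s) (fun x => j sg x * g' (phi - x) s)).
  - apply RInt_ext. intros x _. Req. ring.
  - apply (cont_mult (U := RU)); [apply c2_slice1, Hj|apply (cont_comp2 (U := RU)); cont_tac].
  - apply (cont_mult (U := RU)); [apply c2_slice1, Hj|apply (cont_comp2 (U := RU)); cont_tac].
Qed.
Lemma conv_scal k j g sg s phi : c2 j -> c2 g ->
  conv j (fun x y => k * g x y) sg s phi = k * conv j g sg s phi.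
Proof.
  intros Hj Hg. unfold conv.
  rewrite <- (RI_scal (fun x => j sg x * g (phi - x) s)).
  - apply RInt_ext. intros x _. Req. ring.
  - apply (cont_mult (U := RU)); [apply c2_slice1, Hj|apply (cont_comp2 (U := RU)); cont_tac].
Qed.

Lemma opconv_minus a b c j g g' phi s : c2 j -> c2 g -> c2 g' -> 0 <= s <= L ->
  op L a b c (conv j (fun x y => g x y - g' x y)) phi s
  = op L a b c (conv j g) phi s - op L a b c (conv j g') phi s.
Proof.
  intros Hj Hg Hg' Hs. rewrite <- op_minus by (apply c3_conv; assumption).
  apply (op_ext L HL); [exact Hs|]. intros. apply conv_minus; assumption.
Qed.
Lemma opconv_scal k a b c j g phi s : c2 j -> c2 g -> 0 <= s <= L ->
  op L a b c (conv j (fun x y => k * g x y)) phi s = k * op L a b c (conv j g) phi s.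
Proof.
  intros Hj Hg Hs. rewrite <- op_scal by (apply c3_conv; assumption).
  apply (op_ext L HL); [exact Hs|]. intros. apply conv_scal; assumption.
Qed.
Lemma opconv_shift a b c j g d phi s :
  op L a b c (conv j (fun x y => g (x + d) y)) phi s = op L a b c (conv j g) (phi + d) s.
Proof.
  assert (E : forall sg y, conv j (fun x y => g (x + d) y) sg y phi = conv j g sg y (phi + d)).
  { intros sg y. unfold conv. apply RInt_ext. intros x _. do 2 f_equal. ring. }
  unfold op, I1, I2, I3. do 2 f_equal; [f_equal|]; f_equal; apply RInt_ext; intros; apply E.
Qed.
Lemma opconv_ext a b c j g g' phi s : 0 <= s <= L -> (forall x y, 0 < y < L -> g x y = g' x y) ->
  op L a b c (conv j g) phi s = op L a b c (conv j g') phi s.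
Proof.
  intros Hs H. apply (op_ext L HL); [exact Hs|]. intros sg y _ Hy. unfold conv. apply RInt_ext. intros x _.
  rewrite H by exact Hy. reflexivity.
Qed.

(** * Velocity operators applied to the derivatives of a flux *)

Section Flux.
Variables (F Fx Fs : R -> R -> R).
Hypotheses (HF : c2 F) (HFx : c2 Fx) (HFs : c2 Fs) (PF : per F).
Hypothesis Dx : forall x s, 0 < s < L -> is_derive (fun x => F x s) x (Fx x s).
Hypothesis Ds : forall x s, 0 < s < L -> is_derive (fun s => F x s) s (Fs x s).

(** Both sides arise from the phi-derivative of the same convolution, computed once on the density
    and once on the kernel; uniqueness of the derivative identifies them. *)
Lemma Vop_Fx tau phi s : 0 <= s <= L -> Vop tau Fx phi s = Vop' tau F phi s.
Proof.
  intros Hs. apply (op_ext L HL); [exact Hs|]. intros sg y Hsg Hy.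
  assert (A := conv_dphi_g jq F Fx sg y phi cjq HF HFx (fun x => Dx x y Hy)).
  assert (B := conv_dphi jq jq' F sg y phi cjq cjq' HF PF (jq_period e L N sg) (jq'_period e L N sg)
     (jq_dphi e L N He HL sg)).
  apply is_derive_unique in A. apply is_derive_unique in B. congruence.
Qed.
Lemma Uop_Fx tau phi s : 0 <= s <= L -> Uop tau Fx phi s = Uop' tau F phi s.
Proof.
  intros Hs. apply (op_ext L HL); [exact Hs|]. intros sg y Hsg Hy.
  assert (A := conv_dphi_g jp F Fx sg y phi cjp HF HFx (fun x => Dx x y Hy)).
  assert (B := conv_dphi jp jp' F sg y phi cjp cjp' HF PF (jp_period e L N sg) (jp'_period e L N sg)
     (jp_dphi e L N He HL sg)).
  apply is_derive_unique in A. apply is_derive_unique in B. congruence.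
Qed.

Hypotheses (F0 : forall x, F x 0 = 0) (FL : forall x, F x L = 0).

(** Moving the source height changes the separation at rate t: 1 for y - s and s + y, -1 for s - y.
    The total derivative therefore combines the kernel and the density. *)
Lemma conv_diag j k t sg y phi : c2 j -> c2 k ->
  (forall u x, - (e / 2) < u < 2 * L + e / 2 -> is_derive (fun u => j u x) u (k u x)) ->
  0 < y < L -> 0 <= sg <= 2 * L -> (t = 1 \/ t = -1) ->
  is_derive (fun w => conv j F (sg + t * (w - y)) w phi) y (t * conv k F sg y phi + conv j Fs sg y phi).
Proof.
  intros Hj Hk D Hy Hsg Ht. assert (Hp := PI_RGT_0).
  set (r := Rmin (e / 2) (Rmin y (L - y))).
  assert (r1 : r <= e / 2) by apply Rmin_l.
  assert (r2 : r <= y) by (eapply Rle_trans; [apply Rmin_r|apply Rmin_l]).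
  assert (r3 : r <= L - y) by (eapply Rle_trans; [apply Rmin_r|apply Rmin_r]).
  assert (Hr : 0 < r) by (apply Rmin_pos; [lra|apply Rmin_pos; lra]).
  evar_last.
  - unfold conv.
    apply (derive_RInt_param (fun w x => j (sg + t * (w - y)) x * F (phi - x) w)
      (fun w x => t * (k (sg + t * (w - y)) x * F (phi - x) w) + j (sg + t * (w - y)) x * Fs (phi - x) w) _ _ y r);
      [lra|lra| | |].
    + apply cont_mult; apply cont_comp2; cont_tac.
    + apply cont_plus; [apply cont_mult; [cont_tac|]|]; apply cont_mult; apply cont_comp2; cont_tac.
    + intros w x Hw _. apply Rabs_def2 in Hw. evar_last.
      * apply (is_derive_mult (K := R_AbsRing) (fun w => j (sg + t * (w - y)) x) (fun w => F (phi - x) w)).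
        -- apply (is_derive_comp (V := RN) (fun u => j u x) (fun w => sg + t * (w - y))).
           ++ apply D. destruct Ht as [-> | ->]; lra.
           ++ instantiate (1 := t). auto_derive; [exact I|ring].
        -- apply Ds. lra.
        -- intros; apply Rmult_comm.
      * unfold plus, mult, scal; simpl; unfold mult; simpl. ring.
  - replace (sg + t * (y - y)) with sg by ring. unfold conv.
    assert (A : forall k g, c2 k -> c2 g -> cont (fun x => k sg x * g (phi - x) y)).
    { intros k0 g0 A B. apply (cont_mult (U := RU)); [apply c2_slice1, A|].
      apply (cont_comp2 (U := RU)); cont_tac. }
    rewrite (RI_plus (fun x => t * (k sg x * F (phi - x) y)) (fun x => j sg x * Fs (phi - x) y)).
    + rewrite (RI_scal (fun x => k sg x * F (phi - x) y)) by auto. reflexivity.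
    + apply (cont_mult (U := RU)); cont_tac.
    + auto.
Qed.

(** The flux vanishes on the walls, so [op_ibp] leaves no boundary term there, and the diagonal
    terms cancel because a = b. The sign of the image term flips, which turns tau = -1 into tau =
    1. *)
Lemma Vop_Fs phi s : 0 <= s <= L -> Vop (-1) Fs phi s = - Uop' 1 F phi s.
Proof.
  intros Hs. unfold Vop, Uop'.
  rewrite (op_ibp L HL 1 1 (-1) (conv jq F) (conv jp' F) (conv jq Fs) phi s 1); auto using c3_conv; [|lra| | |].
  - rewrite <- op_opp3. replace (- (-1)) with 1 by ring. replace (- - (1)) with 1 by ring. lra.
  - intros sg. unfold conv. transitivity (RInt (fun _ => 0) (- PI) PI); [|rewrite RI_const; ring].
    apply RInt_ext. intros x _. rewrite F0. Req. ring.
  - intros sg. unfold conv. transitivity (RInt (fun _ => 0) (- PI) PI); [|rewrite RI_const; ring].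
    apply RInt_ext. intros x _. rewrite FL. Req. ring.
  - intros t sg y Hy Hsg Ht. apply conv_diag; auto. intros u x Hu. apply jq_dsg; auto.
Qed.

Lemma Uop_Fs phi s : 0 <= s <= L -> Uop (-1) Fs phi s = Vop' 1 F phi s - Zop F phi s.
Proof.
  intros Hs. unfold Uop, Vop', Zop.
  assert (cc : c3 (fun x y z => - conv jq' F x y z)) by (apply cont_opp, c3_conv; auto).
  rewrite (op_ibp L HL (-1) 1 (- -1) (conv jp F) (fun x y z => - conv jq' F x y z) (conv jp Fs) phi s 1);
    auto using c3_conv; [|lra| | |].
  - rewrite op_oppG by (apply c3_conv; auto). rewrite <- op_opp3.
    replace (- (-1)) with 1 by ring. replace (- - (1)) with 1 by ring. lra.
  - intros sg. unfold conv. transitivity (RInt (fun _ => 0) (- PI) PI); [|rewrite RI_const; ring].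
    apply RInt_ext. intros x _. rewrite F0. Req. ring.
  - intros sg. unfold conv. transitivity (RInt (fun _ => 0) (- PI) PI); [|rewrite RI_const; ring].
    apply RInt_ext. intros x _. rewrite FL. Req. ring.
  - intros t sg y Hy Hsg Ht.
    replace (- conv jq' F sg y phi) with (conv (fun a b => - jq' a b) F sg y phi).
    + apply conv_diag; auto.
      * apply cont_opp. apply cjq'.
      * intros u x Hu. apply jp_dsg; auto.
    + unfold conv. rewrite <- (RI_opp (fun x => jq' sg x * F (phi - x) y)).
      * apply RInt_ext. intros x _. Req. ring.
      * apply (cont_mult (U := RU)); [apply c2_slice1, cjq'|].
        apply (cont_comp2 (U := RU)); cont_tac.
Qed.
End Flux.
End Vel.

(** * Logarithmic gradient estimates *)

Lemma Rpower_pos x r : 0 < Rpower x r. Proof. apply exp_pos. Qed.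

Lemma Rpower_le_base x y r : 0 < x <= y -> 0 <= r -> Rpower x r <= Rpower y r.
Proof. intros H Hr. apply Rle_Rpower_l; lra. Qed.

Section Bounds.
Variables (e L : R) (N : nat).
Hypotheses (He : 0 < e <= 1) (HL : 0 < L).
Notation jp := (jp e L N). Notation jq := (jq e L N).
Notation jp' := (jp' e L N). Notation jq' := (jq' e L N).

Definition kap (eta sg : R) := Rpower (X1 e sg) (eta - 1) + Rpower (X2 e L sg) (eta - 1).

Lemma X1_pos0 sg : 0 < X1 e sg.
Proof. assert (H := Rmax_r (e + sg) (e / 2)). unfold X1. lra. Qed.
Lemma X2_pos0 sg : 0 < X2 e L sg.
Proof. assert (H := Rmax_r (e + 2 * L - sg) (e / 2)). unfold X2. lra. Qed.

Lemma cont_kap eta : cont (kap eta).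
Proof.
  unfold kap. apply (cont_plus (U := RU)); apply (cont_Rpower (U := RU)).
  - unfold X1. cont_tac.
  - intros; apply X1_pos0.
  - unfold X2. cont_tac.
  - intros; apply X2_pos0.
Qed.

Lemma kap_pos eta sg : 0 < kap eta sg.
Proof. unfold kap. assert (A := Rpower_pos (X1 e sg) (eta - 1)). assert (B := Rpower_pos (X2 e L sg) (eta - 1)). lra. Qed.

(** The factor 1/eta is the source of the logarithm: the gradient estimate later takes eta inversely
    proportional to the logarithm of the Hölder constant. *)
Lemma int_kap eta : 0 < eta < 1 -> RInt (kap eta) 0 (2 * L) <= 2 * (2 * L + 1) / eta.
Proof.
  intros Het.
  assert (DP : forall y, 0 < y -> is_derive (fun y => Rpower y eta / eta) y (Rpower y (eta - 1))).
  { intros y Hy. unfold Rpower. auto_derive; [exact Hy|].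
    replace ((eta - 1) * ln y) with (eta * ln y - ln y) by ring. unfold Rminus.
    rewrite exp_plus, exp_Ropp, exp_ln by exact Hy. field. split; lra. }
  assert (cc : forall x, cont x -> (forall z : R, 0 < x z) -> cont (fun z => Rpower (x z) eta / eta)).
  { intros x Hx Hp. unfold Rdiv. apply (cont_mult (U := RU)); [|cont_tac].
    apply (cont_Rpower (U := RU)); assumption. }
  rewrite (RInt_FTC_closed (fun sg => Rpower (X1 e sg) eta / eta - Rpower (X2 e L sg) eta / eta));
    [|lra| |apply cont_kap|].
  - unfold X1, X2. rewrite !Rmax_left by lra.
    replace (e + 2 * L - 0) with (e + 2 * L) by ring. replace (e + 2 * L - 2 * L) with e by ring.
    replace (e + 0) with e by ring.
    assert (P := Rpower_pos e eta).
    assert (Q : Rpower (e + 2 * L) eta <= 2 * L + 1).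
    { apply Rle_trans with (Rpower (2 * L + 1) eta); [apply Rpower_le_base; lra|].
      rewrite <- (Rpower_1 (2 * L + 1)) at 2 by lra. apply Rle_Rpower; lra. }
    apply Rmult_le_reg_r with eta; [lra|]. field_simplify; lra.
  - apply (cont_minus (U := RU)); apply cc.
    + unfold X1; cont_tac.
    + apply X1_pos0.
    + unfold X2; cont_tac.
    + apply X2_pos0.
  - intros sg Hsg. unfold kap.
    apply is_derive_ext_loc with (fun sg => Rpower (e + sg) eta / eta - Rpower (e + 2 * L - sg) eta / eta).
    + assert (Hr : 0 < Rmin sg (2 * L - sg)) by (apply Rmin_pos; lra).
      exists (mkposreal _ Hr). intros w Hw.
      unfold ball in Hw; simpl in Hw; unfold AbsRing_ball, abs, minus, plus, opp in Hw; simpl in Hw.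
      assert (H1 := Rlt_le_trans _ _ _ Hw (Rmin_l _ _)). assert (H2 := Rlt_le_trans _ _ _ Hw (Rmin_r _ _)).
      apply Rabs_def2 in H1. apply Rabs_def2 in H2.
      unfold X1, X2. rewrite !Rmax_left by lra. reflexivity.
    + unfold X1, X2. rewrite !Rmax_left by lra. evar_last.
      * apply (is_derive_minus (V := RN)).
        -- apply (is_derive_comp (V := RN) (fun y => Rpower y eta / eta) (fun y => e + y)).
           ++ apply DP; lra.
           ++ instantiate (1 := 1). auto_derive; [exact I|ring].
        -- apply (is_derive_comp (V := RN) (fun y => Rpower y eta / eta) (fun y => e + 2 * L - y)).
           ++ apply DP; lra.
           ++ instantiate (1 := -1). auto_derive; [exact I|ring].
      * unfold scal, minus, plus, opp; simpl; unfold mult; simpl. Req; ring.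
Qed.

Lemma cont_conv_int j g sg s phi : c2 j -> c2 g -> cont (fun x => j sg x * g (phi - x) s).
Proof.
  intros Hj Hg. apply (cont_mult (U := RU)); [apply c2_slice1, Hj|].
  apply (cont_comp2 (U := RU)); cont_tac.
Qed.

Lemma cont_Rpow_abs x r : 0 < x -> cont (fun phi => Rpower (x + Rabs phi) r).
Proof.
  intros Hx. apply (cont_Rpower (U := RU)); [cont_tac|].
  intros z. assert (K := Rabs_pos z). lra.
Qed.

(** The singularity 1/r is bounded by a product of two inverse square roots, one in the separation
    alone and one integrable in phi. A direct integration in phi would leave a logarithm of the
    separation. *)
Lemma conv_bound0 j g M sg s phi : c2 j -> c2 g -> 0 <= sg <= 2 * L ->
  (forall x, Rabs x <= PI -> Rabs (j sg x) <= C0 L * nu e L 1 sg x) ->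
  (forall x, Rabs (g x s) <= M) ->
  Rabs (conv j g sg s phi) <= M * (C0 L * (4 * (2 * L + 5))) * kap (/ 2) sg.
Proof.
  intros Hj Hg Hsg Bj Bg. assert (Hp := PI_RGT_0).
  assert (M0 : 0 <= M) by (eapply Rle_trans; [apply Rabs_pos|apply (Bg 0)]).
  assert (C := C0_pos L HL).
  set (x1 := e + sg). set (x2 := e + 2 * L - sg).
  assert (P1 : 0 < x1 <= 2 * L + 1) by (unfold x1; lra).
  assert (P2 : 0 < x2 <= 2 * L + 1) by (unfold x2; lra).
  assert (inv : forall x z, 0 < x -> / (x + Rabs z) ^ 1 <= Rpower x (- / 2) * Rpower (x + Rabs z) (- / 2)).
  { intros x z Hx. assert (K := Rabs_pos z). rewrite pow_1.
    replace (/ (x + Rabs z)) with (Rpower (x + Rabs z) (- / 2) * Rpower (x + Rabs z) (- / 2)).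
    - apply Rmult_le_compat_r; [left; apply Rpower_pos|]. rewrite !Rpower_Ropp.
      apply Rinv_le_contravar; [apply Rpower_pos|]. apply Rpower_le_base; lra.
    - rewrite <- Rpower_plus. replace (- / 2 + - / 2) with (- (1)) by field.
      rewrite Rpower_Ropp, Rpower_1 by lra. reflexivity. }
  unfold conv.
  eapply Rle_trans.
  { apply (RInt_abs_le' _ (fun x => M * C0 L * (Rpower x1 (- / 2) * Rpower (x1 + Rabs x) (- / 2)
       + Rpower x2 (- / 2) * Rpower (x2 + Rabs x) (- / 2)))); [lra|apply cont_conv_int; assumption| |].
    - apply cont_ex_RInt. apply (cont_mult (U := RU)); [cont_tac|].
      apply (cont_plus (U := RU)); (apply (cont_mult (U := RU)); [cont_tac|]);
        apply cont_Rpow_abs; lra.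
    - intros x Hx. assert (Hx' : Rabs x <= PI) by (apply Rabs_le; lra).
      rewrite Rabs_mult. assert (B1 := Bj x Hx'). assert (B2 := Bg (phi - x)).
      unfold nu in B1. fold x1 in B1. fold x2 in B1.
      assert (i1 := inv x1 x (proj1 P1)). assert (i2 := inv x2 x (proj1 P2)).
      apply Rle_trans with (C0 L * (/ (x1 + Rabs x) ^ 1 + / (x2 + Rabs x) ^ 1) * M).
      + apply Rmult_le_compat; auto using Rabs_pos.
      + rewrite (Rmult_comm _ M), <- Rmult_assoc.
        apply Rmult_le_compat_l; [apply Rmult_le_pos; lra|]. lra. }
  rewrite (RI_scal (fun x => Rpower x1 (- / 2) * Rpower (x1 + Rabs x) (- / 2)
       + Rpower x2 (- / 2) * Rpower (x2 + Rabs x) (- / 2))).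
  2:{ apply (cont_plus (U := RU)); (apply (cont_mult (U := RU)); [cont_tac|]);
        apply cont_Rpow_abs; lra. }
  rewrite (RI_plus (fun x => Rpower x1 (- / 2) * Rpower (x1 + Rabs x) (- / 2))
       (fun x => Rpower x2 (- / 2) * Rpower (x2 + Rabs x) (- / 2)))
    by ((apply (cont_mult (U := RU)); [cont_tac|]); apply cont_Rpow_abs; lra).
  rewrite (RI_scal (fun x => Rpower (x1 + Rabs x) (- / 2))) by (apply cont_Rpow_abs; lra).
  rewrite (RI_scal (fun x => Rpower (x2 + Rabs x) (- / 2))) by (apply cont_Rpow_abs; lra).
  assert (K1 := RInt_pow_half L HL x1 P1). assert (K2 := RInt_pow_half L HL x2 P2).
  unfold kap. replace (X1 e sg) with x1 by (unfold X1; rewrite Rmax_left; unfold x1; lra).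
  replace (X2 e L sg) with x2 by (unfold X2; rewrite Rmax_left; unfold x2; lra).
  replace (/ 2 - 1) with (- / 2) by field.
  assert (Q1 := Rpower_pos x1 (- / 2)). assert (Q2 := Rpower_pos x2 (- / 2)).
  replace (M * (C0 L * (4 * (2 * L + 5))) * (Rpower x1 (- / 2) + Rpower x2 (- / 2)))
   with (M * C0 L * (Rpower x1 (- / 2) * (4 * (2 * L + 5)) + Rpower x2 (- / 2) * (4 * (2 * L + 5)))) by ring.
  apply Rmult_le_compat_l; [apply Rmult_le_pos; lra|].
  apply Rplus_le_compat; apply Rmult_le_compat_l; lra.
Qed.

(** 24 is 3/2 from [op_bound], times 4 from [RInt_pow_half], times 4 from [int_kap] at eta = 1/2. *)
Definition K0 := 24 * C0 L * (2 * L + 5) * (2 * L + 1).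

Lemma opconv_bound0 a b c j g M phi s : c2 j -> c2 g -> 0 <= s <= L ->
  Rabs a <= 1 -> Rabs b <= 1 -> Rabs c <= 1 ->
  (forall sg x, 0 <= sg <= 2 * L -> Rabs x <= PI -> Rabs (j sg x) <= C0 L * nu e L 1 sg x) ->
  (forall x y, 0 < y < L -> Rabs (g x y) <= M) ->
  Rabs (op L a b c (conv j g) phi s) <= K0 * M.
Proof.
  intros Hj Hg Hs Ha Hb Hc Bj Bg.
  assert (M0 : 0 <= M) by (eapply Rle_trans; [apply Rabs_pos|apply (Bg 0 (L / 2)); lra]).
  assert (C := C0_pos L HL).
  assert (P : 0 <= M * (C0 L * (4 * (2 * L + 5)))) by (repeat apply Rmult_le_pos; lra).
  eapply Rle_trans.
  - apply (op_bound L HL a b c (conv j g) (fun sg => M * (C0 L * (4 * (2 * L + 5))) * kap (/ 2) sg));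
      auto using c3_conv.
    + apply (cont_mult (U := RU)); [cont_tac|apply cont_kap].
    + intros sg y Hsg Hy. apply conv_bound0; auto.
    + intros sg Hsg. apply Rmult_le_pos; [exact P|left; apply kap_pos].
  - rewrite (RI_scal (kap (/ 2))) by apply cont_kap.
    assert (I := int_kap (/ 2) ltac:(lra)).
    apply Rle_trans with (3 / 2 * (M * (C0 L * (4 * (2 * L + 5))) * (2 * (2 * L + 1) / / 2))).
    + apply Rmult_le_compat_l; [lra|]. apply Rmult_le_compat_l; assumption.
    + unfold K0. apply Req_le. field.
Qed.

Lemma Vop_bound tau g M phi s : c2 g -> 0 <= s <= L -> Rabs tau <= 1 ->
  (forall x y, 0 < y < L -> Rabs (g x y) <= M) -> Rabs (Vop e L N tau g phi s) <= K0 * M.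
Proof.
  intros Hg Hs Ht B. apply opconv_bound0; auto using c2_jq; try (rewrite Rabs_R1; lra).
  intros sg x Hsg Hx. apply j_bound; auto.
Qed.
Lemma Uop_bound tau g M phi s : c2 g -> 0 <= s <= L -> Rabs tau <= 1 ->
  (forall x y, 0 < y < L -> Rabs (g x y) <= M) -> Rabs (Uop e L N tau g phi s) <= K0 * M.
Proof.
  intros Hg Hs Ht B. apply opconv_bound0; auto using c2_jp.
  - rewrite Rabs_left; lra.
  - rewrite Rabs_R1; lra.
  - rewrite Rabs_Ropp; exact Ht.
  - intros sg x Hsg Hx. apply j_bound; auto.
Qed.

(** The differentiated kernel has a periodic primitive, hence integral zero over a period, and the
    value of g at phi may be subtracted. The Hölder bound, taken at the distances to the two nearest
    images, turns the exponent -2 into eta - 2, which leaves an integrable power eta - 1 of the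
    separation. *)
Lemma conv_bound1 j j' g A eta sg s phi : c2 j -> c2 j' -> c2 g -> 0 <= sg <= 2 * L -> 0 < eta < 1 ->
  (forall x, is_derive (j sg) x (j' sg x)) -> (forall x, j sg (x + 2 * PI) = j sg x) ->
  (forall x, Rabs x <= PI -> Rabs (j' sg x) <= C0 L * nu e L 2 sg x) ->
  (forall x d, 0 < d -> Rabs x <= d -> Rabs (g (phi - x) s - g phi s) <= A * Rpower d eta) ->
  Rabs (conv j' g sg s phi) <= A * (C0 L * (2 / (1 - eta))) * kap eta sg.
Proof.
  intros Hj Hj' Hg Hsg Het D Pj Bj Bg. assert (Hp := PI_RGT_0).
  assert (A0 : 0 <= A).
  { assert (B := Bg 0 1 ltac:(lra) ltac:(rewrite Rabs_R0; lra)).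
    unfold Rpower in B. rewrite ln_1, Rmult_0_r, exp_0 in B.
    assert (K := Rabs_pos (g (phi - 0) s - g phi s)). lra. }
  assert (C := C0_pos L HL).
  assert (Z : RInt (j' sg) (- PI) PI = 0).
  { rewrite (RInt_FTC_closed (j sg)); [|lra|apply c2_slice1, Hj|apply c2_slice1, Hj'|intros; apply D].
    replace PI with (- PI + 2 * PI) at 1 by ring. rewrite Pj. Req. ring. }
  assert (E : conv j' g sg s phi = RInt (fun x => j' sg x * (g (phi - x) s - g phi s)) (- PI) PI).
  { transitivity (RInt (fun x => j' sg x * g (phi - x) s - g phi s * j' sg x) (- PI) PI).
    - rewrite (RI_minus (fun x => j' sg x * g (phi - x) s) (fun x => g phi s * j' sg x)).
      + rewrite (RI_scal (j' sg)), Z by (apply c2_slice1, Hj'). unfold conv. symmetry. Req. ring.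
      + apply cont_conv_int; assumption.
      + apply (cont_mult (U := RU)); [cont_tac|apply c2_slice1, Hj'].
    - apply RInt_ext. intros x _. Req. ring. }
  rewrite E. clear E Z.
  set (x1 := e + sg). set (x2 := e + 2 * L - sg).
  assert (P1 : 0 < x1 <= 2 * L + 1) by (unfold x1; lra).
  assert (P2 : 0 < x2 <= 2 * L + 1) by (unfold x2; lra).
  assert (inv : forall x z, 0 < x -> / (x + Rabs z) ^ 2 * Rpower (x + Rabs z) eta = Rpower (x + Rabs z) (eta - 2)).
  { intros x z Hx. assert (K := Rabs_pos z). rewrite <- (Rpower_pow 2) by lra.
    rewrite <- Rpower_Ropp, <- Rpower_plus. f_equal. simpl. ring. }
  eapply Rle_trans.
  { apply (RInt_abs_le' _ (fun x => A * C0 L * (Rpower (x1 + Rabs x) (eta - 2)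
       + Rpower (x2 + Rabs x) (eta - 2)))); [lra| | |].
    - apply (cont_mult (U := RU)); [apply c2_slice1, Hj'|].
      apply (cont_minus (U := RU)); [|cont_tac].
      apply (cont_comp2 (U := RU)); cont_tac.
    - apply cont_ex_RInt. apply (cont_mult (U := RU)); [cont_tac|].
      apply (cont_plus (U := RU)); apply cont_Rpow_abs; lra.
    - intros x Hx. assert (Hx' : Rabs x <= PI) by (apply Rabs_le; lra). assert (K := Rabs_pos x).
      rewrite Rabs_mult. assert (B1 := Bj x Hx').
      assert (B2 := Bg x (x1 + Rabs x) ltac:(lra) ltac:(lra)).
      assert (B3 := Bg x (x2 + Rabs x) ltac:(lra) ltac:(lra)).
      unfold nu in B1. fold x1 in B1. fold x2 in B1.
      rewrite <- (inv x1 x (proj1 P1)), <- (inv x2 x (proj1 P2)).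
      assert (i1 : 0 < / (x1 + Rabs x) ^ 2) by (apply Rinv_0_lt_compat, pow_lt; lra).
      assert (i2 : 0 < / (x2 + Rabs x) ^ 2) by (apply Rinv_0_lt_compat, pow_lt; lra).
      set (D0 := Rabs (g (phi - x) s - g phi s)) in *.
      apply Rle_trans with (C0 L * (/ (x1 + Rabs x) ^ 2 + / (x2 + Rabs x) ^ 2) * D0).
      + apply Rmult_le_compat_r; [apply Rabs_pos|exact B1].
      + apply Rle_trans with (C0 L * (/ (x1 + Rabs x) ^ 2 * (A * Rpower (x1 + Rabs x) eta)
          + / (x2 + Rabs x) ^ 2 * (A * Rpower (x2 + Rabs x) eta))).
        * rewrite Rmult_assoc, Rmult_plus_distr_r. apply Rmult_le_compat_l; [lra|].
          apply Rplus_le_compat; apply Rmult_le_compat_l; lra.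
        * apply Req_le. ring. }
  rewrite (RI_scal (fun x => Rpower (x1 + Rabs x) (eta - 2) + Rpower (x2 + Rabs x) (eta - 2)))
    by (apply (cont_plus (U := RU)); apply cont_Rpow_abs; lra).
  rewrite (RI_plus (fun x => Rpower (x1 + Rabs x) (eta - 2)) (fun x => Rpower (x2 + Rabs x) (eta - 2)))
    by (apply cont_Rpow_abs; lra).
  assert (K1 := RInt_pow_neg x1 eta (proj1 P1) Het). assert (K2 := RInt_pow_neg x2 eta (proj1 P2) Het).
  unfold kap. replace (X1 e sg) with x1 by (unfold X1; rewrite Rmax_left; unfold x1; lra).
  replace (X2 e L sg) with x2 by (unfold X2; rewrite Rmax_left; unfold x2; lra).
  replace (A * (C0 L * (2 / (1 - eta))) * (Rpower x1 (eta - 1) + Rpower x2 (eta - 1)))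
   with (A * C0 L * (2 / (1 - eta) * Rpower x1 (eta - 1) + 2 / (1 - eta) * Rpower x2 (eta - 1))) by ring.
  apply Rmult_le_compat_l; [apply Rmult_le_pos; lra|]. lra.
Qed.

(** 6 is 3/2 from [op_bound], times 2 from [RInt_pow_neg], times 2 from [int_kap]; the factor 1/eta
    is kept apart. *)
Definition K1 (al : R) := 6 * C0 L * (2 * L + 1) / (1 - al).

Lemma opconv_bound1 al a b c j j' g A eta phi s : c2 j -> c2 j' -> c2 g -> 0 <= s <= L ->
  0 < eta <= al -> al < 1 ->
  Rabs a <= 1 -> Rabs b <= 1 -> Rabs c <= 1 ->
  (forall sg x, is_derive (j sg) x (j' sg x)) -> (forall sg x, j sg (x + 2 * PI) = j sg x) ->
  (forall sg x, 0 <= sg <= 2 * L -> Rabs x <= PI -> Rabs (j' sg x) <= C0 L * nu e L 2 sg x) ->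
  (forall x y d, 0 < y < L -> 0 < d -> Rabs x <= d -> Rabs (g (phi - x) y - g phi y) <= A * Rpower d eta) ->
  Rabs (op L a b c (conv j' g) phi s) <= K1 al * A / eta.
Proof.
  intros Hj Hj' Hg Hs Het Hal Ha Hb Hc D Pj Bj Bg.
  assert (A0 : 0 <= A).
  { assert (B := Bg 0 (L / 2) 1 ltac:(lra) ltac:(lra) ltac:(rewrite Rabs_R0; lra)).
    unfold Rpower in B. rewrite ln_1, Rmult_0_r, exp_0 in B.
    assert (K := Rabs_pos (g (phi - 0) (L / 2) - g phi (L / 2))). lra. }
  assert (C := C0_pos L HL).
  assert (i : 2 / (1 - eta) <= 2 / (1 - al)).
  { apply Rmult_le_compat_l; [lra|]. apply Rinv_le_contravar; lra. }
  assert (i0 : 0 < 2 / (1 - eta)) by (apply Rdiv_lt_0_compat; lra).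
  assert (P : 0 <= A * (C0 L * (2 / (1 - eta)))) by (repeat apply Rmult_le_pos; lra).
  eapply Rle_trans.
  - apply (op_bound L HL a b c (conv j' g) (fun sg => A * (C0 L * (2 / (1 - eta))) * kap eta sg));
      auto using c3_conv.
    + apply (cont_mult (U := RU)); [cont_tac|apply cont_kap].
    + intros sg y Hsg Hy. apply (conv_bound1 j); auto. lra.
    + intros sg Hsg. apply Rmult_le_pos; [exact P|left; apply kap_pos].
  - rewrite (RI_scal (kap eta)) by apply cont_kap.
    assert (I := int_kap eta ltac:(lra)).
    apply Rle_trans with (3 / 2 * (A * (C0 L * (2 / (1 - al))) * (2 * (2 * L + 1) / eta))).
    + apply Rmult_le_compat_l; [lra|]. apply Rmult_le_compat; auto.
      * apply RInt_ge_0; [lra|apply cont_ex_RInt, cont_kap|]. intros. left; apply kap_pos.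
      * apply Rmult_le_compat_l; [exact A0|]. apply Rmult_le_compat_l; lra.
    + unfold K1. apply Req_le. field. lra.
Qed.

Lemma Vop'_bound al tau g A eta phi s : c2 g -> 0 <= s <= L -> Rabs tau <= 1 -> 0 < eta <= al -> al < 1 ->
  (forall x y d, 0 < y < L -> 0 < d -> Rabs x <= d -> Rabs (g (phi - x) y - g phi y) <= A * Rpower d eta) ->
  Rabs (Vop' e L N tau g phi s) <= K1 al * A / eta.
Proof.
  intros Hg Hs Ht Het Hal B. apply (opconv_bound1 al 1 1 tau jq jq'); auto using c2_jq, c2_jq', jq_dphi, jq_period;
    try (rewrite Rabs_R1; lra).
  intros sg x Hsg Hx. apply j_bound; auto.
Qed.
Lemma Uop'_bound al tau g A eta phi s : c2 g -> 0 <= s <= L -> Rabs tau <= 1 -> 0 < eta <= al -> al < 1 ->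
  (forall x y d, 0 < y < L -> 0 < d -> Rabs x <= d -> Rabs (g (phi - x) y - g phi y) <= A * Rpower d eta) ->
  Rabs (Uop' e L N tau g phi s) <= K1 al * A / eta.
Proof.
  intros Hg Hs Ht Het Hal B. apply (opconv_bound1 al (-1) 1 (- tau) jp jp'); auto using c2_jp, c2_jp', jp_dphi, jp_period.
  - rewrite Rabs_left; lra.
  - rewrite Rabs_R1; lra.
  - rewrite Rabs_Ropp; exact Ht.
  - intros sg x Hsg Hx. apply j_bound; auto.
Qed.

Lemma pk_e_bound x : Rabs x <= PI -> 0 <= pk e x <= 6 * e / (e + Rabs x) ^ 2.
Proof.
  intros Hx. assert (D := dk_pos e x (proj1 He)). assert (Hp := PI_gt_3). assert (K := Rabs_pos x).
  assert (Dg := dk_ge2 e x ltac:(lra) Hx).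
  assert (S : 0 < sinh e <= 2 * e).
  { destruct (MVT_gen sinh 0 e cosh) as [c [Hc H]].
    - intros z _. apply is_derive_Reals, derivable_pt_lim_sinh.
    - intros z _. apply derivable_continuous_pt, derivable_pt_sinh.
    - rewrite sinh_0 in H. rewrite Rmin_left, Rmax_right in Hc by lra.
      assert (A := cosh_ge c). assert (B := cosh_incr c 1 ltac:(lra)).
      assert (B1 : cosh 1 <= 2).
      { unfold cosh. assert (E := exp_le_3). assert (E2 : exp (- (1)) <= 1); [|lra].
        apply Rle_trans with (exp 0); [left; apply exp_increasing; lra|rewrite exp_0; lra]. }
      nra. }
  assert (P2 : 0 < (e + Rabs x) ^ 2) by (apply pow_lt; lra).
  unfold pk. split.
  - left. apply Rdiv_lt_0_compat; nra.
  - apply Rle_trans with (2 * e / (2 * PI * dk e x)).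
    + apply Rmult_le_compat_r; [left; apply Rinv_0_lt_compat; nra|lra].
    + apply Rle_trans with (2 * e * (3 / (e + Rabs x) ^ 2)).
      * apply Rmult_le_compat_l; [lra|].
        replace (3 / (e + Rabs x) ^ 2) with (/ ((e + Rabs x) ^ 2 / 3)) by (field; lra).
        apply Rinv_le_contravar; nra.
      * apply Req_le. field. lra.
Qed.

(** [Zop] convolves with the difference of two Poisson kernels. The near one has mass one and
    concentrates at scale e, so it reproduces g up to its Hölder modulus; the far one is within
    1/X^2 of 1/(2 PI) and reproduces the mean. *)
Lemma Zop_approx g A M eta phi s : c2 g -> per g -> 0 < eta < 1 ->
  (forall x d, 0 < d -> Rabs x <= d -> Rabs (g (phi - x) s - g phi s) <= A * Rpower d eta) ->
  (forall x, Rabs (g x s) <= M) ->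
  Rabs (Zop e L N g phi s + mean g s - g phi s)
  <= 12 / (1 - eta) * A * Rpower e eta + 2 / L ^ 2 * M / (INR N + 1).
Proof.
  intros Hg Pg Het Bg BM. assert (Hp := PI_gt_3). assert (Hp4 := PI_4).
  assert (A0 : 0 <= A).
  { assert (B := Bg 0 1 ltac:(lra) ltac:(rewrite Rabs_R0; lra)).
    unfold Rpower in B. rewrite ln_1, Rmult_0_r, exp_0 in B.
    assert (K := Rabs_pos (g (phi - 0) s - g phi s)). lra. }
  assert (M0 : 0 <= M) by (eapply Rle_trans; [apply Rabs_pos|apply (BM 0)]).
  set (X := e + 2 * INR (S N) * L).
  assert (HN := pos_INR N). assert (HX : 0 < X) by (unfold X; rewrite S_INR; nra).
  assert (cg : cont (fun x => g (phi - x) s)) by (apply (cont_comp2 (U := RU)); cont_tac).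
  assert (ce : cont (pk e)) by (apply (cont_pk (fun _ => e) (fun z => z)); [cont_tac|cont_tac|intros; lra]).
  assert (cX : cont (pk X)) by (apply (cont_pk (fun _ => X) (fun z => z)); [cont_tac|cont_tac|intros; lra]).
  assert (Em : mean g s = RInt (fun x => / (2 * PI) * g (phi - x) s) (- PI) PI).
  { rewrite (RI_scal (fun x => g (phi - x) s)) by exact cg.
    rewrite (RI_reflect (fun x => g x s)) by (apply c2_slice2, Hg).
    replace (phi - - PI) with (phi - PI + 2 * PI) by ring.
    rewrite (RI_period (fun x => g x s)); [|apply c2_slice2, Hg|intros; apply Pg].
    unfold mean. field. lra. }
  assert (E : Zop e L N g phi s + mean g s - g phi s =
    RInt (fun x => pk e x * (g (phi - x) s - g phi s)) (- PI) PI
    - RInt (fun x => (pk X x - / (2 * PI)) * g (phi - x) s) (- PI) PI).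
  { assert (E1 : Zop e L N g phi s = RInt (fun x => pk e x * g (phi - x) s - pk X x * g (phi - x) s) (- PI) PI).
    { unfold Zop, conv. apply RInt_ext. intros x _. rewrite jp_zero by assumption. fold X. Req. ring. }
    rewrite (RI_minus (fun x => pk e x * g (phi - x) s) (fun x => pk X x * g (phi - x) s)) in E1 by cont_tac.
    assert (E2 : RInt (fun x => pk e x * (g (phi - x) s - g phi s)) (- PI) PI
       = RInt (fun x => pk e x * g (phi - x) s) (- PI) PI - g phi s).
    { transitivity (RInt (fun x => pk e x * g (phi - x) s - g phi s * pk e x) (- PI) PI).
      - apply RInt_ext. intros x _. Req. ring.
      - rewrite (RI_minus (fun x => pk e x * g (phi - x) s) (fun x => g phi s * pk e x)) by cont_tac.
        rewrite (RI_scal (pk e)) by exact ce. rewrite pk_int by lra. Req. ring. }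
    assert (E3 : RInt (fun x => (pk X x - / (2 * PI)) * g (phi - x) s) (- PI) PI
       = RInt (fun x => pk X x * g (phi - x) s) (- PI) PI - mean g s).
    { rewrite Em. transitivity (RInt (fun x => pk X x * g (phi - x) s - / (2 * PI) * g (phi - x) s) (- PI) PI).
      - apply RInt_ext. intros x _. Req. ring.
      - apply (RI_minus (fun x => pk X x * g (phi - x) s) (fun x => / (2 * PI) * g (phi - x) s)); cont_tac. }
    rewrite E1, E2, E3. ring. }
  rewrite E. clear E Em. unfold Rminus at 1. abs_tri. rewrite Rabs_Ropp.
  apply Rplus_le_compat.
  - eapply Rle_trans.
    { apply (RInt_abs_le' _ (fun x => A * (6 * e) * Rpower (e + Rabs x) (eta - 2))); [lra|cont_tac| |].
      - apply cont_ex_RInt. apply (cont_mult (U := RU)); [cont_tac|apply cont_Rpow_abs; lra].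
      - intros x Hx. assert (Hx' : Rabs x <= PI) by (apply Rabs_le; lra). assert (K := Rabs_pos x).
        destruct (pk_e_bound x Hx') as [B1 B2]. assert (B3 := Bg x (e + Rabs x) ltac:(lra) ltac:(lra)).
        rewrite Rabs_mult, (Rabs_right (pk e x)) by lra.
        apply Rle_trans with (6 * e / (e + Rabs x) ^ 2 * (A * Rpower (e + Rabs x) eta)).
        + apply Rmult_le_compat; auto using Rabs_pos.
        + replace (eta - 2) with (eta + - INR 2) by (simpl; ring).
          rewrite Rpower_plus, Rpower_Ropp, Rpower_pow by lra. apply Req_le. field. lra. }
    rewrite (RI_scal (fun x => Rpower (e + Rabs x) (eta - 2))) by (apply cont_Rpow_abs; lra).
    assert (I := RInt_pow_neg e eta (proj1 He) Het).
    apply Rle_trans with (A * (6 * e) * (2 / (1 - eta) * Rpower e (eta - 1))).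
    + apply Rmult_le_compat_l; [apply Rmult_le_pos; lra|exact I].
    + apply Req_le. replace (Rpower e eta) with (e * Rpower e (eta - 1)); [field; lra|].
      rewrite <- (Rpower_1 e) at 1 by lra. rewrite <- Rpower_plus. f_equal. ring.
  - eapply Rle_trans.
    { apply (RInt_abs_le _ (- PI) PI (/ X ^ 2 * M)); [lra|cont_tac|].
      intros x _. rewrite Rabs_mult. apply Rmult_le_compat; auto using Rabs_pos. apply pk_far, HX. }
    apply Rle_trans with (8 * (/ (4 * L ^ 2 * (INR N + 1)) * M)).
    + apply Rmult_le_compat; [lra| |lra|].
      * apply Rmult_le_pos; [left; apply Rinv_0_lt_compat, pow_lt, HX|exact M0].
      * apply Rmult_le_compat_r; [exact M0|]. apply Rinv_le_contravar.
        -- apply Rmult_lt_0_compat; [|lra]. nra.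
        -- unfold X. rewrite S_INR. assert (0 <= INR N * L) by nra. nra.
    + apply Req_le. field. split; lra.
Qed.
End Bounds.

Lemma Rpower_interp D P Q t : 0 <= D -> 0 < P -> 0 < Q -> D <= P -> D <= Q -> 0 <= t <= 1 ->
  D <= Rpower P (1 - t) * Rpower Q t.
Proof.
  intros [HD|<-] HP HQ H1 H2 Ht.
  - replace D with (Rpower D (1 - t) * Rpower D t).
    + apply Rmult_le_compat; try (left; apply Rpower_pos); apply Rpower_le_base; lra.
    + rewrite <- Rpower_plus. replace (1 - t + t) with 1 by ring. apply Rpower_1, HD.
  - apply Rmult_le_pos; left; apply Rpower_pos.
Qed.

(** The increment of Q is taken first in x at the new height and then in s at the old abscissa. The
    mean value theorem on each leg and the continuity of the partial derivatives leave four
    errors. *)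
Lemma chain2 (L : R) (Q Qx Qs : R -> R -> R) (X Y : R -> R) (t x' y' : R) :
  c2 Qx -> c2 Qs ->
  (forall x s, 0 < s < L -> is_derive (fun x => Q x s) x (Qx x s)) ->
  (forall x s, 0 < s < L -> is_derive (fun s => Q x s) s (Qs x s)) ->
  is_derive X t x' -> is_derive Y t y' -> 0 < Y t < L ->
  is_derive (fun t => Q (X t) (Y t)) t (Qx (X t) (Y t) * x' + Qs (X t) (Y t) * y').
Proof.
  intros HQx HQs Dx Ds DX DY HY. apply is_derive_eps. intros eps He.
  assert (Bnd : exists B, 0 < B /\ (Rabs (Qx (X t) (Y t)) <= B /\ Rabs (Qs (X t) (Y t)) <= B) /\ (Rabs x' <= B /\ Rabs y' <= B)).
  { exists (1 + Rabs (Qx (X t) (Y t)) + Rabs (Qs (X t) (Y t)) + Rabs x' + Rabs y').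
    assert (A1 := Rabs_pos (Qx (X t) (Y t))). assert (A2 := Rabs_pos (Qs (X t) (Y t))).
    assert (A3 := Rabs_pos x'). assert (A4 := Rabs_pos y'). repeat split; lra. }
  destruct Bnd as [B [HB [[B1 B2] [B3 B4]]]].
  (* Each of the four errors is at most ep (B + 1) |w - t|. *)
  set (ep := Rmin 1 (eps / (4 * (B + 1)))).
  assert (E0 : 0 < eps / (4 * (B + 1))) by (apply Rdiv_lt_0_compat; lra).
  assert (Ep : 0 < ep) by (apply Rmin_pos; lra).
  assert (Ep1 : ep <= 1) by apply Rmin_l.
  assert (Ep2 : ep * (4 * (B + 1)) <= eps).
  { apply Rle_trans with (eps / (4 * (B + 1)) * (4 * (B + 1))).
    - apply Rmult_le_compat_r; [lra|apply Rmin_r].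
    - apply Req_le. field. lra. }
  destruct (proj1 (continuous_eps _ _) (HQx (X t, Y t)) ep Ep) as [d1 [Hd1 C1]].
  destruct (proj1 (continuous_eps _ _) (HQs (X t, Y t)) ep Ep) as [d2 [Hd2 C2]].
  set (d := Rmin (Rmin d1 d2) (Rmin (Y t) (L - Y t))).
  assert (Hd : 0 < d) by (repeat apply Rmin_pos; lra).
  assert (e1 : d <= d1) by (eapply Rle_trans; [apply Rmin_l|apply Rmin_l]).
  assert (e2 : d <= d2) by (eapply Rle_trans; [apply Rmin_l|apply Rmin_r]).
  assert (e3 : d <= Y t) by (eapply Rle_trans; [apply Rmin_r|apply Rmin_l]).
  assert (e4 : d <= L - Y t) by (eapply Rle_trans; [apply Rmin_r|apply Rmin_r]).
  destruct (proj1 (is_derive_eps X t x') DX ep Ep) as [dx [Hdx Hx]].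
  destruct (proj1 (is_derive_eps Y t y') DY ep Ep) as [dy [Hdy Hy]].
  set (r := d / (B + 2)).
  assert (Hr : 0 < r) by (apply Rdiv_lt_0_compat; lra).
  assert (Hr2 : r * (B + 2) = d) by (unfold r; field; lra).
  exists (Rmin r (Rmin dx dy)). split; [repeat apply Rmin_pos; assumption|].
  intros w Hw.
  assert (w1 : Rabs (w - t) < r) by (eapply Rlt_le_trans; [exact Hw|apply Rmin_l]).
  assert (w2 : Rabs (w - t) < dx) by (eapply Rlt_le_trans; [exact Hw|eapply Rle_trans; [apply Rmin_r|apply Rmin_l]]).
  assert (w3 : Rabs (w - t) < dy) by (eapply Rlt_le_trans; [exact Hw|eapply Rle_trans; [apply Rmin_r|apply Rmin_r]]).
  specialize (Hx w w2). specialize (Hy w w3).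
  set (a := Rabs (w - t)) in *. assert (a0 : 0 <= a) by apply Rabs_pos.
  assert (T : forall P p, Rabs p <= B -> Rabs (P - (w - t) * p) <= ep * a -> Rabs P <= (B + 1) * a).
  { intros P p Hp H. replace P with ((P - (w - t) * p) + (w - t) * p) by ring.
    abs_tri. rewrite Rabs_mult. fold a. nra. }
  assert (LX := T _ _ B3 Hx). assert (LY := T _ _ B4 Hy).
  assert (LX' : Rabs (X w - X t) < d) by nra. assert (LY' : Rabs (Y w - Y t) < d) by nra.
  assert (bt : forall u v z, Rmin u v <= z <= Rmax u v -> Rabs (z - u) <= Rabs (v - u)).
  { intros u v z. unfold Rmin, Rmax, Rabs. destruct (Rle_dec _ _), (Rcase_abs _), (Rcase_abs _); lra. }
  assert (yw : 0 < Y w < L) by (apply Rabs_def2 in LY'; lra).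
  destruct (MVT_abs (fun x => Q x (Y w)) (fun x => Qx x (Y w)) (X t) (X w)) as [xi [Hxi Ex]].
  { intros z Hz. apply Dx. exact yw. }
  destruct (MVT_abs (fun y => Q (X t) y) (fun y => Qs (X t) y) (Y t) (Y w)) as [ze [Hze Ey]].
  { intros z Hz. apply Ds. specialize (bt _ _ _ Hz). assert (K := Rle_lt_trans _ _ _ bt LY').
    apply Rabs_def2 in K. lra. }
  assert (F1 : Rabs (Qx xi (Y w) - Qx (X t) (Y t)) < ep).
  { apply (C1 (xi, Y w)). split; simpl.
    - eapply Rlt_le_trans; [|exact e1]. eapply Rle_lt_trans; [apply (bt _ _ _ Hxi)|exact LX'].
    - eapply Rlt_le_trans; [exact LY'|exact e1]. }
  assert (F2 : Rabs (Qs (X t) ze - Qs (X t) (Y t)) < ep).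
  { apply (C2 (X t, ze)). split; simpl.
    - change (Rabs (X t - X t) < d2). rewrite Rminus_diag, Rabs_R0. exact Hd2.
    - eapply Rlt_le_trans; [|exact e2]. eapply Rle_lt_trans; [apply (bt _ _ _ Hze)|exact LY']. }
  set (q1 := Qx (X t) (Y t)) in *. set (q2 := Qs (X t) (Y t)) in *.
  replace (Q (X w) (Y w) - Q (X t) (Y t) - (w - t) * (q1 * x' + q2 * y')) with
    ((Qx xi (Y w) - q1) * (X w - X t) + q1 * (X w - X t - (w - t) * x')
     + ((Qs (X t) ze - q2) * (Y w - Y t) + q2 * (Y w - Y t - (w - t) * y'))).
  2:{ replace (Q (X w) (Y w) - Q (X t) (Y t)) with
       ((Q (X w) (Y w) - Q (X t) (Y w)) + (Q (X t) (Y w) - Q (X t) (Y t))) by ring.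
      rewrite Ex, Ey. ring. }
  assert (P1 : Rabs ((Qx xi (Y w) - q1) * (X w - X t)) <= ep * ((B + 1) * a)).
  { rewrite Rabs_mult. apply Rmult_le_compat; auto using Rabs_pos. lra. }
  assert (P2 : Rabs (q1 * (X w - X t - (w - t) * x')) <= B * (ep * a)).
  { rewrite Rabs_mult. apply Rmult_le_compat; auto using Rabs_pos. }
  assert (P3 : Rabs ((Qs (X t) ze - q2) * (Y w - Y t)) <= ep * ((B + 1) * a)).
  { rewrite Rabs_mult. apply Rmult_le_compat; auto using Rabs_pos. lra. }
  assert (P4 : Rabs (q2 * (Y w - Y t - (w - t) * y')) <= B * (ep * a)).
  { rewrite Rabs_mult. apply Rmult_le_compat; auto using Rabs_pos. }
  abs_tri.
  eapply Rle_trans; [apply Rplus_le_compat; apply Rabs_triang|].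
  apply Rle_trans with (ep * (4 * (B + 1)) * a); [|apply Rmult_le_compat_r; assumption].
  assert (0 <= ep * a) by (apply Rmult_le_pos; lra). nra.
Qed.

(** * Interpolation and the logarithmic bound *)

Section Est.
Variables (e L al : R) (N : nat).
Hypotheses (He : 0 < e <= 1) (HL : 0 < L) (Hal : 0 < al < 1).

(** The scale d is any positive bound of the distance rather than the distance itself, because
    [Rpower] does not vanish at 0. Only increments in the first variable are measured. *)
Definition holx (g : R -> R -> R) (H : R) := forall x x' y d, 0 <= y <= L -> 0 < d ->
  Rabs (x - x') <= d -> Rabs (g x y - g x' y) <= H * Rpower d al.
Definition supb (g : R -> R -> R) (M : R) := forall x y, 0 <= y <= L -> Rabs (g x y) <= M.

Lemma hol_interp g M H eta : supb g M -> holx g H -> 0 < M -> 0 < H -> 0 < eta <= al ->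
  forall phi x y d, 0 < y < L -> 0 < d -> Rabs x <= d ->
  Rabs (g (phi - x) y - g phi y) <= (Rpower (2 * M) (1 - eta / al) * Rpower H (eta / al)) * Rpower d eta.
Proof.
  intros Hs Hh HM HH Het phi x y d Hy Hd Hx.
  assert (t01 : 0 <= eta / al <= 1).
  { split; [apply Rdiv_le_0_compat; lra|]. apply Rmult_le_reg_r with al; [lra|]. field_simplify; lra. }
  eapply Rle_trans.
  - apply (Rpower_interp _ (2 * M) (H * Rpower d al) (eta / al)); [apply Rabs_pos|lra| | | |exact t01].
    + apply Rmult_lt_0_compat; [lra|apply Rpower_pos].
    + unfold Rminus. abs_tri. rewrite Rabs_Ropp.
      assert (A := Hs (phi - x) y ltac:(lra)). assert (B := Hs phi y ltac:(lra)).
      unfold Rminus in A. lra.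
    + apply Hh; [lra|lra|]. replace (phi - x - phi) with (- x) by ring. rewrite Rabs_Ropp. exact Hx.
  - rewrite <- (Rpower_mult_distr H (Rpower d al)) by (try apply Rpower_pos; lra).
    rewrite Rpower_mult. replace (al * (eta / al)) with eta by (field; lra). apply Req_le. ring.
Qed.

Definition KL (M : R) := K1 L al * (6 * M) / al.

Lemma K1_pos : 0 < K1 L al.
Proof.
  unfold K1. assert (C := C0_pos L HL). apply Rdiv_lt_0_compat; [|lra].
  repeat apply Rmult_lt_0_compat; lra.
Qed.

(** With eta = al / ln H the interpolated Hölder constant contains H to the power 1 / ln H, which is
    exp 1, so it is at most 2 M exp 1 <= 6 M; the factor 1/eta becomes ln H / al. The bound exp 1 <=
    H keeps eta below al. *)
Lemma grad_log g M H tau phi s : c2 g -> supb g M -> holx g H -> 1 <= M -> exp 1 <= H ->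
  0 <= s <= L -> Rabs tau <= 1 ->
  Rabs (Vop' e L N tau g phi s) <= KL M * ln H /\ Rabs (Uop' e L N tau g phi s) <= KL M * ln H.
Proof.
  intros Hg Hs Hh HM HH Hsl Ht. assert (E1 := exp_pos 1).
  assert (l1 : 1 <= ln H).
  { rewrite <- (ln_exp 1). apply ln_le; [exact E1|exact HH]. }
  set (eta := al / ln H).
  assert (Het : 0 < eta <= al).
  { unfold eta. split; [apply Rdiv_lt_0_compat; lra|]. apply Rmult_le_reg_r with (ln H); [lra|]. field_simplify; nra. }
  assert (B := hol_interp g M H eta Hs Hh ltac:(lra) ltac:(lra) Het).
  set (A := Rpower (2 * M) (1 - eta / al) * Rpower H (eta / al)) in *.
  assert (HA : 0 <= A <= 6 * M).
  { unfold A. split; [apply Rmult_le_pos; left; apply Rpower_pos|].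
    assert (t : eta / al = / ln H) by (unfold eta; field; lra).
    rewrite t. replace (Rpower H (/ ln H)) with (exp 1) by (unfold Rpower; f_equal; field; lra).
    assert (E3 := exp_le_3).
    assert (t1 : 0 < / ln H) by (apply Rinv_0_lt_compat; lra).
    assert (Rpower (2 * M) (1 - / ln H) <= 2 * M).
    { rewrite <- (Rpower_1 (2 * M)) at 2 by lra. apply Rle_Rpower; lra. }
    assert (P := Rpower_pos (2 * M) (1 - / ln H)). nra. }
  assert (R : K1 L al * A / eta <= KL M * ln H).
  { unfold KL, eta. assert (P := K1_pos).
    replace (K1 L al * A / (al / ln H)) with (K1 L al * A / al * ln H) by (field; lra).
    apply Rmult_le_compat_r; [lra|]. unfold Rdiv. apply Rmult_le_compat_r; [left; apply Rinv_0_lt_compat; lra|].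
    apply Rmult_le_compat_l; lra. }
  split; (eapply Rle_trans; [|exact R]).
  - apply Vop'_bound; auto; lra.
  - apply Uop'_bound; auto; lra.
Qed.

(** The gradient bound is applied to the increment of g under translation by d. Interpolation
    between 2 H d^al and 2 H dd^al gives the increment a Hölder bound of exponent al / 2 and leaves
    the other half of the exponent as a modulus in d. *)
Lemma grad_holder g H tau phi d s : c2 g -> holx g H -> 0 < H -> 0 <= s <= L -> Rabs tau <= 1 -> 0 < d ->
  Rabs (Vop' e L N tau g (phi + d) s - Vop' e L N tau g phi s) <= 4 * K1 L al * H / al * Rpower d (al / 2) /\
  Rabs (Uop' e L N tau g (phi + d) s - Uop' e L N tau g phi s) <= 4 * K1 L al * H / al * Rpower d (al / 2).
Proof.
  intros Hg Hh HH Hs Ht Hd.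
  set (gd := fun x y => g (x + d) y).
  assert (cgd : c2 gd) by (unfold c2, gd; apply (cont_comp2 g); cont_tac).
  set (G := fun x y => gd x y - g x y).
  assert (cG : c2 G) by (apply (cont_minus (U := RU2)); assumption).
  assert (B : forall x y dd, 0 < y < L -> 0 < dd -> Rabs x <= dd ->
    Rabs (G (phi - x) y - G phi y) <= (2 * H * Rpower d (al / 2)) * Rpower dd (al / 2)).
  { intros x y dd Hy Hdd Hx. eapply Rle_trans.
    - apply (Rpower_interp _ (2 * H * Rpower d al) (2 * H * Rpower dd al) (/ 2)); [apply Rabs_pos| | | | |lra].
      + apply Rmult_lt_0_compat; [lra|apply Rpower_pos].
      + apply Rmult_lt_0_compat; [lra|apply Rpower_pos].
      + unfold Rminus. abs_tri. rewrite Rabs_Ropp.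
        assert (T : forall z, Rabs (G z y) <= H * Rpower d al).
        { intros z. unfold G, gd. apply Hh; [lra|lra|]. replace (z + d - z) with d by ring. rewrite Rabs_right; lra. }
        assert (A1 := T (phi - x)). assert (A2 := T phi). unfold Rminus in A1. lra.
      + unfold G, gd.
        replace (g (phi - x + d) y - g (phi - x) y - (g (phi + d) y - g phi y)) with
          ((g (phi - x + d) y - g (phi + d) y) + - (g (phi - x) y - g phi y)) by ring.
        abs_tri. rewrite Rabs_Ropp.
        assert (A1 := Hh (phi - x + d) (phi + d) y dd ltac:(lra) Hdd
          ltac:(replace (phi - x + d - (phi + d)) with (- x) by ring; rewrite Rabs_Ropp; exact Hx)).
        assert (A2 := Hh (phi - x) phi y dd ltac:(lra) Hdd
          ltac:(replace (phi - x - phi) with (- x) by ring; rewrite Rabs_Ropp; exact Hx)). lra.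
    - replace (1 - / 2) with (/ 2) by field.
      rewrite <- !Rpower_mult_distr by (try apply Rpower_pos; try lra).
      rewrite !Rpower_mult. replace (al * / 2) with (al / 2) by field.
      apply Req_le. replace (Rpower 2 (/ 2) * Rpower H (/ 2) * Rpower d (al / 2) * (Rpower 2 (/ 2) * Rpower H (/ 2) * Rpower dd (al / 2)))
        with ((Rpower 2 (/ 2) * Rpower 2 (/ 2)) * (Rpower H (/ 2) * Rpower H (/ 2)) * Rpower d (al / 2) * Rpower dd (al / 2)) by ring.
      rewrite <- !Rpower_plus. replace (/ 2 + / 2) with 1 by field. rewrite !Rpower_1 by lra. ring. }
  assert (R : K1 L al * (2 * H * Rpower d (al / 2)) / (al / 2) = 4 * K1 L al * H / al * Rpower d (al / 2)) by (field; lra).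
  split.
  - unfold Vop'. rewrite <- opconv_shift, <- opconv_minus by (auto using c2_jq'; lra).
    rewrite <- R. apply (Vop'_bound e L N He HL al tau G); auto; lra.
  - unfold Uop'. rewrite <- opconv_shift, <- opconv_minus by (auto using c2_jp'; lra).
    rewrite <- R. apply (Uop'_bound e L N He HL al tau G); auto; lra.
Qed.

Lemma pk_nonneg x phi : 0 < x -> 0 <= pk x phi.
Proof.
  intros Hx. unfold pk. assert (D := dk_pos x phi Hx). assert (P := PI_RGT_0).
  assert (0 <= sinh x).
  { unfold sinh. assert (exp (- x) < exp x) by (apply exp_increasing; lra). lra. }
  apply Rdiv_le_0_compat; nra.
Qed.

(** Both kernels of [jp_zero] are nonnegative with integral one. *)
Lemma Zop_bound g M phi s : c2 g -> (forall x, Rabs (g x s) <= M) -> Rabs (Zop e L N g phi s) <= 2 * M.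
Proof.
  intros Hg BM. assert (Hp := PI_gt_3).
  set (X := e + 2 * INR (S N) * L).
  assert (HN := pos_INR N). assert (HX : 0 < X) by (unfold X; rewrite S_INR; nra).
  assert (ce : cont (pk e)) by (apply (cont_pk (fun _ => e) (fun z => z)); [cont_tac|cont_tac|intros; lra]).
  assert (cX : cont (pk X)) by (apply (cont_pk (fun _ => X) (fun z => z)); [cont_tac|cont_tac|intros; lra]).
  unfold Zop, conv.
  eapply Rle_trans.
  - apply (RInt_abs_le' _ (fun x => M * (pk e x + pk X x))); [lra| | |].
    + apply cont_conv_int; auto using c2_jp.
    + apply cont_ex_RInt. apply (cont_mult (U := RU)); cont_tac.
    + intros x _. rewrite jp_zero by assumption. fold X. rewrite Rabs_mult, Rmult_comm.
      apply Rmult_le_compat; auto using Rabs_pos.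
      assert (A := pk_nonneg e x (proj1 He)). assert (B := pk_nonneg X x HX).
      apply Rabs_le. lra.
  - rewrite (RI_scal (fun x => pk e x + pk X x)) by cont_tac.
    rewrite (RI_plus (pk e) (pk X)) by assumption. rewrite !pk_int by lra. apply Req_le. Req. ring.
Qed.
End Est.

(** * Transport along a vector field *)

Lemma lip_strip (L : R) (b bx bs : R -> R -> R) (Lam : R) : c2 b ->
  (forall x s, 0 <= s <= L -> is_derive (fun x => b x s) x (bx x s)) ->
  (forall x s, 0 < s < L -> is_derive (fun s => b x s) s (bs x s)) ->
  (forall x s, 0 <= s <= L -> Rabs (bx x s) <= Lam) ->
  (forall x s, 0 <= s <= L -> Rabs (bs x s) <= Lam) ->
  forall x x' s s', 0 <= s <= L -> 0 <= s' <= L ->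
    Rabs (b x s - b x' s') <= Lam * (Rabs (x - x') + Rabs (s - s')).
Proof.
  intros Hb Dx Ds Bx Bs x x' s s' Hs Hs'.
  assert (A : Rabs (b x s - b x' s) <= Lam * Rabs (x - x')).
  { destruct (MVT_abs (fun x => b x s) (fun x => bx x s) x' x) as [c [_ E]].
    - intros z _. apply Dx, Hs.
    - rewrite E, Rabs_mult. apply Rmult_le_compat_r; [apply Rabs_pos|]. apply Bx, Hs. }
  assert (B : Rabs (b x' s - b x' s') <= Lam * Rabs (s - s')).
  { assert (mm : 0 <= Rmin s' s /\ Rmax s' s <= L) by (split; [apply Rmin_glb|apply Rmax_lub]; lra).
    destruct (MVT_gen (fun s => b x' s) s' s (fun s => bs x' s)) as [c [Hc E]].
    - intros z Hz. apply Ds. lra.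
    - intros z _. apply continuity_pt_filterlim. apply (c2_slice1 b x' Hb).
    - rewrite E, Rabs_mult. apply Rmult_le_compat_r; [apply Rabs_pos|]. apply Bs. lra. }
  replace (b x s - b x' s') with ((b x s - b x' s) + (b x' s - b x' s')) by ring.
  abs_tri. lra.
Qed.

Section Strip.
Variables (L al : R).
Hypotheses (HL : 0 < L) (Hal : 0 < al < 1).

Definition cl (s : R) := Rmax 0 (Rmin L s).
Lemma cl_in s : 0 <= cl s <= L.
Proof. unfold cl. split; [apply Rmax_l|apply Rmax_lub; [lra|apply Rmin_l]]. Qed.
Lemma cl_id s : 0 <= s <= L -> cl s = s.
Proof. intros H. unfold cl. rewrite Rmin_right, Rmax_right; lra. Qed.
Lemma cont_cl {U : UniformSpace} (g : U -> R) : cont g -> cont (fun z => cl (g z)).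
Proof. intros H. unfold cl. cont_tac. Qed.

Definition hol2 (Q : R -> R -> R) (H : R) := forall x x' y y' d, 0 <= y <= L -> 0 <= y' <= L -> 0 < d ->
  Rabs (x - x') <= d -> Rabs (y - y') <= d -> Rabs (Q x y - Q x' y') <= H * Rpower d al.

Record C1 (Q Qx Qs : R -> R -> R) : Prop := {
  C1_c : c2 Q; C1_cx : c2 Qx; C1_cs : c2 Qs;
  C1_dx : forall x s, 0 < s < L -> is_derive (fun x => Q x s) x (Qx x s);
  C1_ds : forall x s, 0 < s < L -> is_derive (fun s => Q x s) s (Qs x s) }.

(** What the velocity operators deliver: phi-derivatives up to the walls, s-derivatives inside. B
    bounds the field and Lam its gradient; the second component vanishes on the walls. *)
Record gfield (b1 b1x b1s b2 b2x b2s : R -> R -> R) (B Lam : R) : Prop := {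
  gf_C1 : C1 b1 b1x b1s;
  gf_C2 : C1 b2 b2x b2s;
  gf_d1 : forall x s, 0 <= s <= L -> is_derive (fun x => b1 x s) x (b1x x s);
  gf_d2 : forall x s, 0 <= s <= L -> is_derive (fun x => b2 x s) x (b2x x s);
  gf_p1 : per b1;
  gf_p2 : per b2;
  gf_B : 0 < B;
  gf_Lam : 0 < Lam;
  gf_b : forall x s, 0 <= s <= L -> Rabs (b1 x s) <= B /\ Rabs (b2 x s) <= B;
  gf_L1 : forall x s, 0 <= s <= L -> Rabs (b1x x s) <= Lam /\ Rabs (b1s x s) <= Lam;
  gf_L2 : forall x s, 0 <= s <= L -> Rabs (b2x x s) <= Lam /\ Rabs (b2s x s) <= Lam;
  gf_0 : forall x, b2 x 0 = 0;
  gf_1 : forall x, b2 x L = 0 }.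

Section Adv.
Variables (b1 b1x b1s b2 b2x b2s : R -> R -> R) (B Lam : R).
Hypothesis GF : gfield b1 b1x b1s b2 b2x b2s B Lam.
Let Cb1 : C1 b1 b1x b1s := gf_C1 _ _ _ _ _ _ _ _ GF.
Let Cb2 : C1 b2 b2x b2s := gf_C2 _ _ _ _ _ _ _ _ GF.
Let D1 := gf_d1 _ _ _ _ _ _ _ _ GF.
Let D2 := gf_d2 _ _ _ _ _ _ _ _ GF.
Let Pb1 : per b1 := gf_p1 _ _ _ _ _ _ _ _ GF.
Let Pb2 : per b2 := gf_p2 _ _ _ _ _ _ _ _ GF.
Let HB : 0 < B := gf_B _ _ _ _ _ _ _ _ GF.
Let HLam : 0 < Lam := gf_Lam _ _ _ _ _ _ _ _ GF.
Let Bb := gf_b _ _ _ _ _ _ _ _ GF.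
Let BL1 := gf_L1 _ _ _ _ _ _ _ _ GF.
Let BL2 := gf_L2 _ _ _ _ _ _ _ _ GF.
Let b20 : forall x, b2 x 0 = 0 := gf_0 _ _ _ _ _ _ _ _ GF.
Let b2L : forall x, b2 x L = 0 := gf_1 _ _ _ _ _ _ _ _ GF.

(* Foot point of one backward Euler step along (b1, b2). *)
Definition YX (h x s : R) := x - h * b1 x (cl s).
Definition YS (h x s : R) := cl s - h * b2 x (cl s).
Definition adv (h : R) (Q : R -> R -> R) (x s : R) := Q (YX h x s) (YS h x s).

Section H.
Variable h : R.
Hypotheses (Hh : 0 <= h) (HhL : h * Lam <= / 2).

(** The normal component vanishes on the walls and has Lipschitz constant Lam there, so a step with
    h Lam <= 1/2 covers at most half of the distance to either wall. *)
Lemma YS_in x s : 0 <= YS h x s <= L.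
Proof.
  unfold YS. assert (K := cl_in s). set (t := cl s) in *.
  assert (A := lip_strip L b2 b2x b2s Lam (C1_c _ _ _ Cb2) D2 (C1_ds _ _ _ Cb2)
     (fun x s H => proj1 (BL2 x s H)) (fun x s H => proj2 (BL2 x s H)) x x t 0 K ltac:(lra)).
  assert (A' := lip_strip L b2 b2x b2s Lam (C1_c _ _ _ Cb2) D2 (C1_ds _ _ _ Cb2)
     (fun x s H => proj1 (BL2 x s H)) (fun x s H => proj2 (BL2 x s H)) x x t L K ltac:(lra)).
  rewrite b20 in A. rewrite b2L in A'. rewrite Rminus_diag, Rabs_R0, Rminus_0_r, Rplus_0_l in A, A'.
  rewrite Rminus_0_r in A. rewrite (Rabs_right t) in A by lra. rewrite (Rabs_left1 (t - L)) in A' by lra.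
  assert (U1 := Rle_abs (b2 x t)). assert (U2 := Rle_abs (- b2 x t)). rewrite Rabs_Ropp in U2.
  assert (h * b2 x t <= t) by nra. assert (- (h * b2 x t) <= L - t) by nra. lra.
Qed.
Lemma YS_int x s : 0 < s < L -> 0 < YS h x s < L.
Proof.
  intros Hs. unfold YS. rewrite cl_id by lra.
  assert (A := lip_strip L b2 b2x b2s Lam (C1_c _ _ _ Cb2) D2 (C1_ds _ _ _ Cb2)
     (fun x s H => proj1 (BL2 x s H)) (fun x s H => proj2 (BL2 x s H)) x x s 0 ltac:(lra) ltac:(lra)).
  assert (A' := lip_strip L b2 b2x b2s Lam (C1_c _ _ _ Cb2) D2 (C1_ds _ _ _ Cb2)
     (fun x s H => proj1 (BL2 x s H)) (fun x s H => proj2 (BL2 x s H)) x x s L ltac:(lra) ltac:(lra)).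
  rewrite b20 in A. rewrite b2L in A'. rewrite Rminus_diag, Rabs_R0, Rminus_0_r, Rplus_0_l in A, A'.
  rewrite Rminus_0_r in A. rewrite (Rabs_right s) in A by lra. rewrite (Rabs_left1 (s - L)) in A' by lra.
  assert (U1 := Rle_abs (b2 x s)). assert (U2 := Rle_abs (- b2 x s)). rewrite Rabs_Ropp in U2.
  assert (h * b2 x s <= / 2 * s) by nra. assert (- (h * b2 x s) <= / 2 * (L - s)) by nra. lra.
Qed.

Lemma Y_lip x x' y y' d : 0 <= y <= L -> 0 <= y' <= L -> Rabs (x - x') <= d -> Rabs (y - y') <= d ->
  Rabs (YX h x y - YX h x' y') <= (1 + 2 * h * Lam) * d /\
  Rabs (YS h x y - YS h x' y') <= (1 + 2 * h * Lam) * d.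
Proof.
  intros Hy Hy' Hx Hs.
  assert (A := lip_strip L b1 b1x b1s Lam (C1_c _ _ _ Cb1) D1 (C1_ds _ _ _ Cb1)
     (fun x s H => proj1 (BL1 x s H)) (fun x s H => proj2 (BL1 x s H)) x x' y y' Hy Hy').
  assert (A' := lip_strip L b2 b2x b2s Lam (C1_c _ _ _ Cb2) D2 (C1_ds _ _ _ Cb2)
     (fun x s H => proj1 (BL2 x s H)) (fun x s H => proj2 (BL2 x s H)) x x' y y' Hy Hy').
  assert (K : Lam * (Rabs (x - x') + Rabs (y - y')) <= Lam * (2 * d)) by (apply Rmult_le_compat_l; lra).
  assert (T : forall a u, Rabs a <= d -> Rabs u <= Lam * (2 * d) -> Rabs (a - h * u) <= (1 + 2 * h * Lam) * d).
  { intros a u Ha Hu. unfold Rminus. abs_tri.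
    rewrite Rabs_Ropp, Rabs_mult, (Rabs_right h) by lra. nra. }
  unfold YX, YS. rewrite !cl_id by assumption. split.
  - replace (x - h * b1 x y - (x' - h * b1 x' y')) with ((x - x') - h * (b1 x y - b1 x' y')) by ring.
    apply T; lra.
  - replace (y - h * b2 x y - (y' - h * b2 x' y')) with ((y - y') - h * (b2 x y - b2 x' y')) by ring.
    apply T; lra.
Qed.

Lemma Y_near x y : 0 <= y <= L -> Rabs (YX h x y - x) <= h * B /\ Rabs (YS h x y - y) <= h * B.
Proof.
  intros Hy. unfold YX, YS. rewrite cl_id by assumption. destruct (Bb x y Hy) as [A1 A2].
  split; [replace (x - h * b1 x y - x) with (- (h * b1 x y)) by ring|replace (y - h * b2 x y - y) with (- (h * b2 x y)) by ring];
    rewrite Rabs_Ropp, Rabs_mult, (Rabs_right h) by lra; apply Rmult_le_compat_l; lra.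
Qed.

Lemma c2_YX : c2 (YX h).
Proof.
  unfold YX. apply cont_minus; [cont_tac|]. apply cont_mult; [cont_tac|].
  apply (cont_comp2 b1); [apply (C1_c _ _ _ Cb1)|cont_tac|apply cont_cl; cont_tac].
Qed.
Lemma c2_YS : c2 (YS h).
Proof.
  unfold YS. apply cont_minus; [apply cont_cl; cont_tac|]. apply cont_mult; [cont_tac|].
  apply (cont_comp2 b2); [apply (C1_c _ _ _ Cb2)|cont_tac|apply cont_cl; cont_tac].
Qed.
Lemma c2_adv Q : c2 Q -> c2 (adv h Q).
Proof. intros H. unfold adv. apply (cont_comp2 Q); [exact H|apply c2_YX|apply c2_YS]. Qed.
Lemma per_adv Q : per Q -> per (adv h Q).
Proof.
  intros P x s. unfold adv, YX, YS. rewrite Pb1, Pb2.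
  replace (x + 2 * PI - h * b1 x (cl s)) with (x - h * b1 x (cl s) + 2 * PI) by ring. apply P.
Qed.
Lemma adv_sup Q M : supb L Q M -> supb L (adv h Q) M.
Proof. intros H x s _. apply H, YS_in. Qed.

(** The foot map has Lipschitz constant 1 + 2 h Lam. Its power al <= 1 is bounded by the constant
    itself, since that is at least 1. *)
Lemma adv_hol Q H : 0 < H -> hol2 Q H -> hol2 (adv h Q) (H * (1 + 2 * h * Lam)).
Proof.
  intros HH Hq x x' y y' d Hy Hy' Hd Hx Hs. destruct (Y_lip x x' y y' d Hy Hy' Hx Hs) as [A1 A2].
  assert (P : 1 <= 1 + 2 * h * Lam) by nra.
  eapply Rle_trans; [apply (Hq _ _ _ _ ((1 + 2 * h * Lam) * d)); auto using YS_in; nra|].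
  rewrite <- Rpower_mult_distr by lra. rewrite <- Rmult_assoc.
  apply Rmult_le_compat_r; [left; apply Rpower_pos|]. apply Rmult_le_compat_l; [lra|].
  rewrite <- (Rpower_1 (1 + 2 * h * Lam)) at 2 by lra. apply Rle_Rpower; lra.
Qed.

Definition advx (Qx Qs : R -> R -> R) x s :=
  Qx (YX h x s) (YS h x s) * (1 - h * b1x x (cl s)) + Qs (YX h x s) (YS h x s) * (- (h * b2x x (cl s))).
Definition advs (Qx Qs : R -> R -> R) x s :=
  Qx (YX h x s) (YS h x s) * (- (h * b1s x (cl s))) + Qs (YX h x s) (YS h x s) * (1 - h * b2s x (cl s)).

Lemma adv_C1 Q Qx Qs : C1 Q Qx Qs -> C1 (adv h Q) (advx Qx Qs) (advs Qx Qs).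
Proof.
  intros [A1 A2 A3 A4 A5].
  assert (T : forall k, c2 k -> c2 (fun x s => k x (cl s))).
  { intros k Hk. unfold c2. apply (cont_comp2 k); [exact Hk|cont_tac|apply cont_cl; cont_tac]. }
  assert (T1 := T _ (C1_cx _ _ _ Cb1)). assert (T2 := T _ (C1_cs _ _ _ Cb1)).
  assert (T3 := T _ (C1_cx _ _ _ Cb2)). assert (T4 := T _ (C1_cs _ _ _ Cb2)).
  assert (S1 : forall k, c2 k -> c2 (fun x s => k (YX h x s) (YS h x s))) by (intros; apply (c2_adv k); assumption).
  assert (S2 := S1 _ A2). assert (S3 := S1 _ A3). unfold c2 in T1, T2, T3, T4, S2, S3.
  constructor.
  - apply c2_adv, A1.
  - unfold advx, c2. cont_tac.
  - unfold advs, c2. cont_tac.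
  - intros x s Hs. unfold adv, advx.
    apply (chain2 L Q Qx Qs (fun x => YX h x s) (fun x => YS h x s)); auto using YS_int.
    + unfold YX. rewrite cl_id by lra. apply (is_derive_minus (V := RN)).
      * apply (is_derive_id (K := R_AbsRing)).
      * apply is_derive_scal. apply D1. lra.
    + unfold YS. rewrite cl_id by lra. evar_last.
      * apply (is_derive_minus (V := RN)).
        -- apply (is_derive_const (V := RN)).
        -- apply is_derive_scal. apply D2. lra.
      * unfold minus, plus, opp, zero; simpl. ring.
  - intros x s Hs. unfold adv, advs.
    assert (loc : locally s (fun t => 0 <= t <= L)).
    { assert (Hr : 0 < Rmin s (L - s)) by (apply Rmin_pos; lra).
      exists (mkposreal _ Hr). intros t Ht. change (Rabs (t - s) < Rmin s (L - s)) in Ht.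
      assert (m1 := Rmin_l s (L - s)). assert (m2 := Rmin_r s (L - s)). apply Rabs_def2 in Ht. lra. }
    apply (chain2 L Q Qx Qs (fun s => YX h x s) (fun s => YS h x s)); auto using YS_int.
    + apply is_derive_ext_loc with (fun s => x - h * b1 x s).
      * apply filter_imp with (2 := loc). intros t Ht. unfold YX. rewrite cl_id by exact Ht. reflexivity.
      * rewrite cl_id by lra. evar_last.
        -- apply (is_derive_minus (V := RN)).
           ++ apply (is_derive_const (V := RN)).
           ++ apply is_derive_scal. apply (C1_ds _ _ _ Cb1). exact Hs.
        -- unfold minus, plus, opp, zero; simpl. ring.
    + apply is_derive_ext_loc with (fun s => s - h * b2 x s).
      * apply filter_imp with (2 := loc). intros t Ht. unfold YS. rewrite cl_id by exact Ht. reflexivity.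
      * rewrite cl_id by lra. apply (is_derive_minus (V := RN)).
        -- apply (is_derive_id (K := R_AbsRing)).
        -- apply is_derive_scal. apply (C1_ds _ _ _ Cb2). exact Hs.
Qed.

Lemma adv_grad Qx Qs G : supb L Qx G -> supb L Qs G ->
  supb L (advx Qx Qs) (G * (1 + 2 * h * Lam)) /\ supb L (advs Qx Qs) (G * (1 + 2 * h * Lam)).
Proof.
  intros Gx Gs.
  assert (T : forall p q u v, Rabs p <= G -> Rabs q <= G -> Rabs u <= Lam -> Rabs v <= Lam ->
    Rabs (p * (1 - h * u) + q * (- (h * v))) <= G * (1 + 2 * h * Lam)).
  { intros p q u v Hp Hq Hu Hv.
    replace (p * (1 - h * u) + q * - (h * v)) with (p + - (h * (p * u + q * v))) by ring.
    abs_tri. rewrite Rabs_Ropp, Rabs_mult, (Rabs_right h) by lra.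
    assert (K : Rabs (p * u + q * v) <= 2 * (G * Lam)).
    { abs_tri. rewrite !Rabs_mult.
      assert (Rabs p * Rabs u <= G * Lam) by (apply Rmult_le_compat; auto using Rabs_pos).
      assert (Rabs q * Rabs v <= G * Lam) by (apply Rmult_le_compat; auto using Rabs_pos). lra. }
    assert (h * Rabs (p * u + q * v) <= h * (2 * (G * Lam))) by (apply Rmult_le_compat_l; lra). lra. }
  split; intros x s Hs; assert (P := YS_in x s); assert (A := Gx (YX h x s) (YS h x s) P); assert (A' := Gs (YX h x s) (YS h x s) P);
    destruct (BL1 x (cl s) (cl_in s)); destruct (BL2 x (cl s) (cl_in s)).
  - unfold advx. apply T; assumption.
  - unfold advs. rewrite Rplus_comm. apply T; assumption.
Qed.
End H.

(** * Averages over the foot points of partial steps *)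

Section Avg.
Variable h : R.
Hypotheses (Hh : 0 < h) (HhL : h * Lam <= / 2).
Variables (Q Qx Qs : R -> R -> R) (H G : R).
Hypotheses (CQ : C1 Q Qx Qs) (PQ : per Q) (HH : 0 < H) (hQ : hol2 Q H) (Gx : supb L Qx G) (Gs : supb L Qs G).

(** The Euler increment of Q is an integral over partial steps r h of the gradient of Q at their
    feet. Averaging Q over the same feet gives a function whose own gradient reproduces this
    integral up to derivatives of the field; for this reason the average, and not Q, becomes the
    transported density of the flux. *)
Definition avg (x s : R) : R := RInt (fun r => adv (r * h) Q x s) 0 1.
Definition avgx (x s : R) : R := RInt (fun r => advx (r * h) Qx Qs x s) 0 1.
Definition avgs (x s : R) : R := RInt (fun r => advs (r * h) Qx Qs x s) 0 1.

Lemma rh r : 0 <= r <= 1 -> 0 <= r * h /\ r * h * Lam <= / 2.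
Proof. intros Hr. assert (0 <= h * Lam) by nra. split; nra. Qed.

Lemma c3_Y k : c2 k -> cont (fun z : R * R * R => k (YX (snd z * h) (fst (fst z)) (snd (fst z))) (YS (snd z * h) (fst (fst z)) (snd (fst z)))).
Proof.
  intros Hk. apply (cont_comp2 k); [exact Hk| |].
  - unfold YX. apply cont_minus; [cont_tac|]. apply cont_mult; [cont_tac|].
    apply (cont_comp2 b1); [apply (C1_c _ _ _ Cb1)|cont_tac|apply cont_cl; cont_tac].
  - unfold YS. apply cont_minus; [apply cont_cl; cont_tac|]. apply cont_mult; [cont_tac|].
    apply (cont_comp2 b2); [apply (C1_c _ _ _ Cb2)|cont_tac|apply cont_cl; cont_tac].
Qed.
Lemma c3_cl k : c2 k -> cont (fun z : R * R * R => k (fst (fst z)) (cl (snd (fst z)))).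
Proof. intros Hk. apply (cont_comp2 k); [exact Hk|cont_tac|apply cont_cl; cont_tac]. Qed.
Lemma c3_advx : cont (fun z : R * R * R => advx (snd z * h) Qx Qs (fst (fst z)) (snd (fst z))).
Proof.
  unfold advx. assert (A := c3_Y _ (C1_cx _ _ _ CQ)). assert (A' := c3_Y _ (C1_cs _ _ _ CQ)).
  assert (A1 := c3_cl _ (C1_cx _ _ _ Cb1)). assert (A2 := c3_cl _ (C1_cx _ _ _ Cb2)). cont_tac.
Qed.
Lemma c3_advs : cont (fun z : R * R * R => advs (snd z * h) Qx Qs (fst (fst z)) (snd (fst z))).
Proof.
  unfold advs. assert (A := c3_Y _ (C1_cx _ _ _ CQ)). assert (A' := c3_Y _ (C1_cs _ _ _ CQ)).
  assert (A1 := c3_cl _ (C1_cs _ _ _ Cb1)). assert (A2 := c3_cl _ (C1_cs _ _ _ Cb2)). cont_tac.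
Qed.

Lemma c2_of_c3 k : cont (fun z : R * R * R => k (fst (fst z)) (snd (fst z)) (snd z)) ->
  c2 (fun x s => RInt (fun r => k x s r) 0 1).
Proof.
  intros Hk. apply (cont_RInt (U := RU2) (fun z r => k (fst z) (snd z) r)).
  exact Hk.
Qed.
Lemma c3_fix1 (k : R -> R -> R -> R) s : cont (fun z : R * R * R => k (fst (fst z)) (snd (fst z)) (snd z)) -> c2 (fun x r => k x s r).
Proof.
  intros Hk. unfold c2. apply (cont_comp3 (U := RU2) k fst (fun _ => s) snd Hk); cont_tac.
Qed.
Lemma c3_fix2 (k : R -> R -> R -> R) x : cont (fun z : R * R * R => k (fst (fst z)) (snd (fst z)) (snd z)) -> c2 (fun s r => k x s r).
Proof.
  intros Hk. unfold c2. apply (cont_comp3 (U := RU2) k (fun _ => x) fst snd Hk); cont_tac.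
Qed.

Lemma avg_C1 : C1 avg avgx avgs.
Proof.
  constructor.
  - apply (c2_of_c3 (fun x s r => adv (r * h) Q x s)). apply (c3_Y _ (C1_c _ _ _ CQ)).
  - apply (c2_of_c3 (fun x s r => advx (r * h) Qx Qs x s)). apply c3_advx.
  - apply (c2_of_c3 (fun x s r => advs (r * h) Qx Qs x s)). apply c3_advs.
  - intros x s Hs.
    apply (derive_RInt_param (fun x r => adv (r * h) Q x s) (fun x r => advx (r * h) Qx Qs x s) 0 1 x 1); [lra|lra| | |].
    + apply (c3_fix1 (fun x s r => adv (r * h) Q x s)), (c3_Y _ (C1_c _ _ _ CQ)).
    + apply (c3_fix1 (fun x s r => advx (r * h) Qx Qs x s)), c3_advx.
    + intros y r _ Hr. destruct (rh r ltac:(lra)) as [q1 q2]. apply (C1_dx _ _ _ (adv_C1 (r * h) q1 q2 _ _ _ CQ)), Hs.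
  - intros x s Hs.
    assert (Hr0 : 0 < Rmin s (L - s)) by (apply Rmin_pos; lra).
    apply (derive_RInt_param (fun s r => adv (r * h) Q x s) (fun s r => advs (r * h) Qx Qs x s) 0 1 s (Rmin s (L - s))); [lra|lra| | |].
    + apply (c3_fix2 (fun x s r => adv (r * h) Q x s)), (c3_Y _ (C1_c _ _ _ CQ)).
    + apply (c3_fix2 (fun x s r => advs (r * h) Qx Qs x s)), c3_advs.
    + intros t r Ht Hr. destruct (rh r ltac:(lra)) as [q1 q2].
      assert (m1 := Rmin_l s (L - s)). assert (m2 := Rmin_r s (L - s)). apply Rabs_def2 in Ht.
      apply (C1_ds _ _ _ (adv_C1 (r * h) q1 q2 _ _ _ CQ)). lra.
Qed.

Lemma cont_adv_r x s : cont (fun r => adv (r * h) Q x s).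
Proof.
  apply (slice_cont (U := RU2) (fun z r => adv (r * h) Q (fst z) (snd z)) (x, s)).
  apply (c3_Y _ (C1_c _ _ _ CQ)).
Qed.

Lemma per_avg : per avg.
Proof. intros x s. unfold avg. apply RInt_ext. intros r _. apply per_adv, PQ. Qed.

Lemma RI_01_bound (k : R -> R) K : cont k -> (forall r, 0 <= r <= 1 -> Rabs (k r) <= K) -> Rabs (RInt k 0 1) <= K.
Proof. intros Hk HK. replace K with ((1 - 0) * K) by ring. apply RInt_abs_le; auto. lra. Qed.

Lemma avg_sup M : supb L Q M -> supb L avg M.
Proof.
  intros HM x s Hs. apply RI_01_bound; [apply cont_adv_r|]. intros r Hr. destruct (rh r Hr) as [q1 q2].
  apply (adv_sup (r * h) q1 q2 Q M HM x s Hs).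
Qed.

Lemma avg_hol : hol2 avg (2 * H).
Proof.
  intros x x' y y' d Hy Hy' Hd Hx Hs. unfold avg.
  rewrite <- (RI_minus (fun r => adv (r * h) Q x y) (fun r => adv (r * h) Q x' y')) by apply cont_adv_r.
  apply RI_01_bound; [apply (cont_minus (U := RU)); apply cont_adv_r|].
  intros r Hr. destruct (rh r Hr) as [q1 q2].
  eapply Rle_trans; [apply (adv_hol (r * h) q1 q2 Q H HH hQ x x' y y' d); assumption|].
  apply Rmult_le_compat_r; [left; apply Rpower_pos|]. nra.
Qed.

Lemma avg_near x s : 0 <= s <= L -> Rabs (avg x s - Q x s) <= H * Rpower (h * B) al.
Proof.
  intros Hs. unfold avg.
  replace (Q x s) with (RInt (fun _ => Q x s) 0 1) by (rewrite RI_const; Req; ring).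
  rewrite <- (RI_minus (fun r => adv (r * h) Q x s) (fun r => Q x s)) by (try apply cont_adv_r; cont_tac).
  apply RI_01_bound; [apply (cont_minus (U := RU)); [apply cont_adv_r|cont_tac]|].
  intros r Hr. destruct (rh r Hr) as [q1 q2]. destruct (Y_near (r * h) q1 x s Hs) as [A1 A2].
  assert (r * h * B <= h * B) by (apply Rmult_le_compat_r; [lra|nra]).
  apply hQ; auto; [apply (YS_in (r * h) q1 q2)|nra|lra|lra].
Qed.

(* The time increment of the scheme is a transport term up to a commutator of size h. *)
Lemma adv_increment x s : 0 < s < L ->
  Rabs ((adv h Q x s - Q x s) / h + (b1 x s * avgx x s + b2 x s * avgs x s)) <= h * (4 * B * Lam * G).
Proof.
  intros Hs.
  set (qx := fun r => Qx (YX (r * h) x s) (YS (r * h) x s)).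
  set (qs := fun r => Qs (YX (r * h) x s) (YS (r * h) x s)).
  assert (fixc : forall k : R * R * R -> R, cont k -> cont (fun r => k ((x, s), r))).
  { intros k Hk. apply (slice_cont (U := RU2) (fun z r => k (z, r)) (x, s)).
    intros z. apply (continuous_ext k); [intros [? ?]; reflexivity|apply Hk]. }
  assert (cqx : cont qx) by (apply (fixc _ (c3_Y _ (C1_cx _ _ _ CQ)))).
  assert (cqs : cont qs) by (apply (fixc _ (c3_Y _ (C1_cs _ _ _ CQ)))).
  assert (cax : cont (fun r => advx (r * h) Qx Qs x s)) by (apply (fixc _ c3_advx)).
  assert (cas : cont (fun r => advs (r * h) Qx Qs x s)) by (apply (fixc _ c3_advs)).
  (* Fundamental theorem in r along the segment of foot points. *)
  assert (I0 : RInt (fun r => - h * (b1 x s * qx r + b2 x s * qs r)) 0 1 = adv h Q x s - Q x s).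
  { rewrite (RInt_FTC_closed (fun r => adv (r * h) Q x s)); [|lra|apply cont_adv_r|cont_tac|].
    - rewrite Rmult_1_l, Rmult_0_l. unfold adv at 2, YX, YS. rewrite cl_id by lra.
      rewrite !Rmult_0_l, !Rminus_0_r. reflexivity.
    - intros r Hr. destruct (rh r ltac:(lra)) as [q1 q2]. unfold adv.
      replace (- h * (b1 x s * qx r + b2 x s * qs r)) with (qx r * (- h * b1 x s) + qs r * (- h * b2 x s)) by ring.
      apply (chain2 L Q Qx Qs (fun r => YX (r * h) x s) (fun r => YS (r * h) x s)).
      + apply (C1_cx _ _ _ CQ).
      + apply (C1_cs _ _ _ CQ).
      + apply (C1_dx _ _ _ CQ).
      + apply (C1_ds _ _ _ CQ).
      + unfold YX. rewrite cl_id by lra. auto_derive; [exact I|ring].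
      + unfold YS. rewrite cl_id by lra. auto_derive; [exact I|ring].
      + apply (YS_int (r * h) q1 q2 x s Hs). }
  (* The gradient of the average carries the Jacobian of the foot map; its difference from the
     identity has the factor r h and is all that remains. *)
  assert (E : (adv h Q x s - Q x s) / h + (b1 x s * avgx x s + b2 x s * avgs x s) =
    RInt (fun r => - (r * h) * (b1 x s * (b1x x s * qx r + b2x x s * qs r) + b2 x s * (b1s x s * qx r + b2s x s * qs r))) 0 1).
  { rewrite <- I0. unfold avgx, avgs.
    rewrite (RI_scal (fun r => b1 x s * qx r + b2 x s * qs r)) by cont_tac.
    rewrite <- (RI_scal (fun r => advx (r * h) Qx Qs x s)) by exact cax.
    rewrite <- (RI_scal (fun r => advs (r * h) Qx Qs x s)) by exact cas.
    replace (- h * RInt (fun r => b1 x s * qx r + b2 x s * qs r) 0 1 / h)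
      with (- RInt (fun r => b1 x s * qx r + b2 x s * qs r) 0 1) by (field; lra).
    rewrite <- (RI_opp (fun r => b1 x s * qx r + b2 x s * qs r)) by cont_tac.
    rewrite <- (RI_plus (fun r => b1 x s * advx (r * h) Qx Qs x s) (fun r => b2 x s * advs (r * h) Qx Qs x s)) by cont_tac.
    rewrite <- (RI_plus (fun r => - (b1 x s * qx r + b2 x s * qs r))
       (fun r => b1 x s * advx (r * h) Qx Qs x s + b2 x s * advs (r * h) Qx Qs x s)) by cont_tac.
    apply RInt_ext. intros r _. unfold advx, advs. rewrite cl_id by lra. fold (qx r). fold (qs r). Req. ring. }
  rewrite E. apply RI_01_bound; [cont_tac|].
  intros r Hr. destruct (rh r Hr) as [q1 q2]. assert (P := YS_in (r * h) q1 q2 x s).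
  assert (A := Gx (YX (r * h) x s) _ P). assert (A' := Gs (YX (r * h) x s) _ P).
  change (Rabs (qx r) <= G) in A. change (Rabs (qs r) <= G) in A'.
  destruct (Bb x s ltac:(lra)) as [B1 B2]. destruct (BL1 x s ltac:(lra)) as [L1 L2]. destruct (BL2 x s ltac:(lra)) as [L3 L4].
  assert (G0 : 0 <= G) by (eapply Rle_trans; [apply Rabs_pos|exact A]).
  assert (T : forall u v, Rabs u <= Lam -> Rabs v <= Lam -> Rabs (u * qx r + v * qs r) <= 2 * (Lam * G)).
  { intros u v Hu Hv. abs_tri. rewrite !Rabs_mult.
    assert (Rabs u * Rabs (qx r) <= Lam * G) by (apply Rmult_le_compat; auto using Rabs_pos).
    assert (Rabs v * Rabs (qs r) <= Lam * G) by (apply Rmult_le_compat; auto using Rabs_pos). lra. }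
  rewrite Rabs_mult, Rabs_Ropp, Rabs_mult, (Rabs_right r), (Rabs_right h) by lra.
  assert (K : Rabs (b1 x s * (b1x x s * qx r + b2x x s * qs r) + b2 x s * (b1s x s * qx r + b2s x s * qs r)) <= 4 * B * Lam * G).
  { abs_tri. rewrite !Rabs_mult.
    assert (K1 := Rmult_le_compat _ _ _ _ (Rabs_pos _) (Rabs_pos _) B1 (T _ _ L1 L3)).
    assert (K2 := Rmult_le_compat _ _ _ _ (Rabs_pos _) (Rabs_pos _) B2 (T _ _ L2 L4)). lra. }
  apply Rmult_le_compat; [nra|apply Rabs_pos|nra|exact K].
Qed.
End Avg.
End Adv.
End Strip.

(** * Discrete momentum equations *)

Lemma derive_mult (f g : R -> R) x f' g' : is_derive f x f' -> is_derive g x g' ->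
  is_derive (fun x => f x * g x) x (f' * g x + f x * g').
Proof.
  intros Hf Hg. apply (is_derive_mult (K := R_AbsRing) f g); auto. intros; apply Rmult_comm.
Qed.

Lemma C1_mult L f fx fs g gx gs : C1 L f fx fs -> C1 L g gx gs ->
  C1 L (fun x s => f x s * g x s) (fun x s => fx x s * g x s + f x s * gx x s)
     (fun x s => fs x s * g x s + f x s * gs x s).
Proof.
  intros [A1 A2 A3 A4 A5] [B1 B2 B3 B4 B5]. unfold c2 in *. constructor; unfold c2; try cont_tac.
  - intros x s Hs. apply (derive_mult (fun x => f x s) (fun x => g x s)); auto.
  - intros x s Hs. apply (derive_mult (fun s => f x s) (fun s => g x s)); auto.
Qed.

Lemma mean_dx0 L F Fx s : c2 F -> c2 Fx -> per F -> 0 < s < L ->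
  (forall x s, 0 < s < L -> is_derive (fun x => F x s) x (Fx x s)) -> mean Fx s = 0.
Proof.
  intros HF HFx PF Hs D. assert (Hp := PI_RGT_0). unfold mean.
  rewrite (RInt_FTC_closed (fun x => F x s)); [|lra|apply c2_slice2, HF|apply c2_slice2, HFx|].
  - replace PI with (- PI + 2 * PI) at 1 by ring. rewrite PF. Req. field. lra.
  - intros x _. apply D, Hs.
Qed.

Lemma mean_ds L F Fs s : c2 F -> c2 Fs -> 0 < s < L ->
  (forall x s, 0 < s < L -> is_derive (fun s => F x s) s (Fs x s)) -> is_derive (mean F) s (mean Fs s).
Proof.
  intros HF HFs Hs D. assert (Hp := PI_RGT_0).
  assert (Hr0 : 0 < Rmin s (L - s)) by (apply Rmin_pos; lra).
  apply is_derive_ext with (fun s => / (2 * PI) * RInt (fun x => F x s) (- PI) PI);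
    [intros; unfold mean, Rdiv; apply Rmult_comm|].
  replace (mean Fs s) with (/ (2 * PI) * RInt (fun x => Fs x s) (- PI) PI) by (unfold mean, Rdiv; apply Rmult_comm).
  apply is_derive_scal.
  apply (derive_RInt_param (fun s x => F x s) (fun s x => Fs x s) _ _ s (Rmin s (L - s))); [lra|exact Hr0| | |].
  - unfold c2. apply (cont_comp2 F); [exact HF|cont_tac|cont_tac].
  - unfold c2. apply (cont_comp2 Fs); [exact HFs|cont_tac|cont_tac].
  - intros t x Ht _. assert (m1 := Rmin_l s (L - s)). assert (m2 := Rmin_r s (L - s)). apply Rabs_def2 in Ht.
    apply D. lra.
Qed.

Lemma c2_int0 (k : R -> R) : cont k -> c2 (fun _ s => RInt k 0 s).
Proof.
  intros Hk. unfold c2.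
  apply (cont_RInt_var (U := RU2) (fun _ y => k y) (fun _ => 0) snd); [|cont_tac|cont_tac].
  apply (cont_snd' k Hk).
Qed.
Lemma int0_ds (k : R -> R) s : cont k -> is_derive (fun s => RInt k 0 s) s (k s).
Proof.
  intros Hk. apply (is_derive_RInt (V := RC) k (RInt k 0) 0 s).
  - exists (mkposreal 1 Rlt_0_1). intros y _. apply RInt_correct, cont_ex_RInt, Hk.
  - apply Hk.
Qed.

Section Velocity.
Variables (e L al : R) (N : nat).
Hypotheses (He : 0 < e <= 1) (HL : 0 < L) (Hal : 0 < al < 1).
Variable c0 : R.

(** [Uop] and [Vop] together have curl close to g minus its mean in phi. The shear term supplies the
    missing mean, so that the curl of ([Ug], [Vg]) is [Zop g] plus the mean; c0 is the constant
    which curl and divergence leave free. *)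
Definition Ug (g : R -> R -> R) (x s : R) : R := c0 - RInt (mean g) 0 s + Uop e L N (-1) g x s.
Definition Ugs (g : R -> R -> R) (x s : R) : R := - mean g s + (Vop' e L N (-1) g x s - Zop e L N g x s).
Definition Vg (g : R -> R -> R) : R -> R -> R := Vop e L N (-1) g.
Definition Ugx (g : R -> R -> R) : R -> R -> R := Uop' e L N (-1) g.
Definition Vgx (g : R -> R -> R) : R -> R -> R := Vop' e L N (-1) g.
Definition Vgs (g : R -> R -> R) (x s : R) : R := - Ugx g x s.

Section G.
Variable g : R -> R -> R.
Hypotheses (Hg : c2 g) (Pg : per g).

Lemma Ug_dx x s : 0 <= s <= L -> is_derive (fun x => Ug g x s) x (Ugx g x s).
Proof.
  intros Hs. unfold Ug, Ugx. evar_last.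
  - apply (is_derive_plus (V := RN)); [apply (is_derive_const (V := RN))|].
    apply Uop_dphi; auto.
  - unfold plus, zero; simpl. ring.
Qed.
Lemma Vg_dx x s : 0 <= s <= L -> is_derive (fun x => Vg g x s) x (Vgx g x s).
Proof. intros Hs. apply Vop_dphi; auto. Qed.

Lemma Ug_C1 : C1 L (Ug g) (Ugx g) (Ugs g).
Proof.
  assert (A := c2_Uop e L N He HL g Hg (-1)). assert (A1 := c2_Vop' e L N He HL g Hg (-1)).
  assert (A2 := c2_Zop e L N He HL g Hg). assert (A3 := cont_mean g Hg).
  assert (A4 := c2_int0 _ A3). assert (A5 := cont_snd' (V := R_UniformSpace) (W := R_UniformSpace) _ A3).
  unfold c2 in *. constructor.
  - unfold c2, Ug. cont_tac.
  - apply c2_Uop'; auto.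
  - unfold c2, Ugs. cont_tac.
  - intros x s Hs. apply Ug_dx. lra.
  - intros x s Hs. unfold Ug, Ugs. apply (is_derive_plus (V := RN)).
    + evar_last.
      * apply (is_derive_minus (V := RN)); [apply (is_derive_const (V := RN))|].
        apply int0_ds, A3.
      * unfold minus, plus, opp, zero; simpl. ring.
    + apply Uop_ds; auto.
Qed.
Lemma Vg_C1 : C1 L (Vg g) (Vgx g) (Vgs g).
Proof.
  constructor.
  - apply c2_Vop; auto.
  - apply c2_Vop'; auto.
  - apply cont_opp. apply (c2_Uop' e L N He HL g Hg (-1)).
  - intros x s Hs. apply Vg_dx. lra.
  - intros x s Hs. apply Vop_ds; auto.
Qed.
Lemma per_Ug : per (Ug g).
Proof. intros x s. unfold Ug, Uop. rewrite (per_op L g Pg). reflexivity. Qed.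
Lemma per_Vg : per (Vg g).
Proof. apply per_op, Pg. Qed.

Lemma Vg_0 x : Vg g x 0 = 0. Proof. apply Vop_bdry0. Qed.
Lemma Vg_L x : Vg g x L = 0. Proof. apply Vop_bdryL. Qed.
Lemma Vgs_E x s : Vgs g x s = - Ugx g x s. Proof. reflexivity. Qed.

Definition BU (M : R) := Rabs c0 + L * M + K0 L * M.

Lemma Ug_bound M x s : supb L g M -> 0 <= s <= L -> Rabs (Ug g x s) <= BU M.
Proof.
  intros HM Hs. unfold Ug, BU.
  assert (A1 : Rabs (Uop e L N (-1) g x s) <= K0 L * M).
  { apply Uop_bound; auto; [rewrite Rabs_left; lra|]. intros; apply HM; lra. }
  assert (M0 : 0 <= M) by (eapply Rle_trans; [apply Rabs_pos|apply (HM 0 0); lra]).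
  assert (A2 : Rabs (RInt (mean g) 0 s) <= (s - 0) * M).
  { apply RInt_abs_le; [lra|apply cont_mean, Hg|]. intros y Hy. apply mean_bound; [exact Hg|].
    intros; apply HM; lra. }
  assert (A3 : (s - 0) * M <= L * M) by (apply Rmult_le_compat_r; lra).
  unfold Rminus. abs_tri. apply Rplus_le_compat; [|exact A1].
  abs_tri. rewrite Rabs_Ropp. lra.
Qed.
Lemma Vg_bound M x s : supb L g M -> 0 <= s <= L -> Rabs (Vg g x s) <= K0 L * M.
Proof.
  intros HM Hs. apply Vop_bound; auto; [rewrite Rabs_left; lra|]. intros; apply HM; lra.
Qed.
Lemma Ugs_bound M H x s : supb L g M -> holx L al g H -> 1 <= M -> exp 1 <= H -> 0 <= s <= L ->
  Rabs (Ugs g x s) <= 3 * M + KL L al M * ln H.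
Proof.
  intros HM Hh M1 H1 Hs. unfold Ugs.
  assert (A1 := proj1 (grad_log e L al N He HL Hal g M H (-1) x s Hg HM Hh M1 H1 Hs ltac:(rewrite Rabs_left; lra))).
  assert (A2 : Rabs (Zop e L N g x s) <= 2 * M) by (eapply Zop_bound; eauto).
  assert (A3 := mean_bound g M s Hg (fun x => HM x s Hs)).
  unfold Rminus. abs_tri. rewrite Rabs_Ropp.
  assert (T := Rabs_triang (Vop' e L N (-1) g x s) (- Zop e L N g x s)). rewrite Rabs_Ropp in T. lra.
Qed.
End G.

Section Momentum.
Variables (g g' Fb Fbx Fbs : R -> R -> R) (h eps : R).
Hypotheses (Hg : c2 g) (Pg : per g) (Hg' : c2 g') (Hh : 0 < h).
Hypotheses (CF : C1 L Fb Fbx Fbs) (PF : per Fb).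
Hypothesis Tr : forall x s, 0 < s < L ->
  Rabs ((g' x s - g x s) / h + (Ug g x s * Fbx x s + Vg g x s * Fbs x s)) <= eps.

Definition F1 x s := Ug g x s * Fb x s.
Definition F2 x s := Vg g x s * Fb x s.
Definition F1x x s := Ugx g x s * Fb x s + Ug g x s * Fbx x s.
Definition F1s x s := Ugs g x s * Fb x s + Ug g x s * Fbs x s.
Definition F2x x s := Vgx g x s * Fb x s + Vg g x s * Fbx x s.
Definition F2s x s := Vgs g x s * Fb x s + Vg g x s * Fbs x s.

Lemma F1_C1 : C1 L F1 F1x F1s. Proof. apply C1_mult; [apply Ug_C1; auto|exact CF]. Qed.
Lemma F2_C1 : C1 L F2 F2x F2s. Proof. apply C1_mult; [apply Vg_C1; auto|exact CF]. Qed.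
Lemma per_F1 : per F1. Proof. intros x s. unfold F1. rewrite PF, per_Ug by exact Pg. reflexivity. Qed.
Lemma per_F2 : per F2. Proof. intros x s. unfold F2. rewrite PF, per_Vg by exact Pg. reflexivity. Qed.

(** Residual of the vorticity equation in flux form, with flux (F1, F2). The transport hypothesis
    bounds it because the velocity is exactly divergence free. *)
Definition Ee x s := / h * (g' x s - g x s) + (F1x x s + F2s x s).
Lemma c2_Ee : c2 Ee.
Proof.
  assert (A := C1_cx _ _ _ _ F1_C1). assert (A' := C1_cs _ _ _ _ F2_C1). unfold c2 in *. unfold Ee. cont_tac.
Qed.
Lemma Ee_bound x s : 0 < s < L -> Rabs (Ee x s) <= eps.
Proof.
  intros Hs. eapply Rle_trans; [|apply (Tr x s Hs)]. apply Req_le. f_equal.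
  unfold Ee, F1x, F2s, Vgs. field. lra.
Qed.
Lemma eps_ge0 : 0 <= eps.
Proof. eapply Rle_trans; [apply Rabs_pos|apply (Ee_bound 0 (L / 2)); lra]. Qed.

(** Applying the velocity operators to minus the divergence of the flux and integrating by parts
    leaves the gradient of this function, apart from the local terms F2 and -F1. The limit is
    therefore the rotational form U_t = V Q - P_x, V_t = - U Q - P_s, with P the Bernoulli head. *)
Definition pres x s := Uop e L N (-1) F1 x s + Vop e L N 1 F2 x s - RInt (mean F1) 0 s.
Definition presx x s := Uop' e L N (-1) F1 x s + Vop' e L N 1 F2 x s.
Definition press x s := Vop' e L N (-1) F1 x s - Uop' e L N 1 F2 x s - (Zop e L N F1 x s + mean F1 s).

Lemma pres_C1 : C1 L pres presx press.
Proof.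
  assert (c1 := C1_c _ _ _ _ F1_C1). assert (c1' := C1_c _ _ _ _ F2_C1).
  assert (A := c2_Uop e L N He HL F1 c1 (-1)). assert (A1 := c2_Vop e L N He HL F2 c1' 1).
  assert (A' := c2_Uop' e L N He HL F1 c1 (-1)). assert (A1' := c2_Vop' e L N He HL F2 c1' 1).
  assert (B' := c2_Uop' e L N He HL F2 c1' 1). assert (B1' := c2_Vop' e L N He HL F1 c1 (-1)).
  assert (A2 := c2_Zop e L N He HL F1 c1). assert (A3 := cont_mean F1 c1).
  assert (A4 := c2_int0 _ A3). assert (A5 := cont_snd' (V := R_UniformSpace) (W := R_UniformSpace) _ A3).
  unfold c2 in *. constructor.
  - apply cont_minus; [apply cont_plus; [exact A|exact A1]|exact A4].
  - apply cont_plus; [exact A'|exact A1'].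
  - apply cont_minus; [apply cont_minus; [exact B1'|exact B']|apply cont_plus; [exact A2|exact A5]].
  - intros x s Hs. unfold pres, presx. evar_last.
    + apply (is_derive_minus (V := RN)); [apply (is_derive_plus (V := RN))|
        apply (is_derive_const (V := RN))].
      * apply Uop_dphi; auto using per_F1. lra.
      * apply Vop_dphi; auto using per_F2. lra.
    + unfold minus, plus, opp, zero; simpl. ring.
  - intros x s Hs. unfold pres, press. evar_last.
    + apply (is_derive_minus (V := RN)); [apply (is_derive_plus (V := RN))|].
      * apply Uop_ds; auto using per_F1.
      * apply Vop_ds; auto using per_F2.
      * apply int0_ds, A3.
    + unfold minus, plus, opp, zero; simpl. ring.
Qed.
Lemma per_pres : per pres.
Proof. intros x s. unfold pres, Uop, Vop. rewrite (per_op L F1 per_F1), (per_op L F2 per_F2). reflexivity. Qed.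

Lemma incr_decomp x s : / h * (g' x s - g x s) = Ee x s - F1x x s - F2s x s.
Proof. unfold Ee. ring. Qed.

Lemma opconv_incr a b c j x s : c2 j -> 0 <= s <= L ->
  (op L a b c (conv j g') x s - op L a b c (conv j g) x s) / h =
  op L a b c (conv j Ee) x s - op L a b c (conv j F1x) x s - op L a b c (conv j F2s) x s.
Proof.
  intros Hj Hs. assert (cE := c2_Ee). assert (A := C1_cx _ _ _ _ F1_C1). assert (A' := C1_cs _ _ _ _ F2_C1).
  rewrite <- !opconv_minus; auto.
  2:{ unfold c2 in *. cont_tac. }
  unfold Rdiv. rewrite Rmult_comm. rewrite <- opconv_scal; auto.
  2:{ unfold c2 in *. cont_tac. }
  apply opconv_ext; auto. intros y z Hz. apply incr_decomp.
Qed.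

(** The increment of g is replaced by residual minus divergence of the flux, and [Vop_Fx], [Vop_Fs]
    shift the derivatives onto the kernel. The mean and [Zop] terms inside [press] reproduce F1 up
    to the error of the approximate identity. *)
Lemma momentum_V x s : 0 <= s <= L ->
  (Vg g' x s - Vg g x s) / h + press x s + F1 x s
  = Vop e L N (-1) Ee x s - (Zop e L N F1 x s + mean F1 s - F1 x s).
Proof.
  intros Hs. unfold Vg, Vop. rewrite opconv_incr by (auto using c2_jq).
  change (op L 1 1 (-1) (conv (jq e L N) F1x) x s) with (Vop e L N (-1) F1x x s).
  change (op L 1 1 (-1) (conv (jq e L N) F2s) x s) with (Vop e L N (-1) F2s x s).
  destruct F1_C1 as [a1 a2 a3 a4 a5]. destruct F2_C1 as [d1 d2 d3 d4 d5].
  rewrite (Vop_Fx e L N He HL F1 F1x a1 a2 per_F1 a4) by exact Hs.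
  rewrite (Vop_Fs e L N He HL F2 F2s d1 d3 d5); auto.
  - unfold press, Vop. ring.
  - intros y. unfold F2. unfold Vg. rewrite Vop_bdry0. ring.
  - intros y. unfold F2. unfold Vg. rewrite Vop_bdryL. ring.
Qed.

Lemma momentum_U x s : 0 <= s <= L ->
  (Ug g' x s - Ug g x s) / h + presx x s - F2 x s
  = - RInt (mean Ee) 0 s + Uop e L N (-1) Ee x s + (Zop e L N F2 x s + mean F2 s - F2 x s).
Proof.
  intros Hs. destruct F1_C1 as [a1 a2 a3 a4 a5]. destruct F2_C1 as [d1 d2 d3 d4 d5]. assert (cE := c2_Ee).
  assert (z0 : forall y, F2 y 0 = 0) by (intros y; unfold F2, Vg; rewrite Vop_bdry0; ring).
  assert (zL : forall y, F2 y L = 0) by (intros y; unfold F2, Vg; rewrite Vop_bdryL; ring).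
  (* The shear part: [F1x] has mean zero by periodicity, and the mean of [F2s] integrates to the
     mean of [F2], which vanishes at the wall s = 0. *)
  assert (E1 : (RInt (mean g') 0 s - RInt (mean g) 0 s) / h = RInt (mean Ee) 0 s - mean F2 s).
  { assert (m1 := cont_mean g Hg). assert (m2 := cont_mean g' Hg'). assert (m3 := cont_mean _ cE). assert (m4 := cont_mean _ d3).
    unfold Rdiv. rewrite <- RI_minus by assumption. rewrite Rmult_comm, <- (RI_scal (fun y => mean g' y - mean g y)) by cont_tac.
    replace (mean F2 s) with (mean F2 s - mean F2 0).
    2:{ replace (mean F2 0) with 0; [ring|]. unfold mean.
        replace (RInt (fun y => F2 y 0) (- PI) PI) with (RInt (fun _ => 0) (- PI) PI); [rewrite RI_const; Req; field; apply PI_neq0|].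
        apply RInt_ext. intros y _. symmetry. apply z0. }
    rewrite <- (RInt_FTC_closed (mean F2) (mean F2s) 0 s); [|lra|apply cont_mean, d1|exact m4|].
    2:{ intros y Hy. apply (mean_ds L); auto. lra. }
    rewrite <- (RI_minus (mean Ee) (mean F2s)) by assumption.
    apply RI_ext; [lra|]. intros y Hy.
    assert (mx : mean F1x y = 0) by (apply (mean_dx0 L F1); auto using per_F1; lra).
    assert (Z : / h * (mean g' y - mean g y) = mean Ee y - mean F1x y - mean F2s y).
    { unfold mean, Rdiv. rewrite <- !Rmult_minus_distr_r.
      rewrite <- !RI_minus; try (apply c2_slice2; assumption);
        try (apply (cont_minus (U := RU)); apply c2_slice2; assumption).
      rewrite <- Rmult_assoc. f_equal.
      rewrite <- (RI_scal (fun z => g' z y - g z y)) by (apply (cont_minus (U := RU)); apply c2_slice2; assumption).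
      apply RInt_ext. intros z _. apply incr_decomp. }
    rewrite Z, mx. Req. ring. }
  assert (E2 : (Uop e L N (-1) g' x s - Uop e L N (-1) g x s) / h =
     Uop e L N (-1) Ee x s - Uop' e L N (-1) F1 x s - (Vop' e L N 1 F2 x s - Zop e L N F2 x s)).
  { unfold Uop at 1 2. rewrite opconv_incr by (auto using c2_jp).
    change (op L (-1) 1 (- -1) (conv (jp e L N) F1x) x s) with (Uop e L N (-1) F1x x s).
    change (op L (-1) 1 (- -1) (conv (jp e L N) F2s) x s) with (Uop e L N (-1) F2s x s).
    rewrite (Uop_Fx e L N He HL F1 F1x a1 a2 per_F1 a4) by exact Hs.
    rewrite (Uop_Fs e L N He HL F2 F2s d1 d3 d5); auto. }
  unfold Ug, presx.
  replace ((c0 - RInt (mean g') 0 s + Uop e L N (-1) g' x s - (c0 - RInt (mean g) 0 s + Uop e L N (-1) g x s)) / h)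
    with (- ((RInt (mean g') 0 s - RInt (mean g) 0 s) / h) + (Uop e L N (-1) g' x s - Uop e L N (-1) g x s) / h) by (field; lra).
  rewrite E1, E2. ring.
Qed.

Lemma momentum_err x s : 0 <= s <= L ->
  Rabs (- RInt (mean Ee) 0 s + Uop e L N (-1) Ee x s) <= (L + K0 L) * eps /\
  Rabs (Vop e L N (-1) Ee x s) <= (L + K0 L) * eps.
Proof.
  intros Hs. assert (cE := c2_Ee). assert (e0 := eps_ge0).
  assert (B : forall y z, 0 < z < L -> Rabs (Ee y z) <= eps) by (intros; apply Ee_bound; assumption).
  assert (t1 : Rabs (-1) <= 1) by (rewrite Rabs_left; lra).
  assert (A1 := Uop_bound e L N He HL (-1) Ee eps x s cE Hs t1 B).
  assert (A2 := Vop_bound e L N He HL (-1) Ee eps x s cE Hs t1 B).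
  split; [|nra].
  assert (A3 : Rabs (RInt (mean Ee) 0 s) <= RInt (fun _ => eps) 0 s).
  { apply RInt_abs_le'; [lra|apply cont_mean, cE|apply ex_RInt_const|].
    intros y Hy. apply mean_bound; [exact cE|]. intros; apply B; lra. }
  rewrite RI_const in A3. abs_tri. rewrite Rabs_Ropp. nra.
Qed.
End Momentum.
End Velocity.

(** * The time-stepping scheme *)

Lemma gfield_mono L b1 b1x b1s b2 b2x b2s B Lam Lam' : Lam <= Lam' ->
  gfield L b1 b1x b1s b2 b2x b2s B Lam -> gfield L b1 b1x b1s b2 b2x b2s B Lam'.
Proof.
  intros Hl [A1 A2 A3 A4 A5 A6 A7 A8 A9 A10 A11 A12 A13]. constructor; auto.
  - lra.
  - intros x s Hs. destruct (A10 x s Hs). lra.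
  - intros x s Hs. destruct (A11 x s Hs). lra.
Qed.

Lemma exp_ge_1p x : 1 + x <= exp x.
Proof. destruct (Req_dec x 0) as [->|n]; [rewrite exp_0; lra|]. left. apply exp_ineq1, n. Qed.

Lemma pow_exp_le x k : 0 <= x -> (1 + x) ^ k <= exp (x * INR k).
Proof.
  intros Hx. induction k as [|k IH].
  - simpl. rewrite Rmult_0_r, exp_0. lra.
  - rewrite S_INR. simpl. replace (x * (INR k + 1)) with (x + x * INR k) by ring. rewrite exp_plus.
    apply Rmult_le_compat; [lra|apply pow_le; lra|apply exp_ge_1p|exact IH].
Qed.

Section Scheme.
Variables (L al : R) (mu mu' f : R -> R) (Cmu Cf c0 M0 : R).
Hypotheses (HL : 0 < L) (Hal : 0 < al < 1).
Hypotheses (cmu : cont mu) (cmu' : cont mu') (mu1 : forall s, 1 <= mu s)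
  (dmu : forall s, is_derive mu s (mu' s))
  (mub : forall s, 0 <= s <= L -> mu s <= Cmu /\ Rabs (mu' s) <= Cmu)
  (cf : cont f) (fb : forall s, 0 <= s <= L -> Rabs (f s) <= Cf) (HM0 : 0 <= M0).

(* Relative vorticity of the absolute vorticity Q. *)
Definition gQ (Q : R -> R -> R) (x y : R) := / mu y * (Q x y - f y).
(** The summand 1 secures [Mg] >= 1, which the logarithmic estimate requires. *)
Definition Mg := M0 + Cf + 1.
Definition Bc := Cmu * BU L c0 Mg.
Definition C2c := Cmu * (BU L c0 Mg + 3 * Mg + KL L al Mg).

Lemma Cf_ge0 : 0 <= Cf.
Proof. eapply Rle_trans; [apply Rabs_pos|apply (fb 0); lra]. Qed.
Lemma Mg_ge1 : 1 <= Mg. Proof. assert (H := Cf_ge0). unfold Mg. lra. Qed.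
Lemma Cmu_ge1 : 1 <= Cmu.
Proof. destruct (mub 0 ltac:(lra)). assert (H1 := mu1 0). lra. Qed.
Lemma K0_pos : 0 < K0 L.
Proof. unfold K0. assert (C := C0_pos L HL). repeat apply Rmult_lt_0_compat; lra. Qed.
Lemma BU_pos : 0 < BU L c0 Mg /\ K0 L * Mg <= BU L c0 Mg.
Proof.
  unfold BU. assert (A := Rabs_pos c0). assert (B := Mg_ge1). assert (C := K0_pos).
  assert (0 < K0 L * Mg) by nra. assert (0 < L * Mg) by nra. lra.
Qed.
Lemma KL_pos : 0 < KL L al Mg.
Proof.
  unfold KL. assert (A := K1_pos L al HL Hal). assert (B := Mg_ge1). apply Rdiv_lt_0_compat; [|lra].
  apply Rmult_lt_0_compat; lra.
Qed.
Lemma Bc_pos : 0 < Bc.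
Proof. unfold Bc. assert (A := Cmu_ge1). assert (B := proj1 BU_pos). nra. Qed.
Lemma C2c_pos : 0 < C2c.
Proof. unfold C2c. assert (A := Cmu_ge1). assert (B := proj1 BU_pos). assert (C := KL_pos). assert (D := Mg_ge1). nra. Qed.

Lemma cont_imu : cont (fun s => / mu s).
Proof. apply (cont_inv (U := RU) mu); [|exact cmu]. intros s. assert (H := mu1 s). lra. Qed.
Lemma imu_bound s : 0 < / mu s <= 1.
Proof.
  assert (H := mu1 s). split; [apply Rinv_0_lt_compat; lra|]. rewrite <- Rinv_1. apply Rinv_le_contravar; lra.
Qed.

Section OneQ.
Variable Q : R -> R -> R.
Lemma c2_gQ : c2 Q -> c2 (gQ Q).
Proof.
  intros H. unfold gQ. apply cont_mult; [apply (cont_snd' _ cont_imu)|].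
  apply cont_minus; [exact H|apply (cont_snd' _ cf)].
Qed.
Lemma per_gQ : per Q -> per (gQ Q).
Proof. intros H x s. unfold gQ. rewrite H. reflexivity. Qed.
Lemma gQ_sup : supb L Q M0 -> supb L (gQ Q) Mg.
Proof.
  intros H x s Hs. unfold gQ. rewrite Rabs_mult. destruct (imu_bound s) as [i1 i2].
  rewrite (Rabs_right (/ mu s)) by lra.
  assert (A : Rabs (Q x s - f s) <= Mg).
  { unfold Rminus. abs_tri. rewrite Rabs_Ropp.
    assert (B := H x s Hs). assert (C := fb s Hs). unfold Mg. lra. }
  assert (P := Rabs_pos (Q x s - f s)). nra.
Qed.
Lemma gQ_hol H : hol2 L al Q H -> holx L al (gQ Q) H.
Proof.
  intros Hh x x' y d Hy Hd Hx. unfold gQ.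
  replace (/ mu y * (Q x y - f y) - / mu y * (Q x' y - f y)) with (/ mu y * (Q x y - Q x' y)) by ring.
  rewrite Rabs_mult. destruct (imu_bound y) as [i1 i2]. rewrite (Rabs_right (/ mu y)) by lra.
  assert (A := Hh x x' y y d Hy Hy Hd Hx ltac:(rewrite Rminus_diag, Rabs_R0; lra)).
  assert (P := Rabs_pos (Q x y - Q x' y)). nra.
Qed.
End OneQ.

Variables (e : R) (N : nat).
Hypothesis He : 0 < e <= 1.
Notation Ug := (Ug e L N c0). Notation Ugs := (Ugs e L N). Notation Vg := (Vg e L N).
Notation Ugx := (Ugx e L N). Notation Vgx := (Vgx e L N). Notation Vgs := (Vgs e L N).

Definition b1 Q x s := mu s * Ug (gQ Q) x s.
Definition b1x Q x s := mu s * Ugx (gQ Q) x s.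
Definition b1s Q x s := mu' s * Ug (gQ Q) x s + mu s * Ugs (gQ Q) x s.
Definition b2 Q x s := mu s * Vg (gQ Q) x s.
Definition b2x Q x s := mu s * Vgx (gQ Q) x s.
Definition b2s Q x s := mu' s * Vg (gQ Q) x s + mu s * Vgs (gQ Q) x s.

Lemma C1_mu k kx ks : C1 L k kx ks ->
  C1 L (fun x s => mu s * k x s) (fun x s => mu s * kx x s) (fun x s => mu' s * k x s + mu s * ks x s).
Proof.
  intros [A1 A2 A3 A4 A5].
  assert (m1 := cont_snd' (V := R_UniformSpace) (W := R_UniformSpace) mu cmu).
  assert (m2 := cont_snd' (V := R_UniformSpace) (W := R_UniformSpace) mu' cmu').
  constructor.
  - apply cont_mult; [exact m1|exact A1].
  - apply cont_mult; [exact m1|exact A2].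
  - apply cont_plus; apply cont_mult; assumption.
  - intros x s Hs. apply is_derive_scal. apply A4, Hs.
  - intros x s Hs. apply derive_mult; [apply dmu|apply A5, Hs].
Qed.

(** Since ln H >= 1, all bounded contributions, from the derivative of mu, from [Zop] and from the
    mean, are absorbed into the multiple C2c of ln H. *)
Lemma field_ok Q H : c2 Q -> per Q -> supb L Q M0 -> hol2 L al Q H -> exp 1 <= H ->
  gfield L (b1 Q) (b1x Q) (b1s Q) (b2 Q) (b2x Q) (b2s Q) Bc (C2c * ln H).
Proof.
  intros cQ pQ sQ hQ H1.
  assert (cg := c2_gQ Q cQ). assert (pg := per_gQ Q pQ). assert (sg := gQ_sup Q sQ). assert (hg := gQ_hol Q H hQ).
  assert (M1 := Mg_ge1). assert (cm := Cmu_ge1). assert (bu := BU_pos). assert (kl := KL_pos).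
  assert (E1 := exp_pos 1).
  assert (l1 : 1 <= ln H) by (rewrite <- (ln_exp 1); apply ln_le; [exact E1|exact H1]).
  assert (gl := fun x s Hs => grad_log e L al N He HL Hal (gQ Q) Mg H (-1) x s cg sg hg M1 H1 Hs ltac:(rewrite Rabs_left; lra)).
  assert (ub := fun x s Hs => Ug_bound e L N He HL c0 (gQ Q) cg Mg x s sg Hs).
  assert (vb := fun x s Hs => Vg_bound e L N He HL (gQ Q) cg Mg x s sg Hs).
  assert (usb := fun x s Hs => Ugs_bound e L al N He HL Hal (gQ Q) cg Mg H x s sg hg M1 H1 Hs).
  set (BUm := BU L c0 Mg) in *. set (KLm := KL L al Mg) in *.
  assert (Tm : forall s u K, 0 <= s <= L -> Rabs u <= K -> Rabs (mu s * u) <= Cmu * K).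
  { intros s u K Hs Hu. rewrite Rabs_mult. destruct (mub s Hs) as [q1 q2]. assert (q3 := mu1 s).
    rewrite (Rabs_right (mu s)) by lra. apply Rmult_le_compat; [lra|apply Rabs_pos|lra|exact Hu]. }
  assert (Tm' : forall s u K, 0 <= s <= L -> Rabs u <= K -> Rabs (mu' s * u) <= Cmu * K).
  { intros s u K Hs Hu. rewrite Rabs_mult. destruct (mub s Hs) as [q1 q2].
    apply Rmult_le_compat; auto using Rabs_pos. }
  assert (dom : forall K, K <= KLm * ln H -> Cmu * K <= C2c * ln H).
  { intros K HK. unfold C2c. fold BUm KLm. rewrite Rmult_assoc. apply Rmult_le_compat_l; [lra|]. nra. }
  assert (dom2 : forall K, K <= 3 * Mg + KLm * ln H -> Cmu * BUm + Cmu * K <= C2c * ln H).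
  { intros K HK. unfold C2c. fold BUm KLm. rewrite <- Rmult_plus_distr_l, Rmult_assoc. apply Rmult_le_compat_l; [lra|]. nra. }
  constructor.
  - apply C1_mu, Ug_C1; auto.
  - apply C1_mu, Vg_C1; auto.
  - intros x s Hs. apply is_derive_scal. apply Ug_dx; auto.
  - intros x s Hs. apply is_derive_scal. apply Vg_dx; auto.
  - intros x s. unfold b1. rewrite (per_Ug e L N c0 (gQ Q) pg). reflexivity.
  - intros x s. unfold b2. rewrite (per_Vg e L N (gQ Q) pg). reflexivity.
  - apply Bc_pos.
  - assert (A := C2c_pos). nra.
  - intros x s Hs. split; apply Tm; auto. fold BUm. specialize (vb x s Hs). lra.
  - intros x s Hs. split.
    + eapply Rle_trans; [apply Tm; [exact Hs|apply (proj2 (gl x s Hs))]|]. apply dom. lra.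
    + abs_tri. eapply Rle_trans; [apply Rplus_le_compat|apply dom2, Rle_refl].
      * apply Tm'; auto.
      * apply Tm; auto.
  - intros x s Hs. split.
    + eapply Rle_trans; [apply Tm; [exact Hs|apply (proj1 (gl x s Hs))]|]. apply dom. lra.
    + abs_tri.
      eapply Rle_trans; [apply Rplus_le_compat|apply (dom2 (KLm * ln H)); lra].
      * apply Tm'; auto. specialize (vb x s Hs). lra.
      * apply Tm; auto. rewrite Vgs_E, Rabs_Ropp. apply (proj2 (gl x s Hs)).
  - intros x. unfold b2. rewrite Vg_0. ring.
  - intros x. unfold b2. rewrite Vg_L. ring.
Qed.

Variables (h y0 Ym G0 : R) (K : nat) (Q0 Q0x Q0s : R -> R -> R).
Hypotheses (Hh : 0 < h) (Hy0 : 1 <= y0)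
  (HYm : y0 * (1 + 2 * h * C2c) ^ K <= Ym) (HhY : h * (C2c * Ym) <= / 2)
  (CQ0 : C1 L Q0 Q0x Q0s) (PQ0 : per Q0) (SQ0 : supb L Q0 M0) (HQ0 : hol2 L al Q0 (exp y0))
  (GQ0 : supb L Q0x G0) (GQ0' : supb L Q0s G0).

Definition step (q : (R -> R -> R) * (R -> R -> R) * (R -> R -> R)) :=
  let Q := fst (fst q) in let Qx := snd (fst q) in let Qs := snd q in
  (adv L (b1 Q) (b2 Q) h Q, advx L (b1 Q) (b1x Q) (b2 Q) (b2x Q) h Qx Qs, advs L (b1 Q) (b1s Q) (b2 Q) (b2s Q) h Qx Qs).
Fixpoint traj (k : nat) := match k with O => (Q0, Q0x, Q0s) | S k => step (traj k) end.
Definition Qk k := fst (fst (traj k)).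
Definition Qkx k := snd (fst (traj k)).
Definition Qks k := snd (traj k).
(* exp (yk k) bounds the Hölder constant after k steps: by the logarithmic estimate it is the logarithm
   that grows geometrically. *)
Definition yk k := y0 * (1 + 2 * h * C2c) ^ k.
(** This gradient bound depends on the mollified data and is not uniform along the approximation. It
    enters only through the commutator error, multiplied by h, and h is chosen after the data. *)
Definition Gk k := G0 * (1 + 2 * h * (C2c * Ym)) ^ k.

Lemma yk_bounds k : (k <= K)%nat -> 1 <= yk k <= Ym.
Proof.
  intros Hk. unfold yk. assert (C := C2c_pos). assert (0 < h * C2c) by nra.
  assert (P := pow_R1_Rle (1 + 2 * h * C2c) k ltac:(lra)).
  assert (P2 : (1 + 2 * h * C2c) ^ k <= (1 + 2 * h * C2c) ^ K) by (apply Rle_pow; [lra|exact Hk]).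
  split; [nra|]. eapply Rle_trans; [|exact HYm]. apply Rmult_le_compat_l; lra.
Qed.

Record state (k : nat) : Prop := {
  st_C1 : C1 L (Qk k) (Qkx k) (Qks k);
  st_per : per (Qk k);
  st_sup : supb L (Qk k) M0;
  st_hol : hol2 L al (Qk k) (exp (yk k));
  st_gx : supb L (Qkx k) (Gk k);
  st_gs : supb L (Qks k) (Gk k) }.

Lemma hol2_mono Q H H' : H <= H' -> hol2 L al Q H -> hol2 L al Q H'.
Proof.
  intros Hl HQ x x' y y' d A B C D E. eapply Rle_trans; [apply HQ; eassumption|].
  apply Rmult_le_compat_r; [left; apply Rpower_pos|exact Hl].
Qed.

Lemma exp_mono x y : x <= y -> exp x <= exp y.
Proof. intros [H| ->]; [left; apply exp_increasing, H|lra]. Qed.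

Lemma st_field k : (k <= K)%nat -> state k ->
  gfield L (b1 (Qk k)) (b1x (Qk k)) (b1s (Qk k)) (b2 (Qk k)) (b2x (Qk k)) (b2s (Qk k)) Bc (C2c * yk k).
Proof.
  intros Hk S. destruct (yk_bounds k Hk). replace (yk k) with (ln (exp (yk k))) by apply ln_exp.
  apply field_ok; try apply S.
  apply exp_mono. assumption.
Qed.
Lemma st_field' k : (k <= K)%nat -> state k ->
  gfield L (b1 (Qk k)) (b1x (Qk k)) (b1s (Qk k)) (b2 (Qk k)) (b2x (Qk k)) (b2s (Qk k)) Bc (C2c * Ym).
Proof.
  intros Hk S. apply gfield_mono with (C2c * yk k); [|apply st_field; assumption].
  assert (C := C2c_pos). destruct (yk_bounds k Hk). nra.
Qed.
Lemma hyk k : (k <= K)%nat -> h * (C2c * yk k) <= / 2.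
Proof.
  intros Hk. assert (C := C2c_pos). destruct (yk_bounds k Hk). eapply Rle_trans; [|exact HhY].
  apply Rmult_le_compat_l; [lra|]. apply Rmult_le_compat_l; lra.
Qed.

Lemma states k : (k <= K)%nat -> state k.
Proof.
  induction k as [|k IH]; intros Hk.
  - constructor; auto.
    + unfold yk. simpl. rewrite Rmult_1_r. exact HQ0.
    + unfold Gk. simpl. rewrite Rmult_1_r. exact GQ0.
    + unfold Gk. simpl. rewrite Rmult_1_r. exact GQ0'.
  - assert (Hk' : (k <= K)%nat) by lia. specialize (IH Hk'). assert (F := st_field k Hk' IH).
    assert (hy := hyk k Hk'). destruct (yk_bounds k Hk') as [y1 y2]. assert (C := C2c_pos).
    assert (G0p : 0 <= Gk k) by (eapply Rle_trans; [apply Rabs_pos|apply (st_gx k IH 0 0); lra]).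
    assert (gr := adv_grad L al HL Hal _ _ _ _ _ _ _ _ F h ltac:(lra) hy _ _ _ (st_gx k IH) (st_gs k IH)).
    assert (gm : Gk k * (1 + 2 * h * (C2c * yk k)) <= Gk (S k)).
    { replace (Gk (S k)) with (Gk k * (1 + 2 * h * (C2c * Ym))) by (unfold Gk; simpl; ring).
      apply Rmult_le_compat_l; [exact G0p|]. assert (0 < h * C2c) by nra. nra. }
    constructor.
    + exact (adv_C1 L al HL Hal _ _ _ _ _ _ _ _ F h ltac:(lra) hy _ _ _ (st_C1 k IH)).
    + exact (per_adv L _ _ _ _ _ _ _ _ F h _ (st_per k IH)).
    + exact (adv_sup L al HL Hal _ _ _ _ _ _ _ _ F h ltac:(lra) hy _ _ (st_sup k IH)).
    (* The factor 1 + 2 h C2c yk is at most its exponential, so it adds 2 h C2c yk to the logarithm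
       of the Hölder constant. *)
    + apply hol2_mono with (exp (yk k) * (1 + 2 * h * (C2c * yk k))).
      * replace (yk (S k)) with (yk k + 2 * h * (C2c * yk k)) by (unfold yk; simpl; ring).
        rewrite exp_plus. apply Rmult_le_compat_l; [left; apply exp_pos|apply exp_ge_1p].
      * exact (adv_hol L al HL Hal _ _ _ _ _ _ _ _ F h ltac:(lra) hy _ _ (exp_pos _) (st_hol k IH)).
    + intros x s Hs. eapply Rle_trans; [apply (proj1 gr x s Hs)|exact gm].
    + intros x s Hs. eapply Rle_trans; [apply (proj2 gr x s Hs)|exact gm].
Qed.

Lemma Qk_hol k : (k <= K)%nat -> hol2 L al (Qk k) (exp Ym).
Proof.
  intros Hk. apply hol2_mono with (exp (yk k)); [apply exp_mono, (yk_bounds k Hk)|apply states, Hk].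
Qed.

(** A value after j steps is an earlier value at the composed foot point, displaced by at most j h
    Bc. Spatial Hölder continuity thereby yields continuity in time. *)
Lemma Qk_backtrack j k x s : (k + j <= K)%nat -> 0 <= s <= L -> exists x' s', 0 <= s' <= L /\
  Qk (k + j) x s = Qk k x' s' /\ Rabs (x' - x) <= INR j * (h * Bc) /\ Rabs (s' - s) <= INR j * (h * Bc).
Proof.
  revert x s. induction j as [|j IH]; intros x s Hk Hs.
  - exists x, s. rewrite Nat.add_0_r. repeat split; try lra; simpl; rewrite Rminus_diag, Rabs_R0; lra.
  - assert (Hk' : (k + j <= K)%nat) by lia. assert (F := st_field _ Hk' (states _ Hk')). assert (hy := hyk _ Hk').
    set (X := YX L (b1 (Qk (k + j))) h x s). set (Y := YS L (b2 (Qk (k + j))) h x s).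
    assert (HY : 0 <= Y <= L) by exact (YS_in L al HL Hal _ _ _ _ _ _ _ _ F h ltac:(lra) hy x s).
    destruct (Y_near L _ _ _ _ _ _ _ _ F h ltac:(lra) x s Hs) as [n1 n2]. fold X in n1. fold Y in n2.
    destruct (IH X Y Hk' HY) as [x' [s' [A1 [A2 [A3 A4]]]]].
    exists x', s'. split; [exact A1|]. split.
    + rewrite Nat.add_succ_r. exact A2.
    + rewrite S_INR. split.
      * replace (x' - x) with ((x' - X) + (X - x)) by ring. abs_tri. lra.
      * replace (s' - s) with ((s' - Y) + (Y - s)) by ring. abs_tri. lra.
Qed.

Lemma Qk_time j k x s d : (k + j <= K)%nat -> 0 <= s <= L -> 0 < d -> INR j * (h * Bc) <= d ->
  Rabs (Qk (k + j) x s - Qk k x s) <= exp Ym * Rpower d al.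
Proof.
  intros Hk Hs Hd Hj. destruct (Qk_backtrack j k x s Hk Hs) as [x' [s' [A1 [A2 [A3 A4]]]]].
  rewrite A2. apply (Qk_hol k ltac:(lia)); auto; lra.
Qed.

Definition Fb k := avg L (b1 (Qk k)) (b2 (Qk k)) h (Qk k).
Definition Fbx k := avgx L (b1 (Qk k)) (b1x (Qk k)) (b2 (Qk k)) (b2x (Qk k)) h (Qkx k) (Qks k).
Definition Fbs k := avgs L (b1 (Qk k)) (b1s (Qk k)) (b2 (Qk k)) (b2s (Qk k)) h (Qkx k) (Qks k).

Lemma Fb_C1 k : (k <= K)%nat -> C1 L (Fb k) (Fbx k) (Fbs k).
Proof.
  intros Hk. assert (F := st_field _ Hk (states _ Hk)). assert (hy := hyk _ Hk).
  exact (avg_C1 L al HL Hal _ _ _ _ _ _ _ _ F h Hh hy _ _ _ (st_C1 _ (states _ Hk))).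
Qed.
Lemma Fb_per k : (k <= K)%nat -> per (Fb k).
Proof.
  intros Hk. assert (F := st_field _ Hk (states _ Hk)).
  exact (per_avg L _ _ _ _ _ _ _ _ F h _ (st_per _ (states _ Hk))).
Qed.
Lemma Fb_sup k : (k <= K)%nat -> supb L (Fb k) M0.
Proof.
  intros Hk. assert (F := st_field _ Hk (states _ Hk)). assert (hy := hyk _ Hk).
  exact (avg_sup L al HL Hal _ _ _ _ _ _ _ _ F h Hh hy _ _ _ (st_C1 _ (states _ Hk)) _ (st_sup _ (states _ Hk))).
Qed.
Lemma Fb_hol k : (k <= K)%nat -> hol2 L al (Fb k) (2 * exp Ym).
Proof.
  intros Hk. assert (F := st_field _ Hk (states _ Hk)). assert (hy := hyk _ Hk).
  exact (avg_hol L al HL Hal _ _ _ _ _ _ _ _ F h Hh hy _ _ _ _ (st_C1 _ (states _ Hk)) (exp_pos _) (Qk_hol _ Hk)).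
Qed.
Lemma Fb_near k x s : (k <= K)%nat -> 0 <= s <= L -> Rabs (Fb k x s - Qk k x s) <= exp Ym * Rpower (h * Bc) al.
Proof.
  intros Hk Hs. assert (F := st_field _ Hk (states _ Hk)). assert (hy := hyk _ Hk).
  exact (avg_near L al HL Hal _ _ _ _ _ _ _ _ F h Hh hy _ _ _ _ (st_C1 _ (states _ Hk)) (Qk_hol _ Hk) x s Hs).
Qed.

(** Dividing by mu passes from transport of Q along mu (U, V) to transport by (U, V) for the
    relative vorticity; the planetary term f cancels in the increment. The error uses the last
    gradient bound, so it is the same for all steps. *)
Lemma transport k x s : (S k <= K)%nat -> 0 < s < L ->
  Rabs ((gQ (Qk (S k)) x s - gQ (Qk k) x s) / h
        + (Ug (gQ (Qk k)) x s * Fbx k x s + Vg (gQ (Qk k)) x s * Fbs k x s))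
  <= h * (4 * Bc * (C2c * Ym) * Gk K).
Proof.
  intros Hk Hs. assert (Hk' : (k <= K)%nat) by lia.
  assert (S := states _ Hk'). assert (F := st_field' _ Hk' S).
  assert (Gle : Gk k <= Gk K).
  { unfold Gk. assert (C := C2c_pos). destruct (yk_bounds k Hk'). assert (cy : 0 < C2c * Ym) by (apply Rmult_lt_0_compat; lra).
    assert (0 < h * (C2c * Ym)) by (apply Rmult_lt_0_compat; lra).
    apply Rmult_le_compat_l; [|apply Rle_pow; [lra|exact Hk']].
    eapply Rle_trans; [apply Rabs_pos|apply (GQ0 0 0); lra]. }
  assert (I := adv_increment L al HL Hal _ _ _ _ _ _ _ _ F h Hh HhY _ _ _ _ (st_C1 _ S) (st_gx _ S) (st_gs _ S) x s Hs).
  change (adv L (b1 (Qk k)) (b2 (Qk k)) h (Qk k)) with (Qk (Datatypes.S k)) in I.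
  fold (Fbx k) (Fbs k) in I.
  set (E := (Qk (Datatypes.S k) x s - Qk k x s) / h + (b1 (Qk k) x s * Fbx k x s + b2 (Qk k) x s * Fbs k x s)) in *.
  replace ((gQ (Qk (Datatypes.S k)) x s - gQ (Qk k) x s) / h
        + (Ug (gQ (Qk k)) x s * Fbx k x s + Vg (gQ (Qk k)) x s * Fbs k x s)) with (/ mu s * E).
  2:{ unfold E, b1, b2. assert (m := mu1 s). set (u := Ug (gQ (Qk k)) x s). set (v := Vg (gQ (Qk k)) x s).
      unfold gQ. field. split; lra. }
  rewrite Rabs_mult. destruct (imu_bound s) as [i1 i2]. rewrite (Rabs_right (/ mu s)) by lra.
  assert (P := Rabs_pos E). apply Rle_trans with (Rabs E); [nra|]. eapply Rle_trans; [exact I|].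
  apply Rmult_le_compat_l; [lra|]. apply Rmult_le_compat_l; [|exact Gle].
  assert (C := C2c_pos). assert (B := Bc_pos). destruct (yk_bounds k Hk').
  assert (cy : 0 < C2c * Ym) by (apply Rmult_lt_0_compat; lra). apply Rmult_le_pos; [|lra]. lra.
Qed.
End Scheme.

(** * Ultrafilter limits of equicontinuous families *)

(** The filter of cofinal tails extends to an ultrafilter. Along it every bounded sequence
    converges, so limits are taken at all points of space-time at once, with no extraction of
    subsequences. *)
Lemma ultrafilter_exists : exists G : (nat -> Prop) -> Prop,
  ((forall A B : nat -> Prop, (forall n, A n -> B n) -> G A -> G B) /\
   (forall A B, G A -> G B -> G (fun n => A n /\ B n))) /\
  ~ G (fun _ => False) /\ (forall n0, G (fun n => (n0 <= n)%nat)) /\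
  (forall A, G A \/ G (fun n => ~ A n)).
Proof.
  assert (PF : filter.ProperFilter (fun A : nat -> Prop => exists n0, forall n, (n0 <= n)%nat -> A n)).
  { constructor.
    - intros [n0 H]. exact (H n0 (le_n _)).
    - constructor.
      + exists 0%nat. intros n _. exact I.
      + intros A B [n1 H1] [n2 H2]. exists (max n1 n2). intros n Hn. split; [apply H1|apply H2]; lia.
      + intros A B HAB [n0 H]. exists n0. intros n Hn. apply HAB, H, Hn. }
  destruct (@filter.ultraFilterLemma _ _ PF) as [G [UG HG]].
  assert (PG := filter.ultra_proper (F := G)).
  assert (FG := filter.filter_filter (F := G)).
  destruct FG as [FT FI FS].
  exists G. split; [split|split; [|split]].
  - intros A B HAB HA. exact (FS A B HAB HA).
  - intros A B HA HB. exact (FI A B HA HB).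
  - destruct PG as [NE _]. exact NE.
  - intros n0. apply HG. exists n0. intros n Hn. exact Hn.
  - intros A. exact (filter.in_ultra_setVsetC A UG).
Qed.

Definition ult : (nat -> Prop) -> Prop :=
  proj1_sig (constructive_indefinite_description _ ultrafilter_exists).
Lemma ult_spec :
  ((forall A B : nat -> Prop, (forall n, A n -> B n) -> ult A -> ult B) /\
   (forall A B, ult A -> ult B -> ult (fun n => A n /\ B n))) /\
  ~ ult (fun _ => False) /\ (forall n0, ult (fun n => (n0 <= n)%nat)) /\
  (forall A, ult A \/ ult (fun n => ~ A n)).
Proof. unfold ult. apply proj2_sig. Qed.
Lemma ult_imp (A B : nat -> Prop) : (forall n, A n -> B n) -> ult A -> ult B.
Proof. apply ult_spec. Qed.
Lemma ult_and A B : ult A -> ult B -> ult (fun n => A n /\ B n).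
Proof. apply ult_spec. Qed.
Lemma ult_tail n0 (A : nat -> Prop) : (forall n, (n0 <= n)%nat -> A n) -> ult A.
Proof. intros H. apply ult_imp with (fun n => (n0 <= n)%nat); [exact H|apply ult_spec]. Qed.
Lemma ult_false : ~ ult (fun _ => False).
Proof. apply ult_spec. Qed.
Lemma ult_wit A : ult A -> exists n, A n.
Proof.
  intros H. destruct (classic (exists n, A n)) as [h|h]; [exact h|exfalso].
  apply ult_false. apply ult_imp with (2 := H). intros n Hn. apply h. exists n. exact Hn.
Qed.

Definition ulim (a : nat -> R) (l : R) := forall eps, 0 < eps -> ult (fun n => Rabs (a n - l) < eps).

Lemma ulim_unique a l l' : ulim a l -> ulim a l' -> l = l'.
Proof.
  intros H H'. destruct (Req_dec l l') as [h|h]; [exact h|exfalso].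
  assert (P : 0 < Rabs (l - l')) by (apply Rabs_pos_lt; lra).
  destruct (ult_wit _ (ult_and _ _ (H (Rabs (l - l') / 2) ltac:(lra)) (H' (Rabs (l - l') / 2) ltac:(lra)))) as [n [A B]].
  assert (Rabs (l - l') < Rabs (l - l')); [|lra].
  replace (l - l') with ((a n - l') - (a n - l)) at 1 by ring.
  unfold Rminus at 1. eapply Rle_lt_trans; [apply Rabs_triang|]. rewrite Rabs_Ropp. lra.
Qed.

Definition ebd (a : nat -> R) := exists M n0, forall n, (n0 <= n)%nat -> Rabs (a n) <= M.

(** The limit is the supremum of the x with x <= a n for almost all n. The dichotomy of the
    ultrafilter is what makes the terms eventually smaller than any larger number. *)
Lemma ulim_exists a : ebd a -> exists l, ulim a l.
Proof.
  intros [M [n0 HM]].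
  set (E := fun x => ult (fun n => x <= a n)).
  destruct (completeness E) as [l [L1 L2]].
  - exists M. intros x Hx. destruct (ult_wit _ (ult_and _ _ Hx (ult_tail n0 (fun n => Rabs (a n) <= M) HM))) as [n [A B]].
    apply Rle_trans with (a n); [exact A|]. eapply Rle_trans; [apply Rle_abs|exact B].
  - exists (- M). apply (ult_tail n0). intros n Hn. specialize (HM n Hn).
    assert (K := Rle_abs (- a n)). rewrite Rabs_Ropp in K. lra.
  - exists l. intros eps He.
    assert (A1 : ult (fun n => l - eps / 2 <= a n)).
    { destruct (classic (ult (fun n => l - eps / 2 <= a n))) as [h|h]; [exact h|exfalso].
      assert (l <= l - eps / 2); [|lra]. apply L2. intros x Hx.
      destruct (Rle_dec x (l - eps / 2)) as [q|q]; [exact q|exfalso]. apply h.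
      apply ult_imp with (2 := Hx). intros n Hn. lra. }
    assert (A2 : ult (fun n => ~ (l + eps / 2 <= a n))).
    { destruct (proj2 (proj2 (proj2 ult_spec)) (fun n => l + eps / 2 <= a n)) as [h|h]; [exfalso|exact h].
      specialize (L1 _ h). lra. }
    apply ult_imp with (2 := ult_and _ _ A1 A2). intros n [H1 H2]. apply Rabs_def1; lra.
Qed.

Definition UL (a : nat -> R) : R := epsilon (inhabits 0) (ulim a).
Lemma UL_spec a : ebd a -> ulim a (UL a).
Proof. intros H. unfold UL. apply epsilon_spec. apply ulim_exists, H. Qed.
Lemma UL_eq a l : ulim a l -> UL a = l.
Proof. intros H. apply ulim_unique with a; [|exact H]. unfold UL. apply epsilon_spec. exists l. exact H. Qed.

Lemma ulim_const c : ulim (fun _ => c) c.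
Proof. intros eps He. apply (ult_tail 0). intros n _. rewrite Rminus_diag, Rabs_R0. exact He. Qed.
Lemma ulim_plus a b l l' : ulim a l -> ulim b l' -> ulim (fun n => a n + b n) (l + l').
Proof.
  intros H H' eps He. apply ult_imp with (2 := ult_and _ _ (H (eps / 2) ltac:(lra)) (H' (eps / 2) ltac:(lra))).
  intros n [A B]. replace (a n + b n - (l + l')) with ((a n - l) + (b n - l')) by ring.
  eapply Rle_lt_trans; [apply Rabs_triang|]. lra.
Qed.
Lemma ulim_scal c a l : ulim a l -> ulim (fun n => c * a n) (c * l).
Proof.
  intros H eps He. assert (P := Rabs_pos c).
  assert (Q : 0 < eps / (Rabs c + 1)) by (apply Rdiv_lt_0_compat; lra).
  apply ult_imp with (2 := H _ Q). intros n A.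
  rewrite <- Rmult_minus_distr_l, Rabs_mult.
  apply Rle_lt_trans with ((Rabs c) * (eps / (Rabs c + 1))); [apply Rmult_le_compat_l; lra|].
  apply Rmult_lt_reg_r with (Rabs c + 1); [lra|]. field_simplify; lra.
Qed.
Lemma ulim_opp a l : ulim a l -> ulim (fun n => - a n) (- l).
Proof.
  intros H eps He. apply ult_imp with (2 := H eps He). intros n A.
  replace (- a n - - l) with (- (a n - l)) by ring. rewrite Rabs_Ropp. exact A.
Qed.
Lemma ulim_minus a b l l' : ulim a l -> ulim b l' -> ulim (fun n => a n - b n) (l - l').
Proof. intros H H'. apply (ulim_plus a (fun n => - b n) l (- l')); [exact H|apply ulim_opp, H']. Qed.
Lemma ulim_mult a b l l' : ulim a l -> ulim b l' -> ulim (fun n => a n * b n) (l * l').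
Proof.
  intros H H' eps He. assert (P := Rabs_pos l). assert (P' := Rabs_pos l').
  set (c := Rabs l + Rabs l' + 1). set (ep := Rmin 1 (eps / (2 * c))).
  assert (Q : 0 < eps / (2 * c)) by (apply Rdiv_lt_0_compat; unfold c; lra).
  assert (Ep : 0 < ep) by (apply Rmin_pos; lra). assert (Ep1 : ep <= 1) by apply Rmin_l.
  assert (Ep2 : ep * (2 * c) <= eps).
  { apply Rle_trans with (eps / (2 * c) * (2 * c)); [apply Rmult_le_compat_r; [unfold c; lra|apply Rmin_r]|].
    apply Req_le. field. unfold c. lra. }
  apply ult_imp with (2 := ult_and _ _ (H ep Ep) (H' ep Ep)). intros n [A B].
  replace (a n * b n - l * l') with ((a n - l) * (b n - l') + (l * (b n - l') + l' * (a n - l))) by ring.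
  eapply Rle_lt_trans; [apply Rabs_triang|].
  eapply Rle_lt_trans; [apply Rplus_le_compat_l, Rabs_triang|]. rewrite !Rabs_mult.
  assert (A0 := Rabs_pos (a n - l)). assert (B0 := Rabs_pos (b n - l')).
  assert (T1 : Rabs (a n - l) * Rabs (b n - l') <= ep * 1) by (apply Rmult_le_compat; lra).
  assert (T2 : Rabs l * Rabs (b n - l') <= Rabs l * ep) by (apply Rmult_le_compat_l; lra).
  assert (T3 : Rabs l' * Rabs (a n - l) <= Rabs l' * ep) by (apply Rmult_le_compat_l; lra).
  unfold c in Ep2. nra.
Qed.
Definition small (a : nat -> R) := forall eps, 0 < eps -> exists n0, forall n, (n0 <= n)%nat -> Rabs (a n) <= eps.
Lemma ulim_le a l c : ulim a l -> (forall eps, 0 < eps -> exists n0, forall n, (n0 <= n)%nat -> Rabs (a n) <= c + eps) -> Rabs l <= c.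
Proof.
  intros H Hb. apply Rnot_lt_le. intros Hc.
  set (ep := (Rabs l - c) / 3). assert (Ep : 0 < ep) by (unfold ep; lra).
  destruct (Hb ep Ep) as [n0 Hn].
  destruct (ult_wit _ (ult_and _ _ (H ep Ep) (ult_tail n0 (fun n => Rabs (a n) <= c + ep) Hn))) as [n [A B]].
  assert (Rabs l <= Rabs (a n) + Rabs (a n - l)).
  { replace l with (a n - (a n - l)) at 1 by ring. unfold Rminus at 1.
    abs_tri. rewrite Rabs_Ropp. lra. }
  unfold ep in *. lra.
Qed.

Section Families.
Variables L T : R.
Hypotheses (HL : 0 < L) (HT : 0 < T).
Definition fam := nat -> R -> R -> R -> R.
Implicit Types f g : fam.
Definition dom s t := 0 <= s <= L /\ 0 <= t <= T.

(* Equicontinuity, boundedness and smallness are only required for large n, since the interpolants jump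
   by an amount that vanishes with the time step. *)
Definition EC f := forall eta, 0 < eta -> exists d n0, 0 < d /\ forall n x s t x' s' t', (n0 <= n)%nat ->
  dom s t -> dom s' t' -> Rabs (x - x') <= d -> Rabs (s - s') <= d -> Rabs (t - t') <= d ->
  Rabs (f n x s t - f n x' s' t') <= eta.
Definition BD f := exists M n0, 0 < M /\ forall n x s t, (n0 <= n)%nat -> dom s t -> Rabs (f n x s t) <= M.
Definition SM f := forall eta, 0 < eta -> exists n0, forall n x s t, (n0 <= n)%nat -> dom s t -> Rabs (f n x s t) <= eta.
Definition Lf f (x s t : R) : R := UL (fun n => f n x s t).

Lemma BD_ebd f x s t : BD f -> dom s t -> ebd (fun n => f n x s t).
Proof. intros [M [n0 [_ H]]] Hd. exists M, n0. intros n Hn. apply H; assumption. Qed.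
Lemma Lf_spec f x s t : BD f -> dom s t -> ulim (fun n => f n x s t) (Lf f x s t).
Proof. intros H Hd. apply UL_spec. apply BD_ebd; assumption. Qed.

Lemma SM_BD f : SM f -> BD f.
Proof. intros H. destruct (H 1 Rlt_0_1) as [n0 Hn]. exists 1, n0. split; [lra|exact Hn]. Qed.
Lemma SM_EC f : SM f -> EC f.
Proof.
  intros H eta He. destruct (H (eta / 2) ltac:(lra)) as [n0 Hn]. exists 1, n0. split; [lra|].
  intros n x s t x' s' t' h D D' _ _ _. unfold Rminus. abs_tri. rewrite Rabs_Ropp.
  assert (A := Hn n x s t h D). assert (B := Hn n x' s' t' h D'). lra.
Qed.
Lemma BD_plus f g : BD f -> BD g -> BD (fun n x s t => f n x s t + g n x s t).
Proof.
  intros [M [n0 [P H]]] [M' [n0' [P' H']]]. exists (M + M'), (max n0 n0'). split; [lra|]. intros n x s t Hn D.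
  abs_tri. apply Rplus_le_compat; [apply H|apply H']; auto; lia.
Qed.
Lemma BD_scal c f : BD f -> BD (fun n x s t => c * f n x s t).
Proof.
  intros [M [n0 [P H]]]. exists ((Rabs c + 1) * M), n0. assert (K := Rabs_pos c). split; [nra|]. intros n x s t Hn D.
  rewrite Rabs_mult. apply Rmult_le_compat; auto using Rabs_pos. lra.
Qed.
Lemma BD_mult f g : BD f -> BD g -> BD (fun n x s t => f n x s t * g n x s t).
Proof.
  intros [M [n0 [P H]]] [M' [n0' [P' H']]]. exists (M * M'), (max n0 n0'). split; [nra|]. intros n x s t Hn D.
  rewrite Rabs_mult. apply Rmult_le_compat; auto using Rabs_pos; [apply H|apply H']; auto; lia.
Qed.
Lemma EC_plus f g : EC f -> EC g -> EC (fun n x s t => f n x s t + g n x s t).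
Proof.
  intros H H' eta He. destruct (H (eta / 2) ltac:(lra)) as [d [n0 [P A]]]. destruct (H' (eta / 2) ltac:(lra)) as [d' [n0' [P' A']]].
  exists (Rmin d d'), (max n0 n0'). split; [apply Rmin_pos; assumption|].
  intros n x s t x' s' t' Hn D D' Hx Hs Ht. assert (m1 := Rmin_l d d'). assert (m2 := Rmin_r d d').
  replace (f n x s t + g n x s t - (f n x' s' t' + g n x' s' t')) with
    ((f n x s t - f n x' s' t') + (g n x s t - g n x' s' t')) by ring.
  abs_tri.
  assert (B := A n x s t x' s' t' ltac:(lia) D D' ltac:(lra) ltac:(lra) ltac:(lra)).
  assert (B' := A' n x s t x' s' t' ltac:(lia) D D' ltac:(lra) ltac:(lra) ltac:(lra)). lra.
Qed.
Lemma EC_mult f g : EC f -> EC g -> BD f -> BD g -> EC (fun n x s t => f n x s t * g n x s t).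
Proof.
  intros H H' [M [m0 [HM BM]]] [M' [m0' [HM' BM']]] eta He.
  assert (P1 : 0 < eta / (2 * M')) by (apply Rdiv_lt_0_compat; lra).
  assert (P2 : 0 < eta / (2 * M)) by (apply Rdiv_lt_0_compat; lra).
  destruct (H _ P1) as [d [n0 [P A]]]. destruct (H' _ P2) as [d' [n0' [P' A']]].
  exists (Rmin d d'), (max (max n0 n0') (max m0 m0')). split; [apply Rmin_pos; assumption|].
  intros n x s t x' s' t' Hn D D' Hx Hs Ht. assert (m1 := Rmin_l d d'). assert (m2 := Rmin_r d d').
  replace (f n x s t * g n x s t - f n x' s' t' * g n x' s' t') with
    ((f n x s t - f n x' s' t') * g n x s t + f n x' s' t' * (g n x s t - g n x' s' t')) by ring.
  abs_tri. rewrite !Rabs_mult.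
  assert (B := A n x s t x' s' t' ltac:(lia) D D' ltac:(lra) ltac:(lra) ltac:(lra)).
  assert (B' := A' n x s t x' s' t' ltac:(lia) D D' ltac:(lra) ltac:(lra) ltac:(lra)).
  assert (C := BM n x' s' t' ltac:(lia) D'). assert (C' := BM' n x s t ltac:(lia) D).
  assert (K1 := Rmult_le_compat _ _ _ _ (Rabs_pos _) (Rabs_pos _) B C').
  assert (K2 := Rmult_le_compat _ _ _ _ (Rabs_pos _) (Rabs_pos _) C B').
  replace (eta / (2 * M') * M') with (eta / 2) in K1 by (field; lra).
  replace (M * (eta / (2 * M))) with (eta / 2) in K2 by (field; lra). lra.
Qed.
Lemma EC_scal c f : EC f -> EC (fun n x s t => c * f n x s t).
Proof.
  intros H eta He. assert (K := Rabs_pos c). assert (P : 0 < eta / (Rabs c + 1)) by (apply Rdiv_lt_0_compat; lra).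
  destruct (H _ P) as [d [n0 [Hd A]]]. exists d, n0. split; [exact Hd|].
  intros n x s t x' s' t' Hn D D' Hx Hs Ht. rewrite <- Rmult_minus_distr_l, Rabs_mult.
  assert (B := A n x s t x' s' t' Hn D D' Hx Hs Ht).
  apply Rle_trans with (Rabs c * (eta / (Rabs c + 1))); [apply Rmult_le_compat_l; lra|].
  apply Rmult_le_reg_r with (Rabs c + 1); [lra|]. field_simplify; nra.
Qed.

Lemma Lf_cont f : EC f -> BD f -> forall eta, 0 < eta -> exists d, 0 < d /\ forall x s t x' s' t',
  dom s t -> dom s' t' -> Rabs (x - x') <= d -> Rabs (s - s') <= d -> Rabs (t - t') <= d ->
  Rabs (Lf f x s t - Lf f x' s' t') <= eta.
Proof.
  intros H HB eta He. destruct (H eta He) as [d [n0 [Hd A]]]. exists d. split; [exact Hd|].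
  intros x s t x' s' t' D D' Hx Hs Ht.
  apply (ulim_le _ _ eta (ulim_minus _ _ _ _ (Lf_spec f x s t HB D) (Lf_spec f x' s' t' HB D'))).
  intros eps Hep. exists n0. intros n Hn. assert (B := A n x s t x' s' t' Hn D D' Hx Hs Ht). lra.
Qed.

Lemma lin_bound a b c (fn fn' gn : nat -> R) l l' lg : ulim fn l -> ulim fn' l' -> ulim gn lg ->
  (forall eps, 0 < eps -> exists n0, forall n, (n0 <= n)%nat -> Rabs (fn' n - fn n - (b - a) * gn n) <= c + eps) ->
  Rabs (l' - l - (b - a) * lg) <= c.
Proof.
  intros H H' Hg B. apply (ulim_le (fun n => fn' n - fn n - (b - a) * gn n)); [|exact B].
  apply ulim_minus; [apply ulim_minus; assumption|]. apply ulim_scal, Hg.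
Qed.

(** By the mean value theorem the difference quotients of the approximations differ from g by its
    oscillation, which is asymptotically uniform in n; so differentiation commutes with a merely
    pointwise limit. *)
Lemma Lf_dx f g x s t : BD f -> BD g -> EC g -> dom s t ->
  (forall n x, is_derive (fun x => f n x s t) x (g n x s t)) ->
  is_derive (fun x => Lf f x s t) x (Lf g x s t).
Proof.
  intros Bf Bg Eg D Df. apply is_derive_eps. intros eps He.
  destruct (Eg eps He) as [d [n0 [Hd A]]]. exists d. split; [exact Hd|]. intros y Hy.
  apply (lin_bound x y _ _ _ _ _ _ _ (Lf_spec f x s t Bf D) (Lf_spec f y s t Bf D) (Lf_spec g x s t Bg D)).
  intros ep Hep. exists n0. intros n Hn.
  destruct (MVT_abs (fun x => f n x s t) (fun x => g n x s t) x y) as [c [Hc E]]; [intros; apply Df|].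
  rewrite E. replace (g n c s t * (y - x) - (y - x) * g n x s t) with ((g n c s t - g n x s t) * (y - x)) by ring.
  rewrite Rabs_mult.
  assert (B : Rabs (g n c s t - g n x s t) <= eps).
  { apply A; auto; try (rewrite Rminus_diag, Rabs_R0; lra).
    revert Hc Hy. unfold Rmin, Rmax, Rabs. destruct (Rle_dec _ _), (Rcase_abs _), (Rcase_abs _); lra. }
  assert (K := Rmult_le_compat_r _ _ _ (Rabs_pos (y - x)) B). lra.
Qed.

Lemma Lf_ds f g x s t : BD f -> BD g -> EC g -> 0 < s < L -> 0 <= t <= T ->
  (forall n s, 0 < s < L -> is_derive (fun s => f n x s t) s (g n x s t)) ->
  is_derive (fun s => Lf f x s t) s (Lf g x s t).
Proof.
  intros Bf Bg Eg Hs Ht Df. apply is_derive_eps. intros eps He.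
  destruct (Eg eps He) as [d [n0 [Hd A]]].
  set (r := Rmin d (Rmin s (L - s))). assert (Hr : 0 < r) by (repeat apply Rmin_pos; lra).
  assert (r1 : r <= d) by apply Rmin_l.
  assert (r2 : r <= s) by (eapply Rle_trans; [apply Rmin_r|apply Rmin_l]).
  assert (r3 : r <= L - s) by (eapply Rle_trans; [apply Rmin_r|apply Rmin_r]).
  exists r. split; [exact Hr|]. intros y Hy.
  assert (yL : 0 < y < L) by (apply Rabs_def2 in Hy; lra).
  assert (bt : forall z, Rmin s y <= z <= Rmax s y -> Rabs (z - s) <= d /\ 0 < z < L).
  { intros z Hz. split.
    - assert (Rabs (z - s) <= Rabs (y - s)); [|lra].
      revert Hz. unfold Rmin, Rmax, Rabs. destruct (Rle_dec _ _), (Rcase_abs _), (Rcase_abs _); lra.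
    - revert Hz. unfold Rmin, Rmax. destruct (Rle_dec _ _); lra. }
  assert (D : dom s t) by (split; lra). assert (D' : dom y t) by (split; lra).
  apply (lin_bound s y _ _ _ _ _ _ _ (Lf_spec f x s t Bf D) (Lf_spec f x y t Bf D') (Lf_spec g x s t Bg D)).
  intros ep Hep. exists n0. intros n Hn.
  destruct (MVT_abs (fun s => f n x s t) (fun s => g n x s t) s y) as [c [Hc E]]; [intros z Hz; apply Df, bt, Hz|].
  rewrite E. replace (g n x c t * (y - s) - (y - s) * g n x s t) with ((g n x c t - g n x s t) * (y - s)) by ring.
  rewrite Rabs_mult. destruct (bt c Hc) as [q1 q2].
  assert (B : Rabs (g n x c t - g n x s t) <= eps).
  { apply A; auto; try (rewrite Rminus_diag, Rabs_R0; lra). split; lra. }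
  assert (K := Rmult_le_compat_r _ _ _ (Rabs_pos (y - s)) B). lra.
Qed.

(** The approximations are piecewise constant in time, so the hypothesis is a difference inequality
    with an additive error eps that may be reached only for large n. *)
Lemma Lf_dt f g x s t : BD f -> BD g -> 0 <= s <= L -> 0 < t < T ->
  (forall eta, 0 < eta -> exists d, 0 < d /\ forall t', Rabs (t' - t) < d -> 0 <= t' <= T -> forall eps, 0 < eps ->
     exists n0, forall n, (n0 <= n)%nat -> Rabs (f n x s t' - f n x s t - (t' - t) * g n x s t) <= eta * Rabs (t' - t) + eps) ->
  is_derive (fun t => Lf f x s t) t (Lf g x s t).
Proof.
  intros Bf Bg Hs Ht Df. apply is_derive_eps. intros eps He.
  destruct (Df eps He) as [d [Hd A]].
  set (r := Rmin d (Rmin t (T - t))). assert (Hr : 0 < r) by (repeat apply Rmin_pos; lra).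
  assert (r1 : r <= d) by apply Rmin_l.
  assert (r2 : r <= t) by (eapply Rle_trans; [apply Rmin_r|apply Rmin_l]).
  assert (r3 : r <= T - t) by (eapply Rle_trans; [apply Rmin_r|apply Rmin_r]).
  exists r. split; [exact Hr|]. intros y Hy.
  assert (yT : 0 <= y <= T) by (apply Rabs_def2 in Hy; lra).
  assert (D : dom s t) by (split; lra). assert (D' : dom s y) by (split; lra).
  apply (lin_bound t y _ _ _ _ _ _ _ (Lf_spec f x s t Bf D) (Lf_spec f x s y Bf D') (Lf_spec g x s t Bg D)).
  apply A; [lra|exact yT].
Qed.

(* The derivative in phi is recovered from difference quotients, whose dependence on (s, t) is controlled. *)
Lemma EC_deriv f g : EC f ->
  (forall n x s t, dom s t -> is_derive (fun x => f n x s t) x (g n x s t)) ->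
  (forall eta, 0 < eta -> exists d, 0 < d /\ forall n x x' s t, dom s t -> Rabs (x - x') <= d ->
     Rabs (g n x s t - g n x' s t) <= eta) -> EC g.
Proof.
  intros Ef Df Hx eta He. destruct (Hx (eta / 5) ltac:(lra)) as [d [Hd A]].
  (* Five errors of eta / 5: two for replacing difference quotients by derivatives, two for the
     change of (s, t) in the quotient, one for the change of x. *)
  assert (Hr : 0 < eta / 5 * d) by nra.
  destruct (Ef _ Hr) as [d' [n0 [Hd' B]]].
  exists (Rmin d d'), n0. split; [apply Rmin_pos; assumption|].
  intros n x s t x' s' t' Hn D D' Kx Ks Kt. assert (m1 := Rmin_l d d'). assert (m2 := Rmin_r d d').
  assert (Q : forall s t, dom s t -> Rabs ((f n (x + d) s t - f n x s t) - d * g n x s t) <= d * (eta / 5)).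
  { intros s0 t0 D0. destruct (MVT_abs (fun x => f n x s0 t0) (fun x => g n x s0 t0) x (x + d)) as [c [Hc E]]; [intros; apply Df, D0|].
    rewrite E. replace (g n c s0 t0 * (x + d - x) - d * g n x s0 t0) with (d * (g n c s0 t0 - g n x s0 t0)) by ring.
    rewrite Rabs_mult, (Rabs_right d) by lra. apply Rmult_le_compat_l; [lra|]. apply A; [exact D0|].
    rewrite Rmin_left, Rmax_right in Hc by lra. apply Rabs_le. lra. }
  assert (Q1 := Q s t D). assert (Q2 := Q s' t' D').
  assert (C1 := B n (x + d) s t (x + d) s' t' Hn D D' ltac:(rewrite Rminus_diag, Rabs_R0; lra) ltac:(lra) ltac:(lra)).
  assert (C2 := B n x s t x s' t' Hn D D' ltac:(rewrite Rminus_diag, Rabs_R0; lra) ltac:(lra) ltac:(lra)).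
  assert (E2 := A n x x' s' t' D' ltac:(lra)).
  assert (F : Rabs (d * (g n x s t - g n x s' t')) <= d * (4 * (eta / 5))).
  { apply Rabs_le. apply Rabs_le_between in Q1. apply Rabs_le_between in Q2. apply Rabs_le_between in C1. apply Rabs_le_between in C2. lra. }
  rewrite Rabs_mult, (Rabs_right d) in F by lra. apply Rmult_le_reg_l in F; [|exact Hd].
  replace (g n x s t - g n x' s' t') with ((g n x s t - g n x s' t') + (g n x s' t' - g n x' s' t')) by ring.
  abs_tri. lra.
Qed.
End Families.

Lemma Rpower_small c r eta : 0 < c -> 0 < r -> 0 < eta -> exists d, 0 < d /\ c * Rpower d r <= eta.
Proof.
  intros Hc Hr He. exists (Rpower (eta / c) (/ r)). split; [apply Rpower_pos|].
  rewrite Rpower_mult. replace (/ r * r) with 1 by (field; lra).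
  rewrite Rpower_1 by (apply Rdiv_lt_0_compat; lra). apply Req_le. field. lra.
Qed.

(** * Equicontinuity of the velocity operators along a family of densities *)

Section DensityFamily.
Variables (L T al : R) (en : nat -> R) (Nn : nat -> nat) (g : fam) (M H : R).
Hypotheses (HL : 0 < L) (HT : 0 < T) (Hal : 0 < al < 1).
Hypothesis Hen : forall n, 0 < en n <= 1.
Hypotheses (cg : forall n t, 0 <= t <= T -> c2 (fun x s => g n x s t))
  (pg : forall n t, 0 <= t <= T -> per (fun x s => g n x s t))
  (sg : forall n t, 0 <= t <= T -> supb L (fun x s => g n x s t) M)
  (hg : forall n t, 0 <= t <= T -> holx L al (fun x s => g n x s t) H)
  (HM : 0 < M) (HH : 0 < H).
Hypothesis tg : forall eta, 0 < eta -> exists d n0, 0 < d /\ forall n x s t t', (n0 <= n)%nat ->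
  dom L T s t -> dom L T s t' -> Rabs (t - t') <= d -> Rabs (g n x s t - g n x s t') <= eta.

Definition VF tau : fam := fun n x s t => Vop (en n) L (Nn n) tau (fun x s => g n x s t) x s.
Definition UF tau : fam := fun n x s t => Uop (en n) L (Nn n) tau (fun x s => g n x s t) x s.
Definition VF' tau : fam := fun n x s t => Vop' (en n) L (Nn n) tau (fun x s => g n x s t) x s.
Definition UF' tau : fam := fun n x s t => Uop' (en n) L (Nn n) tau (fun x s => g n x s t) x s.
Definition ZF : fam := fun n x s t => Zop (en n) L (Nn n) (fun x s => g n x s t) x s.
Definition MF : fam := fun n x s t => mean (fun x s => g n x s t) s.

Variable tau : R.
Hypothesis Htau : Rabs tau <= 1.

Definition KB := K1 L al * H / al.
Lemma KB_pos : 0 < KB.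
Proof. unfold KB. assert (P := K1_pos L al HL Hal). apply Rdiv_lt_0_compat; [nra|lra]. Qed.

Lemma grad_bounds n x s t : dom L T s t -> Rabs (VF' tau n x s t) <= KB /\ Rabs (UF' tau n x s t) <= KB.
Proof.
  intros [Hs Ht].
  assert (B : forall y z d, 0 < z < L -> 0 < d -> Rabs y <= d -> Rabs (g n (x - y) z t - g n x z t) <= H * Rpower d al).
  { intros y z d Hz Hd Hy. apply (hg n t Ht (x - y) x z d); [lra|exact Hd|].
    replace (x - y - x) with (- y) by ring. rewrite Rabs_Ropp. exact Hy. }
  split.
  - apply (Vop'_bound (en n) L (Nn n) (Hen n) HL al tau (fun x s => g n x s t) H al); auto; lra.
  - apply (Uop'_bound (en n) L (Nn n) (Hen n) HL al tau (fun x s => g n x s t) H al); auto; lra.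
Qed.

Lemma BD_VF : BD L T (VF tau).
Proof.
  exists (K0 L * M + 1), 0%nat.
  assert (P : 0 < K0 L) by (unfold K0; assert (C := C0_pos L HL); repeat apply Rmult_lt_0_compat; lra).
  split; [nra|]. intros n x s t _ [Hs Ht].
  apply Rle_trans with (K0 L * M); [|lra]. apply (Vop_bound (en n) L (Nn n)); auto. intros y z Hz. apply (sg n t Ht y z). lra.
Qed.
Lemma BD_UF : BD L T (UF tau).
Proof.
  exists (K0 L * M + 1), 0%nat.
  assert (P : 0 < K0 L) by (unfold K0; assert (C := C0_pos L HL); repeat apply Rmult_lt_0_compat; lra).
  split; [nra|]. intros n x s t _ [Hs Ht].
  apply Rle_trans with (K0 L * M); [|lra]. apply (Uop_bound (en n) L (Nn n)); auto. intros y z Hz. apply (sg n t Ht y z). lra.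
Qed.
Lemma BD_VF' : BD L T (VF' tau).
Proof. exists KB, 0%nat. split; [apply KB_pos|]. intros n x s t _ D. apply grad_bounds, D. Qed.
Lemma BD_UF' : BD L T (UF' tau).
Proof. exists KB, 0%nat. split; [apply KB_pos|]. intros n x s t _ D. apply grad_bounds, D. Qed.

Lemma EC_of_lip (f : fam) Lam : 0 < Lam ->
  (forall n t x x' s s', 0 <= t <= T -> 0 <= s <= L -> 0 <= s' <= L ->
     Rabs (f n x s t - f n x' s' t) <= Lam * (Rabs (x - x') + Rabs (s - s'))) ->
  (forall eta, 0 < eta -> exists d n0, 0 < d /\ forall n x s t t', (n0 <= n)%nat ->
     dom L T s t -> dom L T s t' -> Rabs (t - t') <= d -> Rabs (f n x s t - f n x s t') <= eta) ->
  EC L T f.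
Proof.
  intros HLm Hl Ht eta He. destruct (Ht (eta / 2) ltac:(lra)) as [d [n0 [Hd A]]].
  assert (P : 0 < eta / (4 * Lam)) by (apply Rdiv_lt_0_compat; lra).
  exists (Rmin d (eta / (4 * Lam))), n0. split; [apply Rmin_pos; assumption|].
  intros n x s t x' s' t' Hn D D' Kx Ks Kt.
  assert (m1 := Rmin_l d (eta / (4 * Lam))). assert (m2 := Rmin_r d (eta / (4 * Lam))).
  replace (f n x s t - f n x' s' t') with ((f n x s t - f n x' s' t) + (f n x' s' t - f n x' s' t')) by ring.
  abs_tri.
  assert (B := Hl n t x x' s s' (proj2 D) (proj1 D) (proj1 D')).
  assert (D1 : dom L T s' t) by (split; [apply D'|apply D]).
  assert (C := A n x' s' t t' Hn D1 D' ltac:(lra)).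
  assert (E : Lam * (Rabs (x - x') + Rabs (s - s')) <= Lam * (2 * (eta / (4 * Lam)))) by (apply Rmult_le_compat_l; lra).
  replace (Lam * (2 * (eta / (4 * Lam)))) with (eta / 2) in E by (field; lra). lra.
Qed.

(** A linear operator of norm at most [K0 L] transfers the time modulus of the densities to their
    images. *)
Lemma time_op (op : nat -> (R -> R -> R) -> R -> R -> R) :
  (forall n u v x s, c2 u -> c2 v -> 0 <= s <= L -> op n (fun x s => u x s - v x s) x s = op n u x s - op n v x s) ->
  (forall n u K x s, c2 u -> 0 <= s <= L -> (forall y z, 0 < z < L -> Rabs (u y z) <= K) -> Rabs (op n u x s) <= K0 L * K) ->
  forall eta, 0 < eta -> exists d n0, 0 < d /\ forall n x s t t', (n0 <= n)%nat ->
     dom L T s t -> dom L T s t' -> Rabs (t - t') <= d ->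
     Rabs (op n (fun x s => g n x s t) x s - op n (fun x s => g n x s t') x s) <= eta.
Proof.
  intros Hm Hb eta He.
  assert (P : 0 < K0 L) by (unfold K0; assert (C := C0_pos L HL); repeat apply Rmult_lt_0_compat; lra).
  assert (Q : 0 < eta / K0 L) by (apply Rdiv_lt_0_compat; assumption).
  destruct (tg _ Q) as [d [n0 [Hd A]]]. exists d, n0. split; [exact Hd|].
  intros n x s t t' Hn [Hs Ht] [_ Ht'] K. rewrite <- Hm by auto.
  replace eta with (K0 L * (eta / K0 L)) by (field; lra).
  apply Hb; [|exact Hs|].
  - apply (cont_minus (U := RU2)); [apply (cg n t Ht)|apply (cg n t' Ht')].
  - intros y z Hz. apply A; auto; split; auto; lra.
Qed.

Lemma EC_VF : EC L T (VF tau).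
Proof.
  assert (kb := KB_pos). apply EC_of_lip with KB; [exact kb| |].
  - intros n t x x' s s' Ht Hs Hs'.
    apply (lip_strip L (fun x s => VF tau n x s t) (fun x s => VF' tau n x s t) (fun x s => - UF' tau n x s t)); auto.
    + apply (c2_Vop (en n) L (Nn n) (Hen n) HL _ (cg n t Ht)).
    + intros y z Hz. apply (Vop_dphi (en n) L (Nn n) (Hen n) HL _ (cg n t Ht) (pg n t Ht)), Hz.
    + intros y z Hz. apply (Vop_ds (en n) L (Nn n) (Hen n) HL _ (cg n t Ht)), Hz.
    + intros y z Hz. apply grad_bounds. split; auto.
    + intros y z Hz. rewrite Rabs_Ropp. apply grad_bounds. split; auto.
  - apply (time_op (fun n u => Vop (en n) L (Nn n) tau u)).
    + intros n u v x s Hu Hv Hs. apply (opconv_minus L HL); auto using c2_jq.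
    + intros n u K x s Hu Hs HK. apply (Vop_bound (en n) L (Nn n)); auto.
Qed.
Lemma EC_UF : EC L T (UF tau).
Proof.
  assert (kb := KB_pos). apply EC_of_lip with (KB + 2 * M); [lra| |].
  - intros n t x x' s s' Ht Hs Hs'.
    apply (lip_strip L (fun x s => UF tau n x s t) (fun x s => UF' tau n x s t) (fun x s => VF' tau n x s t - ZF n x s t)); auto.
    + apply (c2_Uop (en n) L (Nn n) (Hen n) HL _ (cg n t Ht)).
    + intros y z Hz. apply (Uop_dphi (en n) L (Nn n) (Hen n) HL _ (cg n t Ht) (pg n t Ht)), Hz.
    + intros y z Hz. apply (Uop_ds (en n) L (Nn n) (Hen n) HL _ (cg n t Ht)), Hz.
    + intros y z Hz. destruct (grad_bounds n y z t) as [_ q]; [split; auto|]. lra.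
    + intros y z Hz. destruct (grad_bounds n y z t) as [q _]; [split; auto|].
      assert (Z : Rabs (ZF n y z t) <= 2 * M).
      { unfold ZF. eapply Zop_bound; eauto. intros w. apply (sg n t Ht w z Hz). }
      unfold Rminus. abs_tri. rewrite Rabs_Ropp. lra.
  - apply (time_op (fun n u => Uop (en n) L (Nn n) tau u)).
    + intros n u v x s Hu Hv Hs. apply (opconv_minus L HL); auto using c2_jp.
    + intros n u K x s Hu Hs HK. apply (Uop_bound (en n) L (Nn n)); auto.
Qed.

Lemma phi_mod (f : fam) : (forall n x d s t, dom L T s t -> 0 < d ->
    Rabs (f n (x + d) s t - f n x s t) <= 4 * K1 L al * H / al * Rpower d (al / 2)) ->
  forall eta, 0 < eta -> exists d, 0 < d /\ forall n x x' s t, dom L T s t -> Rabs (x - x') <= d ->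
     Rabs (f n x s t - f n x' s t) <= eta.
Proof.
  intros Hf eta He. assert (P := K1_pos L al HL Hal).
  assert (Q : 0 < 4 * K1 L al * H / al) by (apply Rdiv_lt_0_compat; [|lra]; apply Rmult_lt_0_compat; lra).
  destruct (Rpower_small _ (al / 2) eta Q ltac:(lra) He) as [d [Hd A]]. exists d. split; [exact Hd|].
  assert (K : forall n x x' s t, dom L T s t -> x < x' -> Rabs (x - x') <= d -> Rabs (f n x s t - f n x' s t) <= eta).
  { intros n x x' s t D Hx Hxx. rewrite Rabs_left in Hxx by lra.
    replace x' with (x + (x' - x)) by ring. rewrite Rabs_minus_sym. eapply Rle_trans; [apply Hf; [exact D|lra]|].
    eapply Rle_trans; [|exact A]. apply Rmult_le_compat_l; [lra|]. apply Rpower_le_base; lra. }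
  intros n x x' s t D Hx. destruct (Rtotal_order x x') as [h|[->|h]].
  - apply K; assumption.
  - rewrite Rminus_diag, Rabs_R0. lra.
  - rewrite Rabs_minus_sym. apply K; auto. rewrite Rabs_minus_sym. exact Hx.
Qed.

(** The modulus in phi comes from [grad_holder]; no direct estimate of the gradient in s or t is
    made, since [EC_deriv] derives it from that of [VF]. *)
Lemma EC_VF' : EC L T (VF' tau).
Proof.
  apply EC_deriv with (VF tau).
  - apply EC_VF.
  - intros n x s t [Hs Ht]. apply (Vop_dphi (en n) L (Nn n) (Hen n) HL _ (cg n t Ht) (pg n t Ht)), Hs.
  - apply phi_mod. intros n x d s t [Hs Ht] Hd.
    apply (grad_holder (en n) L al (Nn n) (Hen n) HL Hal (fun x s => g n x s t) H tau x d s); auto.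
Qed.
Lemma EC_UF' : EC L T (UF' tau).
Proof.
  apply EC_deriv with (UF tau).
  - apply EC_UF.
  - intros n x s t [Hs Ht]. apply (Uop_dphi (en n) L (Nn n) (Hen n) HL _ (cg n t Ht) (pg n t Ht)), Hs.
  - apply phi_mod. intros n x d s t [Hs Ht] Hd.
    apply (grad_holder (en n) L al (Nn n) (Hen n) HL Hal (fun x s => g n x s t) H tau x d s); auto.
Qed.

Hypothesis en0 : forall n, en n = / (INR n + 1).
Hypothesis NnE : forall n, Nn n = n.

Lemma inv_small c eta : 0 < c -> 0 < eta -> exists n0, forall n, (n0 <= n)%nat -> c * / (INR n + 1) <= eta.
Proof.
  intros Hc He. destruct (INR_unbounded (c / eta)) as [n0 Hn0]. exists n0. intros n Hn.
  apply le_INR in Hn. assert (P : 0 < c / eta) by (apply Rdiv_lt_0_compat; assumption).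
  apply Rmult_le_reg_r with (INR n + 1); [lra|]. rewrite Rmult_assoc, Rinv_l by lra.
  assert (K : c / eta * eta = c) by (field; lra). nra.
Qed.

(** Here the parameters are coupled: e tends to 0 and the number of images to infinity with n, which
    kills the two errors of [Zop_approx]. *)
Lemma SM_Z : SM L T (fun n x s t => ZF n x s t + MF n x s t - g n x s t).
Proof.
  intros eta He.
  assert (P1 : 0 < 12 / (1 - al) * H) by (apply Rmult_lt_0_compat; [apply Rdiv_lt_0_compat; lra|lra]).
  assert (P2 : 0 < 2 / L ^ 2 * M) by (apply Rmult_lt_0_compat; [apply Rdiv_lt_0_compat; [lra|apply pow_lt; lra]|lra]).
  destruct (Rpower_small _ al (eta / 2) P1 ltac:(lra) ltac:(lra)) as [d [Hd A]].
  destruct (inv_small 1 d ltac:(lra) Hd) as [n1 B1].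
  destruct (inv_small _ (eta / 2) P2 ltac:(lra)) as [n2 B2].
  exists (max n1 n2). intros n x s t Hn [Hs Ht].
  assert (Z : Rabs (ZF n x s t + MF n x s t - g n x s t) <=
     12 / (1 - al) * H * Rpower (en n) al + 2 / L ^ 2 * M / (INR (Nn n) + 1)).
  { apply (Zop_approx (en n) L (Nn n) (Hen n) HL (fun x s => g n x s t) H M al x s); auto.
    - intros y dd Hdd Hy. apply (hg n t Ht (x - y) x s dd Hs Hdd).
      replace (x - y - x) with (- y) by ring. rewrite Rabs_Ropp. exact Hy.
    - intros y. apply (sg n t Ht y s Hs). }
  eapply Rle_trans; [exact Z|]. rewrite NnE. assert (C1 := B1 n ltac:(lia)). assert (C2 := B2 n ltac:(lia)).
  assert (R : Rpower (en n) al <= Rpower d al).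
  { apply Rpower_le_base; [|lra]. split; [apply Hen|]. rewrite en0. lra. }
  assert (R2 : 12 / (1 - al) * H * Rpower (en n) al <= 12 / (1 - al) * H * Rpower d al) by (apply Rmult_le_compat_l; lra).
  unfold Rdiv in *. lra.
Qed.
End DensityFamily.

Definition kf (x : R) : nat := Z.to_nat (Int_part x).
Lemma kf_spec x : 0 <= x -> INR (kf x) <= x < INR (kf x) + 1.
Proof.
  intros Hx. unfold kf. destruct (base_Int_part x) as [A B].
  assert (P : (0 <= Int_part x)%Z).
  { assert (-1 < IZR (Int_part x)) by lra. apply lt_IZR in H. lia. }
  rewrite INR_IZR_INZ, Z2Nat.id by exact P. lra.
Qed.
Lemma kf_unique x k : 0 <= x -> INR k <= x < INR k + 1 -> kf x = k.
Proof.
  intros Hx Hk. destruct (kf_spec x Hx) as [A B].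
  assert (INR (kf x) < INR (S k)) by (rewrite S_INR; lra). apply INR_lt in H.
  assert (INR k < INR (S (kf x))) by (rewrite S_INR; lra). apply INR_lt in H0. lia.
Qed.
Lemma kf_INR k : kf (INR k) = k.
Proof. apply kf_unique; [apply pos_INR|lra]. Qed.
Lemma kf_mono x y : 0 <= x <= y -> (kf x <= kf y)%nat.
Proof.
  intros H. destruct (kf_spec x ltac:(lra)). destruct (kf_spec y ltac:(lra)).
  assert (A : INR (kf x) < INR (S (kf y))) by (rewrite S_INR; lra). apply INR_lt in A. lia.
Qed.

(** * Choice of the time step *)

Section SchemeExists.
Variables (L al : R) (mu mu' f : R -> R) (Cmu Cf c0 M0 T : R).
Hypotheses (HL : 0 < L) (Hal : 0 < al < 1) (HT : 0 < T).
Hypotheses (cmu : cont mu) (cmu' : cont mu') (mu1 : forall s, 1 <= mu s)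
  (dmu : forall s, is_derive mu s (mu' s))
  (mub : forall s, 0 <= s <= L -> mu s <= Cmu /\ Rabs (mu' s) <= Cmu)
  (cf : cont f) (fb : forall s, 0 <= s <= L -> Rabs (f s) <= Cf) (HM0 : 0 <= M0).
Variable y0 : R.
Hypothesis Hy0 : 1 <= y0.
Notation C2 := (C2c L al Cmu Cf c0 M0). Notation BB := (Bc L Cmu Cf c0 M0).
(** Dominates y0 (1 + 2 h C2)^K for all K h <= T + 1. It depends neither on e, N and h nor on the
    gradient of the mollified data, so the Hölder bounds are uniform along the approximation. *)
Definition Ymax := y0 * exp (2 * C2 * (T + 2)).

Lemma scheme_exists (e : R) (N : nat) (Q0 Q0x Q0s : R -> R -> R) (G0 eta : R) : 0 < e <= 1 -> 0 < eta ->
  C1 L Q0 Q0x Q0s -> per Q0 -> supb L Q0 M0 -> hol2 L al Q0 (exp y0) -> supb L Q0x G0 -> supb L Q0s G0 ->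
  exists (h : R) (q fb fbx fbs : nat -> R -> R -> R), 0 < h <= eta /\ q 0%nat = Q0 /\
  (forall k, INR k * h <= T + h ->
     (c2 (q k) /\ per (q k) /\ supb L (q k) M0 /\ hol2 L al (q k) (exp Ymax)) /\
     (C1 L (fb k) (fbx k) (fbs k) /\ per (fb k) /\ supb L (fb k) M0 /\ hol2 L al (fb k) (2 * exp Ymax)) /\
     (forall x s, 0 <= s <= L -> Rabs (fb k x s - q k x s) <= eta)) /\
  (forall k j x s d, INR (k + j) * h <= T + h -> 0 <= s <= L -> 0 < d -> INR j * (h * BB) <= d ->
     Rabs (q (k + j)%nat x s - q k x s) <= exp Ymax * Rpower d al) /\
  (forall k x s, INR k * h <= T -> 0 < s < L ->
     Rabs ((gQ mu f (q (S k)) x s - gQ mu f (q k) x s) / h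
        + (Ug e L N c0 (gQ mu f (q k)) x s * fbx k x s + Vg e L N (gQ mu f (q k)) x s * fbs k x s)) <= eta).
Proof.
  intros He Heta CQ PQ SQ HQ GX GS.
  assert (cp : 0 < C2) by (eapply C2c_pos; eauto).
  assert (bp : 0 < BB) by (eapply Bc_pos; eauto).
  assert (Yp : 1 <= Ymax).
  { unfold Ymax. assert (1 <= exp (2 * C2 * (T + 2))); [|nra].
    apply Rle_trans with (1 + 2 * C2 * (T + 2)); [nra|apply exp_ge_1p]. }
  assert (G0p : 0 <= G0) by (eapply Rle_trans; [apply Rabs_pos|apply (GX 0 0); lra]).
  (* Bounds every gradient constant of the run, and is known before h. *)
  set (GG := G0 * exp (2 * (C2 * Ymax) * (T + 1))).
  assert (GGp : 0 <= GG) by (apply Rmult_le_pos; [exact G0p|left; apply exp_pos]).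
  set (CC := 4 * BB * (C2 * Ymax) * GG + 1).
  assert (cy : 0 < C2 * Ymax) by (apply Rmult_lt_0_compat; lra).
  assert (CCp : 0 < CC).
  { unfold CC. assert (0 <= 4 * BB * (C2 * Ymax) * GG); [|lra]. apply Rmult_le_pos; [|exact GGp].
    apply Rmult_le_pos; lra. }
  destruct (Rpower_small (exp Ymax) al eta (exp_pos _) ltac:(lra) Heta) as [d0 [Hd0 Pd0]].
  (* The constraints: the prescribed size, h <= 1, feet inside the strip, commutator error below
     eta, and the average within eta of Q. *)
  set (h := Rmin (Rmin eta 1) (Rmin (/ (2 * (C2 * Ymax))) (Rmin (eta / CC) (d0 / BB)))).
  assert (h1 : h <= eta) by (eapply Rle_trans; [apply Rmin_l|apply Rmin_l]).
  assert (h2 : h <= 1) by (eapply Rle_trans; [apply Rmin_l|apply Rmin_r]).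
  assert (h3 : h <= / (2 * (C2 * Ymax))) by (eapply Rle_trans; [apply Rmin_r|apply Rmin_l]).
  assert (h4 : h <= eta / CC) by (eapply Rle_trans; [apply Rmin_r|eapply Rle_trans; [apply Rmin_r|apply Rmin_l]]).
  assert (h5 : h <= d0 / BB) by (eapply Rle_trans; [apply Rmin_r|eapply Rle_trans; [apply Rmin_r|apply Rmin_r]]).
  assert (h0 : 0 < h).
  { repeat apply Rmin_pos; try lra.
    - apply Rinv_0_lt_compat. lra.
    - apply Rdiv_lt_0_compat; lra.
    - apply Rdiv_lt_0_compat; lra. }
  assert (hY : h * (C2 * Ymax) <= / 2).
  { apply Rle_trans with (/ (2 * (C2 * Ymax)) * (C2 * Ymax)); [apply Rmult_le_compat_r; lra|].
    apply Req_le. field. split; lra. }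
  assert (h4' : h * CC <= eta).
  { apply Rle_trans with (eta / CC * CC); [apply Rmult_le_compat_r; lra|]. apply Req_le. field. lra. }
  assert (h5' : h * BB <= d0).
  { apply Rle_trans with (d0 / BB * BB); [apply Rmult_le_compat_r; lra|]. apply Req_le. field. lra. }
  assert (Th : 0 <= T / h) by (apply Rdiv_le_0_compat; lra).
  (* One step more than fits into [0, T], because the increment starting at the last grid time is
     also used. *)
  set (K := S (kf (T / h))).
  destruct (kf_spec (T / h) Th) as [k1 k2].
  assert (Th2 : T / h * h = T) by (field; lra).
  assert (Kh : INR K * h <= T + 1) by (unfold K; rewrite S_INR; nra).
  assert (val : forall k, INR k * h <= T + h -> (k <= K)%nat).
  { intros k Hk. assert (INR k < INR (S K)); [|apply INR_lt in H; lia].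
    rewrite S_INR. unfold K. rewrite S_INR. apply Rmult_lt_reg_r with h; [lra|]. nra. }
  assert (valS : forall k, INR k * h <= T -> (S k <= K)%nat).
  { intros k Hk. apply val. rewrite S_INR. nra. }
  assert (HYm : y0 * (1 + 2 * h * C2) ^ K <= Ymax).
  { unfold Ymax. apply Rmult_le_compat_l; [lra|]. eapply Rle_trans; [apply pow_exp_le; nra|].
    apply exp_mono. nra. }
  set (q := Qk L mu mu' f c0 e N h Q0 Q0x Q0s).
  exists h, q, (Fb L mu mu' f c0 e N h Q0 Q0x Q0s), (Fbx L mu mu' f c0 e N h Q0 Q0x Q0s), (Fbs L mu mu' f c0 e N h Q0 Q0x Q0s).
  split; [lra|]. split; [reflexivity|]. split; [|split].
  - intros k Hk. apply val in Hk.
    assert (st : state L al mu mu' f Cmu Cf c0 M0 e N h y0 Ymax G0 Q0 Q0x Q0s k) by (eapply states with (al := al) (Cmu := Cmu) (Cf := Cf) (M0 := M0) (y0 := y0) (Ym := Ymax) (G0 := G0) (K := K); eauto).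
    split; [|split].
    + split; [apply st|]. split; [apply st|]. split; [apply st|]. eapply Qk_hol with (al := al) (Cmu := Cmu) (Cf := Cf) (M0 := M0) (y0 := y0) (Ym := Ymax) (G0 := G0) (K := K); eauto.
    + split; [eapply Fb_C1 with (al := al) (Cmu := Cmu) (Cf := Cf) (M0 := M0) (y0 := y0) (Ym := Ymax) (G0 := G0) (K := K); eauto|]. split; [eapply Fb_per with (al := al) (Cmu := Cmu) (Cf := Cf) (M0 := M0) (y0 := y0) (Ym := Ymax) (G0 := G0) (K := K); eauto|]. split; [eapply Fb_sup with (al := al) (Cmu := Cmu) (Cf := Cf) (M0 := M0) (y0 := y0) (Ym := Ymax) (G0 := G0) (K := K); eauto|eapply Fb_hol with (al := al) (Cmu := Cmu) (Cf := Cf) (M0 := M0) (y0 := y0) (Ym := Ymax) (G0 := G0) (K := K); eauto].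
    + intros x s Hs. eapply Rle_trans; [eapply Fb_near with (al := al) (Cmu := Cmu) (Cf := Cf) (M0 := M0) (y0 := y0) (Ym := Ymax) (G0 := G0) (K := K); eauto|]. eapply Rle_trans; [|exact Pd0].
      apply Rmult_le_compat_l; [left; apply exp_pos|]. apply Rpower_le_base; [|lra]. split; [|exact h5'].
      apply Rmult_lt_0_compat; lra.
  - intros k j x s d Hk Hs Hd Hj. apply val in Hk. eapply Qk_time with (al := al) (Cmu := Cmu) (Cf := Cf) (M0 := M0) (y0 := y0) (Ym := Ymax) (G0 := G0) (K := K); eauto.
  - intros k x s Hk Hs. apply valS in Hk. eapply Rle_trans; [eapply transport with (al := al) (Cmu := Cmu) (Cf := Cf) (M0 := M0) (y0 := y0) (Ym := Ymax) (G0 := G0) (K := K); eauto|].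
    eapply Rle_trans; [|exact h4']. apply Rmult_le_compat_l; [lra|]. unfold CC.
    assert (Gle : Gk L al Cmu Cf c0 M0 h Ymax G0 K <= GG).
    { unfold Gk, GG. apply Rmult_le_compat_l; [exact G0p|]. eapply Rle_trans; [apply pow_exp_le; nra|].
      apply exp_mono.
      replace (2 * h * (C2 * Ymax) * INR K) with (2 * (C2 * Ymax) * (INR K * h)) by ring.
      apply Rmult_le_compat_l; lra. }
    assert (4 * BB * (C2 * Ymax) * Gk L al Cmu Cf c0 M0 h Ymax G0 K <= 4 * BB * (C2 * Ymax) * GG); [|lra].
    apply Rmult_le_compat_l; [|exact Gle]. apply Rmult_le_pos; lra.
Qed.
End SchemeExists.

(** * Steklov means of the initial vorticity *)

Section Steklov.
Variables (L al : R) (Q0 : R -> R -> R) (M0 H : R).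
Hypotheses (HL : 0 < L) (Hal : 0 < al < 1) (cQ : c2 Q0) (pQ : per Q0) (sQ : supb L Q0 M0) (hQ : hol2 L al Q0 H) (HH : 0 < H).

Lemma cl_lip s s' : Rabs (cl L s - cl L s') <= Rabs (s - s').
Proof.
  unfold cl, Rmax, Rmin, Rabs. repeat (destruct (Rle_dec _ _)); repeat (destruct (Rcase_abs _)); lra.
Qed.

Lemma win_ds (k : R -> R) d s : cont k -> is_derive (fun s => RInt k (s - d) (s + d)) s (k (s + d) - k (s - d)).
Proof.
  intros Hk.
  apply is_derive_ext with (fun s => RInt k 0 (s + d) - RInt k 0 (s - d)).
  - intros t. rewrite <- (RI_chasles k (t - d) 0 Hk (t + d)), (RI_swap k 0 (t - d) Hk). Req. ring.
  - assert (T : forall c, is_derive (fun s => RInt k 0 (s + c)) s (k (s + c))).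
    { intros c. evar_last.
      - apply (is_derive_comp (V := RN) (fun y => RInt k 0 y) (fun s => s + c)); [apply int0_ds, Hk|].
        instantiate (1 := 1). auto_derive; [exact I|ring].
      - unfold scal; simpl; unfold mult; simpl. ring. }
    apply (is_derive_minus (V := RN)); [apply T|]. apply (T (- d)).
Qed.

(** The density is extended beyond the walls by its wall values and averaged over a square of side 2
    d. Averaging translates keeps the sup and Hölder bounds with the same constants, while the
    gradient bound deteriorates as d tends to 0. *)
Lemma steklov d : 0 < d -> exists Q Qx Qs G, (C1 L Q Qx Qs /\ per Q) /\ (supb L Q M0 /\ hol2 L al Q H) /\
  (supb L Qx G /\ supb L Qs G) /\ (forall x s, 0 <= s <= L -> Rabs (Q x s - Q0 x s) <= H * Rpower d al).
Proof.
  intros Hd.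
  set (q := fun x s => Q0 x (cl L s)).
  assert (cq : c2 q) by (unfold c2, q; apply (cont_comp2 Q0); [exact cQ|cont_tac|apply cont_cl; cont_tac]).
  assert (bq : forall x s, Rabs (q x s) <= M0) by (intros; apply sQ, cl_in, HL).
  assert (M00 : 0 <= M0) by (eapply Rle_trans; [apply Rabs_pos|apply (bq 0 0)]).
  set (A := fun x s => RInt (fun y => q x y) (s - d) (s + d)).
  assert (cA : c2 A).
  { apply (cont_RInt_var (U := RU2) (fun z y => q (fst z) y) (fun z => snd z - d) (fun z => snd z + d)); [|cont_tac|cont_tac].
    apply (cont_comp2 q); [exact cq|cont_tac|cont_tac]. }
  set (As := fun x s => q x (s + d) - q x (s - d)).
  assert (cAs : c2 As).
  { apply cont_minus; apply (cont_comp2 q); (exact cq || cont_tac). }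
  set (W := fun (k : R -> R -> R) x s => RInt (fun y => k y s) (x - d) (x + d)).
  assert (cW : forall k, c2 k -> c2 (W k)).
  { intros k Hk.
    apply (cont_RInt_var (U := RU2) (fun z y => k y (snd z)) (fun z => fst z - d) (fun z => fst z + d)); [|cont_tac|cont_tac].
    apply (cont_comp2 k); [exact Hk|cont_tac|cont_tac]. }
  set (c := / (4 * d * d)).
  assert (cpos : 0 < c) by (apply Rinv_0_lt_compat; nra).
  assert (cd : c * (2 * d * (2 * d)) = 1) by (unfold c; field; lra).
  (* Over the fixed window (-d, d) the point (x, s) only translates the arguments, so increments of
     the average are averages of increments of q. *)
  assert (Aform : forall x s, A x s = RInt (fun b => q x (b + s)) (- d) d).
  { intros x s. rewrite (RI_shift (q x) s (- d) d) by (apply c2_slice1, cq). unfold A. f_equal; ring. }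
  assert (Wform : forall k x s, c2 k -> W k x s = RInt (fun a => k (a + x) s) (- d) d).
  { intros k x s Hk. rewrite (RI_shift (fun y => k y s) x (- d) d) by (apply c2_slice2, Hk). unfold W. f_equal; ring. }
  assert (Wb : forall k K x s, c2 k -> (forall y, Rabs (y - x) <= d -> Rabs (k y s) <= K) -> Rabs (W k x s) <= 2 * d * K).
  { intros k K x s Hk HK. unfold W. replace (2 * d * K) with ((x + d - (x - d)) * K) by ring.
    apply RInt_abs_le; [lra|apply c2_slice2, Hk|]. intros y Hy. apply HK. apply Rabs_le. lra. }
  assert (Ab : forall x s, Rabs (A x s) <= 2 * d * M0).
  { intros x s. unfold A. replace (2 * d * M0) with ((s + d - (s - d)) * M0) by ring.
    apply RInt_abs_le; [lra|apply c2_slice1, cq|]. intros; apply bq. }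
  assert (dif : forall x s x' s' K, (forall a b, Rabs a <= d -> Rabs b <= d -> Rabs (q (a + x) (b + s) - q (a + x') (b + s')) <= K) ->
    Rabs (c * W A x s - c * W A x' s') <= K).
  { intros x s x' s' K HK. rewrite <- Rmult_minus_distr_l, Rabs_mult, (Rabs_right c) by lra.
    rewrite !Wform by exact cA.
    assert (s1 : forall x s, cont (fun a => A (a + x) s)) by (intros; apply (cont_comp2 (U := RU) A); cont_tac).
    assert (s2 : forall x s, cont (fun b => q x (b + s))) by (intros; apply (cont_comp2 (U := RU) q); cont_tac).
    rewrite <- RI_minus by apply s1.
    assert (B : Rabs (RInt (fun a => A (a + x) s - A (a + x') s') (- d) d) <= (d - - d) * ((d - - d) * K)).
    { apply RInt_abs_le; [lra|apply (cont_minus (U := RU)); apply s1|].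
      intros a Ha. rewrite !Aform, <- RI_minus by apply s2.
      apply RInt_abs_le; [lra|apply (cont_minus (U := RU)); apply s2|].
      intros b Hb. apply HK; apply Rabs_le; lra. }
    apply Rle_trans with (c * ((d - - d) * ((d - - d) * K))); [apply Rmult_le_compat_l; lra|].
    apply Req_le. replace ((d - - d) * ((d - - d) * K)) with ((2 * d * (2 * d)) * K) by ring.
    rewrite <- Rmult_assoc, cd. ring. }
  exists (fun x s => c * W A x s), (fun x s => c * (A (x + d) s - A (x - d) s)), (fun x s => c * W As x s), (c * (4 * d * M0)).
  split; [split|split; [split|split; [split|]]].
  - constructor.
    + apply cont_mult; [cont_tac|apply cW, cA].
    + apply cont_mult; [cont_tac|]. apply cont_minus; apply (cont_comp2 A); (exact cA || cont_tac).
    + apply cont_mult; [cont_tac|apply cW, cAs].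
    + intros x s Hs. apply is_derive_scal. apply (win_ds (fun y => A y s)). apply c2_slice2, cA.
    + intros x s Hs. apply is_derive_scal.
      apply (derive_RInt_param (fun s y => A y s) (fun s y => As y s) (x - d) (x + d) s 1); [lra|lra| | |].
      * unfold c2. apply (cont_comp2 A); [exact cA|cont_tac|cont_tac].
      * unfold c2. apply (cont_comp2 As); [exact cAs|cont_tac|cont_tac].
      * intros t y _ _. apply (win_ds (q y)). apply c2_slice1, cq.
  - intros x s. f_equal. rewrite !Wform by exact cA. apply RInt_ext. intros a _. unfold A. apply RInt_ext. intros y _.
    unfold q. replace (a + (x + 2 * PI)) with (a + x + 2 * PI) by ring. apply pQ.
  - intros x s Hs. rewrite Rabs_mult, (Rabs_right c) by lra.
    assert (B := Wb A (2 * d * M0) x s cA (fun y _ => Ab y s)).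
    apply Rle_trans with (c * (2 * d * (2 * d * M0))); [apply Rmult_le_compat_l; lra|]. apply Req_le.
    replace (2 * d * (2 * d * M0)) with (2 * d * (2 * d) * M0) by ring. rewrite <- Rmult_assoc, cd. ring.
  - intros x x' y y' dd Hy Hy' Hdd Hx Hs. apply dif. intros a b _ _. unfold q.
    apply hQ; auto using cl_in.
    + replace (a + x - (a + x')) with (x - x') by ring. exact Hx.
    + eapply Rle_trans; [apply cl_lip|]. replace (b + y - (b + y')) with (y - y') by ring. exact Hs.
  - intros x s Hs. rewrite Rabs_mult, (Rabs_right c) by lra. apply Rmult_le_compat_l; [lra|].
    unfold Rminus. abs_tri. rewrite Rabs_Ropp.
    assert (B1 := Ab (x + d) s). assert (B2 := Ab (x + - d) s). lra.
  - intros x s Hs. rewrite Rabs_mult, (Rabs_right c) by lra. apply Rmult_le_compat_l; [lra|].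
    replace (4 * d * M0) with (2 * d * (2 * M0)) by ring. apply Wb; [exact cAs|]. intros y _. unfold As.
    unfold Rminus. abs_tri. rewrite Rabs_Ropp.
    assert (B1 := bq y (s + d)). assert (B2 := bq y (s + - d)). lra.
  - intros x s Hs.
    assert (E : Q0 x s = c * RInt (fun _ => RInt (fun _ => Q0 x s) (- d) d) (- d) d).
    { rewrite !RI_const. replace ((d - - d) * ((d - - d) * Q0 x s)) with (2 * d * (2 * d) * Q0 x s) by ring.
      rewrite <- Rmult_assoc, cd. ring. }
    rewrite E, <- Rmult_minus_distr_l, Rabs_mult, (Rabs_right c) by lra. rewrite Wform by exact cA.
    assert (s1 : cont (fun a => A (a + x) s)) by (apply (cont_comp2 (U := RU) A); cont_tac).
    assert (s2 : forall x s, cont (fun b => q x (b + s))) by (intros; apply (cont_comp2 (U := RU) q); cont_tac).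
    rewrite <- RI_minus by (exact s1 || cont_tac).
    assert (B : Rabs (RInt (fun a => A (a + x) s - RInt (fun _ => Q0 x s) (- d) d) (- d) d) <= (d - - d) * ((d - - d) * (H * Rpower d al))).
    { apply RInt_abs_le; [lra|apply (cont_minus (U := RU)); [exact s1|cont_tac]|].
      intros a Ha. rewrite Aform, <- RI_minus by (apply s2 || cont_tac).
      apply RInt_abs_le; [lra|apply (cont_minus (U := RU)); [apply s2|cont_tac]|].
      intros b Hb. unfold q. rewrite <- (cl_id L s Hs) at 2. apply hQ; auto using cl_in.
      - replace (a + x - x) with a by ring. apply Rabs_le; lra.
      - eapply Rle_trans; [apply cl_lip|]. replace (b + s - s) with b by ring. apply Rabs_le; lra. }
    apply Rle_trans with (c * ((d - - d) * ((d - - d) * (H * Rpower d al)))); [apply Rmult_le_compat_l; lra|].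
    apply Req_le. replace ((d - - d) * ((d - - d) * (H * Rpower d al))) with ((2 * d * (2 * d)) * (H * Rpower d al)) by ring.
    rewrite <- Rmult_assoc, cd. ring.
Qed.
End Steklov.

(** [tube] applied to k (u + y) at u = 0. *)
Lemma unif_cont (k : R -> R) a b : cont k -> forall eta, 0 < eta -> exists d, 0 < d /\
  forall s s', a <= s <= b -> a <= s' <= b -> Rabs (s - s') <= d -> Rabs (k s - k s') <= eta.
Proof.
  intros Hk eta He.
  destruct (tube (U := RU) (fun u y => k (u + y)) 0 a b eta) as [d [Hd A]]; [|exact He|].
  - apply (cont_comp k); [exact Hk|cont_tac].
  - exists (d / 2). split; [lra|]. intros s s' Hs Hs' Hd'.
    assert (B := A (s - s') s'). simpl in B.
    replace (s - s' + s') with s in B by ring. rewrite Rplus_0_l in B. left. apply B; [|exact Hs'].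
    change (Rabs ((s - s') - 0) < d). rewrite Rminus_0_r. lra.
Qed.

(** * The shear part along a family of densities *)

Section MeanInt.
Variables (L T : R) (g : fam) (M : R).
Hypotheses (HL : 0 < L) (HT : 0 < T).
Hypotheses (cg : forall n t, 0 <= t <= T -> c2 (fun x s => g n x s t))
  (sg : forall n t, 0 <= t <= T -> supb L (fun x s => g n x s t) M) (HM : 0 < M).
Hypothesis tg : forall eta, 0 < eta -> exists d n0, 0 < d /\ forall n x s t t', (n0 <= n)%nat ->
  dom L T s t -> dom L T s t' -> Rabs (t - t') <= d -> Rabs (g n x s t - g n x s t') <= eta.
Definition MI : fam := fun n x s t => RInt (mean (fun x s => g n x s t)) 0 s.

Lemma MI_diff n t s s' : 0 <= t <= T -> 0 <= s <= L -> 0 <= s' <= L -> Rabs (MI n 0 s t - MI n 0 s' t) <= M * Rabs (s - s').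
Proof.
  intros Ht Hs Hs'.
  assert (K : forall s s', 0 <= s -> s <= s' -> s' <= L -> Rabs (MI n 0 s' t - MI n 0 s t) <= M * Rabs (s' - s)).
  { clear s s' Hs Hs'. intros s s' A1 A2 A3. unfold MI.
    assert (cm := cont_mean _ (cg n t Ht)).
    rewrite <- (RI_chasles _ 0 s cm s').
    replace (RInt (mean (fun x s0 : R => g n x s0 t)) 0 s + RInt (mean (fun x s0 : R => g n x s0 t)) s s' - RInt (mean (fun x s0 : R => g n x s0 t)) 0 s)
      with (RInt (mean (fun x s0 : R => g n x s0 t)) s s') by (symmetry; Req; ring).
    rewrite (Rabs_right (s' - s)) by lra. rewrite Rmult_comm. apply RInt_abs_le; [lra|exact cm|].
    intros y Hy. apply mean_bound; [apply (cg n t Ht)|]. intros x. apply (sg n t Ht x y). lra. }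
  destruct (Rle_dec s s') as [h|h].
  - rewrite Rabs_minus_sym, (Rabs_minus_sym s s'). apply K; lra.
  - apply K; lra.
Qed.
Lemma EC_MI : EC L T MI.
Proof.
  apply (EC_of_lip L T MI M); [exact HM| |].
  - intros n t x x' s s' Ht Hs Hs'. eapply Rle_trans; [apply (MI_diff n t s s' Ht Hs Hs')|].
    apply Rmult_le_compat_l; [lra|]. assert (P := Rabs_pos (x - x')). lra.
  - intros eta He. assert (Q : 0 < eta / L) by (apply Rdiv_lt_0_compat; assumption).
    destruct (tg _ Q) as [d [n0 [Hd A]]]. exists d, n0. split; [exact Hd|].
    intros n x s t t' Hn [Hs Ht] [_ Ht'] K. unfold MI.
    assert (cm := cont_mean _ (cg n t Ht)). assert (cm' := cont_mean _ (cg n t' Ht')).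
    rewrite <- RI_minus by assumption.
    apply Rle_trans with ((s - 0) * (eta / L)).
    + apply RInt_abs_le; [lra|apply (cont_minus (U := RU)); assumption|].
      intros y Hy. unfold mean, Rdiv. rewrite <- Rmult_minus_distr_r.
      rewrite <- RI_minus by (apply (c2_slice2 (fun x s => g n x s _)); apply cg; assumption).
      apply (mean_bound (fun x s => g n x s t - g n x s t') (eta / L) y).
      * apply (cont_minus (U := RU2)); [apply (cg n t Ht)|apply (cg n t' Ht')].
      * intros z. apply A; auto; split; auto; lra.
    + rewrite Rminus_0_r. apply Rle_trans with (L * (eta / L)); [apply Rmult_le_compat_r; lra|]. apply Req_le. field. lra.
Qed.
Lemma BD_MI : BD L T MI.
Proof.
  exists (L * M), 0%nat. split; [nra|]. intros n x s t _ [Hs Ht]. unfold MI.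
  apply Rle_trans with ((s - 0) * M); [|apply Rmult_le_compat_r; lra].
  apply RInt_abs_le; [lra|apply cont_mean, (cg n t Ht)|].
  intros y Hy. apply mean_bound; [apply (cg n t Ht)|]. intros z. apply (sg n t Ht z y). lra.
Qed.
End MeanInt.

Lemma EC_ext L T f f' : (forall n x s t, dom L T s t -> f n x s t = f' n x s t) -> EC L T f -> EC L T f'.
Proof.
  intros E H eta He. destruct (H eta He) as [d [n0 [Hd A]]]. exists d, n0. split; [exact Hd|].
  intros. rewrite <- !E by assumption. apply A; assumption.
Qed.
Lemma BD_ext L T f f' : (forall n x s t, dom L T s t -> f n x s t = f' n x s t) -> BD L T f -> BD L T f'.
Proof.
  intros E [M [n0 [P A]]]. exists M, n0. split; [exact P|]. intros. rewrite <- E by assumption. apply A; assumption.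
Qed.
Lemma EC_opp L T f : EC L T f -> EC L T (fun n x s t => - f n x s t).
Proof. intros H. apply (EC_ext L T (fun n x s t => (-1) * f n x s t)); [intros; ring|]. apply EC_scal, H. Qed.
Lemma BD_opp L T f : BD L T f -> BD L T (fun n x s t => - f n x s t).
Proof. intros H. apply (BD_ext L T (fun n x s t => (-1) * f n x s t)); [intros; ring|]. apply BD_scal, H. Qed.
Lemma EC_minus L T f g : EC L T f -> EC L T g -> EC L T (fun n x s t => f n x s t - g n x s t).
Proof. intros H H'. apply (EC_plus L T f (fun n x s t => - g n x s t)); [exact H|apply EC_opp, H']. Qed.
Lemma BD_minus L T f g : BD L T f -> BD L T g -> BD L T (fun n x s t => f n x s t - g n x s t).
Proof. intros H H'. apply (BD_plus L T f (fun n x s t => - g n x s t)); [exact H|apply BD_opp, H']. Qed.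

Lemma EC_static L T (k : R -> R) : cont k -> EC L T (fun _ _ s _ => k s).
Proof.
  intros Hk eta He. destruct (unif_cont k 0 L Hk eta He) as [d [Hd A]]. exists d, 0%nat. split; [exact Hd|].
  intros n x s t x' s' t' _ D D' _ Hs _. apply A; auto; [apply D|apply D'].
Qed.
Lemma BD_static L T (k : R -> R) M : 0 < M -> (forall s, 0 <= s <= L -> Rabs (k s) <= M) -> BD L T (fun _ _ s _ => k s).
Proof. intros HM H. exists M, 0%nat. split; [exact HM|]. intros n x s t _ [Hs _]. apply H, Hs. Qed.
Lemma EC_time L T f : EC L T f -> forall eta, 0 < eta -> exists d n0, 0 < d /\ forall n x s t t', (n0 <= n)%nat ->
  dom L T s t -> dom L T s t' -> Rabs (t - t') <= d -> Rabs (f n x s t - f n x s t') <= eta.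
Proof.
  intros H eta He. destruct (H eta He) as [d [n0 [Hd A]]]. exists d, n0. split; [exact Hd|].
  intros. apply A; auto; rewrite Rminus_diag, Rabs_R0; lra.
Qed.

(** The factor u is Lipschitz and bounded: for d <= 1 the Lipschitz bound gives d <= d^al, for d > 1
    twice the sup bound suffices. *)
Lemma holx_mult L al u b A Lam M H : 0 < al < 1 -> 0 <= M -> 0 <= A ->
  supb L u A -> supb L b M -> holx L al b H ->
  (forall x x' s, 0 <= s <= L -> Rabs (u x s - u x' s) <= Lam * Rabs (x - x')) -> 0 <= Lam ->
  holx L al (fun x s => u x s * b x s) ((Lam + 2 * A) * M + A * H).
Proof.
  intros Hal HM HA su sb hb lu HLam x x' y d Hy Hd Hx.
  assert (U : Rabs (u x y - u x' y) <= (Lam + 2 * A) * Rpower d al).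
  { destruct (Rle_dec d 1) as [h|h].
    - assert (d <= Rpower d al).
      { rewrite <- (Rpower_1 d) at 1 by lra. unfold Rpower. apply exp_mono.
        assert (ln d <= 0) by (rewrite <- ln_1; apply ln_le; lra). nra. }
      assert (A1 := lu x x' y Hy). assert (Lam * Rabs (x - x') <= Lam * d) by (apply Rmult_le_compat_l; lra). nra.
    - assert (1 <= Rpower d al).
      { rewrite <- (Rpower_O d) by lra. apply Rle_Rpower; lra. }
      assert (Rabs (u x y - u x' y) <= 2 * A).
      { unfold Rminus. abs_tri. rewrite Rabs_Ropp.
        assert (A1 := su x y Hy). assert (A2 := su x' y Hy). lra. }
      nra. }
  replace (u x y * b x y - u x' y * b x' y) with ((u x y - u x' y) * b x y + u x' y * (b x y - b x' y)) by ring.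
  abs_tri. rewrite !Rabs_mult.
  assert (K1 := Rmult_le_compat _ _ _ _ (Rabs_pos _) (Rabs_pos _) U (sb x y Hy)).
  assert (K2 := Rmult_le_compat _ _ _ _ (Rabs_pos _) (Rabs_pos _) (su x' y Hy) (hb x x' y d Hy Hd Hx)). lra.
Qed.

Definition ucont (L T : R) (f : R -> R -> R -> R) := forall eta, 0 < eta -> exists d, 0 < d /\ forall x s t x' s' t',
  dom L T s t -> dom L T s' t' -> Rabs (x - x') <= d -> Rabs (s - s') <= d -> Rabs (t - t') <= d ->
  Rabs (f x s t - f x' s' t') <= eta.

(** * Passage to the limit *)

(* Q is the absolute vorticity; incompressibility is encoded by - Ux being the s-derivative of V. *)
Record strip_sol (L T : R) (mu f : R -> R) (Q0 : R -> R -> R) (c : R) (U V P Ux Vx Us Px Ps Ut Vt Q : R -> R -> R -> R) : Prop := {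
  ss_per : forall x s t, 0 <= s <= L -> 0 <= t <= T -> U (x + 2 * PI) s t = U x s t /\ V (x + 2 * PI) s t = V x s t /\ P (x + 2 * PI) s t = P x s t;
  ss_cont : (ucont L T U /\ ucont L T V /\ ucont L T P /\ ucont L T Ux /\ ucont L T Vx) /\
    (ucont L T Us /\ ucont L T Px /\ ucont L T Ps /\ ucont L T Ut /\ ucont L T Vt);
  ss_dx : forall x s t, 0 <= s <= L -> 0 <= t <= T -> is_derive (fun x => U x s t) x (Ux x s t) /\ is_derive (fun x => V x s t) x (Vx x s t);
  ss_d : forall x s t, 0 < s < L -> 0 <= t <= T ->
    (is_derive (fun x => P x s t) x (Px x s t) /\ is_derive (fun s => P x s t) s (Ps x s t)) /\
    is_derive (fun s => U x s t) s (Us x s t) /\ is_derive (fun s => V x s t) s (- Ux x s t);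
  ss_dt : forall x s t, 0 <= s <= L -> 0 < t < T ->
    is_derive (fun t => U x s t) t (Ut x s t) /\ is_derive (fun t => V x s t) t (Vt x s t);
  ss_eq : forall x s t, 0 <= s <= L -> 0 <= t <= T ->
    Us x s t = Vx x s t - / mu s * (Q x s t - f s) /\
    Ut x s t = V x s t * Q x s t - Px x s t /\ Vt x s t = - (U x s t * Q x s t) - Ps x s t;
  ss_bdry : forall x t, 0 <= t <= T -> V x 0 t = 0 /\ V x L t = 0;
  ss_Q0 : forall x s, 0 <= s <= L -> Q x s 0 = Q0 x s;
  ss_U0 : U 0 0 0 = c }.

Section Evolution.
Variables (L T al : R) (mu mu' f : R -> R) (Cmu Cf c0 M0 : R).
Hypotheses (HL : 0 < L) (Hal : 0 < al < 1) (HT : 0 < T).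
Hypotheses (cmu : cont mu) (cmu' : cont mu') (mu1 : forall s, 1 <= mu s)
  (dmu : forall s, is_derive mu s (mu' s))
  (mub : forall s, 0 <= s <= L -> mu s <= Cmu /\ Rabs (mu' s) <= Cmu)
  (cf : cont f) (fb : forall s, 0 <= s <= L -> Rabs (f s) <= Cf) (HM0 : 0 <= M0).
Variables (Y B : R).
Hypothesis HB : 0 < B.
Variables (hn : nat -> R) (qn fbn fbxn fbsn : nat -> nat -> R -> R -> R).
Definition en (n : nat) := / (INR n + 1).
Definition Nn (n : nat) : nat := n.
Hypothesis hn_b : forall n, 0 < hn n <= en n.
Hypothesis q_ok : forall n k, INR k * hn n <= T + hn n ->
  c2 (qn n k) /\ per (qn n k) /\ supb L (qn n k) M0 /\ hol2 L al (qn n k) (exp Y).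
Hypothesis b_ok : forall n k, INR k * hn n <= T + hn n ->
  C1 L (fbn n k) (fbxn n k) (fbsn n k) /\ per (fbn n k) /\ supb L (fbn n k) M0 /\ hol2 L al (fbn n k) (2 * exp Y).
Hypothesis b_near : forall n k, INR k * hn n <= T + hn n -> forall x s, 0 <= s <= L -> Rabs (fbn n k x s - qn n k x s) <= en n.
Hypothesis q_time : forall n k j x s d, INR (k + j) * hn n <= T + hn n -> 0 <= s <= L -> 0 < d -> INR j * (hn n * B) <= d ->
     Rabs (qn n (k + j)%nat x s - qn n k x s) <= exp Y * Rpower d al.
Hypothesis transp : forall n k x s, INR k * hn n <= T -> 0 < s < L ->
     Rabs ((gQ mu f (qn n (S k)) x s - gQ mu f (qn n k) x s) / hn n
        + (Ug (en n) L n c0 (gQ mu f (qn n k)) x s * fbxn n k x s + Vg (en n) L n (gQ mu f (qn n k)) x s * fbsn n k x s)) <= en n.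

Notation kk n t := (kf (t / hn n)).
Lemma en_b n : 0 < en n <= 1.
Proof.
  unfold en. assert (P := pos_INR n). split; [apply Rinv_0_lt_compat; lra|].
  rewrite <- Rinv_1. apply Rinv_le_contravar; lra.
Qed.
Lemma kk_T n t : 0 <= t <= T -> INR (kk n t) * hn n <= t /\ t < INR (kk n t) * hn n + hn n.
Proof.
  intros Ht. destruct (hn_b n) as [h0 _]. assert (P : 0 <= t / hn n) by (apply Rdiv_le_0_compat; lra).
  destruct (kf_spec _ P) as [A1 A2]. assert (E : t / hn n * hn n = t) by (field; lra). nra.
Qed.
Lemma kk_ok n t : 0 <= t <= T -> INR (kk n t) * hn n <= T + hn n.
Proof. intros Ht. destruct (kk_T n t Ht). destruct (hn_b n). lra. Qed.
Lemma en_small eta : 0 < eta -> exists n0, forall n, (n0 <= n)%nat -> en n <= eta.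
Proof. intros He. destruct (inv_small al Hal 1 eta Rlt_0_1 He) as [n0 A]. exists n0. intros n Hn. specialize (A n Hn). unfold en. lra. Qed.

(* Piecewise constant interpolation in time: kk n t is the last step before t. *)
Definition Qf : fam := fun n x s t => qn n (kk n t) x s.
Definition gf : fam := fun n x s t => gQ mu f (qn n (kk n t)) x s.
Definition bf : fam := fun n x s t => fbn n (kk n t) x s.
Let M := Mg Cf M0.
Let Hq := exp Y.
Let M1 : 1 <= M. Proof. unfold M, Mg. assert (0 <= Cf) by (eapply Rle_trans; [apply Rabs_pos|apply (fb 0); lra]). lra. Qed.
Let Hq0 : 0 < Hq := exp_pos Y.

(** One step hn n is added to the time difference, since rounding down to the grid can increase it
    by that much. *)
Lemma Q_timediff n x s t t' d : 0 <= s <= L -> 0 <= t <= T -> 0 <= t' <= T -> 0 < d -> (Rabs (t - t') + hn n) * B <= d ->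
  Rabs (Qf n x s t - Qf n x s t') <= Hq * Rpower d al.
Proof.
  intros Hs Ht Ht' Hd Hdd.
  assert (K : forall t t', 0 <= t <= T -> 0 <= t' <= T -> t <= t' -> (t' - t + hn n) * B <= d -> Rabs (Qf n x s t' - Qf n x s t) <= Hq * Rpower d al).
  { clear t t' Ht Ht' Hdd. intros t t' Ht Ht' Hl Hdd. destruct (hn_b n) as [h0 _]. unfold Qf.
    assert (km : (kk n t <= kk n t')%nat).
    { apply kf_mono. split; [apply Rdiv_le_0_compat; lra|]. apply Rmult_le_compat_r; [left; apply Rinv_0_lt_compat; lra|lra]. }
    replace (kk n t') with (kk n t + (kk n t' - kk n t))%nat by lia. apply q_time; auto.
    - replace (kk n t + (kk n t' - kk n t))%nat with (kk n t') by lia. apply kk_ok, Ht'.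
    - rewrite minus_INR by exact km. destruct (kk_T n t Ht). destruct (kk_T n t' Ht').
      eapply Rle_trans; [|exact Hdd]. rewrite <- Rmult_assoc. apply Rmult_le_compat_r; lra. }
  destruct (Rle_dec t t') as [h|h].
  - rewrite Rabs_minus_sym. apply K; auto. rewrite Rabs_left1 in Hdd by lra. lra.
  - apply K; auto; [lra|]. rewrite Rabs_right in Hdd by lra. lra.
Qed.

Lemma EC_Q : EC L T Qf.
Proof.
  intros eta He. destruct (Rpower_small (2 * Hq) al eta ltac:(lra) ltac:(lra) He) as [d [Hd A]].
  assert (P : 0 < d / (2 * B)) by (apply Rdiv_lt_0_compat; lra).
  destruct (en_small _ P) as [n0 Hn0].
  exists (Rmin d (d / (2 * B))), n0. split; [apply Rmin_pos; assumption|].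
  intros n x s t x' s' t' Hn [Hs Ht] [Hs' Ht'] Kx Ks Kt.
  assert (m1 := Rmin_l d (d / (2 * B))). assert (m2 := Rmin_r d (d / (2 * B))).
  replace (Qf n x s t - Qf n x' s' t') with ((Qf n x s t - Qf n x' s' t) + (Qf n x' s' t - Qf n x' s' t')) by ring.
  abs_tri.
  assert (B1 : Rabs (Qf n x s t - Qf n x' s' t) <= Hq * Rpower d al).
  { destruct (q_ok n _ (kk_ok n t Ht)) as [_ [_ [_ hh]]]. apply hh; auto; lra. }
  assert (B2 : Rabs (Qf n x' s' t - Qf n x' s' t') <= Hq * Rpower d al).
  { apply Q_timediff; auto. specialize (Hn0 n Hn). destruct (hn_b n).
    apply Rle_trans with (2 * (d / (2 * B)) * B); [apply Rmult_le_compat_r; lra|]. apply Req_le. field. lra. }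
  lra.
Qed.
Lemma BD_Q : BD L T Qf.
Proof.
  exists (M0 + 1), 0%nat. split; [lra|]. intros n x s t _ [Hs Ht].
  destruct (q_ok n _ (kk_ok n t Ht)) as [_ [_ [ss _]]]. specialize (ss x s Hs). unfold Qf. lra.
Qed.
Lemma SM_bQ : SM L T (fun n x s t => bf n x s t - Qf n x s t).
Proof.
  intros eta He. destruct (en_small _ He) as [n0 A]. exists n0. intros n x s t Hn [Hs Ht].
  eapply Rle_trans; [apply (b_near n _ (kk_ok n t Ht)), Hs|apply A, Hn].
Qed.
Lemma EC_b : EC L T bf.
Proof.
  apply (EC_ext L T (fun n x s t => Qf n x s t + (bf n x s t - Qf n x s t))); [intros; ring|].
  apply EC_plus; [apply EC_Q|apply SM_EC, SM_bQ].
Qed.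
Lemma BD_b : BD L T bf.
Proof.
  exists (M0 + 1), 0%nat. split; [lra|]. intros n x s t _ [Hs Ht].
  destruct (b_ok n _ (kk_ok n t Ht)) as [_ [_ [ss _]]]. specialize (ss x s Hs). unfold bf. lra.
Qed.
Lemma imu_b s : Rabs (/ mu s) <= 1.
Proof.
  assert (H := mu1 s). rewrite Rabs_right by (left; apply Rinv_0_lt_compat; lra). rewrite <- Rinv_1. apply Rinv_le_contravar; lra.
Qed.
Lemma cimu : cont (fun s => / mu s).
Proof. apply (cont_inv (U := RU) mu); [|exact cmu]. intros s. assert (H := mu1 s). lra. Qed.
Lemma BD_f : BD L T (fun _ _ s _ => f s).
Proof. apply BD_static with (Cf + 1); [assert (0 <= Cf) by (eapply Rle_trans; [apply Rabs_pos|apply (fb 0); lra]); lra|]. intros s Hs. specialize (fb s Hs). lra. Qed.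
Lemma EC_g : EC L T gf.
Proof.
  apply (EC_mult L T (fun _ _ s _ => / mu s) (fun n x s t => Qf n x s t - f s)).
  - apply EC_static, cimu.
  - apply EC_minus; [apply EC_Q|apply EC_static, cf].
  - apply BD_static with 1; [lra|]. intros; apply imu_b.
  - apply BD_minus; [apply BD_Q|apply BD_f].
Qed.
Lemma BD_g : BD L T gf.
Proof.
  apply (BD_mult L T (fun _ _ s _ => / mu s) (fun n x s t => Qf n x s t - f s)).
  - apply BD_static with 1; [lra|]. intros; apply imu_b.
  - apply BD_minus; [apply BD_Q|apply BD_f].
Qed.

Let cg n t : 0 <= t <= T -> c2 (fun x s => gf n x s t).
Proof. intros Ht. destruct (q_ok n _ (kk_ok n t Ht)) as [a _]. apply (c2_gQ al mu f Hal cmu mu1 cf _ a). Qed.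
Let pg n t : 0 <= t <= T -> per (fun x s => gf n x s t).
Proof. intros Ht. destruct (q_ok n _ (kk_ok n t Ht)) as [_ [a _]]. apply (per_gQ mu f _ a). Qed.
Let sg n t : 0 <= t <= T -> supb L (fun x s => gf n x s t) M.
Proof. intros Ht. destruct (q_ok n _ (kk_ok n t Ht)) as [_ [_ [a _]]]. apply (gQ_sup L al mu f Cf M0 Hal mu1 fb _ a). Qed.
Let hg n t : 0 <= t <= T -> holx L al (fun x s => gf n x s t) Hq.
Proof. intros Ht. destruct (q_ok n _ (kk_ok n t Ht)) as [_ [_ [_ a]]]. apply (gQ_hol L al mu f mu1 _ _ a). Qed.
Let tg := EC_time L T gf EC_g.
Let Mp : 0 < M. Proof. lra. Qed.
Let tm1 : Rabs (-1) <= 1. Proof. rewrite Rabs_left; lra. Qed.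
Let tp1 : Rabs 1 <= 1. Proof. rewrite Rabs_R1; lra. Qed.

Definition Uf : fam := fun n x s t => Ug (en n) L n c0 (gQ mu f (qn n (kk n t))) x s.
Definition Vf : fam := fun n x s t => Vg (en n) L n (gQ mu f (qn n (kk n t))) x s.
Definition Uxf : fam := UF' L en Nn gf (-1).
Definition Vxf : fam := VF' L en Nn gf (-1).
Definition Usf : fam := fun n x s t => Ugs (en n) L n (gQ mu f (qn n (kk n t))) x s.

Lemma EC_U : EC L T Uf.
Proof.
  apply (EC_ext L T (fun n x s t => ((fun _ _ _ _ => c0) n x s t - MI gf n x s t) + UF L en Nn gf (-1) n x s t)); [intros; reflexivity|].
  apply EC_plus; [apply EC_minus|].
  - apply (EC_static L T (fun _ => c0)), cont_const.
  - apply (EC_MI L T gf M); auto.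
  - apply (EC_UF L T al en Nn gf M Hq); auto using en_b.
Qed.
Lemma BD_U : BD L T Uf.
Proof.
  exists (BU L c0 M + 1), 0%nat.
  assert (P : forall n x s t, dom L T s t -> Rabs (Uf n x s t) <= BU L c0 M).
  { intros n x s t [Hs Ht]. apply (Ug_bound (en n) L n (en_b n) HL c0 _ (cg n t Ht) M x s (sg n t Ht) Hs). }
  assert (Q := P 0%nat 0 0 0 ltac:(split; lra)). assert (Q0 := Rabs_pos (Uf 0%nat 0 0 0)).
  split; [lra|]. intros n x s t _ D. specialize (P n x s t D). lra.
Qed.
Lemma EC_V : EC L T Vf.
Proof. apply (EC_VF L T al en Nn gf Hq); auto using en_b. Qed.
Lemma BD_V : BD L T Vf.
Proof. apply (BD_VF L T al en Nn gf M); auto using en_b. Qed.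
Lemma EC_Ux : EC L T Uxf.
Proof. apply (EC_UF' L T al en Nn gf M Hq); auto using en_b. Qed.
Lemma BD_Ux : BD L T Uxf.
Proof. apply (BD_UF' L T al en Nn gf Hq); auto using en_b. Qed.
Lemma EC_Vx : EC L T Vxf.
Proof. apply (EC_VF' L T al en Nn gf Hq); auto using en_b. Qed.
Lemma BD_Vx : BD L T Vxf.
Proof. apply (BD_VF' L T al en Nn gf Hq); auto using en_b. Qed.
(** The curl identity fails only by the error of the approximate identity applied to the density. *)
Lemma SM_Us : SM L T (fun n x s t => Usf n x s t - (Vxf n x s t - gf n x s t)).
Proof.
  intros eta He. destruct (SM_Z L T al en Nn gf M Hq HL Hal en_b cg pg sg hg Mp Hq0 (fun n => eq_refl) (fun n => eq_refl) eta He) as [n0 A].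
  exists n0. intros n x s t Hn D. eapply Rle_trans; [|apply (A n x s t Hn D)]. apply Req_le.
  rewrite <- Rabs_Ropp. f_equal. unfold Usf, Ugs, Vxf, VF', ZF, MF, gf, Nn.
  change (fun x0 s0 : R => gQ mu f (qn n (kk n t)) x0 s0) with (gQ mu f (qn n (kk n t))). ring.
Qed.
Lemma EC_Us : EC L T Usf.
Proof.
  apply (EC_ext L T (fun n x s t => (Vxf n x s t - gf n x s t) + (Usf n x s t - (Vxf n x s t - gf n x s t)))); [intros; ring|].
  apply EC_plus; [apply EC_minus; [apply EC_Vx|apply EC_g]|apply SM_EC, SM_Us].
Qed.
Lemma BD_Us : BD L T Usf.
Proof.
  apply (BD_ext L T (fun n x s t => (Vxf n x s t - gf n x s t) + (Usf n x s t - (Vxf n x s t - gf n x s t)))); [intros; ring|].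
  apply BD_plus; [apply BD_minus; [apply BD_Vx|apply BD_g]|apply SM_BD, SM_Us].
Qed.

Definition F1f : fam := fun n x s t => F1 (en n) L n c0 (gQ mu f (qn n (kk n t))) (fbn n (kk n t)) x s.
Definition F2f : fam := fun n x s t => F2 (en n) L n (gQ mu f (qn n (kk n t))) (fbn n (kk n t)) x s.
Lemma EC_F1 : EC L T F1f.
Proof. apply (EC_mult L T Uf bf); [apply EC_U|apply EC_b|apply BD_U|apply BD_b]. Qed.
Lemma EC_F2 : EC L T F2f.
Proof. apply (EC_mult L T Vf bf); [apply EC_V|apply EC_b|apply BD_V|apply BD_b]. Qed.
Lemma BD_F1 : BD L T F1f.
Proof. apply (BD_mult L T Uf bf); [apply BD_U|apply BD_b]. Qed.
Lemma BD_F2 : BD L T F2f.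
Proof. apply (BD_mult L T Vf bf); [apply BD_V|apply BD_b]. Qed.

Let cF1 n t : 0 <= t <= T -> c2 (fun x s => F1f n x s t).
Proof.
  intros Ht. destruct (b_ok n _ (kk_ok n t Ht)) as [a _].
  apply (C1_c _ _ _ _ (F1_C1 (en n) L n (en_b n) HL c0 _ _ _ _ (cg n t Ht) (pg n t Ht) a)).
Qed.
Let cF2 n t : 0 <= t <= T -> c2 (fun x s => F2f n x s t).
Proof.
  intros Ht. destruct (b_ok n _ (kk_ok n t Ht)) as [a _].
  apply (C1_c _ _ _ _ (F2_C1 (en n) L n (en_b n) HL _ _ _ _ (cg n t Ht) (pg n t Ht) a)).
Qed.
Let pF1 n t : 0 <= t <= T -> per (fun x s => F1f n x s t).
Proof. intros Ht. destruct (b_ok n _ (kk_ok n t Ht)) as [_ [a _]]. apply (per_F1 (en n) L n c0 _ _ (pg n t Ht) a). Qed.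
Let pF2 n t : 0 <= t <= T -> per (fun x s => F2f n x s t).
Proof. intros Ht. destruct (b_ok n _ (kk_ok n t Ht)) as [_ [a _]]. apply (per_F2 (en n) L n _ _ (pg n t Ht) a). Qed.

Definition AU := BU L c0 M + K0 L * M.
Lemma K0p : 0 < K0 L.
Proof. unfold K0. assert (C := C0_pos L HL). repeat apply Rmult_lt_0_compat; lra. Qed.
Lemma AU_pos : 0 < AU /\ BU L c0 M <= AU /\ K0 L * M <= AU.
Proof.
  assert (k := K0p). assert (0 < K0 L * M) by (apply Rmult_lt_0_compat; lra). unfold AU, BU.
  assert (P := Rabs_pos c0). assert (0 < L * M) by (apply Rmult_lt_0_compat; lra). lra.
Qed.
Definition MF1 := AU * M0 + 1.
Definition HF1 := (KB L al Hq + 2 * AU) * M0 + AU * (2 * Hq) + 1.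
Lemma MF1_pos : 0 < MF1.
Proof. unfold MF1. assert (A := AU_pos). nra. Qed.
Lemma HF1_pos : 0 < HF1.
Proof. unfold HF1. assert (A := AU_pos). assert (K := KB_pos L al Hq HL Hal Hq0). assert (0 < AU * (2 * Hq)) by (apply Rmult_lt_0_compat; lra). nra. Qed.

Lemma supU n t : 0 <= t <= T -> supb L (fun x s => Uf n x s t) AU /\ supb L (fun x s => Vf n x s t) AU.
Proof.
  intros Ht. assert (A := AU_pos). split; intros x s Hs.
  - eapply Rle_trans; [apply (Ug_bound (en n) L n (en_b n) HL c0 _ (cg n t Ht) M x s (sg n t Ht) Hs)|lra].
  - eapply Rle_trans; [apply (Vg_bound (en n) L n (en_b n) HL _ (cg n t Ht) M x s (sg n t Ht) Hs)|lra].
Qed.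
Lemma lipU n t : 0 <= t <= T -> forall x x' s, 0 <= s <= L ->
  Rabs (Uf n x s t - Uf n x' s t) <= KB L al Hq * Rabs (x - x') /\ Rabs (Vf n x s t - Vf n x' s t) <= KB L al Hq * Rabs (x - x').
Proof.
  intros Ht x x' s Hs.
  assert (gb := fun y => grad_bounds L T al en Nn gf Hq HL Hal en_b cg hg (-1) tm1 n y s t (conj Hs Ht)).
  split.
  - destruct (MVT_abs (fun x => Uf n x s t) (fun x => Uxf n x s t) x' x) as [c [_ E]].
    + intros z _. apply (Ug_dx (en n) L n (en_b n) HL c0 _ (cg n t Ht) (pg n t Ht)), Hs.
    + rewrite E, Rabs_mult. apply Rmult_le_compat_r; [apply Rabs_pos|]. apply gb.
  - destruct (MVT_abs (fun x => Vf n x s t) (fun x => Vxf n x s t) x' x) as [c [_ E]].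
    + intros z _. apply (Vg_dx (en n) L n (en_b n) HL _ (cg n t Ht) (pg n t Ht)), Hs.
    + rewrite E, Rabs_mult. apply Rmult_le_compat_r; [apply Rabs_pos|]. apply gb.
Qed.
Let sF1 n t : 0 <= t <= T -> supb L (fun x s => F1f n x s t) MF1 /\ supb L (fun x s => F2f n x s t) MF1.
Proof.
  intros Ht. destruct (b_ok n _ (kk_ok n t Ht)) as [_ [_ [a _]]]. destruct (supU n t Ht) as [u v]. assert (A := AU_pos).
  split; intros x s Hs; unfold MF1.
  - change (F1f n x s t) with (Uf n x s t * bf n x s t). rewrite Rabs_mult.
    assert (K := Rmult_le_compat _ _ _ _ (Rabs_pos _) (Rabs_pos _) (u x s Hs) (a x s Hs)). unfold bf. lra.
  - change (F2f n x s t) with (Vf n x s t * bf n x s t). rewrite Rabs_mult.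
    assert (K := Rmult_le_compat _ _ _ _ (Rabs_pos _) (Rabs_pos _) (v x s Hs) (a x s Hs)). unfold bf. lra.
Qed.
Let hF1 n t : 0 <= t <= T -> holx L al (fun x s => F1f n x s t) HF1 /\ holx L al (fun x s => F2f n x s t) HF1.
Proof.
  intros Ht. destruct (b_ok n _ (kk_ok n t Ht)) as [_ [_ [a hb]]]. destruct (supU n t Ht) as [u v]. assert (A := AU_pos).
  assert (hb' : holx L al (fbn n (kk n t)) (2 * Hq)).
  { intros x x' y d Hy Hd Hx. apply hb; auto. rewrite Rminus_diag, Rabs_R0. lra. }
  assert (kb := KB_pos L al Hq HL Hal Hq0).
  split; intros x x' y d Hy Hd Hx.
  - assert (K : holx L al (fun x s => Uf n x s t * fbn n (kk n t) x s) ((KB L al Hq + 2 * AU) * M0 + AU * (2 * Hq))).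
    { apply (holx_mult L al (fun x s => Uf n x s t) (fbn n (kk n t)) AU (KB L al Hq) M0 (2 * Hq)); auto; try lra.
      intros z z' s Hs. apply (lipU n t Ht z z' s Hs). }
    eapply Rle_trans; [apply (K x x' y d Hy Hd Hx)|].
    apply Rmult_le_compat_r; [left; apply Rpower_pos|]. unfold HF1. lra.
  - assert (K : holx L al (fun x s => Vf n x s t * fbn n (kk n t) x s) ((KB L al Hq + 2 * AU) * M0 + AU * (2 * Hq))).
    { apply (holx_mult L al (fun x s => Vf n x s t) (fbn n (kk n t)) AU (KB L al Hq) M0 (2 * Hq)); auto; try lra.
      intros z z' s Hs. apply (lipU n t Ht z z' s Hs). }
    eapply Rle_trans; [apply (K x x' y d Hy Hd Hx)|].
    apply Rmult_le_compat_r; [left; apply Rpower_pos|]. unfold HF1. lra.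
Qed.
Let s1' := fun n t Ht => proj1 (sF1 n t Ht).
Let s2' := fun n t Ht => proj2 (sF1 n t Ht).
Let h1' := fun n t Ht => proj1 (hF1 n t Ht).
Let h2' := fun n t Ht => proj2 (hF1 n t Ht).
Let t1 := EC_time L T F1f EC_F1.
Let t2 := EC_time L T F2f EC_F2.
Let mp := MF1_pos.
Let hp := HF1_pos.

Definition Pf : fam := fun n x s t => pres (en n) L n c0 (gQ mu f (qn n (kk n t))) (fbn n (kk n t)) x s.
Definition Pxf : fam := fun n x s t => presx (en n) L n c0 (gQ mu f (qn n (kk n t))) (fbn n (kk n t)) x s.
Definition Psf : fam := fun n x s t => press (en n) L n c0 (gQ mu f (qn n (kk n t))) (fbn n (kk n t)) x s.

Lemma EC_P : EC L T Pf.
Proof.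
  apply (EC_ext L T (fun n x s t => (UF L en Nn F1f (-1) n x s t + VF L en Nn F2f 1 n x s t) - MI F1f n x s t)); [intros; reflexivity|].
  apply EC_minus; [apply EC_plus|].
  - apply (EC_UF L T al en Nn F1f MF1 HF1); auto using en_b.
  - apply (EC_VF L T al en Nn F2f HF1); auto using en_b.
  - apply (EC_MI L T F1f MF1); auto.
Qed.
Lemma BD_P : BD L T Pf.
Proof.
  apply (BD_ext L T (fun n x s t => (UF L en Nn F1f (-1) n x s t + VF L en Nn F2f 1 n x s t) - MI F1f n x s t)); [intros; reflexivity|].
  apply BD_minus; [apply BD_plus|].
  - apply (BD_UF L T al en Nn F1f MF1); auto using en_b.
  - apply (BD_VF L T al en Nn F2f MF1); auto using en_b.
  - apply (BD_MI L T F1f MF1); auto.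
Qed.
Lemma EC_Px : EC L T Pxf.
Proof.
  apply (EC_plus L T (UF' L en Nn F1f (-1)) (VF' L en Nn F2f 1)).
  - apply (EC_UF' L T al en Nn F1f MF1 HF1); auto using en_b.
  - apply (EC_VF' L T al en Nn F2f HF1); auto using en_b.
Qed.
Lemma BD_Px : BD L T Pxf.
Proof.
  apply (BD_plus L T (UF' L en Nn F1f (-1)) (VF' L en Nn F2f 1)).
  - apply (BD_UF' L T al en Nn F1f HF1); auto using en_b.
  - apply (BD_VF' L T al en Nn F2f HF1); auto using en_b.
Qed.
Lemma SM_Z1 : SM L T (fun n x s t => ZF L en Nn F1f n x s t + MF F1f n x s t - F1f n x s t).
Proof. apply (SM_Z L T al en Nn F1f MF1 HF1); auto using en_b. Qed.
Lemma SM_Z2 : SM L T (fun n x s t => ZF L en Nn F2f n x s t + MF F2f n x s t - F2f n x s t).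
Proof. apply (SM_Z L T al en Nn F2f MF1 HF1); auto using en_b. Qed.
Lemma Ps_form n x s t : Psf n x s t = ((VF' L en Nn F1f (-1) n x s t - UF' L en Nn F2f 1 n x s t) - F1f n x s t)
   - (ZF L en Nn F1f n x s t + MF F1f n x s t - F1f n x s t).
Proof.
  change (Psf n x s t) with ((VF' L en Nn F1f (-1) n x s t - UF' L en Nn F2f 1 n x s t) - (ZF L en Nn F1f n x s t + MF F1f n x s t)). ring.
Qed.
Lemma EC_Ps : EC L T Psf.
Proof.
  eapply EC_ext; [intros n x s t _; symmetry; apply Ps_form|].
  apply EC_minus; [apply EC_minus; [apply EC_minus|apply EC_F1]|apply SM_EC, SM_Z1].
  - apply (EC_VF' L T al en Nn F1f HF1); auto using en_b.
  - apply (EC_UF' L T al en Nn F2f MF1 HF1); auto using en_b.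
Qed.
Lemma BD_Ps : BD L T Psf.
Proof.
  eapply BD_ext; [intros n x s t _; symmetry; apply Ps_form|].
  apply BD_minus; [apply BD_minus; [apply BD_minus|apply BD_F1]|apply SM_BD, SM_Z1].
  - apply (BD_VF' L T al en Nn F1f HF1); auto using en_b.
  - apply (BD_UF' L T al en Nn F2f HF1); auto using en_b.
Qed.

Definition DUf : fam := fun n x s t => (Ug (en n) L n c0 (gQ mu f (qn n (S (kk n t)))) x s - Uf n x s t) / hn n.
Definition DVf : fam := fun n x s t => (Vg (en n) L n (gQ mu f (qn n (S (kk n t)))) x s - Vf n x s t) / hn n.
Lemma kS n t : 0 <= t <= T -> INR (S (kk n t)) * hn n <= T + hn n.
Proof. intros Ht. destruct (kk_T n t Ht). rewrite S_INR. lra. Qed.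

(** Two errors: the residual of the vorticity equation, at most (L + K0 L) en n, and the approximate
    identity applied to the flux [F2f]. *)
Lemma SM_DU : SM L T (fun n x s t => DUf n x s t - (F2f n x s t - Pxf n x s t)).
Proof.
  intros eta He. destruct (SM_Z2 (eta / 2) ltac:(lra)) as [n0 A].
  assert (k0 := K0p). assert (P : 0 < eta / (2 * (L + K0 L))) by (apply Rdiv_lt_0_compat; lra).
  destruct (en_small _ P) as [n1 A1]. exists (max n0 n1). intros n x s t Hn [Hs Ht].
  destruct (hn_b n) as [hh _]. destruct (b_ok n _ (kk_ok n t Ht)) as [bC [bP _]]. destruct (q_ok n _ (kS n t Ht)) as [qC [qP _]].
  assert (cgt : c2 (gQ mu f (qn n (kk n t)))) by exact (cg n t Ht). assert (pgt : per (gQ mu f (qn n (kk n t)))) by exact (pg n t Ht).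
  assert (cg' := c2_gQ al mu f Hal cmu mu1 cf _ qC).
  assert (tr := fun x s Hs => transp n (kk n t) x s (Rle_trans _ _ _ (proj1 (kk_T n t Ht)) (proj2 Ht)) Hs).
  assert (E := momentum_U (en n) L n (en_b n) HL c0 _ _ _ _ _ (hn n) cgt pgt cg' hh bC bP x s Hs).
  assert (Er := proj1 (momentum_err (en n) L n (en_b n) HL c0 _ _ _ _ _ (hn n) (en n) cgt pgt cg' hh bC tr x s Hs)).
  match type of E with ?l = ?a + ?z => set (EE := a) in *; set (ZZ := z) in * end.
  replace (DUf n x s t - (F2f n x s t - Pxf n x s t)) with (EE + ZZ) by (rewrite <- E; unfold DUf, F2f, Pxf, Uf, gf; ring).
  abs_tri.
  assert (B1 := A n x s t ltac:(lia) (conj Hs Ht)). change (Rabs ZZ <= eta / 2) in B1.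
  assert (B2 := A1 n ltac:(lia)).
  assert (B3 : (L + K0 L) * en n <= (L + K0 L) * (eta / (2 * (L + K0 L)))) by (apply Rmult_le_compat_l; lra).
  replace ((L + K0 L) * (eta / (2 * (L + K0 L)))) with (eta / 2) in B3 by (field; lra).
  change (Rabs EE <= (L + K0 L) * en n) in Er. lra.
Qed.
Lemma SM_DV : SM L T (fun n x s t => DVf n x s t - (- F1f n x s t - Psf n x s t)).
Proof.
  intros eta He. destruct (SM_Z1 (eta / 2) ltac:(lra)) as [n0 A].
  assert (k0 := K0p). assert (P : 0 < eta / (2 * (L + K0 L))) by (apply Rdiv_lt_0_compat; lra).
  destruct (en_small _ P) as [n1 A1]. exists (max n0 n1). intros n x s t Hn [Hs Ht].
  destruct (hn_b n) as [hh _]. destruct (b_ok n _ (kk_ok n t Ht)) as [bC [bP _]]. destruct (q_ok n _ (kS n t Ht)) as [qC [qP _]].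
  assert (cgt : c2 (gQ mu f (qn n (kk n t)))) by exact (cg n t Ht). assert (pgt : per (gQ mu f (qn n (kk n t)))) by exact (pg n t Ht).
  assert (cg' := c2_gQ al mu f Hal cmu mu1 cf _ qC).
  assert (tr := fun x s Hs => transp n (kk n t) x s (Rle_trans _ _ _ (proj1 (kk_T n t Ht)) (proj2 Ht)) Hs).
  assert (E := momentum_V (en n) L n (en_b n) HL c0 _ _ _ _ _ (hn n) cgt pgt cg' bC bP x s Hs).
  assert (Er := proj2 (momentum_err (en n) L n (en_b n) HL c0 _ _ _ _ _ (hn n) (en n) cgt pgt cg' hh bC tr x s Hs)).
  match type of E with ?l = ?a - ?z => set (EE := a) in *; set (ZZ := z) in * end.
  replace (DVf n x s t - (- F1f n x s t - Psf n x s t)) with (EE + - ZZ) by (transitivity (EE - ZZ); [ring|rewrite <- E; unfold DVf, F1f, Psf, Vf, gf; ring]).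
  abs_tri. rewrite Rabs_Ropp.
  assert (B1 := A n x s t ltac:(lia) (conj Hs Ht)). change (Rabs ZZ <= eta / 2) in B1.
  assert (B2 := A1 n ltac:(lia)).
  assert (B3 : (L + K0 L) * en n <= (L + K0 L) * (eta / (2 * (L + K0 L)))) by (apply Rmult_le_compat_l; lra).
  replace ((L + K0 L) * (eta / (2 * (L + K0 L)))) with (eta / 2) in B3 by (field; lra).
  change (Rabs EE <= (L + K0 L) * en n) in Er. lra.
Qed.

Lemma kk_grid n i : kk n (INR i * hn n) = i.
Proof. destruct (hn_b n). replace (INR i * hn n / hn n) with (INR i) by (field; lra). apply kf_INR. Qed.

(** A discrete fundamental theorem: the increments are summed over the grid points between t and t',
    where G stays close to its value at t. The ends of the interval miss the grid by less than one
    step, which costs hn n times a bound of G and is covered by eps. *)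
Lemma time_derivative_cond (A : nat -> nat -> R -> R -> R) (G : fam) : EC L T G -> BD L T G ->
  SM L T (fun n x s t => (A n (S (kk n t)) x s - A n (kk n t) x s) / hn n - G n x s t) ->
  forall x s t, 0 <= s <= L -> 0 < t < T -> forall eta, 0 < eta -> exists d, 0 < d /\ forall t', Rabs (t' - t) < d -> 0 <= t' <= T ->
  forall eps, 0 < eps -> exists n0, forall n, (n0 <= n)%nat ->
    Rabs (A n (kk n t') x s - A n (kk n t) x s - (t' - t) * G n x s t) <= eta * Rabs (t' - t) + eps.
Proof.
  intros EG [MG [m0 [MGp BG]]] SA x s t Hs Ht eta He.
  destruct (EG (eta / 2) ltac:(lra)) as [d [n1 [Hd A1]]]. destruct (SA (eta / 2) ltac:(lra)) as [n2 A2].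
  exists (d / 2). split; [lra|]. intros t' Hd' Ht' eps Heps.
  (* Steps below d / 2 keep the grid point preceding the interval within d of t; the second bound
     pays for the mismatch with the grid. *)
  assert (P : 0 < Rmin (d / 2) (eps / (eta + MG))) by (apply Rmin_pos; [lra|apply Rdiv_lt_0_compat; lra]).
  destruct (en_small _ P) as [n3 A3]. exists (max (max m0 n1) (max n2 n3)). intros n Hn.
  destruct (hn_b n) as [h0 h1]. assert (h2 := A3 n ltac:(lia)).
  assert (r1 := Rmin_l (d / 2) (eps / (eta + MG))). assert (r2 := Rmin_r (d / 2) (eps / (eta + MG))).
  assert (hM : hn n * (eta + MG) <= eps).
  { apply Rle_trans with (eps / (eta + MG) * (eta + MG)); [apply Rmult_le_compat_r; lra|]. apply Req_le. field. lra. }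
  assert (step : forall k j, INR (k + j) * hn n <= T -> (forall i, (k <= i <= k + j)%nat -> Rabs (INR i * hn n - t) <= d) ->
    Rabs (A n (k + j)%nat x s - A n k x s - INR j * hn n * G n x s t) <= INR j * hn n * eta).
  { intros k. induction j as [|j IH]; intros HT' Hi.
    - rewrite Nat.add_0_r. simpl. rewrite !Rmult_0_l, Rminus_diag, Rminus_0_r, Rabs_R0. lra.
    - rewrite Nat.add_succ_r in *. rewrite S_INR in HT'.
      assert (IH' := IH ltac:(lra) ltac:(intros; apply Hi; lia)).
      assert (D : dom L T s (INR (k + j) * hn n)) by (split; [exact Hs|split; [apply Rmult_le_pos; [apply pos_INR|lra]|lra]]).
      assert (B2 := A2 n x s _ ltac:(lia) D). cbv beta in B2. rewrite kk_grid in B2.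
      assert (B1 := A1 n x s (INR (k + j) * hn n) x s t ltac:(lia) D ltac:(split; lra)
        ltac:(rewrite Rminus_diag, Rabs_R0; lra) ltac:(rewrite Rminus_diag, Rabs_R0; lra) ltac:(apply Hi; lia)).
      set (a0 := A n k x s) in *. set (a1 := A n (k + j)%nat x s) in *. set (a2 := A n (S (k + j)) x s) in *.
      set (g1 := G n x s (INR (k + j) * hn n)) in *. set (g := G n x s t) in *.
      rewrite S_INR.
      replace (a2 - a0 - (INR j + 1) * hn n * g) with ((a1 - a0 - INR j * hn n * g) + hn n * (((a2 - a1) / hn n - g1) + (g1 - g))) by (field; lra).
      abs_tri. rewrite Rabs_mult, (Rabs_right (hn n)) by lra.
      assert (K : Rabs ((a2 - a1) / hn n - g1 + (g1 - g)) <= eta) by (eapply Rle_trans; [apply Rabs_triang|]; lra).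
      assert (hn n * Rabs ((a2 - a1) / hn n - g1 + (g1 - g)) <= hn n * eta) by (apply Rmult_le_compat_l; lra). lra. }
  assert (gb : Rabs (G n x s t) <= MG) by (apply BG; [lia|split; lra]).
  assert (main : forall ta tb, 0 <= ta -> ta <= tb -> tb <= T -> tb - ta < d / 2 -> ta <= t <= tb ->
     Rabs (A n (kk n tb) x s - A n (kk n ta) x s - (tb - ta) * G n x s t) <= eta * (tb - ta) + eps).
  { intros ta tb H1 H2 H3 H4 H5.
    assert (km : (kk n ta <= kk n tb)%nat).
    { apply kf_mono. split; [apply Rdiv_le_0_compat; lra|]. apply Rmult_le_compat_r; [left; apply Rinv_0_lt_compat; lra|lra]. }
    destruct (kk_T n ta ltac:(lra)) as [u1 u2]. destruct (kk_T n tb ltac:(lra)) as [u3 u4].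
    set (k1 := kk n ta) in *. set (k2 := kk n tb) in *.
    assert (S0 := step k1 (k2 - k1)%nat). replace (k1 + (k2 - k1))%nat with k2 in S0 by lia.
    rewrite minus_INR in S0 by exact km.
    assert (S1 : Rabs (A n k2 x s - A n k1 x s - (INR k2 - INR k1) * hn n * G n x s t) <= (INR k2 - INR k1) * hn n * eta).
    { apply S0; [lra|]. intros i [i1 i2]. apply le_INR in i1. apply le_INR in i2.
      assert (INR k1 * hn n <= INR i * hn n) by (apply Rmult_le_compat_r; lra).
      assert (INR i * hn n <= INR k2 * hn n) by (apply Rmult_le_compat_r; lra).
      apply Rabs_le. lra. }
    replace (A n k2 x s - A n k1 x s - (tb - ta) * G n x s t) with
      ((A n k2 x s - A n k1 x s - (INR k2 - INR k1) * hn n * G n x s t) + ((INR k2 - INR k1) * hn n - (tb - ta)) * G n x s t) by ring.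
    abs_tri. rewrite Rabs_mult.
    assert (Rabs ((INR k2 - INR k1) * hn n - (tb - ta)) <= hn n) by (apply Rabs_le; lra).
    assert (Rabs ((INR k2 - INR k1) * hn n - (tb - ta)) * Rabs (G n x s t) <= hn n * MG) by (apply Rmult_le_compat; auto using Rabs_pos).
    assert ((INR k2 - INR k1) * hn n * eta <= (tb - ta + hn n) * eta) by (apply Rmult_le_compat_r; lra).
    lra. }
  destruct (Rle_dec t t') as [h|h].
  - rewrite Rabs_right in Hd' by lra. rewrite (Rabs_right (t' - t)) by lra. apply main; lra.
  - rewrite Rabs_left in Hd' by lra. rewrite (Rabs_left (t' - t)) by lra.
    rewrite <- Rabs_Ropp. replace (- (A n (kk n t') x s - A n (kk n t) x s - (t' - t) * G n x s t)) with (A n (kk n t) x s - A n (kk n t') x s - (t - t') * G n x s t) by ring.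
    replace (- (t' - t)) with (t - t') by ring. apply main; lra.
Qed.

Lemma ulim_near (a b : nat -> R) l : small (fun n => a n - b n) -> ulim b l -> ulim a l.
Proof.
  intros H1 H2 eps He. destruct (H1 (eps / 2) ltac:(lra)) as [n0 A].
  assert (T0 := ult_tail n0 (fun n => Rabs (a n - b n) <= eps / 2) A).
  apply ult_imp with (2 := ult_and _ _ T0 (H2 (eps / 2) ltac:(lra))). intros n [u v].
  replace (a n - l) with ((a n - b n) + (b n - l)) by ring. eapply Rle_lt_trans; [apply Rabs_triang|]. lra.
Qed.

(** The time derivatives of the limit, read off from the momentum equations. Unlike the difference
    quotients they are built from families already known to be equicontinuous. *)
Definition GUf : fam := fun n x s t => F2f n x s t - Pxf n x s t.
Definition GVf : fam := fun n x s t => - F1f n x s t - Psf n x s t.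
Lemma EC_GU : EC L T GUf. Proof. apply EC_minus; [apply EC_F2|apply EC_Px]. Qed.
Lemma BD_GU : BD L T GUf. Proof. apply BD_minus; [apply BD_F2|apply BD_Px]. Qed.
Lemma EC_GV : EC L T GVf. Proof. apply EC_minus; [apply EC_opp, EC_F1|apply EC_Ps]. Qed.
Lemma BD_GV : BD L T GVf. Proof. apply BD_minus; [apply BD_opp, BD_F1|apply BD_Ps]. Qed.

Lemma lim_b x s t : dom L T s t -> ulim (fun n => bf n x s t) (Lf Qf x s t).
Proof.
  intros D. apply ulim_near with (fun n => Qf n x s t); [|apply (Lf_spec L T), D; apply BD_Q].
  intros eta He. destruct (SM_bQ eta He) as [n0 A]. exists n0. intros n Hn. apply (A n x s t Hn D).
Qed.
Lemma lim_Us x s t : dom L T s t -> Lf Usf x s t = Lf Vxf x s t - / mu s * (Lf Qf x s t - f s).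
Proof.
  intros D. apply UL_eq. apply ulim_near with (fun n => Vxf n x s t - gf n x s t).
  - intros eta He. destruct (SM_Us eta He) as [n0 A]. exists n0. intros n Hn. apply (A n x s t Hn D).
  - apply ulim_minus; [apply (Lf_spec L T); [apply BD_Vx|exact D]|].
    apply (ulim_scal (/ mu s) (fun n => Qf n x s t - f s)). apply (ulim_minus (fun n => Qf n x s t) (fun _ => f s)); [|apply ulim_const].
    apply (Lf_spec L T); [apply BD_Q|exact D].
Qed.
Lemma lim_GU x s t : dom L T s t -> Lf GUf x s t = Lf Vf x s t * Lf Qf x s t - Lf Pxf x s t.
Proof.
  intros D. apply UL_eq. apply (ulim_minus (fun n => F2f n x s t)); [|apply (Lf_spec L T); [apply BD_Px|exact D]].
  apply (ulim_mult (fun n => Vf n x s t) (fun n => bf n x s t)); [apply (Lf_spec L T); [apply BD_V|exact D]|apply lim_b, D].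
Qed.
Lemma lim_GV x s t : dom L T s t -> Lf GVf x s t = - (Lf Uf x s t * Lf Qf x s t) - Lf Psf x s t.
Proof.
  intros D. apply UL_eq. apply (ulim_minus (fun n => - F1f n x s t)); [|apply (Lf_spec L T); [apply BD_Ps|exact D]].
  apply ulim_opp. apply (ulim_mult (fun n => Uf n x s t) (fun n => bf n x s t)); [apply (Lf_spec L T); [apply BD_U|exact D]|apply lim_b, D].
Qed.
Lemma Lf_V_bdry x t : 0 <= t <= T -> Lf Vf x 0 t = 0 /\ Lf Vf x L t = 0.
Proof.
  intros Ht. split; apply UL_eq; intros eps He; apply (ult_tail 0); intros n _; unfold Vf, Vg.
  - rewrite Vop_bdry0, Rminus_0_r, Rabs_R0. exact He.
  - rewrite Vop_bdryL, Rminus_0_r, Rabs_R0. exact He.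
Qed.
Let pC n t Ht := pres_C1 (en n) L n (en_b n) HL c0 (gQ mu f (qn n (kk n t))) _ _ _ (cg n t Ht) (pg n t Ht) (proj1 (b_ok n _ (kk_ok n t Ht))) (proj1 (proj2 (b_ok n _ (kk_ok n t Ht)))).
Lemma Lf_Ux x s t : dom L T s t -> is_derive (fun x => Lf Uf x s t) x (Lf Uxf x s t) /\
  is_derive (fun x => Lf Vf x s t) x (Lf Vxf x s t).
Proof.
  intros [Hs Ht]. split.
  - apply (Lf_dx L T); [apply BD_U|apply BD_Ux|apply EC_Ux|split; assumption|].
    intros n z. apply (Ug_dx (en n) L n (en_b n) HL c0 _ (cg n t Ht) (pg n t Ht)), Hs.
  - apply (Lf_dx L T); [apply BD_V|apply BD_Vx|apply EC_Vx|split; assumption|].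
    intros n z. apply (Vg_dx (en n) L n (en_b n) HL _ (cg n t Ht) (pg n t Ht)), Hs.
Qed.
Lemma Lf_d x s t : 0 < s < L -> 0 <= t <= T ->
  (is_derive (fun x => Lf Pf x s t) x (Lf Pxf x s t) /\ is_derive (fun s => Lf Pf x s t) s (Lf Psf x s t)) /\
  is_derive (fun s => Lf Uf x s t) s (Lf Usf x s t) /\
  is_derive (fun s => Lf Vf x s t) s (- Lf Uxf x s t).
Proof.
  intros Hs Ht. assert (D : dom L T s t) by (split; lra). split; [split|split].
  - apply (Lf_dx L T); [apply BD_P|apply BD_Px|apply EC_Px|exact D|].
    intros n z. apply (C1_dx _ _ _ _ (pC n t Ht)), Hs.
  - apply (Lf_ds L T); [apply BD_P|apply BD_Ps|apply EC_Ps|exact Hs|exact Ht|].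
    intros n z Hz. apply (C1_ds _ _ _ _ (pC n t Ht)), Hz.
  - apply (Lf_ds L T); [apply BD_U|apply BD_Us|apply EC_Us|exact Hs|exact Ht|].
    intros n z Hz. apply (C1_ds _ _ _ _ (Ug_C1 (en n) L n (en_b n) HL c0 _ (cg n t Ht) (pg n t Ht))), Hz.
  - replace (- Lf Uxf x s t) with (Lf (fun n x s t => - Uxf n x s t) x s t).
    + apply (Lf_ds L T); [apply BD_V|apply BD_opp, BD_Ux|apply EC_opp, EC_Ux|exact Hs|exact Ht|].
      intros n z Hz. apply (C1_ds _ _ _ _ (Vg_C1 (en n) L n (en_b n) HL _ (cg n t Ht) (pg n t Ht))), Hz.
    + apply UL_eq. apply ulim_opp. apply (Lf_spec L T); [apply BD_Ux|exact D].
Qed.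
Lemma Lf_t x s t : 0 <= s <= L -> 0 < t < T ->
  is_derive (fun t => Lf Uf x s t) t (Lf GUf x s t) /\ is_derive (fun t => Lf Vf x s t) t (Lf GVf x s t).
Proof.
  intros Hs Ht. split.
  - apply (Lf_dt L T Uf GUf); [apply BD_U|apply BD_GU|exact Hs|exact Ht|].
    apply (time_derivative_cond (fun n k => Ug (en n) L n c0 (gQ mu f (qn n k)))); [apply EC_GU|apply BD_GU|apply SM_DU|exact Hs|exact Ht].
  - apply (Lf_dt L T Vf GVf); [apply BD_V|apply BD_GV|exact Hs|exact Ht|].
    apply (time_derivative_cond (fun n k => Vg (en n) L n (gQ mu f (qn n k)))); [apply EC_GV|apply BD_GV|apply SM_DV|exact Hs|exact Ht].
Qed.
Lemma kk_0 n : kk n 0 = 0%nat.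
Proof. unfold Rdiv. rewrite Rmult_0_l. apply (kf_INR 0). Qed.
(** At t = 0 the constant c0 enters only additively, since the initial density does not depend on
    it. Therefore c0 can be prescribed before the scheme is run, although all later steps depend on
    it. *)
Lemma Lf_U0 x s : 0 <= s <= L -> Lf Uf x s 0 = c0 + UL (fun n => Ug (en n) L n 0 (gQ mu f (qn n 0%nat)) x s).
Proof.
  intros Hs. assert (S0 := Lf_spec L T Uf x s 0 BD_U ltac:(split; lra)).
  replace (UL (fun n => Ug (en n) L n 0 (gQ mu f (qn n 0%nat)) x s)) with (Lf Uf x s 0 - c0); [ring|]. symmetry. apply UL_eq.
  apply ulim_near with (fun n => Uf n x s 0 - c0).
  - intros eta He. exists 0%nat. intros n _. unfold Uf. rewrite kk_0. unfold Ug.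
    match goal with |- Rabs ?e <= _ => replace e with 0 by ring end. rewrite Rabs_R0. lra.
  - apply (ulim_minus (fun n => Uf n x s 0) (fun _ => c0)); [exact S0|apply ulim_const].
Qed.

Lemma evolution_limit (Q0 : R -> R -> R) (c : R) :
  (forall x s, 0 <= s <= L -> small (fun n => qn n 0%nat x s - Q0 x s)) ->
  c0 + UL (fun n => Ug (en n) L n 0 (gQ mu f (qn n 0%nat)) 0 0) = c ->
  strip_sol L T mu f Q0 c (Lf Uf) (Lf Vf) (Lf Pf) (Lf Uxf) (Lf Vxf) (Lf Usf) (Lf Pxf) (Lf Psf) (Lf GUf) (Lf GVf) (Lf Qf).
Proof.
  intros HQ Hc.
  assert (uc : forall fm, EC L T fm -> BD L T fm -> ucont L T (Lf fm)) by (intros fm E1 E2; exact (Lf_cont L T fm E1 E2)).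
  split.
  - intros x s t Hs Ht. unfold Lf.  split; [|split]; f_equal; apply functional_extensionality; intros n.
    + apply (per_Ug (en n) L n c0 _ (pg n t Ht)).
    + apply (per_Vg (en n) L n _ (pg n t Ht)).
    + apply (per_pres (en n) L n c0 _ _ (pg n t Ht)). apply (b_ok n _ (kk_ok n t Ht)).
  - exact (conj (conj (uc _ EC_U BD_U) (conj (uc _ EC_V BD_V) (conj (uc _ EC_P BD_P) (conj (uc _ EC_Ux BD_Ux) (uc _ EC_Vx BD_Vx)))))
      (conj (uc _ EC_Us BD_Us) (conj (uc _ EC_Px BD_Px) (conj (uc _ EC_Ps BD_Ps) (conj (uc _ EC_GU BD_GU) (uc _ EC_GV BD_GV)))))).
  - intros x s t Hs Ht. apply Lf_Ux. split; assumption.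
  - intros x s t Hs Ht. apply Lf_d; assumption.
  - intros x s t Hs Ht. apply Lf_t; assumption.
  - intros x s t Hs Ht. split; [apply lim_Us; split; assumption|split; [apply lim_GU; split; assumption|apply lim_GV; split; assumption]].
  - intros x t Ht. apply Lf_V_bdry, Ht.
  - intros x s Hs. apply UL_eq. apply ulim_near with (fun _ => Q0 x s); [|apply ulim_const].
    unfold Qf. intros eta He. destruct (HQ x s Hs eta He) as [n0 A]. exists n0. intros n Hn. rewrite kk_0. apply A, Hn.
  - rewrite Lf_U0 by lra. exact Hc.
Qed.
End Evolution.

Lemma strip_exists (L T al : R) (mu mu' f : R -> R) (Cmu Cf M0 H c : R) (Q0 : R -> R -> R) :
  0 < L -> 0 < al < 1 -> 0 < T -> cont mu -> cont mu' -> (forall s, 1 <= mu s) -> (forall s, is_derive mu s (mu' s)) ->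
  (forall s, 0 <= s <= L -> mu s <= Cmu /\ Rabs (mu' s) <= Cmu) -> cont f -> (forall s, 0 <= s <= L -> Rabs (f s) <= Cf) ->
  c2 Q0 -> per Q0 -> supb L Q0 M0 -> hol2 L al Q0 H ->
  exists U V P Ux Vx Us Px Ps Ut Vt Q, strip_sol L T mu f Q0 c U V P Ux Vx Us Px Ps Ut Vt Q.
Proof.
  intros HL Hal HT cmu cmu' mu1 dmu mub cf fb cQ pQ sQ hQ.
  assert (HM0 : 0 <= M0) by (eapply Rle_trans; [apply Rabs_pos|apply (sQ 0 0); lra]).
  (* The maximum with exp 1 makes the logarithm of the Hölder constant at least 1. *)
  set (y0 := ln (Rmax H (exp 1))).
  assert (e1 := exp_pos 1). assert (m1 := Rmax_l H (exp 1)). assert (m2 := Rmax_r H (exp 1)).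
  assert (ey : exp y0 = Rmax H (exp 1)) by (apply exp_ln; lra).
  assert (Hy0 : 1 <= y0) by (rewrite <- (ln_exp 1); apply ln_le; lra).
  assert (hQ' : hol2 L al Q0 (exp y0)).
  { intros x s x' s' d Hs Hs' Hd Hx Hds. eapply Rle_trans; [apply (hQ x s x' s' d); assumption|].
    apply Rmult_le_compat_r; [left; apply Rpower_pos|lra]. }
  assert (mol : forall n, exists z : (R -> R -> R) * (R -> R -> R) * (R -> R -> R) * R,
    let '(Q, Qx, Qs, G) := z in (C1 L Q Qx Qs /\ per Q) /\ (supb L Q M0 /\ hol2 L al Q (exp y0)) /\
    (supb L Qx G /\ supb L Qs G) /\ (forall x s, 0 <= s <= L -> Rabs (Q x s - Q0 x s) <= exp y0 * Rpower (en n) al)).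
  { intros n. destruct (steklov L al Q0 M0 (exp y0) HL cQ pQ sQ hQ' (en n) (proj1 (en_b n))) as [Q [Qx [Qs [G Z]]]].
    exists (Q, Qx, Qs, G). exact Z. }
  set (mz := fun n => proj1_sig (constructive_indefinite_description _ (mol n))).
  assert (mzp := fun n => proj2_sig (constructive_indefinite_description _ (mol n))).
  change (forall n, let '(Q, Qx, Qs, G) := mz n in (C1 L Q Qx Qs /\ per Q) /\ (supb L Q M0 /\ hol2 L al Q (exp y0)) /\
    (supb L Qx G /\ supb L Qs G) /\ (forall x s, 0 <= s <= L -> Rabs (Q x s - Q0 x s) <= exp y0 * Rpower (en n) al)) in mzp.
  set (Qn := fun n => fst (fst (fst (mz n)))).
  (* The limit is taken over the mollified initial densities alone, so this choice is not
     circular. *)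
  set (c0 := c - UL (fun n => Ug (en n) L n 0 (gQ mu f (Qn n)) 0 0)).
  set (Y := Ymax L al Cmu Cf c0 M0 T y0).
  set (B := Bc L Cmu Cf c0 M0).
  assert (sch : forall n, exists z : R * (nat -> R -> R -> R) * (nat -> R -> R -> R) * (nat -> R -> R -> R) * (nat -> R -> R -> R),
    let '(h, q, b, bx, bs) := z in 0 < h <= en n /\ q 0%nat = Qn n /\
  (forall k, INR k * h <= T + h ->
     (c2 (q k) /\ per (q k) /\ supb L (q k) M0 /\ hol2 L al (q k) (exp Y)) /\
     (C1 L (b k) (bx k) (bs k) /\ per (b k) /\ supb L (b k) M0 /\ hol2 L al (b k) (2 * exp Y)) /\
     (forall x s, 0 <= s <= L -> Rabs (b k x s - q k x s) <= en n)) /\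
  (forall k j x s d, INR (k + j) * h <= T + h -> 0 <= s <= L -> 0 < d -> INR j * (h * B) <= d ->
     Rabs (q (k + j)%nat x s - q k x s) <= exp Y * Rpower d al) /\
  (forall k x s, INR k * h <= T -> 0 < s < L ->
     Rabs ((gQ mu f (q (S k)) x s - gQ mu f (q k) x s) / h
        + (Ug (en n) L n c0 (gQ mu f (q k)) x s * bx k x s + Vg (en n) L n (gQ mu f (q k)) x s * bs k x s)) <= en n)).
  { intros n. assert (mp := mzp n). unfold Qn. destruct (mz n) as [[[Q Qx] Qs] G]. simpl.
    destruct mp as [[u1 u2] [[u3 u4] [[u5 u6] u7]]].
    destruct (scheme_exists L al mu mu' f Cmu Cf c0 M0 T HL Hal HT cmu cmu' mu1 dmu mub cf fb HM0 y0 Hy0 (en n) n Q Qx Qs G (en n) (en_b n) (proj1 (en_b n)) u1 u2 u3 u4 u5 u6)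
      as [h [q [b [bx [bs Z]]]]]. exists (h, q, b, bx, bs). exact Z. }
  set (sz := fun n => proj1_sig (constructive_indefinite_description _ (sch n))).
  assert (szp := fun n => proj2_sig (constructive_indefinite_description _ (sch n))).
  set (hn := fun n => fst (fst (fst (fst (sz n))))). set (qn := fun n => snd (fst (fst (fst (sz n))))).
  set (bn := fun n => snd (fst (fst (sz n)))). set (bxn := fun n => snd (fst (sz n))). set (bsn := fun n => snd (sz n)).
  assert (ZZ : forall n, (0 < hn n <= en n /\ qn n 0%nat = Qn n) /\
  (forall k, INR k * hn n <= T + hn n ->
     (c2 (qn n k) /\ per (qn n k) /\ supb L (qn n k) M0 /\ hol2 L al (qn n k) (exp Y)) /\
     (C1 L (bn n k) (bxn n k) (bsn n k) /\ per (bn n k) /\ supb L (bn n k) M0 /\ hol2 L al (bn n k) (2 * exp Y)) /\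
     (forall x s, 0 <= s <= L -> Rabs (bn n k x s - qn n k x s) <= en n)) /\
  (forall k j x s d, INR (k + j) * hn n <= T + hn n -> 0 <= s <= L -> 0 < d -> INR j * (hn n * B) <= d ->
     Rabs (qn n (k + j)%nat x s - qn n k x s) <= exp Y * Rpower d al) /\
  (forall k x s, INR k * hn n <= T -> 0 < s < L ->
     Rabs ((gQ mu f (qn n (S k)) x s - gQ mu f (qn n k) x s) / hn n
        + (Ug (en n) L n c0 (gQ mu f (qn n k)) x s * bxn n k x s + Vg (en n) L n (gQ mu f (qn n k)) x s * bsn n k x s)) <= en n)).
  { intros n. assert (z := szp n). unfold hn, qn, bn, bxn, bsn, sz.
    destruct (proj1_sig (constructive_indefinite_description _ (sch n))) as [[[[h q] b] bx] bs]. simpl.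
    destruct z as [z1 [z2 z3]]. split; [split; assumption|exact z3]. }
  clearbody hn qn bn bxn bsn. clear sz szp sch.
  assert (hB : 0 < B) by (eapply Bc_pos; eauto).
  assert (sml : forall x s, 0 <= s <= L -> small (fun n => qn n 0%nat x s - Q0 x s)).
  { intros x s Hs eta He. destruct (Rpower_small (exp y0) al eta (exp_pos _) ltac:(lra) He) as [d [Hd A]].
    destruct (en_small al Hal d Hd) as [n0 B0]. exists n0. intros n Hn.
    rewrite (proj2 (proj1 (ZZ n))). assert (mp := mzp n). unfold Qn. destruct (mz n) as [[[Q Qx] Qs] G]. simpl.
    destruct mp as [_ [_ [_ mp]]]. eapply Rle_trans; [apply mp, Hs|]. eapply Rle_trans; [|exact A].
    apply Rmult_le_compat_l; [left; apply exp_pos|]. apply Rpower_le_base; [split; [apply (proj1 (en_b n))|apply B0, Hn]|lra]. }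
  assert (hc : c0 + UL (fun n => Ug (en n) L n 0 (gQ mu f (qn n 0%nat)) 0 0) = c).
  { replace (fun n => Ug (en n) L n 0 (gQ mu f (qn n 0%nat)) 0 0) with (fun n => Ug (en n) L n 0 (gQ mu f (Qn n)) 0 0); [unfold c0; ring|].
    apply functional_extensionality. intros n. rewrite (proj2 (proj1 (ZZ n))). reflexivity. }
  do 11 eexists. eapply (evolution_limit L T al mu f Cf c0 M0) with (fbn := bn) (fbxn := bxn) (fbsn := bsn) (hn := hn) (qn := qn) (Y := Y) (B := B); eauto; try (intros; apply ZZ; assumption).
Qed.

(** * The div-curl system *)

Lemma cont_zero_closed (f : R -> R) a b : a < b -> cont f -> (forall x, a < x < b -> f x = 0) -> forall x, a <= x <= b -> f x = 0.
Proof.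
  intros Hab Hf H x Hx. destruct (Req_dec (f x) 0) as [h|h]; [exact h|exfalso].
  destruct (proj1 (continuous_eps f x) (Hf x) (Rabs (f x)) (Rabs_pos_lt _ h)) as [d [Hd A]].
  assert (E : exists y, a < y < b /\ Rabs (y - x) < d).
  { set (r := Rmin (d / 2) ((b - a) / 3)).
    assert (r1 : r <= d / 2) by apply Rmin_l. assert (r2 : r <= (b - a) / 3) by apply Rmin_r.
    assert (r0 : 0 < r) by (apply Rmin_pos; lra).
    destruct (Rle_dec x ((a + b) / 2)).
    - exists (x + r). split; [lra|]. rewrite Rabs_right; lra.
    - exists (x - r). split; [lra|]. rewrite Rabs_left; lra. }
  destruct E as [y [Hy Hd']]. specialize (A y Hd'). rewrite (H y Hy) in A.
  replace (0 - f x) with (- f x) in A by ring. rewrite Rabs_Ropp in A. lra.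
Qed.

Lemma RInt_nonneg (f : R -> R) a b : a <= b -> cont f -> (forall x, a < x < b -> 0 <= f x) -> 0 <= RInt f a b.
Proof. intros Hab Hf H. apply RInt_ge_0; [exact Hab|apply cont_ex_RInt, Hf|exact H]. Qed.

(** Both parts of the integral are nonnegative and add up to zero, so the primitive vanishes
    identically and so does its derivative f. *)
Lemma RInt_zero_nonneg (f : R -> R) a b : a < b -> cont f -> (forall x, a < x < b -> 0 <= f x) -> RInt f a b = 0 ->
  forall x, a <= x <= b -> f x = 0.
Proof.
  intros Hab Hf H H0. apply cont_zero_closed; auto. intros x Hx.
  assert (G0 : forall y, a < y < b -> RInt f a y = 0).
  { intros y Hy. assert (C := RI_chasles f a y Hf b). assert (A1 := RInt_nonneg f a y ltac:(lra) Hf ltac:(intros; apply H; lra)).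
    assert (A2 := RInt_nonneg f y b ltac:(lra) Hf ltac:(intros; apply H; lra)). rewrite H0 in C.
    change (@eq R (RInt f a y + RInt f y b) 0) in C. change (RInt f a y = 0 :> R). lra. }
  assert (D : is_derive (fun y => RInt f a y) x (f x)).
  { apply (is_derive_RInt (V := RC) f (RInt f a) a x); [|apply Hf].
    exists (mkposreal 1 Rlt_0_1). intros y _. apply RInt_correct, cont_ex_RInt, Hf. }
  apply is_derive_unique in D. rewrite <- D.
  assert (r0 : 0 < Rmin (x - a) (b - x)) by (apply Rmin_pos; lra).
  rewrite (Derive_ext_loc _ (fun _ => 0)); [apply Derive_const|].
  exists (mkposreal _ r0). intros y Hy. change (Rabs (y - x) < Rmin (x - a) (b - x)) in Hy.
  assert (m1 := Rmin_l (x - a) (b - x)). assert (m2 := Rmin_r (x - a) (b - x)). apply Rabs_def2 in Hy. apply G0. lra.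
Qed.

Lemma mean_zero_nonneg (E : R -> R -> R) s : c2 E -> (forall x, E (x + 2 * PI) s = E x s) -> (forall x, 0 <= E x s) -> mean E s = 0 -> forall x, E x s = 0.
Proof.
  intros cE pE nE H x. assert (Hp := PI_RGT_0). assert (c := c2_slice2 E s cE).
  apply (RInt_zero_nonneg (fun x => E x s) (x - PI) (x - PI + 2 * PI)); [lra|exact c|intros; apply nE| |lra].
  rewrite (RI_period (fun x => E x s)) by (auto; exact c). unfold mean in H.
  apply Rmult_eq_reg_r with (/ (2 * PI)); [rewrite Rmult_0_l; exact H|]. apply Rinv_neq_0_compat. lra.
Qed.

Lemma mean_plus g k s : c2 g -> c2 k -> mean (fun x s => g x s + k x s) s = mean g s + mean k s.
Proof.
  intros Hg Hk. unfold mean. rewrite (RI_plus (fun x => g x s) (fun x => k x s)) by (apply c2_slice2; assumption).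
  unfold Rdiv. apply Rmult_plus_distr_r.
Qed.
Lemma mean_scal (c : R -> R) g s : c2 g -> mean (fun x s => c s * g x s) s = c s * mean g s.
Proof.
  intros Hg. unfold mean. rewrite (RI_scal (fun x => g x s)) by (apply c2_slice2; assumption). unfold Rdiv. apply Rmult_assoc.
Qed.
Lemma mean_ext g k s : (forall x, g x s = k x s) -> mean g s = mean k s.
Proof. intros H. unfold mean. f_equal. apply RInt_ext. intros; apply H. Qed.
Lemma mean_const (c : R -> R) s : mean (fun _ s => c s) s = c s.
Proof. assert (Hp := PI_RGT_0). unfold mean. rewrite RI_const. field. lra. Qed.

Lemma const_on_closed (f : R -> R) L : 0 < L -> cont f -> (forall s, 0 < s < L -> is_derive f s 0) -> forall s, 0 <= s <= L -> f s = f 0.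
Proof.
  intros HL Hf D s Hs. assert (E := RInt_FTC_closed f (fun _ => 0) 0 s ltac:(lra) Hf ltac:(apply cont_const) ltac:(intros; apply D; lra)).
  rewrite RI_const in E. lra.
Qed.

(* With W the primitive of w1 - a in x, the mean of W w2 vanishes on both walls and has derivative
   the mean of (w1 - a)^2 + w2^2. *)
Lemma div_curl_zero (L : R) (w1 w1x w1s w2 w2x w2s : R -> R -> R) : 0 < L ->
  C1 L w1 w1x w1s -> C1 L w2 w2x w2s -> per w1 -> per w2 ->
  (forall x s, 0 < s < L -> w1x x s + w2s x s = 0 /\ w2x x s - w1s x s = 0) ->
  (forall x, w2 x 0 = 0 /\ w2 x L = 0) -> w1 0 0 = 0 ->
  forall x s, 0 <= s <= L -> w1 x s = 0 /\ w2 x s = 0.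
Proof.
  intros HL [c1 c1x c1s d1x d1s] [c2' c2x c2s d2x d2s] p1 p2 EQ BD0 Z0. assert (Hp := PI_RGT_0).
  (* The s-derivative of w1 equals the phi-derivative of w2 and has mean zero. *)
  assert (m1 : forall s, 0 <= s <= L -> mean w1 s = mean w1 0).
  { apply const_on_closed; [exact HL|apply cont_mean, c1|]. intros s Hs.
    replace 0 with (mean w1s s); [apply (mean_ds L); auto|].
    rewrite (mean_ext w1s w2x); [apply (mean_dx0 L w2); auto|]. intros x. destruct (EQ x s Hs). lra. }
  assert (m2 : forall s, 0 <= s <= L -> mean w2 s = 0).
  { intros s Hs. rewrite (const_on_closed (mean w2) L HL (cont_mean _ c2')).
    - rewrite (mean_ext w2 (fun _ s => 0)); [apply (mean_const (fun _ => 0))|]. intros x. apply BD0.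
    - intros r Hr. replace 0 with (mean w2s r); [apply (mean_ds L); auto|].
      rewrite (mean_ext w2s (fun x s => (fun _ => -1) s * w1x x s)) by (intros x; destruct (EQ x r Hr); lra).
      rewrite (mean_scal (fun _ => -1)) by exact c1x. rewrite (mean_dx0 L w1 w1x r); auto; ring.
    - exact Hs. }
  set (a := mean w1 0) in *.
  set (z := fun x s => w1 x s - a).
  assert (cz : c2 z) by (unfold c2, z; apply cont_minus; [exact c1|apply cont_const]).
  (* The primitive of z from 0 to x, rescaled to a fixed interval so that joint continuity and the
     derivative in s come from parametric integrals. *)
  set (W := fun x s => RInt (fun y => x * z (x * y) s) 0 1).
  assert (Wf : forall x s, W x s = RInt (fun y => z y s) 0 x).
  { intros x s. rewrite (RInt_rescale (fun y => z y s) 0 x) by (apply c2_slice2, cz). unfold W. apply RInt_ext.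
    intros y _. rewrite Rminus_0_r, Rplus_0_r. reflexivity. }
  assert (cW : c2 W).
  { apply (cont_RInt (U := RU2) (fun p y => fst p * z (fst p * y) (snd p))).
    apply cont_mult; [cont_tac|]. apply (cont_comp2 z); [exact cz|cont_tac|cont_tac]. }
  assert (dWx : forall x s, 0 < s < L -> is_derive (fun x => W x s) x (z x s)).
  { intros x s Hs. apply is_derive_ext with (fun x => RInt (fun y => z y s) 0 x); [intros; symmetry; apply Wf|].
    apply (int0_ds (fun y => z y s)), c2_slice2, cz. }
  set (Ws := fun x s => w2 x s - w2 0 s).
  assert (cWs : c2 Ws).
  { unfold c2, Ws. apply cont_minus; [exact c2'|]. apply (cont_comp2 w2); [exact c2'|apply cont_const|cont_tac]. }
  assert (dWs : forall x s, 0 < s < L -> is_derive (fun s => W x s) s (Ws x s)).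
  { intros x s Hs.
    assert (Hr0 : 0 < Rmin s (L - s)) by (apply Rmin_pos; lra).
    replace (Ws x s) with (RInt ((fun s y => x * w1s (x * y) s) s) 0 1).
    - apply (derive_RInt_param (fun s y => x * z (x * y) s) (fun s y => x * w1s (x * y) s) 0 1 s (Rmin s (L - s))); [lra|exact Hr0| | |].
      + unfold c2. apply cont_mult; [apply cont_const|]. apply (cont_comp2 z); [exact cz|apply cont_mult; [apply cont_const|cont_tac]|cont_tac].
      + unfold c2. apply cont_mult; [apply cont_const|]. apply (cont_comp2 w1s); [exact c1s|apply cont_mult; [apply cont_const|cont_tac]|cont_tac].
      + intros t y Ht _. assert (r1 := Rmin_l s (L - s)). assert (r2 := Rmin_r s (L - s)). apply Rabs_def2 in Ht.
        apply is_derive_scal. unfold z. replace (w1s (x * y) t) with (w1s (x * y) t - 0) by ring.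
        apply (is_derive_minus (V := RN)); [apply d1s; lra|apply (is_derive_const (V := RN))].
    - transitivity (RInt (fun y => x * w2x (x * y) s) 0 1).
      + apply RInt_ext. intros y _. simpl. destruct (EQ (x * y) s Hs). replace (w1s (x * y) s) with (w2x (x * y) s) by lra. reflexivity.
      + rewrite (RInt_FTC_closed (fun y => w2 (x * y) s)); [unfold Ws; rewrite Rmult_1_r, Rmult_0_r; reflexivity|lra| | |].
        * apply (cont_comp2 (U := RU) w2); [exact c2'|cont_tac|apply cont_const].
        * apply (cont_mult (U := RU)); [apply cont_const|].
          apply (cont_comp2 (U := RU) w2x); [exact c2x|cont_tac|apply cont_const].
        * intros y _. apply (is_derive_comp (V := RN) (fun u => w2 u s) (fun y => x * y)); [apply d2x, Hs|].
          auto_derive; [exact I|ring]. }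
  assert (pz : per z) by (intros x s; unfold z; rewrite p1; reflexivity).
  (* W is periodic because z, from which the constant mean of w1 has been removed, has mean zero. *)
  assert (pW : forall x s, 0 <= s <= L -> W (x + 2 * PI) s = W x s).
  { intros x s Hs. rewrite !Wf. rewrite <- (RI_chasles (fun y => z y s) 0 x (c2_slice2 z s cz)).
    rewrite (RI_period (fun y => z y s)); [|apply c2_slice2, cz|intros; apply pz].
    assert (K : mean z s = 0).
    { unfold z. rewrite (mean_ext _ (fun x s => w1 x s + (fun _ => - a) s)) by (intros; ring).
      rewrite (mean_plus w1 (fun _ _ => - a) s c1 (cont_const _)), (mean_const (fun _ => - a)), m1 by exact Hs. ring. }
    unfold mean in K. assert (K' : RInt (fun x => z x s) (- PI) PI = 0).
    { apply Rmult_eq_reg_r with (/ (2 * PI)); [rewrite Rmult_0_l; exact K|]. apply Rinv_neq_0_compat. lra. }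
    rewrite K'. Req. ring. }
  assert (cz1 : C1 L z w1x w1s).
  { constructor; auto.
    - intros x s Hs. unfold z. replace (w1x x s) with (w1x x s - 0) by ring.
      apply (is_derive_minus (V := RN)); [apply d1x, Hs|apply (is_derive_const (V := RN))].
    - intros x s Hs. unfold z. replace (w1s x s) with (w1s x s - 0) by ring.
      apply (is_derive_minus (V := RN)); [apply d1s, Hs|apply (is_derive_const (V := RN))]. }
  assert (CW : C1 L W z Ws) by (constructor; auto).
  assert (Cw2 : C1 L w2 w2x w2s) by (constructor; auto).
  assert (P1 := C1_mult L _ _ _ _ _ _ CW Cw2). assert (P2 := C1_mult L _ _ _ _ _ _ CW cz1).
  set (En := fun x s => w2 x s * w2 x s + z x s * z x s).
  assert (cEn : c2 En) by (unfold c2, En; apply cont_plus; apply cont_mult; assumption).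
  assert (cq : c2 (fun x s => w2 0 s * w2 x s)).
  { apply cont_mult; [|exact c2']. apply (cont_comp2 w2); [exact c2'|apply cont_const|cont_tac]. }
  assert (dA : forall s, 0 < s < L -> is_derive (mean (fun x s => W x s * w2 x s)) s (mean En s)).
  { intros s Hs.
    assert (D := mean_ds L _ _ s (C1_c _ _ _ _ P1) (C1_cs _ _ _ _ P1) Hs (C1_ds _ _ _ _ P1)).
    set (X1 := fun x s : R => Ws x s * w2 x s + W x s * w2s x s) in *.
    assert (cX1 : c2 X1) by exact (C1_cs _ _ _ _ P1).
    set (X2 := fun x s : R => z x s * z x s + W x s * w1x x s) in *.
    assert (cX2 : c2 X2) by exact (C1_cx _ _ _ _ P2).
    assert (E2 : mean X2 s = 0).
    { unfold mean. rewrite (RInt_FTC_closed (fun x => W x s * z x s)); [|lra|apply (c2_slice2 (fun x s => W x s * z x s)), (C1_c _ _ _ _ P2)|apply c2_slice2, cX2|].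
      - assert (u1 := pz (- PI) s). assert (u2 := pW (- PI) s ltac:(lra)). replace (- PI + 2 * PI) with PI in u1, u2 by ring.
        rewrite u1, u2. Req. field. lra.
      - intros x _. apply (C1_dx _ _ _ _ P2), Hs. }
    (* En is X1 + X2 + w2(0, s) w2. The mean of X2 vanishes because it is the x-derivative of the
       periodic W z, and the last mean vanishes because w2 has mean zero. *)
    assert (E1 : mean En s = mean X1 s).
    { rewrite (mean_ext En (fun x s => (X1 x s + X2 x s) + w2 0 s * w2 x s)).
      - rewrite (mean_plus (fun x s => X1 x s + X2 x s) (fun x s => w2 0 s * w2 x s)); [|apply cont_plus; assumption|exact cq].
        rewrite mean_plus by assumption. rewrite (mean_scal (fun s => w2 0 s)) by exact c2'. rewrite m2 by lra. rewrite E2. ring.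
      - intros x. destruct (EQ x s Hs). unfold En, X1, X2, Ws. replace (w1x x s) with (- w2s x s) by lra. ring. }
    rewrite E1. exact D. }
  assert (I0 : RInt (mean En) 0 L = 0).
  { rewrite (RInt_FTC_closed (mean (fun x s => W x s * w2 x s)) (mean En) 0 L); [|lra|apply cont_mean, (C1_c _ _ _ _ P1)|apply cont_mean, cEn|exact dA].
    rewrite !(mean_ext (fun x s => W x s * w2 x s) (fun _ _ => 0)) by (intros x; destruct (BD0 x) as [b1 b2]; rewrite ?b1, ?b2; ring).
    rewrite !(mean_const (fun _ => 0)). Req. ring. }
  assert (En0 : forall x s, 0 <= En x s) by (intros; unfold En; nra).
  assert (mz : forall s, 0 <= s <= L -> mean En s = 0).
  { apply RInt_zero_nonneg; [exact HL|apply cont_mean, cEn| |exact I0]. intros s _. unfold mean.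
    apply Rdiv_le_0_compat; [apply RInt_nonneg; [lra|apply c2_slice2, cEn|auto]|lra]. }
  assert (fin : forall x s, 0 <= s <= L -> w1 x s = a /\ w2 x s = 0).
  { intros x s Hs. assert (E := mean_zero_nonneg En s cEn ltac:(intros y; unfold En; rewrite pz, p2; reflexivity) ltac:(auto) (mz s Hs) x).
    unfold En, z in E. destruct (Rplus_sqr_eq_0 (w2 x s) (w1 x s - a) E). split; lra. }
  assert (a0 : a = 0) by (rewrite <- Z0; symmetry; apply (fin 0 0); lra).
  intros x s Hs. rewrite <- a0 at 1. apply fin, Hs.
Qed.

(** * Energy estimate and uniqueness *)

Lemma c3_fixt (f : R -> R -> R -> R) t : c3 f -> c2 (fun x s => f x s t).
Proof. intros H. unfold c2. apply (cont_comp3 f); [exact H|cont_tac|cont_tac|apply cont_const]. Qed.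
Lemma c3_fixs (f : R -> R -> R -> R) s : c3 f -> c2 (fun x t => f x s t).
Proof. intros H. unfold c2. apply (cont_comp3 f); [exact H|cont_tac|apply cont_const|cont_tac]. Qed.
Lemma c3_cont3 (f : R -> R -> R -> R) x s : c3 f -> cont (fun t => f x s t).
Proof. intros H. apply (cont_comp3 (U := RU) f); [exact H|apply cont_const|apply cont_const|apply cont_id]. Qed.

Lemma c3_plus f g : c3 f -> c3 g -> c3 (fun x s t => f x s t + g x s t).
Proof. intros Hf Hg. apply (cont_plus _ _ Hf Hg). Qed.
Lemma c3_minus f g : c3 f -> c3 g -> c3 (fun x s t => f x s t - g x s t).
Proof. intros Hf Hg. apply (cont_minus _ _ Hf Hg). Qed.
Lemma c3_mult f g : c3 f -> c3 g -> c3 (fun x s t => f x s t * g x s t).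
Proof. intros Hf Hg. apply (cont_mult _ _ Hf Hg). Qed.
Lemma c3_const (c : R) : c3 (fun _ _ _ => c).
Proof. intros p. apply continuous_const. Qed.
Ltac c3_tac := repeat match goal with
  | H : c3 ?f |- c3 ?f => exact H
  | |- c3 (fun x s t => @?f x s t + @?g x s t) => apply (c3_plus f g)
  | |- c3 (fun x s t => @?f x s t - @?g x s t) => apply (c3_minus f g)
  | |- c3 (fun x s t => @?f x s t * @?g x s t) => apply (c3_mult f g)
  | |- c3 (fun _ _ _ => ?c) => apply (c3_const c)
  | |- c3 (fun x s t => ?f x s t) => change (c3 f)
  end.

(** The function E t exp(-k t) is nonincreasing, starts at 0 and is nonnegative. *)
Lemma gronwall_zero (E E' : R -> R) (k T : R) : cont E -> (forall t, 0 < t < T -> is_derive E t (E' t)) ->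
  (forall t, 0 < t < T -> E' t <= k * E t) -> (forall t, 0 <= E t) -> E 0 = 0 -> forall t, 0 <= t <= T -> E t = 0.
Proof.
  intros cE dE bE pE E0 t Ht. destruct (Req_dec t 0) as [h|h]; [rewrite h; exact E0|].
  set (G := fun t => E t * exp (- k * t)).
  set (G' := fun t => E' t * exp (- k * t) + E t * (- k * exp (- k * t))).
  assert (dG : forall c, 0 < c < t -> derivable_pt_lim G c (G' c)).
  { intros c Hc. apply is_derive_Reals. apply (derive_mult E (fun t => exp (- k * t))); [apply dE; lra|]. auto_derive; [exact I|ring]. }
  destruct (MVT G id 0 t (fun c Hc => exist _ (G' c) (dG c Hc)) (fun c _ => derivable_pt_id c)) as [c [Hc HE]]; [lra| |intros; apply derivable_continuous_pt, derivable_pt_id|].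
  - intros x Hx. apply continuity_pt_filterlim. apply (continuous_mult E (fun t => exp (- k * t))); [apply cE|].
    apply (ex_derive_continuous (fun t => exp (- k * t))). auto_derive. exact I.
  - rewrite derive_pt_id in HE. unfold id in HE. change (derive_pt G c _) with (G' c) in HE.
    assert (Gt : G t <= 0).
    { replace (G t) with (t * G' c) by (unfold G in *; rewrite E0 in HE; lra).
      specialize (bE c ltac:(lra)). assert (P := exp_pos (- k * c)). unfold G'.
      replace (t * (E' c * exp (- k * c) + E c * (- k * exp (- k * c)))) with (- ((k * E c - E' c) * exp (- k * c) * t)) by ring.
      assert (0 <= (k * E c - E' c) * exp (- k * c) * t); [|lra]. apply Rmult_le_pos; [apply Rmult_le_pos; lra|lra]. }
    unfold G in Gt. assert (P := exp_pos (- k * t)). assert (Q := pE t).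
    assert (0 <= E t * exp (- k * t)) by (apply Rmult_le_pos; lra).
    destruct (Rmult_integral (E t) (exp (- k * t))); lra.
Qed.

Lemma mean_ext_in g k s : (forall x, - PI < x < PI -> g x s = k x s) -> mean g s = mean k s.
Proof. intros H. assert (Hp := PI_RGT_0). unfold mean. f_equal. apply RI_ext; [lra|exact H]. Qed.

Section Energy.
Variables (L T k0 K : R) (cs : R -> R).
Variables (w1 w2 q w1x w1s w1t w2x w2s w2t qx qs a1 a1x b bs z zs : R -> R -> R -> R).
Hypotheses (HL : 0 < L) (HT : 0 < T) (Hk0 : 0 < k0) (HK : 0 <= K) (ccs : cont cs) (cs0 : forall s, k0 <= cs s).
Hypotheses (cw1 : c3 w1) (cw2 : c3 w2) (cq : c3 q) (cw1x : c3 w1x) (cw1s : c3 w1s) (cw1t : c3 w1t) (cw2x : c3 w2x) (cw2s : c3 w2s) (cw2t : c3 w2t)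
  (cqx : c3 qx) (cqs : c3 qs) (ca1 : c3 a1) (ca1x : c3 a1x) (cb : c3 b) (cbs : c3 bs) (cz : c3 z) (czs : c3 zs).
Hypotheses (pw1 : forall s t, w1 PI s t = w1 (- PI) s t) (pw2 : forall s t, w2 PI s t = w2 (- PI) s t)
  (pq : forall s t, q PI s t = q (- PI) s t) (pa1 : forall s t, a1 PI s t = a1 (- PI) s t).
Hypothesis dx : forall x s t, 0 < s < L -> 0 < t < T ->
  is_derive (fun x => w1 x s t) x (w1x x s t) /\ is_derive (fun x => w2 x s t) x (w2x x s t) /\
  is_derive (fun x => q x s t) x (qx x s t) /\ is_derive (fun x => a1 x s t) x (a1x x s t).
Hypothesis ds : forall x s t, 0 < s < L -> 0 < t < T ->
  (is_derive (fun s => w1 x s t) s (w1s x s t) /\ is_derive (fun s => w2 x s t) s (w2s x s t)) /\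
  is_derive (fun s => q x s t) s (qs x s t) /\ is_derive (fun s => b x s t) s (bs x s t) /\ is_derive (fun s => z x s t) s (zs x s t).
Hypothesis dt : forall x s t, 0 < s < L -> 0 < t < T ->
  is_derive (fun t => w1 x s t) t (w1t x s t) /\ is_derive (fun t => w2 x s t) t (w2t x s t).
Hypothesis mom : forall x s t, - PI < x < PI -> 0 < s < L -> 0 < t < T ->
  Rabs (cs s * w1t x s t + a1 x s t * w1x x s t + b x s t * w1s x s t + qx x s t) <= K * (Rabs (w1 x s t) + Rabs (w2 x s t)) /\
  Rabs (cs s * w2t x s t + a1 x s t * w2x x s t + b x s t * w2s x s t + cs s * qs x s t) <= K * (Rabs (w1 x s t) + Rabs (w2 x s t)).
Hypothesis inc : forall x s t, - PI < x < PI -> 0 < s < L -> 0 < t < T -> a1x x s t + bs x s t = 0 /\ w1x x s t + zs x s t = 0.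
Hypothesis zdef : forall x s t, 0 < s < L -> z x s t = cs s * w2 x s t.
Hypothesis bdry : forall x t, - PI < x < PI -> b x 0 t = 0 /\ b x L t = 0 /\ z x 0 t = 0 /\ z x L t = 0.
Hypothesis init : forall x s, - PI < x < PI -> 0 < s < L -> w1 x s 0 = 0 /\ w2 x s 0 = 0.

Let sq x s t := w1 x s t * w1 x s t + w2 x s t * w2 x s t.
(** The weight [cs], the cosine of the latitude, is the area density of the sphere. In these
    variables w is the velocity difference, q the pressure difference, (a1, b) the advecting
    velocity with b weighted by the cosine, and z the weighted normal difference. *)
Let edens x s t := cs s * sq x s t.
Let ent x s t := cs s * (2 * (w1 x s t * w1t x s t + w2 x s t * w2t x s t)).
Let Fx x s t := a1x x s t * sq x s t + a1 x s t * (2 * (w1 x s t * w1x x s t + w2 x s t * w2x x s t))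
  + 2 * (qx x s t * w1 x s t + q x s t * w1x x s t).
Let Gs x s t := bs x s t * sq x s t + b x s t * (2 * (w1 x s t * w1s x s t + w2 x s t * w2s x s t))
  + 2 * (qs x s t * z x s t + q x s t * zs x s t).
Let F x s t := a1 x s t * sq x s t + 2 * (q x s t * w1 x s t).
Let G x s t := b x s t * sq x s t + 2 * (q x s t * z x s t).
Let ccs3 : c3 (fun _ s _ => cs s).
Proof. unfold c3. apply cont_comp; [exact ccs|cont_tac]. Qed.
Let csq : c3 sq. Proof. unfold sq. c3_tac. Qed.
Let cen : c3 edens. Proof. unfold edens. c3_tac. Qed.
Let cent : c3 ent. Proof. unfold ent. c3_tac. Qed.
Let cFx : c3 Fx. Proof. unfold Fx. c3_tac. Qed.
Let cGs : c3 Gs. Proof. unfold Gs. c3_tac. Qed.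
Let cF : c3 F. Proof. unfold F. c3_tac. Qed.
Let cG : c3 G. Proof. unfold G. c3_tac. Qed.

Let E t := RInt (fun s => mean (fun x t => edens x s t) t) 0 L.
Let E' t := RInt (fun s => mean (fun x t => ent x s t) t) 0 L.

Lemma mean_c2 (f : R -> R -> R -> R) : c3 f -> c2 (fun t s => mean (fun x t => f x s t) t).
Proof.
  intros H. unfold c2, mean, Rdiv. apply cont_mult; [|apply cont_const].
  apply (cont_RInt (U := RU2) (fun p x => f x (snd p) (fst p))).
  apply (cont_comp3 f); [exact H|cont_tac|cont_tac|cont_tac].
Qed.
Lemma derive_sq (f g : R -> R) y f' g' : is_derive f y f' -> is_derive g y g' ->
  is_derive (fun y => f y * f y + g y * g y) y (2 * (f y * f' + g y * g')).
Proof.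
  intros Hf Hg. replace (2 * (f y * f' + g y * g')) with ((f' * f y + f y * f') + (g' * g y + g y * g')) by ring.
  apply (is_derive_plus (V := RN)); apply derive_mult; assumption.
Qed.
Let dE t : 0 < t < T -> is_derive E t (E' t).
Proof.
  intros Ht. assert (Hr0 : 0 < Rmin t (T - t)) by (apply Rmin_pos; lra).
  apply (derive_RInt_param (fun t s => mean (fun x t => edens x s t) t) (fun t s => mean (fun x t => ent x s t) t) 0 L t (Rmin t (T - t))); [lra|exact Hr0| | |].
  - apply mean_c2, cen.
  - apply mean_c2, cent.
  - intros r s Hr Hs. assert (r1 := Rmin_l t (T - t)). assert (r2 := Rmin_r t (T - t)). apply Rabs_def2 in Hr.
    apply (mean_ds T); [apply c3_fixs, cen|apply c3_fixs, cent|lra|]. intros x t' Ht'.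
    apply is_derive_scal. destruct (dt x s t' Hs Ht'). apply (derive_sq (fun t => w1 x s t) (fun t => w2 x s t)); assumption.
Qed.
Let kapE := 4 * K / k0.
(** Testing the momentum residuals with 2 w gives the rate of energy plus the divergence of the flux
    (F, G): the advecting velocity is divergence free, which puts the transport terms into
    divergence form, and so is w, which does the same for the pressure terms. The factor 1 / k0
    compares the unweighted square with the weighted energy. *)
Let resid x s t : - PI < x < PI -> 0 < s < L -> 0 < t < T -> Rabs (ent x s t + Fx x s t + Gs x s t) <= kapE * edens x s t.
Proof.
  intros Hx Hs Ht. destruct (mom x s t Hx Hs Ht) as [M1 M2]. destruct (inc x s t Hx Hs Ht) as [I1 I2].
  set (r1 := cs s * w1t x s t + a1 x s t * w1x x s t + b x s t * w1s x s t + qx x s t) in *.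
  set (r2 := cs s * w2t x s t + a1 x s t * w2x x s t + b x s t * w2s x s t + cs s * qs x s t) in *.
  replace (ent x s t + Fx x s t + Gs x s t) with (2 * (w1 x s t * r1 + w2 x s t * r2)).
  - rewrite Rabs_mult, (Rabs_right 2) by lra.
    assert (A : Rabs (w1 x s t * r1 + w2 x s t * r2) <= 2 * K * sq x s t).
    { abs_tri. rewrite !Rabs_mult. unfold sq.
      set (x1 := w1 x s t) in *. set (x2 := w2 x s t) in *.
      assert (P1 := Rabs_pos x1). assert (P2 := Rabs_pos x2).
      replace (x1 * x1) with (Rabs x1 * Rabs x1) by (rewrite <- Rabs_mult; apply Rabs_right; nra).
      replace (x2 * x2) with (Rabs x2 * Rabs x2) by (rewrite <- Rabs_mult; apply Rabs_right; nra).
      assert (Rabs x1 * Rabs r1 <= Rabs x1 * (K * (Rabs x1 + Rabs x2))) by (apply Rmult_le_compat_l; assumption).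
      assert (Rabs x2 * Rabs r2 <= Rabs x2 * (K * (Rabs x1 + Rabs x2))) by (apply Rmult_le_compat_l; assumption).
      assert (0 <= K * ((Rabs x1 - Rabs x2) * (Rabs x1 - Rabs x2))) by (apply Rmult_le_pos; [exact HK|apply Rle_0_sqr]). nra. }
    assert (S0 : 0 <= sq x s t) by (unfold sq; nra).
    assert (kapE * edens x s t = 4 * K * (cs s / k0) * sq x s t) by (unfold kapE, edens; field; lra).
    assert (1 <= cs s / k0) by (apply Rle_div_r; [exact Hk0|]; rewrite Rmult_1_l; apply cs0).
    assert (0 <= 4 * K * sq x s t * (cs s / k0 - 1)); [|lra]. apply Rmult_le_pos; [|lra]. apply Rmult_le_pos; lra.
  - unfold ent, Fx, Gs, r1, r2. rewrite (zdef x s t Hs). replace (a1x x s t) with (- bs x s t) by lra. replace (w1x x s t) with (- zs x s t) at 2 by lra.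
    replace (zs x s t) with (- w1x x s t) by lra. ring.
Qed.
(** The flux F integrates to zero by periodicity and G because b and z vanish on the walls, so only
    the residual contributes. *)
Let E'_bound t : 0 < t < T -> E' t <= kapE * E t.
Proof.
  intros Ht. assert (Hp := PI_RGT_0).
  assert (cm : forall f, c3 f -> cont (fun s => mean (fun x t => f x s t) t)) by (intros f H; apply (cont_mean (fun x s => f x s t)), c3_fixt, H).
  assert (FX : forall s, 0 < s < L -> mean (fun x t => Fx x s t) t = 0).
  { intros s Hs. unfold mean. rewrite (RInt_FTC_closed (fun x => F x s t)); [|lra| | |].
    - unfold F, sq. rewrite pw1, pw2, pq, pa1. Req. field. lra.
    - apply (c2_slice2 (fun x s => F x s t)), c3_fixt, cF.
    - apply (c2_slice2 (fun x s => Fx x s t)), c3_fixt, cFx.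
    - intros x _. destruct (dx x s t Hs Ht) as [d1 [d2 [d3 d4]]].
      apply (is_derive_plus (V := RN) (fun x => a1 x s t * sq x s t) (fun x => 2 * (q x s t * w1 x s t)));
        [apply (derive_mult (fun x => a1 x s t) (fun x => sq x s t)); [exact d4|apply (derive_sq (fun x => w1 x s t) (fun x => w2 x s t)); assumption]|].
      apply is_derive_scal, (derive_mult (fun x => q x s t) (fun x => w1 x s t)); assumption. }
  assert (GS : RInt (fun s => mean (fun x t => Gs x s t) t) 0 L = 0).
  { rewrite (RInt_FTC_closed (mean (fun x s => G x s t))); [|lra|apply cont_mean, c3_fixt, cG|apply cm, cGs|].
    - rewrite !(mean_ext_in (fun x s => G x s t) (fun _ _ => 0)) by (intros x Hx; unfold G; destruct (bdry x t Hx) as [b1 [b2 [b3 b4]]]; rewrite ?b1, ?b2, ?b3, ?b4; ring).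
      rewrite !(mean_const (fun _ => 0)). Req. ring.
    - intros s Hs. apply (mean_ds L (fun x s => G x s t) (fun x s => Gs x s t)); [apply c3_fixt, cG|apply c3_fixt, cGs|exact Hs|].
      intros x r Hr. destruct (ds x r t Hr Ht) as [[d1 d2] [d3 [d4 d5]]].
      apply (is_derive_plus (V := RN) (fun s => b x s t * sq x s t) (fun s => 2 * (q x s t * z x s t)));
        [apply (derive_mult (fun s => b x s t) (fun s => sq x s t)); [exact d4|apply (derive_sq (fun s => w1 x s t) (fun s => w2 x s t)); assumption]|].
      apply is_derive_scal, (derive_mult (fun s => q x s t) (fun s => z x s t)); assumption. }
  set (rr := fun x s t => ent x s t + Fx x s t + Gs x s t).
  assert (crr : c3 rr) by (unfold rr; c3_tac).
  assert (EE : E' t = RInt (fun s => mean (fun x t => rr x s t) t) 0 L).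
  { transitivity (RInt (fun s => mean (fun x t => ent x s t) t + mean (fun x t => Gs x s t) t) 0 L).
    - rewrite (RI_plus (fun s => mean (fun x t => ent x s t) t) (fun s => mean (fun x t => Gs x s t) t)) by (apply cm; assumption).
      rewrite GS. unfold E'. symmetry. Req. ring.
    - apply RI_ext; [lra|]. intros s Hs. unfold rr.
      rewrite (mean_plus (fun x t => ent x s t + Fx x s t) (fun x t => Gs x s t)); [|apply cont_plus; apply (c3_fixs _ s); assumption|apply c3_fixs, cGs].
      rewrite (mean_plus (fun x t => ent x s t) (fun x t => Fx x s t)) by (apply c3_fixs; assumption). rewrite FX by exact Hs. ring. }
  rewrite EE. unfold E. rewrite <- (RI_scal (fun s => mean (fun x t => edens x s t) t)) by (apply cm, cen).
  apply RInt_le; [lra|apply cont_ex_RInt, cm, crr| |].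
  - apply cont_ex_RInt. apply (cont_mult (U := RU)); [apply cont_const|apply cm, cen].
  - intros s Hs. unfold mean, Rdiv. rewrite <- Rmult_assoc. apply Rmult_le_compat_r; [left; apply Rinv_0_lt_compat; lra|].
    rewrite <- (RI_scal (fun x => edens x s t)) by (apply (c2_slice2 (fun x s => edens x s t)), c3_fixt, cen).
    apply RInt_le; [lra|apply cont_ex_RInt; apply (c2_slice2 (fun x s => rr x s t)), c3_fixt, crr| |].
    + apply cont_ex_RInt. apply (cont_mult (U := RU)); [apply cont_const|apply (c2_slice2 (fun x s => edens x s t)), c3_fixt, cen].
    + intros x Hx. eapply Rle_trans; [apply Rle_abs|]. apply resid; assumption.
Qed.
Let en0 x s t : 0 <= edens x s t.
Proof. unfold edens, sq. apply Rmult_le_pos; [assert (H := cs0 s); lra|nra]. Qed.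

Lemma energy_w x s t : - PI <= x <= PI -> 0 <= s <= L -> 0 <= t <= T -> w1 x s t = 0 /\ w2 x s t = 0.
Proof.
  intros Hx Hs Ht. assert (Hp := PI_RGT_0).
  assert (cm : forall f t, c3 f -> cont (fun s => mean (fun x t => f x s t) t)) by (intros f t0 H; apply (cont_mean (fun x s => f x s t0)), c3_fixt, H).
  assert (mp : forall t s, 0 <= mean (fun x t => edens x s t) t).
  { intros t0 s0. unfold mean. apply Rdiv_le_0_compat; [|lra]. apply RInt_nonneg; [lra|apply (c2_slice2 (fun x s => edens x s t0)), c3_fixt, cen|auto]. }
  assert (Z : E t = 0).
  { apply (gronwall_zero E E' kapE T); [| exact dE | exact E'_bound | | |exact Ht].
    - apply (cont_RInt (U := RU) (fun t s => mean (fun x t => edens x s t) t)). apply mean_c2, cen.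
    - intros t0. unfold E. apply RInt_nonneg; [lra|apply cm, cen|auto].
    - unfold E. rewrite (RI_ext _ (fun _ => 0)); [rewrite RI_const; Req; ring|lra|]. intros s0 Hs0.
      unfold mean. rewrite (RI_ext (fun x => edens x s0 0) (fun _ => 0)); [rewrite RI_const; Req; field; lra|lra|].
      intros x0 Hx0. unfold edens, sq. destruct (init x0 s0 Hx0 Hs0) as [i1 i2]. rewrite i1, i2. ring. }
  assert (Zs := RInt_zero_nonneg _ 0 L HL (cm edens t cen) (fun s _ => mp t s) Z s Hs). cbv beta in Zs.
  assert (I0 : RInt (fun x => edens x s t) (- PI) PI = 0).
  { unfold mean in Zs. apply Rmult_eq_reg_r with (/ (2 * PI)); [rewrite Rmult_0_l; exact Zs|]. apply Rinv_neq_0_compat. lra. }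
  assert (Zx := RInt_zero_nonneg _ (- PI) PI ltac:(lra) (c2_slice2 (fun x s => edens x s t) s (c3_fixt _ t cen)) (fun x _ => en0 x s t) I0 x Hx).
  cbv beta in Zx. unfold edens, sq in Zx. assert (c := cs0 s).
  destruct (Rmult_integral _ _ Zx) as [h|h]; [lra|]. apply (Rplus_sqr_eq_0 _ _ h).
Qed.

(** Once w vanishes so do its derivatives at interior points, and the residual bound forces the
    gradient of q to vanish there. Constancy is then propagated in x, in s, and by continuity to the
    walls and to the end times. *)
Lemma energy_q x s t : - PI <= x <= PI -> 0 <= s <= L -> 0 <= t <= T -> q x s t = q 0 0 t.
Proof.
  intros Hx Hs Ht. assert (Hp := PI_RGT_0).
  assert (D0 : forall (f : R -> R) y l r, 0 < r -> (forall y', Rabs (y' - y) < r -> f y' = 0) -> is_derive f y l -> l = 0).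
  { intros f y l r Hr Hz D. apply is_derive_unique in D. rewrite <- D. rewrite (Derive_ext_loc _ (fun _ => 0)); [apply Derive_const|].
    exists (mkposreal _ Hr). intros y' Hy. apply Hz, Hy. }
  assert (Z : forall x s t, - PI < x < PI -> 0 < s < L -> 0 < t < T -> qx x s t = 0 /\ qs x s t = 0).
  { clear x s t Hx Hs Ht. intros x s t Hx Hs Ht.
    destruct (dx x s t Hs Ht) as [d1 [d2 _]]. destruct (ds x s t Hs Ht) as [[d3 d4] _]. destruct (dt x s t Hs Ht) as [d5 d6].
    assert (rx : 0 < Rmin (x + PI) (PI - x)) by (apply Rmin_pos; lra).
    assert (rs : 0 < Rmin s (L - s)) by (apply Rmin_pos; lra). assert (rt : 0 < Rmin t (T - t)) by (apply Rmin_pos; lra).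
    assert (x1 := Rmin_l (x + PI) (PI - x)). assert (x2 := Rmin_r (x + PI) (PI - x)).
    assert (s1 := Rmin_l s (L - s)). assert (s2 := Rmin_r s (L - s)). assert (t1 := Rmin_l t (T - t)). assert (t2 := Rmin_r t (T - t)).
    apply (D0 _ _ _ _ rx) in d1; [|intros y Hy; apply Rabs_def2 in Hy; apply energy_w; lra].
    apply (D0 _ _ _ _ rx) in d2; [|intros y Hy; apply Rabs_def2 in Hy; apply energy_w; lra].
    apply (D0 _ _ _ _ rs) in d3; [|intros y Hy; apply Rabs_def2 in Hy; apply energy_w; lra].
    apply (D0 _ _ _ _ rs) in d4; [|intros y Hy; apply Rabs_def2 in Hy; apply energy_w; lra].
    apply (D0 _ _ _ _ rt) in d5; [|intros y Hy; apply Rabs_def2 in Hy; apply energy_w; lra].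
    apply (D0 _ _ _ _ rt) in d6; [|intros y Hy; apply Rabs_def2 in Hy; apply energy_w; lra].
    destruct (mom x s t Hx Hs Ht) as [M1 M2]. destruct (energy_w x s t) as [e1 e2]; try lra.
    rewrite d1, d3, d5, e1, e2, Rabs_R0 in M1. rewrite d2, d4, d6, e1, e2, Rabs_R0 in M2.
    replace (cs s * 0 + a1 x s t * 0 + b x s t * 0 + qx x s t) with (qx x s t) in M1 by ring.
    replace (cs s * 0 + a1 x s t * 0 + b x s t * 0 + cs s * qs x s t) with (cs s * qs x s t) in M2 by ring.
    assert (c := cs0 s). assert (A1 := Rabs_pos (qx x s t)). assert (A2 := Rabs_pos (cs s * qs x s t)).
    split; [destruct (Req_dec (qx x s t) 0) as [h|h]; [exact h|apply Rabs_pos_lt in h; lra]|].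
    destruct (Req_dec (cs s * qs x s t) 0) as [h|h]; [|apply Rabs_pos_lt in h; lra].
    destruct (Rmult_integral _ _ h); lra. }
  apply Rminus_diag_uniq.
  apply (cont_zero_closed (fun t => q x s t - q 0 0 t) 0 T); [exact HT| | |exact Ht].
  { apply (cont_minus (U := RU)); apply c3_cont3, cq. }
  clear t Ht. intros t Ht. assert (c := c3_fixt q t cq).
  assert (X : forall s, 0 < s < L -> forall x, - PI <= x <= PI -> q x s t = q 0 s t).
  { intros s0 Hs0 x0 Hx0.
    assert (K0 : forall y, - PI <= y <= PI -> q y s0 t = q (- PI) s0 t).
    { intros y Hy. assert (I := RInt_FTC_closed (fun x => q x s0 t) (fun _ => 0) (- PI) y ltac:(lra) (c2_slice2 _ s0 c) ltac:(apply cont_const)).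
      rewrite RI_const in I. assert (J : (y - - PI) * 0 = q y s0 t - q (- PI) s0 t); [|lra]. apply I. intros x1 Hx1.
      assert (K1 := proj1 (proj2 (proj2 (dx x1 s0 t Hs0 Ht)))). rewrite (proj1 (Z x1 s0 t ltac:(lra) Hs0 Ht)) in K1. exact K1. }
    rewrite (K0 x0 Hx0), (K0 0 ltac:(lra)). reflexivity. }
  assert (X' : forall s, 0 <= s <= L -> q x s t = q 0 s t).
  { intros s0 Hs0. apply Rminus_diag_uniq. apply (cont_zero_closed (fun s => q x s t - q 0 s t) 0 L); [exact HL| | |exact Hs0].
    - apply (cont_minus (U := RU)); apply (c2_slice1 _ _ c).
    - intros r Hr. rewrite (X r Hr x Hx). ring. }
  assert (S : forall s, 0 <= s <= L -> q 0 s t = q 0 0 t).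
  { apply (const_on_closed (fun s => q 0 s t)); [exact HL|apply (c2_slice1 _ _ c)|]. intros r Hr.
    assert (K1 := proj1 (proj2 (ds 0 r t Hr Ht))). rewrite (proj2 (Z 0 r t ltac:(lra) Hr Ht)) in K1. exact K1. }
  rewrite (X' s Hs), (S s Hs). ring.
Qed.
End Energy.

(** * Uniform bounds by compactness *)

Lemma local_bound (B : R -> R -> Prop) a b : (forall s M M', M <= M' -> B s M -> B s M') ->
  (forall s0, exists M d, 0 < d /\ forall s, Rabs (s - s0) < d -> B s M) -> exists M, forall s, a <= s <= b -> B s M.
Proof.
  intros mono loc. destruct (Rle_dec a b) as [hab|hab]; [|exists 0; intros; lra].
  (* The supremum of the endpoints up to which one bound serves has a neighbourhood with a bound of
     its own, so it cannot lie below b and is attained. *)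
  set (P := fun c => a <= c <= b /\ exists M, forall s, a <= s <= c -> B s M).
  destruct (completeness P) as [c [c1 c2]].
  - exists b. intros x [Hx _]. lra.
  - destruct (loc a) as [M [d [Hd A]]]. exists a. split; [lra|]. exists M. intros s Hs. apply A. replace (s - a) with 0 by lra. rewrite Rabs_R0. exact Hd.
  - assert (ac : a <= c).
    { apply c1. split; [lra|]. destruct (loc a) as [M [d [Hd A]]]. exists M. intros s Hs. apply A. replace (s - a) with 0 by lra. rewrite Rabs_R0. exact Hd. }
    assert (cb : c <= b) by (apply c2; intros x [Hx _]; lra).
    destruct (loc c) as [M [d [Hd A]]].
    assert (E : exists c', P c' /\ c - d < c').
    { destruct (classic (exists c', P c' /\ c - d < c')) as [h|h]; [exact h|exfalso].
      assert (c <= c - d); [|lra]. apply c2. intros x Hx. apply Rnot_lt_le. intros Hl. apply h. exists x. split; assumption. }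
    destruct E as [c' [[Hc' [M' A']] Hl]].
    set (c'' := Rmin b (c + d / 2)).
    assert (P c'').
    { split; [unfold c''; split; [apply Rmin_glb; lra|apply Rmin_l]|]. exists (Rmax M M'). intros s Hs.
      assert (m : c'' <= c + d / 2) by apply Rmin_r.
      destruct (Rle_dec s c') as [h|h].
      - apply mono with M'; [apply Rmax_r|apply A'; lra].
      - apply mono with M; [apply Rmax_l|]. apply A. apply Rabs_def1; lra. }
    assert (K := c1 c'' H). destruct H as [_ [M2 A2]]. exists M2. intros s Hs. apply A2. split; [lra|].
    unfold c'' in *. apply Rmin_glb; [lra|]. destruct (Rle_dec b (c + d / 2)) as [h|h]; [lra|]. rewrite Rmin_right in K by lra. lra.
Qed.

Lemma c3_bounded (f : R -> R -> R -> R) a b c d e g : c3 f -> exists M, forall x s t, a <= x <= b -> c <= s <= d -> e <= t <= g -> Rabs (f x s t) <= M.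
Proof.
  intros Hf.
  assert (X : forall s0 t0, exists M r, 0 < r /\ forall s t, Rabs (s - s0) < r -> Rabs (t - t0) < r -> forall x, a <= x <= b -> Rabs (f x s t) <= M).
  { intros s0 t0.
    assert (B0 : exists M, forall x, a <= x <= b -> Rabs (f x s0 t0) <= M).
    { apply (local_bound (fun x M => Rabs (f x s0 t0) <= M)); [intros; lra|]. intros x0.
      assert (c0 : cont (fun x => f x s0 t0)) by (apply (cont_comp3 (U := RU) f); [exact Hf|apply cont_id|apply cont_const|apply cont_const]).
      destruct (proj1 (continuous_eps (fun x => f x s0 t0) x0) (c0 x0) 1 Rlt_0_1) as [r [Hr A]].
      exists (Rabs (f x0 s0 t0) + 1), r. split; [exact Hr|]. intros x Hx. specialize (A x Hx). simpl in A.
      assert (T := Rabs_triang (f x s0 t0 - f x0 s0 t0) (f x0 s0 t0)). replace (f x s0 t0 - f x0 s0 t0 + f x0 s0 t0) with (f x s0 t0) in T by ring. lra. }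
    destruct B0 as [M0 B0].
    destruct (tube (U := RU2) (fun p x => f x (fst p) (snd p)) (s0, t0) a b 1) as [r [Hr A]]; [|lra|].
    { apply (cont_comp3 f); [exact Hf|cont_tac|cont_tac|cont_tac]. }
    exists (M0 + 1), r. split; [exact Hr|]. intros s t Hs Ht x Hx. specialize (A (s, t) x (conj Hs Ht) Hx). simpl in A. specialize (B0 x Hx).
    assert (T := Rabs_triang (f x s t - f x s0 t0) (f x s0 t0)). replace (f x s t - f x s0 t0 + f x s0 t0) with (f x s t) in T by ring. lra. }
  (* M is the bound and 1 / M the radius in t: one number, monotone in the required sense, so that
     [local_bound] in s yields both at once. *)
  assert (Y : forall t0, exists M, 0 < M /\ forall s, c <= s <= d -> forall t, Rabs (t - t0) < / M -> forall x, a <= x <= b -> Rabs (f x s t) <= M).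
  { intros t0.
    destruct (local_bound (fun s M => 0 < M /\ forall t, Rabs (t - t0) < / M -> forall x, a <= x <= b -> Rabs (f x s t) <= M) c d) as [M HM].
    - intros s M M' Hl [H0 H1]. split; [lra|]. intros t Ht x Hx. apply Rle_trans with M; [|exact Hl]. apply H1; [|exact Hx].
      eapply Rlt_le_trans; [exact Ht|]. apply Rinv_le_contravar; assumption.
    - intros s0. destruct (X s0 t0) as [M [r [Hr A]]]. exists (Rmax 1 (Rmax M (/ r))), r. split; [exact Hr|]. intros s Hs.
      assert (m1 := Rmax_l 1 (Rmax M (/ r))). assert (m2 := Rmax_r 1 (Rmax M (/ r))). assert (m3 := Rmax_l M (/ r)). assert (m4 := Rmax_r M (/ r)).
      split; [lra|]. intros t Ht x Hx. apply Rle_trans with M; [|lra]. apply A; auto. eapply Rlt_le_trans; [exact Ht|].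
      rewrite <- (Rinv_inv r) at 2. apply Rinv_le_contravar; [apply Rinv_0_lt_compat, Hr|lra].
    - exists (Rmax M 1). split; [apply Rlt_le_trans with 1; [lra|apply Rmax_r]|]. intros s Hs t Ht x Hx. destruct (HM s Hs) as [H0 H1].
      apply Rle_trans with M; [|apply Rmax_l]. apply H1; [|exact Hx]. eapply Rlt_le_trans; [exact Ht|]. apply Rinv_le_contravar; [exact H0|apply Rmax_l]. }
  destruct (local_bound (fun t M => forall s, c <= s <= d -> forall x, a <= x <= b -> Rabs (f x s t) <= M) e g) as [M HM].
  - intros t M M' Hl H s Hs x Hx. apply Rle_trans with M; auto.
  - intros t0. destruct (Y t0) as [M [H0 A]]. exists M, (/ M). split; [apply Rinv_0_lt_compat, H0|]. intros t Ht s Hs x Hx. apply A; auto.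
  - exists M. intros x s t Hx Hs Ht. apply HM; auto.
Qed.

(** * Extension of fields on the band to the whole space *)

Section Lift.
Variables (th1 th2 T : R).
Hypotheses (Hth : th1 < th2) (HT : 0 < T).
Let L := th2 - th1.
(* The longitude is shifted by PI so that (- PI, PI) corresponds to (0, 2 PI), where the equations are required. *)
Definition lift (f : R -> R -> R -> R) (x s t : R) := f (x + PI) (th1 + cl (th2 - th1) s) (cl T t).

Lemma lift_in s t : in_S th1 th2 T 0 (th1 + cl (th2 - th1) s) (cl T t).
Proof. assert (A := cl_in (th2 - th1) ltac:(lra) s). assert (B := cl_in T HT t). split; lra. Qed.
Lemma lift_id f x s t : 0 <= s <= th2 - th1 -> 0 <= t <= T -> lift f x s t = f (x + PI) (th1 + s) t.
Proof. intros Hs Ht. unfold lift. rewrite !cl_id by assumption. reflexivity. Qed.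

Lemma c3_lift f : cont_S th1 th2 T f -> c3 (lift f).
Proof.
  intros H [[x s] t]. apply continuous_eps. intros eps He.
  destruct (H (x + PI) _ _ (lift_in s t) eps He) as [d [Hd A]]. exists d. split; [exact Hd|].
  intros [[x' s'] t'] [[B1 B2] B3]. simpl. unfold lift. apply A.
  - apply lift_in.
  - replace (x' + PI - (x + PI)) with (x' - x) by ring. exact B1.
  - replace (th1 + cl (th2 - th1) s' - (th1 + cl (th2 - th1) s)) with (cl (th2 - th1) s' - cl (th2 - th1) s) by ring.
    eapply Rle_lt_trans; [apply cl_lip; lra|exact B2].
  - eapply Rle_lt_trans; [apply cl_lip; lra|exact B3].
Qed.

Lemma lift_dx f l x s t : 0 <= s <= th2 - th1 -> 0 <= t <= T -> is_derive (fun x => f x (th1 + s) t) (x + PI) l -> is_derive (fun x => lift f x s t) x l.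
Proof.
  intros Hs Ht D. apply is_derive_ext with (fun x => f (x + PI) (th1 + s) t); [intros; symmetry; apply lift_id; assumption|].
  replace l with (1 * l) by ring.
  apply (is_derive_comp (V := RN) (fun x => f x (th1 + s) t) (fun x => x + PI)); [exact D|]. auto_derive; [exact I|ring].
Qed.
Lemma lift_ds f l x s t : 0 < s < th2 - th1 -> 0 <= t <= T -> is_derive (fun y => f (x + PI) y t) (th1 + s) l -> is_derive (fun s => lift f x s t) s l.
Proof.
  intros Hs Ht D. assert (r0 : 0 < Rmin s (th2 - th1 - s)) by (apply Rmin_pos; lra).
  apply is_derive_ext_loc with (fun s => f (x + PI) (th1 + s) t).
  - exists (mkposreal _ r0). intros y Hy. change (Rabs (y - s) < Rmin s (th2 - th1 - s)) in Hy.
    assert (r1 := Rmin_l s (th2 - th1 - s)). assert (r2 := Rmin_r s (th2 - th1 - s)). apply Rabs_def2 in Hy.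
    symmetry. apply lift_id; lra.
  - replace l with (1 * l) by ring.
    apply (is_derive_comp (V := RN) (fun y => f (x + PI) y t) (fun s => th1 + s)); [exact D|]. auto_derive; [exact I|ring].
Qed.
Lemma lift_dt f l x s t : 0 <= s <= th2 - th1 -> 0 < t < T -> is_derive (fun t => f (x + PI) (th1 + s) t) t l -> is_derive (fun t => lift f x s t) t l.
Proof.
  intros Hs Ht D. assert (r0 : 0 < Rmin t (T - t)) by (apply Rmin_pos; lra).
  apply is_derive_ext_loc with (fun t => f (x + PI) (th1 + s) t); [|exact D].
  exists (mkposreal _ r0). intros y Hy. change (Rabs (y - t) < Rmin t (T - t)) in Hy.
  assert (r1 := Rmin_l t (T - t)). assert (r2 := Rmin_r t (T - t)). apply Rabs_def2 in Hy.
  symmetry. apply lift_id; lra.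
Qed.
Lemma lift_per f : periodic3 f -> forall s t, lift f PI s t = lift f (- PI) s t.
Proof. intros H s t. unfold lift. replace (PI + PI) with ((- PI + PI) + 2 * PI) by ring. apply H. Qed.
End Lift.

Lemma derive_minus (f g : R -> R) x l m : is_derive f x l -> is_derive g x m -> is_derive (fun x => f x - g x) x (l - m).
Proof. apply (is_derive_minus (V := RN)). Qed.

(** The second solution advects the difference, and the coefficients of the zeroth order terms
    contain derivatives of the first solution, which are bounded by compactness. *)
Lemma uniqueness (omega th1 th2 T : R) (u0 v0 : R -> R -> R) (u v p u' v' p' : R -> R -> R -> R) :
  0 < omega -> - (PI / 2) < th1 -> th1 < th2 -> th2 < 0 -> 0 < T ->
  is_solution omega th1 th2 T u0 v0 u v p -> is_solution omega th1 th2 T u0 v0 u' v' p' ->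
  (forall phi theta t, in_Cbar th1 th2 phi theta -> 0 <= t <= T -> u' phi theta t = u phi theta t /\ v' phi theta t = v phi theta t) /\
  exists g : R -> R, forall phi theta t, in_Cbar th1 th2 phi theta -> 0 <= t <= T -> p' phi theta t = p phi theta t + g t.
Proof.
  intros Hom H1 H12 H2 HT S S'. assert (Hp := PI_RGT_0).
  destruct S as [pu [pv [pp [ut [ux [us [vt [vx [vs [px [ps [dv [D [Dt [EQ [BC [IC [cu [cv [cp [cut [cux [cus [cvt [cvx [cvs [cdv [cpx cps]]]]]]]]]]]]]]]]]]]]]]]]]]]].
  destruct S' as [pu' [pv' [pp' [ut' [ux' [us' [vt' [vx' [vs' [px' [ps' [dv' [D' [Dt' [EQ' [BC' [IC' [cu' [cv' [cp' [cut' [cux' [cus' [cvt' [cvx' [cvs' [cdv' [cpx' cps']]]]]]]]]]]]]]]]]]]]]]]]]]]].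
  set (L := th2 - th1). assert (HL : 0 < L) by (unfold L; lra).
  set (lf := lift th1 th2 T).
  assert (CL : forall f, cont_S th1 th2 T f -> c3 (lf f)) by (intros; apply c3_lift; assumption).
  apply CL in cu, cv, cp, cut, cux, cus, cvt, cvx, cvs, cdv, cpx, cps.
  apply CL in cu', cv', cp', cut', cux', cus', cvt', cvx', cvs', cdv', cpx', cps'. clear CL.
  assert (id : forall f x s t, 0 <= s <= L -> 0 <= t <= T -> lf f x s t = f (x + PI) (th1 + s) t) by (intros; apply lift_id; assumption).
  set (cs := fun s => cos (th1 + cl L s)).
  assert (ccs : cont cs).
  { unfold cs. apply (cont_cos (U := RU)). apply (cont_plus (U := RU)); [apply cont_const|apply cont_cl, cont_id]. }
  assert (k0 : 0 < cos th1) by (apply cos_gt_0; lra).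
  assert (cs0 : forall s, cos th1 <= cs s).
  { intros s. unfold cs. assert (A := cl_in L HL s). unfold L in *.
    rewrite <- (cos_neg th1), <- (cos_neg (th1 + _)). apply cos_decr_1; lra. }
  assert (csi : forall s, 0 <= s <= L -> cs s = cos (th1 + s)) by (intros s Hs; unfold cs; rewrite cl_id by assumption; reflexivity).
  assert (ccs3 : c3 (fun _ s _ => cs s)) by (unfold c3; apply cont_comp; [exact ccs|cont_tac]).
  set (mi := fun (f g : R -> R -> R -> R) x s t => lf f x s t - lf g x s t).
  set (b := fun x s t => lf v' x s t * cs s). set (z := fun x s t => lf v' x s t * cs s - lf v x s t * cs s).
  (* A sum of squares of all coefficients: a bound M of it bounds each coefficient by M + 1. *)
  set (big := fun x s t => lf u x s t * lf u x s t + lf v x s t * lf v x s t + lf u' x s t * lf u' x s t + lf ux x s t * lf ux x s t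
     + lf us x s t * lf us x s t + lf vx x s t * lf vx x s t + lf vs x s t * lf vs x s t).
  assert (cbig : c3 big) by (unfold big; c3_tac).
  destruct (c3_bounded big (- PI) PI 0 L 0 T cbig) as [M HM].
  assert (M0 : 0 <= M) by (eapply Rle_trans; [apply Rabs_pos|apply (HM 0 0 0); lra]).
  set (K := 4 * (M + 1) + 2 * omega).
  assert (inC : forall x s, - PI < x < PI -> 0 < s < L -> in_C th1 th2 (x + PI) (th1 + s)) by (intros x s Hx Hs; unfold L in *; split; lra).
  assert (dx : forall x s t, 0 < s < L -> 0 < t < T ->
  is_derive (fun x => mi u' u x s t) x (mi ux' ux x s t) /\ is_derive (fun x => mi v' v x s t) x (mi vx' vx x s t) /\
  is_derive (fun x => mi p' p x s t) x (mi px' px x s t) /\ is_derive (fun x => lf u' x s t) x (lf ux' x s t)).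
  { intros x s t Hs Ht. destruct (D (x + PI) (th1 + s) t ltac:(unfold L in *; lra) ltac:(lra)) as [d1 [d2 [d3 [d4 [d5 [d6 d7]]]]]].
    destruct (D' (x + PI) (th1 + s) t ltac:(unfold L in *; lra) ltac:(lra)) as [e1 [e2 [e3 [e4 [e5 [e6 e7]]]]]].
    unfold mi. rewrite !id by lra.
    assert (LX : forall f l, is_derive (fun x => f x (th1 + s) t) (x + PI) l -> is_derive (fun x => lf f x s t) x l) by (intros f l Hd; apply lift_dx; try (unfold L in *; lra); exact Hd).
    exact (conj (derive_minus _ _ _ _ _ (LX _ _ e1) (LX _ _ d1)) (conj (derive_minus _ _ _ _ _ (LX _ _ e3) (LX _ _ d3))
      (conj (derive_minus _ _ _ _ _ (LX _ _ e6) (LX _ _ d6)) (LX _ _ e1)))). }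
  assert (ds : forall x s t, 0 < s < L -> 0 < t < T ->
  (is_derive (fun s => mi u' u x s t) s (mi us' us x s t) /\ is_derive (fun s => mi v' v x s t) s (mi vs' vs x s t)) /\
  is_derive (fun s => mi p' p x s t) s (mi ps' ps x s t) /\ is_derive (fun s => b x s t) s (lf dv' x s t) /\
  is_derive (fun s => z x s t) s (mi dv' dv x s t)).
  { intros x s t Hs Ht. destruct (D (x + PI) (th1 + s) t ltac:(unfold L in *; lra) ltac:(lra)) as [d1 [d2 [d3 [d4 [d5 [d6 d7]]]]]].
    destruct (D' (x + PI) (th1 + s) t ltac:(unfold L in *; lra) ltac:(lra)) as [e1 [e2 [e3 [e4 [e5 [e6 e7]]]]]].
    assert (B' : is_derive (fun s => lf v' x s t * cs s) s (dv' (x + PI) (th1 + s) t)).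
    { apply (lift_ds th1 th2 T (fun a b c => v' a b c * cos b)); try (unfold L in *; lra). exact e5. }
    assert (B0 : is_derive (fun s => lf v x s t * cs s) s (dv (x + PI) (th1 + s) t)).
    { apply (lift_ds th1 th2 T (fun a b c => v a b c * cos b)); try (unfold L in *; lra). exact d5. }
    unfold mi, b, z. rewrite !id by lra.
    assert (LX : forall f l, is_derive (fun y => f (x + PI) y t) (th1 + s) l -> is_derive (fun s => lf f x s t) s l) by (intros f l Hd; apply lift_ds; try (unfold L in *; lra); exact Hd).
    exact (conj (conj (derive_minus _ _ _ _ _ (LX _ _ e2) (LX _ _ d2)) (derive_minus _ _ _ _ _ (LX _ _ e4) (LX _ _ d4)))
      (conj (derive_minus _ _ _ _ _ (LX _ _ e7) (LX _ _ d7)) (conj B' (derive_minus _ _ _ _ _ B' B0)))). }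
  assert (dt : forall x s t, 0 < s < L -> 0 < t < T ->
  is_derive (fun t => mi u' u x s t) t (mi ut' ut x s t) /\ is_derive (fun t => mi v' v x s t) t (mi vt' vt x s t)).
  { intros x s t Hs Ht. destruct (Dt (x + PI) (th1 + s) t ltac:(unfold L in *; lra) Ht) as [d1 d2].
    destruct (Dt' (x + PI) (th1 + s) t ltac:(unfold L in *; lra) Ht) as [e1 e2].
    unfold mi. rewrite !id by lra.
    split; apply derive_minus; apply lift_dt; try (unfold L in *; lra); assumption. }
  assert (mom : forall x s t, - PI < x < PI -> 0 < s < L -> 0 < t < T ->
  Rabs (cs s * mi ut' ut x s t + lf u' x s t * mi ux' ux x s t + b x s t * mi us' us x s t + mi px' px x s t) <= K * (Rabs (mi u' u x s t) + Rabs (mi v' v x s t)) /\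
  Rabs (cs s * mi vt' vt x s t + lf u' x s t * mi vx' vx x s t + b x s t * mi vs' vs x s t + cs s * mi ps' ps x s t) <= K * (Rabs (mi u' u x s t) + Rabs (mi v' v x s t))).
  { intros x s t Hx Hs Ht. assert (HB := HM x s t ltac:(lra) ltac:(lra) ltac:(lra)).
    destruct (EQ _ _ t (inC x s Hx Hs) ltac:(lra)) as [E1 [E2 _]]. destruct (EQ' _ _ t (inC x s Hx Hs) ltac:(lra)) as [E1' [E2' _]].
    unfold big in HB. unfold mi, b. rewrite !id in HB by lra. rewrite !id by lra. rewrite csi by lra.
    assert (c0 : 0 < cos (th1 + s)) by (rewrite <- csi by lra; specialize (cs0 s); lra).
    assert (tn : tan (th1 + s) = sin (th1 + s) / cos (th1 + s)) by reflexivity. rewrite tn in *.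
    assert (c1 : Rabs (cos (th1 + s)) <= 1) by (apply Rabs_le, COS_bound).
    assert (s1 : Rabs (sin (th1 + s)) <= 1) by (apply Rabs_le, SIN_bound).
    set (C := cos (th1 + s)) in *. set (Sn := sin (th1 + s)) in *. set (ph := x + PI) in *. set (th := th1 + s) in *.
    set (a1 := u ph th t) in *. set (a2 := v ph th t) in *. set (a3 := u' ph th t) in *. set (a4 := v' ph th t) in *.
    set (x1 := ux ph th t) in *. set (x2 := us ph th t) in *. set (x3 := vx ph th t) in *. set (x4 := vs ph th t) in *.
    rewrite Rabs_right in HB by nra.
    assert (sqb : forall y, y * y <= M -> Rabs y <= M + 1) by (intros y Hy; apply Rabs_le; split; nra).
    assert (q1 := Rle_0_sqr a1). assert (q2 := Rle_0_sqr a2). assert (q3 := Rle_0_sqr a3). assert (q4 := Rle_0_sqr x1).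
    assert (q5 := Rle_0_sqr x2). assert (q6 := Rle_0_sqr x3). assert (q7 := Rle_0_sqr x4). unfold Rsqr in *.
    assert (n1 := sqb a1 ltac:(lra)). assert (n2 := sqb a2 ltac:(lra)). assert (n3 := sqb a3 ltac:(lra)). assert (n4 := sqb x1 ltac:(lra)).
    assert (n5 := sqb x2 ltac:(lra)). assert (n6 := sqb x3 ltac:(lra)). assert (n7 := sqb x4 ltac:(lra)).
    assert (lin : forall A B y1 y2 KA, Rabs A <= KA -> Rabs B <= KA -> Rabs (A * y1 + B * y2) <= KA * (Rabs y1 + Rabs y2)).
    { intros A B y1 y2 KA hA hB. abs_tri. rewrite !Rabs_mult.
      assert (P1 := Rabs_pos y1). assert (P2 := Rabs_pos y2).
      assert (Rabs A * Rabs y1 <= KA * Rabs y1) by (apply Rmult_le_compat_r; lra).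
      assert (Rabs B * Rabs y2 <= KA * Rabs y2) by (apply Rmult_le_compat_r; lra). lra. }
    assert (tri : forall A B a b, Rabs A <= a -> Rabs B <= b -> Rabs (A + B) <= a + b).
    { intros A B a' b' hA hB. abs_tri. lra. }
    assert (con : forall A B b, Rabs A <= 1 -> Rabs B <= b -> Rabs (A * B) <= b).
    { intros A B b' hA hB. rewrite Rabs_mult. assert (P := Rabs_pos B). assert (Rabs A * Rabs B <= 1 * Rabs B) by (apply Rmult_le_compat_r; lra). lra. }
    assert (ng : forall A a, Rabs A <= a -> Rabs (- A) <= a) by (intros A a' hA; rewrite Rabs_Ropp; exact hA).
    assert (om : Rabs (2 * omega) <= 2 * omega) by (rewrite Rabs_right; lra).
    split.
    (* Multiplied by the cosine and subtracted, the two equations leave an expression linear in the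
       velocity differences; its coefficients are undifferentiated velocities, derivatives of the
       first solution and the Coriolis factor. *)
    - match goal with |- Rabs ?e <= _ => replace e with ((- x1 + Sn * a2) * (a3 - a1) + (- (C * x2) + Sn * a3 + C * (Sn * (2 * omega))) * (a4 - a2)) end.
      + apply lin.
        * eapply Rle_trans; [apply tri; [apply ng, n4|apply con; [exact s1|exact n2]]|unfold K; lra].
        * eapply Rle_trans; [apply tri; [apply tri; [apply ng, con; [exact c1|exact n5]|apply con; [exact s1|exact n3]]|apply con; [exact c1|apply con; [exact s1|exact om]]]|unfold K; lra].
      + assert (F1 : C * ut ph th t = - px ph th t - a1 * x1 - C * (a2 * x2) + a1 * a2 * Sn + 2 * omega * a2 * Sn * C).
        { replace (ut ph th t) with (- px ph th t / C - a1 * x1 / C - a2 * x2 + a1 * a2 * (Sn / C) + 2 * omega * a2 * Sn) by lra. field. lra. }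
        assert (F1' : C * ut' ph th t = - px' ph th t - a3 * ux' ph th t - C * (a4 * us' ph th t) + a3 * a4 * Sn + 2 * omega * a4 * Sn * C).
        { replace (ut' ph th t) with (- px' ph th t / C - a3 * ux' ph th t / C - a4 * us' ph th t + a3 * a4 * (Sn / C) + 2 * omega * a4 * Sn) by lra. field. lra. }
        rewrite (Rmult_minus_distr_l C (ut' ph th t)), F1, F1'. ring.
    - match goal with |- Rabs ?e <= _ => replace e with ((- x3 + - (Sn * (a3 + a1)) + - (C * (Sn * (2 * omega)))) * (a3 - a1) + (- (C * x4)) * (a4 - a2)) end.
      + apply lin.
        * eapply Rle_trans; [apply tri; [apply tri; [apply ng, n6|apply ng, con; [exact s1|apply tri; [exact n3|exact n1]]]|apply ng, con; [exact c1|apply con; [exact s1|exact om]]]|unfold K; lra].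
        * eapply Rle_trans; [apply ng, con; [exact c1|exact n7]|unfold K; lra].
      + assert (F1 : C * vt ph th t = - (C * ps ph th t) - a1 * x3 - C * (a2 * x4) - a1 ^ 2 * Sn - 2 * omega * a1 * Sn * C).
        { replace (vt ph th t) with (- ps ph th t - a1 * x3 / C - a2 * x4 - a1 ^ 2 * (Sn / C) - 2 * omega * a1 * Sn) by lra. field. lra. }
        assert (F1' : C * vt' ph th t = - (C * ps' ph th t) - a3 * vx' ph th t - C * (a4 * vs' ph th t) - a3 ^ 2 * Sn - 2 * omega * a3 * Sn * C).
        { replace (vt' ph th t) with (- ps' ph th t - a3 * vx' ph th t / C - a4 * vs' ph th t - a3 ^ 2 * (Sn / C) - 2 * omega * a3 * Sn) by lra. field. lra. }
        rewrite (Rmult_minus_distr_l C (vt' ph th t)), F1, F1'. ring. }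
  assert (inc : forall x s t, - PI < x < PI -> 0 < s < L -> 0 < t < T -> lf ux' x s t + lf dv' x s t = 0 /\ mi ux' ux x s t + mi dv' dv x s t = 0).
  { intros x s t Hx Hs Ht. destruct (EQ _ _ t (inC x s Hx Hs) ltac:(lra)) as [_ [_ E]]. destruct (EQ' _ _ t (inC x s Hx Hs) ltac:(lra)) as [_ [_ E']].
    unfold mi. rewrite !id by lra. lra. }
  assert (zd : forall x s t, 0 < s < L -> z x s t = cs s * mi v' v x s t) by (intros; unfold z, mi; ring).
  assert (bd : forall x t, - PI < x < PI -> b x 0 t = 0 /\ b x L t = 0 /\ z x 0 t = 0 /\ z x L t = 0).
  { intros x t Hx. unfold b, z, lf, lift. fold L. rewrite (cl_id L 0), (cl_id L L) by lra. assert (ct := cl_in T HT t).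
    destruct (BC (x + PI) (cl T t) ltac:(lra) ct) as [r1 r2]. destruct (BC' (x + PI) (cl T t) ltac:(lra) ct) as [r3 r4].
    rewrite Rplus_0_r. replace (th1 + L) with th2 by (unfold L; ring). rewrite r1, r2, r3, r4. repeat split; ring. }
  assert (ini : forall x s, - PI < x < PI -> 0 < s < L -> mi u' u x s 0 = 0 /\ mi v' v x s 0 = 0).
  { intros x s Hx Hs. unfold mi. rewrite !id by lra. destruct (inC x s Hx Hs) as [i1 i2].
    assert (ic : in_Cbar th1 th2 (x + PI) (th1 + s)) by (split; lra).
    destruct (IC _ _ ic) as [r1 r2]. destruct (IC' _ _ ic) as [r3 r4]. rewrite r1, r2, r3, r4. split; ring. }
  assert (pl : forall f, periodic3 f -> forall s t, lf f PI s t = lf f (- PI) s t) by (intros f Hf; apply lift_per, Hf).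
  assert (pm : forall f g, periodic3 f -> periodic3 g -> forall s t, mi f g PI s t = mi f g (- PI) s t) by (intros f g Hf Hg s t; unfold mi; rewrite !pl by assumption; reflexivity).
  assert (cmi : forall f g, c3 (lf f) -> c3 (lf g) -> c3 (mi f g)) by (intros f g Hf Hg; unfold mi; c3_tac).
  assert (K0 : 0 <= K) by (unfold K; lra).
  assert (cb : c3 b) by (unfold b; c3_tac). assert (cz : c3 z) by (unfold z; c3_tac).
  assert (EW := energy_w L T (cos th1) K cs (mi u' u) (mi v' v) (mi p' p) (mi ux' ux) (mi us' us) (mi ut' ut) (mi vx' vx) (mi vs' vs) (mi vt' vt)
    (mi px' px) (mi ps' ps) (lf u') (lf ux') b (lf dv') z (mi dv' dv) HL k0 K0 ccs cs0
    (cmi _ _ cu' cu) (cmi _ _ cv' cv) (cmi _ _ cp' cp) (cmi _ _ cux' cux) (cmi _ _ cus' cus) (cmi _ _ cut' cut) (cmi _ _ cvx' cvx) (cmi _ _ cvs' cvs) (cmi _ _ cvt' cvt)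
    (cmi _ _ cpx' cpx) (cmi _ _ cps' cps) cu' cux' cb cdv' cz (cmi _ _ cdv' cdv)
    (pm _ _ pu' pu) (pm _ _ pv' pv) (pm _ _ pp' pp) (pl _ pu') dx ds dt mom inc zd bd ini).
  assert (EP := energy_q L T (cos th1) K cs (mi u' u) (mi v' v) (mi p' p) (mi ux' ux) (mi us' us) (mi ut' ut) (mi vx' vx) (mi vs' vs) (mi vt' vt)
    (mi px' px) (mi ps' ps) (lf u') (lf ux') b (lf dv') z (mi dv' dv) HL HT k0 K0 ccs cs0
    (cmi _ _ cu' cu) (cmi _ _ cv' cv) (cmi _ _ cp' cp) (cmi _ _ cux' cux) (cmi _ _ cus' cus) (cmi _ _ cut' cut) (cmi _ _ cvx' cvx) (cmi _ _ cvs' cvs) (cmi _ _ cvt' cvt)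
    (cmi _ _ cpx' cpx) (cmi _ _ cps' cps) cu' cux' cb cdv' cz (cmi _ _ cdv' cdv)
    (pm _ _ pu' pu) (pm _ _ pv' pv) (pm _ _ pp' pp) (pl _ pu') dx ds dt mom inc zd bd ini).
  assert (pt : forall f phi theta t, in_Cbar th1 th2 phi theta -> 0 <= t <= T -> lf f (phi - PI) (theta - th1) t = f phi theta t).
  { intros f phi theta t [A1 A2] Ht. rewrite id by (unfold L; lra). f_equal; ring. }
  split.
  - intros phi theta t Hc Ht. assert (Hc' := Hc). destruct Hc' as [A1 A2].
    destruct (EW (phi - PI) (theta - th1) t ltac:(lra) ltac:(unfold L; lra) Ht) as [z1 z2]. unfold mi in z1, z2. rewrite !pt in z1, z2 by assumption. lra.
  - exists (fun t => mi p' p 0 0 t). intros phi theta t Hc Ht. assert (Hc' := Hc). destruct Hc' as [A1 A2].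
    assert (z1 := EP (phi - PI) (theta - th1) t ltac:(lra) ltac:(unfold L; lra) Ht). unfold mi at 1 in z1. rewrite !pt in z1 by assumption. lra.
Qed.

(** * Initial data on the sphere *)

Definition turns (x : R) : Z := Int_part (x / (2 * PI)).
(** The representative of a longitude in [0, 2 PI), the only range in which the hypotheses on the
    data speak. *)
Definition red (x : R) : R := x - 2 * IZR (turns x) * PI.
Lemma red_in x : 0 <= red x < 2 * PI.
Proof.
  assert (Hp := PI_RGT_0). unfold red, turns. destruct (base_Int_part (x / (2 * PI))) as [A B].
  set (k := IZR (Int_part (x / (2 * PI)))) in *.
  replace (x - 2 * k * PI) with ((x / (2 * PI) - k) * (2 * PI)) by (field; lra). nra.
Qed.
Lemma period_Z (h : R -> R) : (forall x, h (x + 2 * PI) = h x) -> forall k x, h (x + 2 * IZR k * PI) = h x.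
Proof.
  intros H.
  assert (N : forall n x, h (x + 2 * INR n * PI) = h x).
  { induction n as [|n IH]; intros x; [simpl; f_equal; ring|]. rewrite S_INR.
    replace (x + 2 * (INR n + 1) * PI) with ((x + 2 * INR n * PI) + 2 * PI) by ring. rewrite H. apply IH. }
  intros k x. destruct (Z_le_dec 0 k) as [h0|h0].
  - rewrite <- (Z2Nat.id k h0), <- INR_IZR_INZ. apply N.
  - rewrite <- (N (Z.to_nat (- k)) (x + 2 * IZR k * PI)). f_equal. rewrite INR_IZR_INZ, Z2Nat.id by lia. rewrite opp_IZR. ring.
Qed.
Lemma red_per (h : R -> R) x : (forall x, h (x + 2 * PI) = h x) -> h (red x) = h x.
Proof. intros H. rewrite <- (period_Z h H (turns x) (red x)). f_equal. unfold red. ring. Qed.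
Lemma red_plus x : red (x + 2 * PI) = red x.
Proof.
  assert (A := red_in x). assert (B := red_in (x + 2 * PI)). assert (Hp := PI_RGT_0). unfold red in *.
  set (k := turns x) in *. set (k' := turns (x + 2 * PI)) in *.
  assert (B1 : IZR (k' - k) < 2) by (rewrite minus_IZR; nra). assert (B2 : 0 < IZR (k' - k)) by (rewrite minus_IZR; nra).
  apply (lt_IZR _ 2) in B1. apply (lt_IZR 0) in B2. replace k' with (k + 1)%Z by lia. rewrite plus_IZR. ring.
Qed.
Lemma cos_2PI x : cos (x + 2 * PI) = cos x.
Proof. rewrite <- (cos_period x 1). f_equal. simpl. ring. Qed.
Lemma cos_red x y : cos (red x - red y) = cos (x - y).
Proof.
  rewrite <- (period_Z cos cos_2PI (turns x - turns y) (red x - red y)). f_equal. unfold red. rewrite minus_IZR. ring.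
Qed.

Lemma one_minus_cos_le x : 1 - cos x <= x ^ 2 / 2.
Proof.
  assert (K : forall y, 0 <= y -> 1 - cos y <= y ^ 2 / 2).
  { intros y Hy. destruct (MVT_abs (fun y => y ^ 2 / 2 + cos y) (fun y => y - sin y) 0 y) as [c [Hc E]].
    - intros z _. auto_derive; [exact I|field].
    - rewrite Rmin_left, Rmax_right in Hc by lra. rewrite cos_0 in E.
      assert (sin c <= c).
      { destruct (MVT_abs (fun y => y - sin y) (fun y => 1 - cos y) 0 c) as [e [He E2]]; [intros z _; auto_derive; [exact I|ring]|].
        rewrite sin_0 in E2. assert (B := COS_bound e). nra. }
      nra. }
  destruct (Rle_dec 0 x) as [h|h]; [apply K, h|]. rewrite <- cos_neg. replace (x ^ 2) with ((- x) ^ 2) by ring. apply K. lra.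
Qed.

Section Data.
Variables (th1 th2 a : R).
Hypotheses (H1 : - (PI / 2) < th1) (H12 : th1 < th2) (H2 : th2 < 0) (Ha : 0 < a < 1).

(** The inner product is cos(y - y') - cos y cos y' (1 - cos(x - x')), so 1 minus it is at most d^2.
    As 1 - cos of an angle is at least one eighth of its square, the geodesic distance is at most
    sqrt 8 d <= 3 d. Reduction of the longitudes does not affect the cosine. *)
Lemma geod_le x x' y y' d : th1 <= y <= th2 -> th1 <= y' <= th2 -> 0 < d -> Rabs (x - x') <= d -> Rabs (y - y') <= d ->
  0 <= geod (sph (red x) y) (sph (red x') y') <= 3 * d.
Proof.
  intros Hy Hy' Hd Hx Hyy. unfold geod, sph. set (c := _ + _ + _).
  assert (E : c = cos (y - y') - cos y * cos y' * (1 - cos (x - x'))).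
  { unfold c. rewrite <- (cos_red x x'), !cos_minus. ring. }
  assert (Hp := PI_RGT_0).
  assert (p1 : 0 < cos y) by (apply cos_gt_0; lra). assert (p2 : 0 < cos y') by (apply cos_gt_0; lra).
  assert (B1 := COS_bound y). assert (B2 := COS_bound y'). assert (B3 := COS_bound (x - x')). assert (B4 := COS_bound (y - y')).
  assert (C1 := one_minus_cos_le (x - x')). assert (C2 := one_minus_cos_le (y - y')).
  assert (pp : 0 <= cos y * cos y' <= 1) by nra.
  assert (u1 : 1 - c <= d ^ 2).
  { rewrite E. assert (Q1 : (x - x') ^ 2 <= d ^ 2) by (apply Rabs_le_between in Hx; nra).
    assert (Q2 : (y - y') ^ 2 <= d ^ 2) by (apply Rabs_le_between in Hyy; nra).
    assert (cos y * cos y' * (1 - cos (x - x')) <= 1 * (1 - cos (x - x'))) by (apply Rmult_le_compat_r; lra). lra. }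
  assert (u2 : c <= 1) by (rewrite E; nra).
  assert (u3 : -1 <= c).
  { assert (G' := COS_bound (y + y')). rewrite E. rewrite cos_minus.
    rewrite cos_plus in G'. nra. }
  assert (A := acos_bound c). split; [lra|].
  assert (K := one_minus_cos_ge (acos c) ltac:(rewrite Rabs_right; lra)). rewrite cos_acos in K by lra.
  apply Rnot_lt_le. intros Hl. nra.
Qed.

(** [holder0] speaks only of points at positive distance; points at distance zero have to be
    identified. On the band the cosine of the latitude is positive, and two reduced longitudes
    differ by less than 2 PI, so they agree once their difference has cosine 1. *)
Lemma geod_zero x x' y y' : th1 <= y <= th2 -> th1 <= y' <= th2 -> geod (sph (red x) y) (sph (red x') y') <= 0 -> red x = red x' /\ y = y'.
Proof.
  intros Hy Hy' Hg. assert (Hp := PI_RGT_0).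
  assert (Hg0 := proj1 (geod_le x x' y y' (Rabs (x - x') + Rabs (y - y') + 1) Hy Hy' ltac:(assert (P := Rabs_pos (x - x')); assert (P' := Rabs_pos (y - y')); lra)
    ltac:(assert (P' := Rabs_pos (y - y')); lra) ltac:(assert (P' := Rabs_pos (x - x')); lra))).
  unfold geod, sph in *. set (c := _ + _ + _) in *.
  assert (E : c = cos (y - y') - cos y * cos y' * (1 - cos (red x - red x'))).
  { unfold c. rewrite !cos_minus. ring. }
  assert (p1 : 0 < cos y) by (apply cos_gt_0; lra). assert (p2 : 0 < cos y') by (apply cos_gt_0; lra).
  assert (pp : 0 < cos y * cos y') by nra.
  assert (B3 := COS_bound (red x - red x')). assert (B4 := COS_bound (y - y')).
  assert (c1 : 1 <= c).
  { apply Rnot_lt_le. intros Hl. assert (u3 : -1 <= c).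
    { rewrite E. assert (G' := COS_bound (y + y')). rewrite cos_plus in G'. rewrite cos_minus.
      assert (B1 := COS_bound y). assert (B2 := COS_bound y'). nra. }
    assert (Z : acos c = 0) by lra. assert (K := cos_acos c ltac:(lra)). rewrite Z, cos_0 in K. lra. }
  assert (Y1 : cos (y - y') = 1) by nra. assert (X1 : cos (red x - red x') = 1) by nra.
  assert (yz : y = y').
  { assert (K := one_minus_cos_ge (y - y') ltac:(apply Rabs_le; lra)). nra. }
  split; [|exact yz].
  assert (r1 := red_in x). assert (r2 := red_in x').
  destruct (Rle_dec (Rabs (red x - red x')) PI) as [h|h].
  - assert (K := one_minus_cos_ge _ h). nra.
  - exfalso. set (D := red x - red x') in *.
    assert (Dd : Rabs (Rabs D - 2 * PI) < PI) by (apply Rabs_def1; [assert (Rabs D < 2 * PI) by (apply Rabs_def1; unfold D; lra); lra|lra]).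
    assert (K := one_minus_cos_ge (Rabs D - 2 * PI) ltac:(lra)).
    assert (Ec : cos (Rabs D - 2 * PI) = cos D).
    { rewrite <- (cos_2PI (Rabs D - 2 * PI)). replace (Rabs D - 2 * PI + 2 * PI) with (Rabs D) by ring.
      unfold Rabs. destruct (Rcase_abs D); [apply cos_neg|reflexivity]. }
    rewrite Ec, X1 in K. assert (Rabs D = 2 * PI) by nra. assert (Rabs D < 2 * PI) by (apply Rabs_def1; unfold D; lra). lra.
Qed.

Definition hold (f : R -> R -> R) (C : R) := forall x x' y y' d, th1 <= y <= th2 -> th1 <= y' <= th2 -> 0 < d ->
  Rabs (x - x') <= d -> Rabs (y - y') <= d -> Rabs (f x y - f x' y') <= C * Rpower d a.

Lemma holder0_hold f : holder0 th1 th2 a f -> exists C, hold (fun x y => f (red x) y) C.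
Proof.
  intros [C [HC H]]. exists (C * Rpower 3 a). intros x x' y y' d Hy Hy' Hd Hx Hyy.
  assert (P : 0 < Rpower 3 a * Rpower d a) by (apply Rmult_lt_0_compat; apply Rpower_pos).
  destruct (geod_le x x' y y' d Hy Hy' Hd Hx Hyy) as [g0 g1].
  destruct (Rle_dec (geod (sph (red x) y) (sph (red x') y')) 0) as [h|h].
  - destruct (geod_zero x x' y y' Hy Hy' h) as [e1 e2]. rewrite e1, e2, Rminus_diag, Rabs_R0. rewrite Rmult_assoc. nra.
  - eapply Rle_trans; [apply H; [split; [apply red_in|lra]|split; [apply red_in|lra]|lra]|].
    rewrite Rmult_assoc. apply Rmult_le_compat_l; [lra|]. rewrite Rpower_mult_distr by lra. apply Rpower_le_base; lra.
Qed.

(** The derivatives are given on one period. Composed with [red] they become periodic functions on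
    the line, and by periodicity of f they are its derivatives everywhere. *)
Lemma holder1_data f : periodic2 f -> holder1 th1 th2 a f -> exists fx fs C,
  (hold f C /\ hold fx C /\ hold fs C) /\ (per fx /\ per fs) /\
  (forall x y, th1 < y < th2 -> is_derive (fun x => f x y) x (fx x y) /\ is_derive (fun y => f x y) y (fs x y)).
Proof.
  intros Pf [fx [fs [D [Hf [Hx Hs]]]]].
  destruct (holder0_hold f Hf) as [C0 K0]. destruct (holder0_hold fx Hx) as [C1 K1]. destruct (holder0_hold fs Hs) as [C2 K2].
  assert (rf : forall x y, f (red x) y = f x y) by (intros x y; apply (red_per (fun x => f x y)); intros; apply Pf).
  exists (fun x y => fx (red x) y), (fun x y => fs (red x) y), (Rmax C0 (Rmax C1 C2)).
  assert (up : forall k c, hold k c -> c <= Rmax C0 (Rmax C1 C2) -> hold k (Rmax C0 (Rmax C1 C2))).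
  { intros k c Hk Hc x x' y y' d h1 h2 h3 h4 h5. eapply Rle_trans; [apply (Hk x x' y y' d); assumption|].
    apply Rmult_le_compat_r; [left; apply Rpower_pos|exact Hc]. }
  split; [|split].
  - split; [|split].
    + apply up with C0; [|apply Rmax_l]. intros x x' y y' d. rewrite <- (rf x), <- (rf x'). apply K0.
    + apply up with C1; [exact K1|]. eapply Rle_trans; [apply (Rmax_l C1 C2)|apply Rmax_r].
    + apply up with C2; [exact K2|]. eapply Rle_trans; [apply (Rmax_r C1 C2)|apply Rmax_r].
  - split; intros x y; rewrite red_plus; reflexivity.
  - intros x y Hy. destruct (D (red x) y) as [d1 d2]; [split; [apply red_in|exact Hy]|]. split.
    + apply is_derive_ext with (fun z => f (z + 2 * IZR (- turns x) * PI) y).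
      * intros z. apply (period_Z (fun x => f x y)). intros; apply Pf.
      * replace (fx (red x) y) with (1 * fx (red x) y) by ring.
        apply (is_derive_comp (V := RN) (fun x => f x y) (fun z => z + 2 * IZR (- turns x) * PI)).
        -- replace (x + 2 * IZR (- turns x) * PI) with (red x) by (unfold red; rewrite opp_IZR; ring). exact d1.
        -- auto_derive; [exact I|ring].
    + apply is_derive_ext with (fun y => f (red x) y); [intros; apply rf|exact d2].
Qed.
End Data.

(** * Hölder classes on the strip *)

Section StripHolder.
Variables (L al : R).
Hypotheses (HL : 0 < L) (Hal : 0 < al < 1).

Lemma pow_ge d : 0 < d -> d <= 1 -> d <= Rpower d al.
Proof.
  intros Hd H. rewrite <- (Rpower_1 d) at 1 by lra. unfold Rpower. apply exp_mono.
  assert (ln d <= 0) by (rewrite <- ln_1; apply ln_le; lra). nra.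
Qed.
(** The derivative bound serves for d <= 1, twice the sup bound for d > 1. *)
Lemma hol2_of_C1 (k k' : R -> R) K : (forall s, is_derive k s (k' s)) -> (forall s, 0 <= s <= L -> Rabs (k s) <= K /\ Rabs (k' s) <= K) ->
  hol2 L al (fun _ s => k s) (2 * K).
Proof.
  intros D B x x' y y' d Hy Hy' Hd Hx Hyy.
  assert (K0 : 0 <= K) by (eapply Rle_trans; [apply Rabs_pos|apply (B 0); lra]).
  destruct (Rle_dec d 1) as [h|h].
  - assert (P := pow_ge d Hd h).
    destruct (MVT_abs k k' y' y) as [c [Hc E]]; [intros; apply D|]. rewrite E, Rabs_mult.
    assert (Hc' : 0 <= c <= L) by (unfold Rmin, Rmax in Hc; destruct (Rle_dec y' y); lra).
    assert (Rabs (k' c) * Rabs (y - y') <= K * d) by (apply Rmult_le_compat; auto using Rabs_pos; apply (B c Hc')).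
    assert (K * d <= K * Rpower d al) by (apply Rmult_le_compat_l; lra). assert (0 <= K * Rpower d al) by (apply Rmult_le_pos; [lra|left; apply Rpower_pos]). lra.
  - assert (P : 1 <= Rpower d al) by (rewrite <- (Rpower_O d) by lra; apply Rle_Rpower; lra).
    unfold Rminus. abs_tri. rewrite Rabs_Ropp. assert (b1 := proj1 (B y Hy)). assert (b2 := proj1 (B y' Hy')). nra.
Qed.
Lemma hol2_plus f g H H' : hol2 L al f H -> hol2 L al g H' -> hol2 L al (fun x s => f x s + g x s) (H + H').
Proof.
  intros A B x x' y y' d Hy Hy' Hd Hx Hyy. specialize (A x x' y y' d Hy Hy' Hd Hx Hyy). specialize (B x x' y y' d Hy Hy' Hd Hx Hyy).
  replace (f x y + g x y - (f x' y' + g x' y')) with ((f x y - f x' y') + (g x y - g x' y')) by ring.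
  abs_tri. lra.
Qed.
Lemma hol2_mult f g H H' M M' : supb L f M -> supb L g M' -> hol2 L al f H -> hol2 L al g H' -> hol2 L al (fun x s => f x s * g x s) (M * H' + M' * H).
Proof.
  intros sf sg A B x x' y y' d Hy Hy' Hd Hx Hyy. specialize (A x x' y y' d Hy Hy' Hd Hx Hyy). specialize (B x x' y y' d Hy Hy' Hd Hx Hyy).
  replace (f x y * g x y - f x' y' * g x' y') with (f x y * (g x y - g x' y') + g x' y' * (f x y - f x' y')) by ring.
  abs_tri. rewrite !Rabs_mult. rewrite Rmult_plus_distr_r, !Rmult_assoc.
  apply Rplus_le_compat; apply Rmult_le_compat; auto using Rabs_pos.
Qed.
(** One period of the strip has finite diameter, so Hölder continuity bounds the oscillation from
    the value at the origin. *)
Lemma hol2_supb f H : per f -> hol2 L al f H -> exists M, supb L f M.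
Proof.
  intros pf hf. assert (Hp := PI_RGT_0). exists (Rabs (f 0 0) + H * Rpower (2 * PI + L) al). intros x s Hs.
  rewrite <- (red_per (fun x => f x s) x) by (intros; apply pf). assert (r := red_in x).
  assert (K := hf (red x) 0 s 0 (2 * PI + L) Hs ltac:(lra) ltac:(lra) ltac:(apply Rabs_le; lra) ltac:(apply Rabs_le; lra)).
  assert (T := Rabs_triang (f (red x) s - f 0 0) (f 0 0)). replace (f (red x) s - f 0 0 + f 0 0) with (f (red x) s) in T by ring. lra.
Qed.
Lemma hol2_c2 f H : hol2 L al f H -> c2 (fun x s => f x (cl L s)).
Proof.
  intros hf [x s]. apply continuous_eps. intros eps He.
  assert (Hm : 0 < Rmax H 1) by (eapply Rlt_le_trans; [apply Rlt_0_1|apply Rmax_r]).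
  destruct (Rpower_small (Rmax H 1) al (eps / 2)) as [d [Hd A]]; [exact Hm|lra|lra|].
  exists d. split; [exact Hd|]. intros [x' s'] [B1 B2]. simpl.
  assert (c1 := cl_in L HL s). assert (c2 := cl_in L HL s').
  assert (K := hf x' x (cl L s') (cl L s) d c2 c1 Hd ltac:(left; exact B1) ltac:(left; eapply Rle_lt_trans; [apply cl_lip, HL|exact B2])).
  assert (H * Rpower d al <= Rmax H 1 * Rpower d al) by (apply Rmult_le_compat_r; [left; apply Rpower_pos|apply Rmax_l]). lra.
Qed.
End StripHolder.

(** * Mercator coordinates and existence *)

Lemma derive_scal_r (f : R -> R) x l c : is_derive f x l -> is_derive (fun x => f x * c) x (l * c).
Proof.
  intros H. rewrite Rmult_comm. apply is_derive_ext with (fun x => c * f x); [intros; apply Rmult_comm|]. apply is_derive_scal, H.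
Qed.
Lemma cl_derive L (f : R -> R) s l : 0 < s < L -> is_derive f s l -> is_derive (fun s => f (cl L s)) s l.
Proof.
  intros Hs D. assert (r0 : 0 < Rmin s (L - s)) by (apply Rmin_pos; lra). apply is_derive_ext_loc with f; [|exact D].
  exists (mkposreal _ r0). intros y Hy. change (Rabs (y - s) < Rmin s (L - s)) in Hy.
  assert (r1 := Rmin_l s (L - s)). assert (r2 := Rmin_r s (L - s)). apply Rabs_def2 in Hy. rewrite cl_id by lra. reflexivity.
Qed.
Lemma ucont_c3 L T f : 0 < L -> 0 < T -> ucont L T f -> c3 (fun x s t => f x (cl L s) (cl T t)).
Proof.
  intros HL HT H [[x s] t]. apply continuous_eps. intros eps He. destruct (H (eps / 2) ltac:(lra)) as [d [Hd A]].
  exists d. split; [exact Hd|]. intros [[x' s'] t'] [[B1 B2] B3]. simpl.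
  assert (K : Rabs (f x' (cl L s') (cl T t') - f x (cl L s) (cl T t)) <= eps / 2); [|lra].
  apply A.
  - split; apply cl_in; assumption.
  - split; apply cl_in; assumption.
  - left. exact B1.
  - left. eapply Rle_lt_trans; [apply cl_lip, HL|exact B2].
  - left. eapply Rle_lt_trans; [apply cl_lip, HT|exact B3].
Qed.
Lemma c3_cont_S th1 th2 T f : c3 f -> cont_S th1 th2 T f.
Proof.
  intros H x y t _ eps He. destruct (proj1 (continuous_eps _ (x, y, t)) (H (x, y, t)) eps He) as [d [Hd A]].
  exists d. split; [exact Hd|]. intros x' y' t' _ B1 B2 B3. apply (A (x', y', t')). repeat split; assumption.
Qed.

Section Mercator.
Variables (th1 th2 : R).
Hypotheses (H1 : - (PI / 2) < th1) (H12 : th1 < th2) (H2 : th2 < 0).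
(* lat is the inverse of merc and satisfies lat' = cos lat. *)
Definition merc (y : R) : R := arcsinh (tan y) - arcsinh (tan th1).
Definition lat (s : R) : R := atan (sinh (s + arcsinh (tan th1))).
Definition mlen := merc th2.

Lemma sqrt_sinh y : sqrt (1 + (sinh y)²) = cosh y.
Proof.
  assert (E := cosh_sinh_sq y). assert (P : 0 < cosh y) by (unfold cosh; assert (A := exp_pos y); assert (B := exp_pos (- y)); lra).
  replace (1 + (sinh y)²) with ((cosh y)²) by (unfold Rsqr; lra). apply sqrt_Rsqr. lra.
Qed.
Lemma cosh_pos y : 0 < cosh y.
Proof. unfold cosh. assert (A := exp_pos y). assert (B := exp_pos (- y)). lra. Qed.
(** Up to a translation [lat] is the Gudermannian function, and cos(atan(sinh y)) = 1 / cosh y. *)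
Lemma lat_derive s : is_derive lat s (cos (lat s)).
Proof.
  unfold lat. rewrite cos_atan, sqrt_sinh. set (c := arcsinh (tan th1)). assert (P := cosh_pos (s + c)). assert (E := cosh_sinh_sq (s + c)).
  replace (1 / cosh (s + c)) with (cosh (s + c) * / (1 + (sinh (s + c))²)).
  - apply (is_derive_comp (V := RN) atan (fun s => sinh (s + c))); [apply is_derive_atan|].
    replace (cosh (s + c)) with (1 * cosh (s + c)) by ring.
    apply (is_derive_comp (V := RN) sinh (fun s => s + c)); [apply is_derive_Reals, derivable_pt_lim_sinh|]. auto_derive; [exact I|ring].
  - replace (1 + (sinh (s + c))²) with (cosh (s + c) * cosh (s + c)) by (unfold Rsqr; lra). field. lra.
Qed.
Lemma lat_bound s : - (PI / 2) < lat s < PI / 2.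
Proof. unfold lat. assert (B := atan_bound (sinh (s + arcsinh (tan th1)))). lra. Qed.
Lemma cos_lat_pos s : 0 < cos (lat s).
Proof. assert (B := lat_bound s). apply cos_gt_0; lra. Qed.
Lemma lat_merc y : - (PI / 2) < y < PI / 2 -> lat (merc y) = y.
Proof. intros Hy. unfold lat, merc. replace (arcsinh (tan y) - arcsinh (tan th1) + arcsinh (tan th1)) with (arcsinh (tan y)) by ring. rewrite sinh_arcsinh. apply atan_tan, Hy. Qed.
Lemma merc_0 : merc th1 = 0. Proof. unfold merc. ring. Qed.
Lemma merc_lt y y' : - (PI / 2) < y -> y < y' -> y' < PI / 2 -> merc y < merc y'.
Proof. intros A B C. unfold merc. assert (K := arcsinh_lt _ _ (tan_increasing y y' ltac:(lra) B C)). lra. Qed.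
Lemma merc_in y : th1 <= y <= th2 -> 0 <= merc y <= mlen.
Proof.
  intros Hy. assert (Hp := PI_RGT_0). unfold mlen. rewrite <- merc_0. split.
  - destruct (Req_dec th1 y) as [h|h]; [rewrite h; lra|]. left. apply merc_lt; lra.
  - destruct (Req_dec y th2) as [h|h]; [rewrite h; lra|]. left. apply merc_lt; lra.
Qed.
Lemma merc_in' y : th1 < y < th2 -> 0 < merc y < mlen.
Proof. intros Hy. assert (Hp := PI_RGT_0). unfold mlen. rewrite <- merc_0. split; apply merc_lt; lra. Qed.
Lemma mlen_pos : 0 < mlen.
Proof. assert (A := merc_in' ((th1 + th2) / 2) ltac:(lra)). lra. Qed.
Lemma lat_mono s s' : s < s' -> lat s < lat s'.
Proof.
  intros Hs. destruct (MVT_abs lat (fun s => cos (lat s)) s s') as [c [_ E]]; [intros; apply lat_derive|].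
  assert (P := cos_lat_pos c). nra.
Qed.
Lemma lat_0 : lat 0 = th1.
Proof. rewrite <- merc_0. apply lat_merc. lra. Qed.
Lemma lat_len : lat mlen = th2.
Proof. apply lat_merc. lra. Qed.
Lemma lat_in s : 0 <= s <= mlen -> th1 <= lat s <= th2.
Proof.
  intros Hs. rewrite <- lat_0, <- lat_len. split.
  - destruct (Req_dec 0 s) as [h|h]; [rewrite h; lra|]. left. apply lat_mono. lra.
  - destruct (Req_dec s mlen) as [h|h]; [rewrite h; lra|]. left. apply lat_mono. lra.
Qed.
Lemma lat_in' s : 0 < s < mlen -> th1 < lat s < th2.
Proof. intros Hs. rewrite <- lat_0, <- lat_len. split; apply lat_mono; lra. Qed.
Lemma lat_lip s s' : Rabs (lat s - lat s') <= Rabs (s - s').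
Proof.
  destruct (MVT_abs lat (fun s => cos (lat s)) s' s) as [c [_ E]]; [intros; apply lat_derive|]. rewrite E, Rabs_mult.
  assert (B : Rabs (cos (lat c)) <= 1) by (apply Rabs_le, COS_bound). assert (P := Rabs_pos (s - s')). nra.
Qed.
Lemma cont_lat : cont lat.
Proof. intros s. apply (ex_derive_continuous lat). exists (cos (lat s)). apply lat_derive. Qed.
Lemma cos_ge y : th1 <= y <= th2 -> cos th1 <= cos y.
Proof. intros Hy. assert (Hp := PI_RGT_0). rewrite <- (cos_neg th1), <- (cos_neg y). apply cos_decr_1; lra. Qed.
Lemma merc_derive y : - (PI / 2) < y < PI / 2 -> is_derive merc y (/ cos y).
Proof.
  intros Hy. assert (c : 0 < cos y) by (apply cos_gt_0; lra). unfold merc.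
  assert (E : / cos y = (1 + tan y ^ 2) * / sqrt (tan y ^ 2 + 1) - 0).
  { rewrite Rminus_0_r. assert (S : tan y ^ 2 + 1 = / cos y * / cos y).
    { unfold tan. assert (P := sin2_cos2 y). unfold Rsqr in P. apply Rmult_eq_reg_r with (cos y * cos y); [|nra].
      replace ((sin y / cos y) ^ 2 + 1) with ((sin y * sin y + cos y * cos y) / (cos y * cos y)) by (field; lra). rewrite P. field. lra. }
    assert (i : 0 < / cos y) by (apply Rinv_0_lt_compat, c).
    rewrite (Rplus_comm 1), S. rewrite sqrt_square by lra. field. lra. }
  rewrite E. apply (is_derive_minus (V := RN)); [|apply (is_derive_const (V := RN))].
  apply (is_derive_comp (V := RN) arcsinh tan).
  - apply is_derive_Reals, derivable_pt_lim_arcsinh.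
  - unfold tan. auto_derive; [lra|field; lra].
Qed.
Lemma sec_derive s : is_derive (fun s => / cos (lat s)) s (sin (lat s) / cos (lat s)).
Proof.
  assert (c := cos_lat_pos s).
  replace (sin (lat s) / cos (lat s)) with (cos (lat s) * (sin (lat s) / (cos (lat s) * cos (lat s)))) by (field; lra).
  apply (is_derive_comp (V := RN) (fun y => / cos y) lat); [|apply lat_derive]. auto_derive; [lra|field; lra].
Qed.
Lemma tan_derive s : is_derive (fun s => sin (lat s) / cos (lat s)) s (/ cos (lat s)).
Proof.
  assert (c := cos_lat_pos s). assert (P := sin2_cos2 (lat s)). unfold Rsqr in P.
  replace (/ cos (lat s)) with (cos (lat s) * ((sin (lat s) * sin (lat s) + cos (lat s) * cos (lat s)) / (cos (lat s) * cos (lat s)))) by (rewrite P; field; lra).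
  apply (is_derive_comp (V := RN) (fun y => sin y / cos y) lat); [|apply lat_derive]. auto_derive; [lra|field; lra].
Qed.
Lemma sin_lat_derive s : is_derive (fun s => sin (lat s)) s (cos (lat s) * cos (lat s)).
Proof. apply (is_derive_comp (V := RN) sin lat); [auto_derive; [exact I|ring]|apply lat_derive]. Qed.
Lemma sec_bounds s : 0 <= s <= mlen -> 1 <= / cos (lat s) <= / cos th1 /\ Rabs (sin (lat s) / cos (lat s)) <= / cos th1.
Proof.
  intros Hs. assert (Hp := PI_RGT_0). assert (c := cos_lat_pos s). assert (C := COS_bound (lat s)). assert (G := cos_ge _ (lat_in s Hs)).
  assert (k : 0 < cos th1) by (apply cos_gt_0; lra).
  assert (A : / cos (lat s) <= / cos th1) by (apply Rinv_le_contravar; assumption).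
  split; [split; [rewrite <- Rinv_1; apply Rinv_le_contravar; lra|exact A]|].
  unfold Rdiv. rewrite Rabs_mult, (Rabs_right (/ cos (lat s))) by (left; apply Rinv_0_lt_compat, c).
  assert (Rabs (sin (lat s)) <= 1) by (apply Rabs_le, SIN_bound). assert (0 < / cos (lat s)) by (apply Rinv_0_lt_compat, c). nra.
Qed.
End Mercator.

Section Existence.
Variables (omega th1 th2 a T : R) (u0 v0 : R -> R -> R).
Hypotheses (Hom : 0 < omega) (H1 : - (PI / 2) < th1) (H12 : th1 < th2) (H2 : th2 < 0) (Ha : 0 < a < 1) (HT : 0 < T).
Hypotheses (pu0 : periodic2 u0) (pv0 : periodic2 v0).
Hypothesis bc0 : forall phi, 0 <= phi < 2 * PI -> v0 phi th1 = 0 /\ v0 phi th2 = 0.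
Variables (u0x u0s v0x v0s : R -> R -> R) (Cu Cv : R).
Hypotheses (hu : hold th1 th2 a u0 Cu /\ hold th1 th2 a u0x Cu /\ hold th1 th2 a u0s Cu) (pu : per u0x /\ per u0s)
  (du : forall x y, th1 < y < th2 -> is_derive (fun x => u0 x y) x (u0x x y) /\ is_derive (fun y => u0 x y) y (u0s x y)).
Hypotheses (hv : hold th1 th2 a v0 Cv /\ hold th1 th2 a v0x Cv /\ hold th1 th2 a v0s Cv) (pv : per v0x /\ per v0s)
  (dv : forall x y, th1 < y < th2 -> is_derive (fun x => v0 x y) x (v0x x y) /\ is_derive (fun y => v0 x y) y (v0s x y)).
Hypothesis div0 : forall x y, th1 < y < th2 -> u0x x y + (v0s x y * cos y - v0 x y * sin y) = 0.
Notation Th := (lat th1). Notation L := (mlen th1 th2). Notation sg := (merc th1).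
Let HL : 0 < L := mlen_pos th1 th2 H1 H12 H2.
Let k0 : 0 < cos th1. Proof. assert (Hp := PI_RGT_0). apply cos_gt_0; lra. Qed.

Definition smu s := / cos (Th s) * / cos (Th s).
Definition smu' s := 2 * (sin (Th s) / cos (Th s) * / cos (Th s)).
Definition sfc s := 2 * omega * sin (Th s).
Definition onstrip (g : R -> R -> R) (x s : R) := g x (Th s).
(** The absolute vorticity of the data, v_phi / cos theta - u_theta + u tan theta + 2 omega sin
    theta, along the Mercator coordinate. In this expanded form each summand is a product of Hölder
    functions. *)
Definition Q00 (x s : R) := / cos (Th s) * onstrip v0x x s + sin (Th s) / cos (Th s) * onstrip u0 x s + (-1) * onstrip u0s x s + sfc s.
Definition Qini (x s : R) := Q00 x (cl L s).

Lemma hol_onstrip g C : hold th1 th2 a g C -> hol2 L a (onstrip g) C.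
Proof.
  intros H x x' y y' d Hy Hy' Hd Hx Hyy. unfold onstrip. apply H; auto; try (apply (lat_in th1 th2); assumption).
  eapply Rle_trans; [apply lat_lip|exact Hyy].
Qed.
Lemma c_der (k k' : R -> R) : (forall s, is_derive k s (k' s)) -> cont k.
Proof. intros H s. apply (ex_derive_continuous k). exists (k' s). apply H. Qed.
Lemma csec : cont (fun s => / cos (Th s)). Proof. eapply c_der, sec_derive. Qed.
Lemma ctn : cont (fun s => sin (Th s) / cos (Th s)). Proof. eapply c_der, tan_derive. Qed.

Lemma Q00_hol : exists H, hol2 L a Q00 H.
Proof.
  assert (i0 : 0 < / cos th1) by (apply Rinv_0_lt_compat, k0).
  assert (A1 : hol2 L a (fun _ s => / cos (Th s)) (2 * / cos th1)).
  { apply (hol2_of_C1 L a HL Ha (fun s => / cos (Th s)) (fun s => sin (Th s) / cos (Th s))); [apply sec_derive|].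
    intros s Hs. destruct (sec_bounds th1 th2 H1 H12 H2 s Hs) as [[b1 b2] b3]. split; [rewrite Rabs_right; lra|exact b3]. }
  assert (A2 : hol2 L a (fun _ s => sin (Th s) / cos (Th s)) (2 * / cos th1)).
  { apply (hol2_of_C1 L a HL Ha (fun s => sin (Th s) / cos (Th s)) (fun s => / cos (Th s))); [apply tan_derive|].
    intros s Hs. destruct (sec_bounds th1 th2 H1 H12 H2 s Hs) as [[b1 b2] b3]. split; [exact b3|rewrite Rabs_right; lra]. }
  assert (A3 : hol2 L a (fun _ s => sfc s) (2 * (2 * omega))).
  { apply (hol2_of_C1 L a HL Ha sfc (fun s => 2 * omega * (cos (Th s) * cos (Th s)))).
    - intros s. apply is_derive_scal, sin_lat_derive.
    - intros s _. unfold sfc. assert (S : Rabs (sin (Th s)) <= 1) by (apply Rabs_le, SIN_bound).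
      assert (C : Rabs (cos (Th s)) <= 1) by (apply Rabs_le, COS_bound). assert (C' := Rabs_pos (cos (Th s))).
      rewrite !(Rabs_mult (2 * omega)), (Rabs_mult (cos (Th s))), (Rabs_right (2 * omega)) by lra.
      assert (Rabs (cos (Th s)) * Rabs (cos (Th s)) <= 1) by nra. split; nra. }
  assert (A4 : hol2 L a (fun _ _ => -1) (2 * 1)).
  { apply (hol2_of_C1 L a HL Ha (fun _ => -1) (fun _ => 0)); [intros; apply (is_derive_const (V := RN))|].
    intros. rewrite Rabs_R0, Rabs_left; lra. }
  assert (st : forall k : R -> R, per (fun _ s => k s)) by (intros k x s; reflexivity).
  assert (pon : forall g, per g -> per (onstrip g)) by (intros g Hg x s; apply Hg).
  assert (ML : forall f g H H', per f -> per g -> hol2 L a f H -> hol2 L a g H' -> exists H'', hol2 L a (fun x s => f x s * g x s) H'').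
  { intros f g H H' pf pg hf hg. destruct (hol2_supb L a HL f H pf hf) as [M sf]. destruct (hol2_supb L a HL g H' pg hg) as [M' sg].
    eexists. apply (hol2_mult L a f g H H' M M'); assumption. }
  destruct (ML _ _ _ _ (st _) (pon _ (proj1 pv)) A1 (hol_onstrip _ _ (proj1 (proj2 hv)))) as [h1 B1].
  destruct (ML _ _ _ _ (st _) (pon u0 ltac:(intros x y; apply pu0)) A2 (hol_onstrip _ _ (proj1 hu))) as [h2 B2].
  destruct (ML _ _ _ _ (st (fun _ => -1)) (pon _ (proj2 pu)) A4 (hol_onstrip _ _ (proj2 (proj2 hu)))) as [h3 B3].
  eexists. exact (hol2_plus L a _ _ _ _ (hol2_plus L a _ _ _ _ (hol2_plus L a _ _ _ _ B1 B2) B3) A3).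
Qed.

(** The prescribed value of U at the corner is that of the scaled data and fixes the one constant
    that divergence, curl and wall values leave open. *)
Lemma strip_data : exists U V P Ux Vx Us Px Ps Ut Vt Q, strip_sol L T smu sfc Qini (u0 0 th1 * cos th1) U V P Ux Vx Us Px Ps Ut Vt Q.
Proof.
  destruct Q00_hol as [H hQ].
  assert (pQ : per Q00).
  { intros x s. unfold Q00, onstrip. rewrite (proj1 pv), (proj2 pu), (pu0 x). reflexivity. }
  destruct (hol2_supb L a HL Q00 H pQ hQ) as [M sQ].
  assert (i0 : 0 < / cos th1) by (apply Rinv_0_lt_compat, k0).
  apply (strip_exists L T a smu smu' sfc (2 * (/ cos th1 * / cos th1)) (2 * omega) M H); auto.
  - apply (cont_mult (U := RU)); apply csec.
  - apply (cont_mult (U := RU)); [apply cont_const|apply (cont_mult (U := RU)); [apply ctn|apply csec]].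
  - intros s. unfold smu. assert (c := cos_lat_pos th1 s). assert (C := COS_bound (Th s)).
    assert (1 <= / cos (Th s)) by (rewrite <- Rinv_1; apply Rinv_le_contravar; lra). nra.
  - intros s. unfold smu, smu'.
    replace (2 * (sin (Th s) / cos (Th s) * / cos (Th s))) with (sin (Th s) / cos (Th s) * / cos (Th s) + / cos (Th s) * (sin (Th s) / cos (Th s))) by ring.
    apply (derive_mult (fun s => / cos (Th s)) (fun s => / cos (Th s))); apply sec_derive.
  - intros s Hs. destruct (sec_bounds th1 th2 H1 H12 H2 s Hs) as [[b1 b2] b3]. unfold smu, smu'. split.
    + assert (/ cos (Th s) * / cos (Th s) <= / cos th1 * / cos th1) by (apply Rmult_le_compat; lra). nra.
    + rewrite !Rabs_mult, (Rabs_right 2), (Rabs_right (/ cos (Th s))) by lra.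
      apply Rmult_le_compat_l; [lra|]. apply Rmult_le_compat; try lra. apply Rabs_pos.
  - eapply (c_der sfc). intros s. apply is_derive_scal, sin_lat_derive.
  - intros s _. unfold sfc. rewrite Rabs_mult, (Rabs_right (2 * omega)) by lra.
    assert (S : Rabs (sin (Th s)) <= 1) by (apply Rabs_le, SIN_bound). nra.
  - apply (hol2_c2 L a HL Ha Q00 H hQ).
  - intros x s. apply pQ.
  - intros x s Hs. unfold Qini. rewrite cl_id by exact Hs. apply sQ, Hs.
  - intros x x' y y' d Hy Hy' Hd Hx Hyy. unfold Qini. rewrite !cl_id by assumption. apply hQ; assumption.
Qed.

(** * Return from the strip to the sphere *)

Section Fields.
Variables (U V P Ux Vx Us Px Ps Ut Vt Q : R -> R -> R -> R).
Hypothesis SS : strip_sol L T smu sfc Qini (u0 0 th1 * cos th1) U V P Ux Vx Us Px Ps Ut Vt Q.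

Lemma initial_velocity x s : 0 <= s <= L -> U x s 0 = u0 x (Th s) * cos (Th s) /\ V x s 0 = v0 x (Th s) * cos (Th s).
Proof.
  intros Hs. assert (Hp := PI_RGT_0).
  destruct SS as [sper [[uU [uV [uP [uUx uVx]]]] [uUs _]] sdx sd sdt seq sb sQ sU0].
  set (c := fun s => cos (Th (cl L s))). set (sn := fun s => sin (Th (cl L s))).
  assert (ccl : cont (fun s => Th (cl L s))) by (apply (cont_comp (U := RU)); [apply cont_lat|apply cont_cl, cont_id]).
  assert (cc : c2 (fun _ s => c s)) by (unfold c2, c; apply cont_cos, (cont_snd' (fun s => Th (cl L s))), ccl).
  assert (cs : c2 (fun _ s => sn s)) by (unfold c2, sn; apply cont_sin, (cont_snd' (fun s => Th (cl L s))), ccl).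
  set (cr := fun (g : R -> R -> R) x s => g x (Th (cl L s))).
  assert (ccr : forall g C, hold th1 th2 a g C -> c2 (cr g)) by (intros g C Hg; apply (hol2_c2 L a HL Ha (onstrip g) C (hol_onstrip g C Hg))).
  set (F := fun (W : R -> R -> R -> R) x s => W x (cl L s) (cl T 0)).
  assert (cF : forall W, ucont L T W -> c2 (F W)) by (intros W HW; apply (c3_fixt (fun x s t => W x (cl L s) (cl T t)) 0), ucont_c3; assumption).
  assert (T0 : cl T 0 = 0) by (apply cl_id; lra).
  assert (c2m : forall f g, c2 f -> c2 g -> c2 (fun x s => f x s * g x s)) by (intros f g Hf Hg; apply (cont_mult _ _ Hf Hg)).
  assert (c2d : forall f g, c2 f -> c2 g -> c2 (fun x s => f x s - g x s)) by (intros f g Hf Hg; apply (cont_minus _ _ Hf Hg)).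
  assert (in0 : 0 <= cl T 0 <= T) by (rewrite T0; lra).
  destruct hu as [hu1 [hu2 hu3]]. destruct hv as [hv1 [hv2 hv3]].
  assert (dth : forall (g gs : R -> R -> R) x s, 0 < s < L -> (forall x y, th1 < y < th2 -> is_derive (fun y => g x y) y (gs x y)) ->
    is_derive (fun s => cr g x s * c s) s ((cos (Th s) * gs x (Th s)) * cos (Th s) + g x (Th s) * (cos (Th s) * - sin (Th s)))).
  { intros g gs z r Hr Dg. unfold cr, c. apply (cl_derive L (fun s => g z (Th s) * cos (Th s))); [exact Hr|].
    apply (derive_mult (fun s => g z (Th s)) (fun s => cos (Th s))).
    - apply (is_derive_comp (V := RN) (fun y => g z y) Th); [apply Dg, (lat_in' th1 th2); assumption|apply lat_derive].
    - apply (is_derive_comp (V := RN) cos Th); [auto_derive; [exact I|ring]|apply lat_derive]. }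
  (* The difference of the two velocities, with latitude and time clamped so that it is continuous
     on the whole plane. *)
  set (w1 := fun x s => F U x s - cr u0 x s * c s). set (w2 := fun x s => F V x s - cr v0 x s * c s).
  set (w1x := fun x s => F Ux x s - cr u0x x s * c s). set (w2x := fun x s => F Vx x s - cr v0x x s * c s).
  set (w1s := fun x s => F Us x s - ((cr u0s x s * c s) * c s - (cr u0 x s * c s) * sn s)).
  set (w2s := fun x s => (0 - F Ux x s) - ((cr v0s x s * c s) * c s - (cr v0 x s * c s) * sn s)).
  assert (clr : forall s, 0 <= s <= L -> cl L s = s) by (intros; apply cl_id; assumption).
  assert (D1 : C1 L w1 w1x w1s).
  { constructor.
    - apply (c2d (F U)); [apply cF, uU|apply (c2m (cr u0) (fun _ s => c s)); [apply (ccr _ _ hu1)|exact cc]].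
    - apply (c2d (F Ux)); [apply cF, uUx|apply (c2m (cr u0x) (fun _ s => c s)); [apply (ccr _ _ hu2)|exact cc]].
    - apply (c2d (F Us)); [apply cF, uUs|].
      assert (A1 := c2m _ _ (c2m _ _ (ccr _ _ hu3) cc) cc). assert (A2 := c2m _ _ (c2m _ _ (ccr _ _ hu1) cc) cs). apply (c2d _ _ A1 A2).
    - intros z r Hr. apply derive_minus.
      + apply (sdx z (cl L r) (cl T 0)); [apply cl_in, HL|exact in0].
      + apply derive_scal_r. unfold cr. rewrite clr by lra. apply du, (lat_in' th1 th2); assumption.
    - intros z r Hr. unfold w1s. apply derive_minus.
      + unfold F. rewrite clr by lra. apply (cl_derive L (fun s => U z s (cl T 0))); [exact Hr|apply sd; [exact Hr|exact in0]].
      + replace (cr u0s z r * c r * c r - cr u0 z r * c r * sn r) with ((cos (Th r) * u0s z (Th r)) * cos (Th r) + u0 z (Th r) * (cos (Th r) * - sin (Th r)))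
          by (unfold cr, c, sn; rewrite clr by lra; ring).
        apply dth; [exact Hr|intros; apply du; assumption]. }
  assert (D2 : C1 L w2 w2x w2s).
  { constructor.
    - apply (c2d (F V)); [apply cF, uV|apply (c2m (cr v0) (fun _ s => c s)); [apply (ccr _ _ hv1)|exact cc]].
    - apply (c2d (F Vx)); [apply cF, uVx|apply (c2m (cr v0x) (fun _ s => c s)); [apply (ccr _ _ hv2)|exact cc]].
    - apply (c2d (fun x s => 0 - F Ux x s)); [apply (c2d (fun _ _ => 0)); [intros zz; apply continuous_const|apply cF, uUx]|].
      assert (A1 := c2m _ _ (c2m _ _ (ccr _ _ hv3) cc) cc). assert (A2 := c2m _ _ (c2m _ _ (ccr _ _ hv1) cc) cs). apply (c2d _ _ A1 A2).
    - intros z r Hr. apply derive_minus.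
      + apply (sdx z (cl L r) (cl T 0)); [apply cl_in, HL|exact in0].
      + apply derive_scal_r. unfold cr. rewrite clr by lra. apply dv, (lat_in' th1 th2); assumption.
    - intros z r Hr. unfold w2s. apply derive_minus.
      + unfold F. rewrite clr by lra. apply (cl_derive L (fun s => V z s (cl T 0))); [exact Hr|]. unfold Rminus. rewrite Rplus_0_l. apply sd; [exact Hr|exact in0].
      + replace (cr v0s z r * c r * c r - cr v0 z r * c r * sn r) with ((cos (Th r) * v0s z (Th r)) * cos (Th r) + v0 z (Th r) * (cos (Th r) * - sin (Th r)))
          by (unfold cr, c, sn; rewrite clr by lra; ring).
        apply dth; [exact Hr|intros; apply dv; assumption]. }
  assert (Z := div_curl_zero L w1 w1x w1s w2 w2x w2s HL D1 D2).
  destruct (fun A1 A2 A3 A4 A5 => Z A1 A2 A3 A4 A5 x s Hs) as [Z1 Z2].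
  - intros z r. unfold w1, F, cr. destruct (sper z (cl L r) (cl T 0) (cl_in L HL r) in0) as [e1 _]. rewrite e1, (pu0 z). reflexivity.
  - intros z r. unfold w2, F, cr. destruct (sper z (cl L r) (cl T 0) (cl_in L HL r) in0) as [_ [e1 _]]. rewrite e1, (pv0 z). reflexivity.
  (* The strip solution has curl (Qini - f) / mu at t = 0, and [Q00] was defined so that the scaled
     data have the same curl; the divergence is [div0] after multiplication by the cosine. *)
  - intros z r Hr. unfold w1x, w2s, w2x, w1s, F, cr, c, sn. rewrite clr, T0 by lra.
    assert (e := div0 z (Th r) (lat_in' th1 th2 H1 H12 H2 r Hr)).
    destruct (seq z r 0 ltac:(lra) ltac:(lra)) as [e1 _]. rewrite e1, (sQ z r ltac:(lra)). unfold Qini, Q00, onstrip, smu, sfc. rewrite clr by lra.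
    assert (cp := cos_lat_pos th1 r). split.
    + replace (u0x z (Th r)) with (- (v0s z (Th r) * cos (Th r) - v0 z (Th r) * sin (Th r))) by lra. ring.
    + field. lra.
  - intros z. unfold w2, F, cr, c. rewrite (clr 0), (clr L) by lra. destruct (sb z (cl T 0) in0) as [e1 e2]. rewrite e1, e2.
    rewrite (lat_0 th1 th2 H1 H12 H2), (lat_len th1 th2 H1 H12 H2).
    rewrite <- (red_per (fun x => v0 x th1) z), <- (red_per (fun x => v0 x th2) z) by (intros; apply pv0).
    destruct (bc0 (red z) (red_in z)) as [b1 b2]. rewrite b1, b2. split; ring.
  - unfold w1, F, cr, c. rewrite clr, T0, sU0 by lra. rewrite (lat_0 th1 th2 H1 H12 H2). ring.
  - unfold w1, w2, F, cr, c in Z1, Z2. rewrite clr, T0 in Z1, Z2 by exact Hs. split; lra.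
Qed.

Definition cth y := th1 + cl (th2 - th1) (y - th1).
Definition sgh y := sg (cth y).
Definition icc y := / cos (cth y).
Definition snc y := sin (cth y).
(* Pullback to (phi, theta, t), frozen outside the band and outside [0, T]. *)
Definition pb (G : R -> R -> R -> R) (x y t : R) := G x (cl L (sgh y)) (cl T t).

Lemma cth_in y : th1 <= cth y <= th2.
Proof. assert (A := cl_in (th2 - th1) ltac:(lra) (y - th1)). unfold cth. lra. Qed.
Lemma cth_id y : th1 <= y <= th2 -> cth y = y.
Proof. intros Hy. unfold cth. rewrite cl_id by lra. ring. Qed.
Lemma cont_cth : cont cth.
Proof. apply (cont_plus (U := RU)); [apply cont_const|]. apply cont_cl. apply (cont_minus (U := RU)); [apply cont_id|apply cont_const]. Qed.
Lemma cont_sgh : cont sgh.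
Proof.
  intros y. assert (Hp := PI_RGT_0). assert (B := cth_in y). apply (continuous_comp cth sg); [apply cont_cth|].
  apply (ex_derive_continuous sg). exists (/ cos (cth y)). apply merc_derive; lra.
Qed.
Lemma cos_cth y : 0 < cos (cth y).
Proof. assert (Hp := PI_RGT_0). assert (B := cth_in y). apply cos_gt_0; lra. Qed.
Lemma c3_icc : c3 (fun _ y _ => icc y).
Proof.
  unfold c3. apply cont_comp; [|cont_tac]. intros y. apply (cont_inv (U := RU) (fun y => cos (cth y))).
  - intros z. assert (A := cos_cth z). lra.
  - apply (cont_cos (U := RU)), cont_cth.
Qed.
Lemma c3_snc : c3 (fun _ y _ => snc y).
Proof. unfold c3. apply cont_comp; [|cont_tac]. intros y. apply (cont_sin (U := RU)), cont_cth. Qed.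
Lemma c3_pb G : ucont L T G -> c3 (pb G).
Proof.
  intros H. unfold c3, pb. apply (cont_comp3 (fun x s t => G x (cl L s) (cl T t))); [apply ucont_c3; assumption|cont_tac| |cont_tac].
  apply cont_comp; [exact cont_sgh|cont_tac].
Qed.
Lemma sgh_id y : th1 <= y <= th2 -> sgh y = sg y.
Proof. intros Hy. unfold sgh. rewrite cth_id by exact Hy. reflexivity. Qed.
Lemma near_interior (f g : R -> R) y l : th1 < y < th2 -> (forall y, th1 < y < th2 -> f y = g y) -> is_derive f y l -> is_derive g y l.
Proof.
  intros Hy H D. assert (r0 : 0 < Rmin (y - th1) (th2 - y)) by (apply Rmin_pos; lra). apply is_derive_ext_loc with f; [|exact D].
  exists (mkposreal _ r0). intros z Hz. change (Rabs (z - y) < Rmin (y - th1) (th2 - y)) in Hz.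
  assert (r1 := Rmin_l (y - th1) (th2 - y)). assert (r2 := Rmin_r (y - th1) (th2 - y)). apply Rabs_def2 in Hz. apply H. lra.
Qed.
Lemma pb_dtheta (G : R -> R -> R -> R) l x y t : th1 < y < th2 -> is_derive (fun s => G x s (cl T t)) (sg y) l ->
  is_derive (fun y => pb G x y t) y (l * icc y).
Proof.
  intros Hy D. assert (Hp := PI_RGT_0). rewrite Rmult_comm. unfold icc. rewrite cth_id by lra.
  apply near_interior with (fun y => G x (cl L (sg y)) (cl T t)); [exact Hy|intros z Hz; unfold pb; rewrite sgh_id by lra; reflexivity|].
  apply (is_derive_comp (V := RN) (fun s => G x (cl L s) (cl T t)) sg); [|apply merc_derive; lra].
  apply (cl_derive L (fun s => G x s (cl T t))); [|exact D]. apply merc_in'; assumption.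
Qed.
Lemma icc_derive y : th1 < y < th2 -> is_derive icc y (snc y * icc y * icc y).
Proof.
  intros Hy. assert (Hp := PI_RGT_0). unfold snc, icc. rewrite cth_id by lra. assert (c : 0 < cos y) by (apply cos_gt_0; lra).
  apply near_interior with (fun y => / cos y); [exact Hy|intros z Hz; rewrite cth_id by lra; reflexivity|]. auto_derive; [lra|field; lra].
Qed.

(** Half the squared secant, so that (U^2 + V^2) [hcc] is the kinetic energy density on the
    sphere. *)
Definition hcc y := / 2 * (icc y * icc y).
Lemma hcc_derive y : th1 < y < th2 -> is_derive hcc y (icc y * (snc y * icc y * icc y)).
Proof.
  intros Hy. assert (D := icc_derive y Hy).
  replace (icc y * (snc y * icc y * icc y)) with (/ 2 * ((snc y * icc y * icc y) * icc y + icc y * (snc y * icc y * icc y))) by field.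
  apply is_derive_scal, (derive_mult icc icc); assumption.
Qed.

(** Dividing (U, V) by the cosine gives the physical velocity, and subtracting the kinetic energy
    from the Bernoulli head gives the pressure of the advective form. *)
Lemma strip_solution_is_solution : is_solution omega th1 th2 T u0 v0 (fun x y t => pb U x y t * icc y) (fun x y t => pb V x y t * icc y)
  (fun x y t => pb P x y t - (pb U x y t * pb U x y t + pb V x y t * pb V x y t) * hcc y).
Proof.
  assert (Hp := PI_RGT_0). assert (IV := initial_velocity).
  destruct SS as [sper [[uU [uV [uP [uUx uVx]]]] [uUs [uPx [uPs [uUt uVt]]]]] sdx sd sdt seq sb sQ sU0].
  assert (ins : forall y, 0 <= cl L (sgh y) <= L) by (intros; apply cl_in, HL). assert (int : forall t, 0 <= cl T t <= T) by (intros; apply cl_in, HT).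
  assert (per_pb : forall x y t, pb U (x + 2 * PI) y t = pb U x y t /\ pb V (x + 2 * PI) y t = pb V x y t /\ pb P (x + 2 * PI) y t = pb P x y t) by (intros; apply sper; auto).
  assert (sgi : forall y, th1 < y < th2 -> 0 < sg y < L) by (intros; apply merc_in'; assumption).
  assert (sgi' : forall y, th1 <= y <= th2 -> 0 <= sg y <= L) by (intros; apply merc_in; assumption).
  assert (pbv : forall G x y t, th1 <= y <= th2 -> 0 <= t <= T -> pb G x y t = G x (sg y) t).
  { intros G x y t Hy Ht. unfold pb. rewrite sgh_id by exact Hy. rewrite !cl_id by auto. reflexivity. }
  assert (icv : forall y, th1 <= y <= th2 -> icc y = / cos y) by (intros y Hy; unfold icc; rewrite cth_id by exact Hy; reflexivity).
  assert (snv : forall y, th1 <= y <= th2 -> snc y = sin y) by (intros y Hy; unfold snc; rewrite cth_id by exact Hy; reflexivity).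
  assert (cpos : forall y, th1 <= y <= th2 -> 0 < cos y) by (intros y Hy; apply cos_gt_0; lra).
  assert (latv : forall y, th1 <= y <= th2 -> Th (sg y) = y) by (intros y Hy; apply lat_merc; lra).
  assert (k1 := c3_icc). assert (k2 := c3_snc). assert (k3 : c3 (fun _ y _ => hcc y)) by (unfold hcc; c3_tac).
  apply c3_pb in uU, uV, uP, uUx, uVx, uUs, uPx, uPs, uUt, uVt.
  split; [intros x y t; cbv beta; destruct (per_pb x y t) as [e1 [e2 e3]]; rewrite e1; reflexivity|].
  split; [intros x y t; cbv beta; destruct (per_pb x y t) as [e1 [e2 e3]]; rewrite e2; reflexivity|].
  split; [intros x y t; cbv beta; destruct (per_pb x y t) as [e1 [e2 e3]]; rewrite e1, e2, e3; reflexivity|].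
  exists (fun x y t => pb Ut x y t * icc y), (fun x y t => pb Ux x y t * icc y),
    (fun x y t => (pb Us x y t * icc y) * icc y + pb U x y t * (snc y * icc y * icc y)),
    (fun x y t => pb Vt x y t * icc y), (fun x y t => pb Vx x y t * icc y),
    (fun x y t => ((-1) * pb Ux x y t * icc y) * icc y + pb V x y t * (snc y * icc y * icc y)),
    (fun x y t => pb Px x y t - 2 * (pb U x y t * pb Ux x y t + pb V x y t * pb Vx x y t) * hcc y),
    (fun x y t => pb Ps x y t * icc y - (2 * (pb U x y t * (pb Us x y t * icc y) + pb V x y t * ((-1) * pb Ux x y t * icc y)) * hcc y
       + (pb U x y t * pb U x y t + pb V x y t * pb V x y t) * (icc y * (snc y * icc y * icc y)))),
    (fun x y t => (-1) * pb Ux x y t * icc y).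
  split; [|split; [|split; [|split; [|split]]]].
  - intros x y t Hy Ht.
    destruct (sdx x (cl L (sgh y)) (cl T t) (ins y) (int t)) as [d1 d2].
    change (is_derive (fun x => pb U x y t) x (pb Ux x y t)) in d1. change (is_derive (fun x => pb V x y t) x (pb Vx x y t)) in d2.
    assert (es : cl L (sgh y) = sg y) by (rewrite sgh_id by lra; apply cl_id, sgi'; lra).
    destruct (sd x (sg y) (cl T t) (sgi y Hy) (int t)) as [[d3 d4] [d5 d6]].
    assert (D3 : is_derive (fun x => pb P x y t) x (pb Px x y t)) by (unfold pb; rewrite es; exact d3).
    assert (D4 := pb_dtheta P _ x y t Hy d4). assert (D5 := pb_dtheta U _ x y t Hy d5). assert (D6 := pb_dtheta V _ x y t Hy d6).
    replace (Ps x (sg y) (cl T t)) with (pb Ps x y t) in D4 by (unfold pb; rewrite es; reflexivity).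
    replace (Us x (sg y) (cl T t)) with (pb Us x y t) in D5 by (unfold pb; rewrite es; reflexivity).
    replace (- Ux x (sg y) (cl T t)) with ((-1) * pb Ux x y t) in D6 by (unfold pb; rewrite es; ring).
    assert (Di := icc_derive y Hy). assert (Dh := hcc_derive y Hy).
    split; [apply (derive_scal_r (fun x => pb U x y t)), d1|].
    split; [apply (derive_mult (fun y => pb U x y t) icc); assumption|].
    split; [apply (derive_scal_r (fun x => pb V x y t)), d2|].
    split; [apply (derive_mult (fun y => pb V x y t) icc); assumption|].
    split.
    { apply near_interior with (fun y => pb V x y t); [exact Hy| |exact D6]. intros z Hz. rewrite icv by lra.
      assert (cz := cpos z ltac:(lra)). field. lra. }
    split.
    + apply derive_minus; [exact D3|]. apply (derive_scal_r (fun x => pb U x y t * pb U x y t + pb V x y t * pb V x y t)).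
      apply (derive_sq (fun x => pb U x y t) (fun x => pb V x y t)); assumption.
    + apply derive_minus; [exact D4|]. apply (derive_mult (fun y => pb U x y t * pb U x y t + pb V x y t * pb V x y t) hcc); [|exact Dh].
      apply (derive_sq (fun y => pb U x y t) (fun y => pb V x y t)); assumption.
  - intros x y t Hy Ht. destruct (sdt x (cl L (sgh y)) t (ins y) Ht) as [d1 d2].
    assert (et : cl T t = t) by (apply cl_id; lra). split.
    + apply (derive_scal_r (fun t => pb U x y t)). unfold pb at 2. rewrite et. apply (cl_derive T (fun t => U x (cl L (sgh y)) t)); assumption.
    + apply (derive_scal_r (fun t => pb V x y t)). unfold pb at 2. rewrite et. apply (cl_derive T (fun t => V x (cl L (sgh y)) t)); assumption.
  (* The curl equation eliminates Q from the rotational form; what remains is algebra. *)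
  - intros x y t [_ Hy] Ht. unfold hcc. rewrite !pbv, !icv, !snv by lra. assert (c := cpos y ltac:(lra)).
    destruct (seq x (sg y) t (sgi' y ltac:(lra)) Ht) as [e1 [e2 e3]].
    unfold smu, sfc in e1. rewrite latv in e1 by lra.
    set (q := Q x (sg y) t) in *. set (vx := Vx x (sg y) t) in *. set (us := Us x (sg y) t) in *.
    assert (eq : q = 2 * omega * sin y + (vx - us) * (/ cos y * / cos y)).
    { assert (e1' : / (/ cos y * / cos y) * (q - 2 * omega * sin y) = vx - us) by lra. rewrite <- e1'. field. lra. }
    rewrite e2, e3, eq. unfold tan. split; [|split]; field; lra.
  - intros x t Hx Ht. rewrite !pbv by lra. rewrite merc_0. destruct (sb x t Ht) as [b1 b2]. fold L. rewrite b1.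
    change (merc th1 th2) with L. rewrite b2. split; ring.
  - intros x y [Hx Hy]. rewrite !pbv, icv by lra. destruct (IV x (sg y) (sgi' y Hy)) as [i1 i2]. rewrite i1, i2, latv by exact Hy.
    assert (c := cpos y Hy). split; field; lra.
  - repeat split; apply c3_cont_S; c3_tac.
Qed.
End Fields.
End Existence.

Lemma existence (omega th1 th2 a T : R) (u0 v0 : R -> R -> R) :
  0 < omega -> - (PI / 2) < th1 -> th1 < th2 -> th2 < 0 -> 0 < a < 1 -> periodic2 u0 -> periodic2 v0 ->
  holder1 th1 th2 a u0 -> holder1 th1 th2 a v0 ->
  (forall phi theta, in_C th1 th2 phi theta ->
     (Derive (fun x => u0 x theta) phi + Derive (fun y => v0 phi y * cos y) theta) / cos theta = 0) ->
  (forall phi, 0 <= phi < 2 * PI -> v0 phi th1 = 0 /\ v0 phi th2 = 0) -> 0 < T ->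
  exists u v p : R -> R -> R -> R, is_solution omega th1 th2 T u0 v0 u v p.
Proof.
  intros Hom H1 H12 H2 Ha pu0 pv0 hu hv div bc HT. assert (Hp := PI_RGT_0).
  destruct (holder1_data th1 th2 a H1 H12 H2 Ha u0 pu0 hu) as [ux [us [Cu [Hu [Pu Du]]]]].
  destruct (holder1_data th1 th2 a H1 H12 H2 Ha v0 pv0 hv) as [vx [vs [Cv [Hv [Pv Dv]]]]].
  (* The divergence condition is freed from the division by the cosine, expanded by the product
     rule, and extended from one period to all longitudes. *)
  assert (div' : forall x y, th1 < y < th2 -> ux x y + (vs x y * cos y - v0 x y * sin y) = 0).
  { intros x y Hy.
    assert (K : forall z, 0 <= z < 2 * PI -> ux z y + (vs z y * cos y - v0 z y * sin y) = 0).
    { intros z Hz. assert (E := div z y (conj Hz Hy)). destruct (Du z y Hy) as [d1 _]. destruct (Dv z y Hy) as [_ d2].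
      assert (d1' : Derive (fun x : R => u0 x y) z = ux z y) by (apply is_derive_unique; exact d1). rewrite d1' in E.
      assert (d3 : is_derive (fun y => v0 z y * cos y) y (vs z y * cos y + v0 z y * - sin y)).
      { apply (derive_mult (fun y => v0 z y) cos); [exact d2|]. auto_derive; [exact I|ring]. }
      assert (d3' : Derive (fun y : R => v0 z y * cos y) y = vs z y * cos y + v0 z y * - sin y) by (apply is_derive_unique; exact d3). rewrite d3' in E. assert (c : 0 < cos y) by (apply cos_gt_0; lra).
      assert (E' : (ux z y + (vs z y * cos y + v0 z y * - sin y)) = (ux z y + (vs z y * cos y + v0 z y * - sin y)) / cos y * cos y) by (field; lra).
      rewrite E in E'. lra. }
    rewrite <- (red_per (fun x => ux x y) x), <- (red_per (fun x => vs x y) x), <- (red_per (fun x => v0 x y) x)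
      by (intros; first [apply Pu|apply Pv|apply pv0]).
    apply K, red_in. }
  destruct (strip_data omega th1 th2 a T u0 v0 Hom H1 H12 H2 Ha HT pu0 ux us vx vs Cu Cv Hu Pu Hv Pv) as [U [V [P [Ux [Vx [Us [Px [Ps [Ut [Vt [Q SS]]]]]]]]]]].
  do 3 eexists. eapply strip_solution_is_solution with (a := a); eauto.
Qed.

Theorem theorem3p1 (omega th1 th2 a T : R) (u0 v0 : R -> R -> R) :
  0 < omega ->
  - (PI / 2) < th1 -> th1 < th2 -> th2 < 0 ->
  0 < a < 1 ->
  periodic2 u0 -> periodic2 v0 ->
  holder1 th1 th2 a u0 -> holder1 th1 th2 a v0 ->
  (forall phi theta, in_C th1 th2 phi theta ->
     (Derive (fun x => u0 x theta) phi
      + Derive (fun y => v0 phi y * cos y) theta) / cos theta = 0) ->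
  (forall phi, 0 <= phi < 2 * PI -> v0 phi th1 = 0 /\ v0 phi th2 = 0) ->
  0 < T ->
  (exists u v p : R -> R -> R -> R, is_solution omega th1 th2 T u0 v0 u v p) /\
  (forall u v p u' v' p' : R -> R -> R -> R,
     is_solution omega th1 th2 T u0 v0 u v p ->
     is_solution omega th1 th2 T u0 v0 u' v' p' ->
     (forall phi theta t, in_Cbar th1 th2 phi theta -> 0 <= t <= T ->
        u' phi theta t = u phi theta t /\ v' phi theta t = v phi theta t) /\
     exists g : R -> R,
       forall phi theta t, in_Cbar th1 th2 phi theta -> 0 <= t <= T ->
         p' phi theta t = p phi theta t + g t).
Proof.
  intros Hom H1 H12 H2 Ha pu pv hu hv div bc HT. split.
  - apply (existence omega th1 th2 a T u0 v0); assumption.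
  - intros u v p u' v' p'. apply uniqueness; assumption.
Qed.
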